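(* Assume $W$ is a finite irreducible Weyl group not of type $A_n$ with $n\ge 2$ and not of type $B_3$. Let $w\in\widetilde{W}^S$ and $\lambda=\pi(w)$. Then $w$ is palindromic if and only if the interval $[\mathrm{id},w]$ in the Bruhat order on $\widetilde{W}^S$ is isomorphic (as a poset) to the interval $[\emptyset,\lambda]$ in the generalized Young's lattice and the interval $[\emptyset,\lambda]$ is rank symmetric.
   Context: $\widetilde{W}$ is the affine Weyl group of $W$, with Coxeter generators $s_0,\dots,s_n$ (standard affine Dynkin labelling, $s_0$ the affine node), $W=W_S$, $S=\{s_1,\dots,s_n\}$; $\widetilde{W}^S$ is the set of minimal length representatives of $\widetilde{W}/W$, ordered by Bruhat order. For $w\in\widetilde{W}^S$ let $P_w(t)=\sum_{v\in\widetilde{W}^S,\,v\le w}t^{\ell(v)}$; $w$ is palindromic if the coefficients $a_i$ of $P_w(t)$ satisfy $a_i=a_{\ell(w)-i}$ for all $i$. For a set $I$ of generators, $w=u_I(w)v_I(w)$ is the unique factorization with $v_I(w)\in W_I$, $u_I(w)$ minimal in $wW_I$, lengths adding. Segments and canonical factorization: if $s_0$ is joined to $s_1$ (types $A_1,C,E,F,G$), let $J=\{s\in S: ss_0=s_0s\}$, list elements of $W^J$ of length $j$ as $f_1(j),\dots,f_k(j)$, segments $\sigma^i(j+1)=f_i(j)s_0$ (color $i$), and $r(w)=r(u_S(ws_0))\sigma^i(j+1)$ where $v_S(ws_0)=f_i(j)$. In types $B_n$, $D_n$ ($s_0,s_1$ both joined to $s_2$), let $J=\{s_2,\dots,s_n\}$,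 $S'=\{s_0,s_2,\dots,s_n\}$; $1$-segments $\sigma_1^i(j)$ are the elements of $W_S^J$ of length $j$, $0$-segments $\sigma^i_0(j)$ those of $(W_{S'})^J$, colored compatibly via a diagram automorphism swapping $s_0,s_1$; $r(w)=\cdots\sigma_0(\lambda_3)\sigma_1(\lambda_2)\sigma_0(\lambda_1)$ by alternately splitting off $v_{S'}$ and $v_S$. Allowed pair $(i^a,j^b)$: $\sigma^a(i)\sigma^b(j)$ (types $B,D$: $\sigma_1^a(i)\sigma_0^b(j)$) lies in $\widetilde{W}^S$ with length $i+j$. $\mathcal{P}$: colored partitions $(\lambda_1^{c_1},\dots,\lambda_f^{c_f})$, $\lambda_1\ge\dots\ge\lambda_f>0$, with every $(\lambda_{t+1}^{c_{t+1}},\lambda_t^{c_t})$ allowed; $\pi(w)=(\lambda_1^{c_1},\dots,\lambda_f^{c_f})$ if $r(w)=\sigma^{c_f}(\lambda_f)\cdots\sigma^{c_1}(\lambda_1)$, a length preserving bijection $\widetilde{W}^S\to\mathcal{P}$. Generalized Young's lattice on $\mathcal{P}$: a colored part $j^c$ covers $(j-1)^d$ if $\sigma^c(j)$ covers $\sigma^d(j-1)$ in left weak order ($\sigma(0)=\mathrm{id}$ denoting an absent part; in types $B,D$ use $0$-segments); $\lambda$ covers $\mu$ if they agree except in one part index $j$ where $\lambda_j^{c_j}$ covers $\mu_j^{d_j}$; the order is the transitive closure. Its rank function is the size $|\lambda|=\sum\lambda_t$. The interval $[\emptyset,\lambda]$ is rank symmetric if for every $r$ the number of its elements of size $r$ equals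 the number of size $|\lambda|-r$. *)

(* Defs.v *)
From Stdlib Require Export Relation_Operators.
From mathcomp Require Export all_boot all_order all_algebra perm finmap.
From mathcomp Require Export boolp classical_sets functions cardinality.

Set Implicit Arguments.
Unset Strict Implicit.
Unset Printing Implicit Defensive.

Local Open Scope classical_set_scope.
Local Open Scope group_scope.

Definition wprod (I : Type) (G : groupType) (s : I -> G) (x : seq I) : G :=
  \big[*%g/1]_(i <- x) s i.

(* The congruence on words generated by (i j)^(M i j) = 1.  A label M i j = 0
   stands for infinity.  As M i i = 1 makes every letter an involution, the
   quotient monoid is the Coxeter group of M. *)
Inductive cox_eq (I : Type) (M : I -> I -> nat) : seq I -> seq I -> Prop :=
| cox_rel x y i j :
    cox_eq M (x ++ flatten (nseq (M i j) [:: i; j]) ++ y) (x ++ y)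
| cox_refl x : cox_eq M x x
| cox_sym x y : cox_eq M x y -> cox_eq M y x
| cox_trans x y z : cox_eq M x y -> cox_eq M y z -> cox_eq M x z.

(* G is presented by the generators s and the Coxeter relations of M. *)
Definition coxeter_system (I : Type) (M : I -> I -> nat)
    (G : groupType) (s : I -> G) : Prop :=
  (forall g : G, exists x, wprod s x = g) /\
  (forall x y, wprod s x = wprod s y <-> cox_eq M x y).

(* The default value 0 is only reached outside the subgroup generated by s. *)
Definition len (I : Type) (G : groupType) (s : I -> G) (g : G) : nat :=
  xget 0%N [set k | (exists2 x, wprod s x = g & size x = k) /\
                    (forall x, wprod s x = g -> (k <= size x)%N)].

Definition reflection (I : Type) (G : groupType) (s : I -> G) (t : G) : Prop :=
  exists (i : I) (g : G), t = s i ^ g.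

Definition bruhat (I : Type) (G : groupType) (s : I -> G) : G -> G -> Prop :=
  clos_refl_trans G (fun u v =>
    (len s u < len s v)%N /\ exists2 t, reflection s t & v = u * t).

Definition left_weak_cover (I : Type) (G : groupType) (s : I -> G)
    (u v : G) : Prop :=
  len s u = (len s v).+1 /\ exists i, u = s i * v.

Definition parabolic (I : Type) (G : groupType) (s : I -> G) (A : pred I)
    (g : G) : Prop :=
  exists2 x, all A x & wprod s x = g.

Definition minrep (I : Type) (G : groupType) (s : I -> G) (A : pred I)
    (g : G) : Prop :=
  forall v, parabolic s A v -> (len s g <= len s (g * v))%N.

(* u = u_A(w) and v = v_A(w). *)
Definition factorization (I : Type) (G : groupType) (s : I -> G) (A : pred I)
    (w u v : G) : Prop :=
  [/\ w = u * v, minrep s A u, parabolic s A v & len s w = (len s u + len s v)%N].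

(* The elements of length j of (W_A)^B. *)
Definition quotient_elt (I : Type) (G : groupType) (s : I -> G) (A B : pred I)
    (j : nat) (g : G) : Prop :=
  [/\ parabolic s A g, minrep s B g & len s g = j].

Inductive dynkin := DA of nat | DB of nat | DC of nat | DD of nat
                  | DE of nat | DF4 | DG2.

Definition rank (T : dynkin) : nat :=
  match T with
  | DA n | DB n | DC n | DD n | DE n => n
  | DF4 => 4
  | DG2 => 2
  end.

(* B_2 and D_3 are listed as C_2 and A_3. *)
Definition dynkin_valid (T : dynkin) : bool :=
  match T with
  | DA n => 1 <= n
  | DB n => 3 <= n
  | DC n => 2 <= n
  | DD n => 4 <= n
  | DE n => 6 <= n <= 8
  | DF4 | DG2 => true
  end%N.

(* The simple bonds i -- i+1 for m <= i < k. *)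
Definition chain (m k : nat) : seq (nat * nat * nat) :=
  [seq (i, i.+1, 3) | i <- iota m (k - m)].

(* Bonds (i, j, m_ij) of the affine diagram; unlisted pairs commute.  Node 0 is
   the affine node.  In types E and G the nodes are numbered along the diagram
   so that node 0 is joined to node 1. *)
Definition affine_bonds (T : dynkin) : seq (nat * nat * nat) :=
  match T with
  | DA 1 => [:: (0, 1, 0)]
  | DA n => (0, n, 3) :: chain 0 n
  | DB n => [:: (0, 2, 3); (1, 2, 3); (n.-1, n, 4)] ++ chain 2 n.-1
  | DC n => [:: (0, 1, 4); (n.-1, n, 4)] ++ chain 1 n.-1
  | DD n => [:: (0, 2, 3); (1, 2, 3); (n.-2, n, 3)] ++ chain 2 n.-1
  | DE 6 => chain 0 4 ++ [:: (2, 5, 3); (5, 6, 3)]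
  | DE 7 => (3, 7, 3) :: chain 0 6
  | DE 8 => (5, 8, 3) :: chain 0 7
  | DE _ => [::]
  | DF4 => [:: (0, 1, 3); (1, 2, 3); (2, 3, 4); (3, 4, 3)]
  | DG2 => [:: (0, 1, 3); (1, 2, 6)]
  end%N.

Definition affine_coxeter (T : dynkin) (i j : 'I_(rank T).+1) : nat :=
  if i == j then 1%N else
  head 2%N [seq e.2 | e <- affine_bonds T
                    & (e.1 == (val i, val j)) || (e.1 == (val j, val i))].

(* In types B and D the nodes 0 and 1 are both joined to node 2. *)
Definition forked (T : dynkin) : bool :=
  match T with DB _ | DD _ => true | _ => false end.

Definition node0 (n : nat) : 'I_n.+1 := ord0.
Definition node1 (n : nat) : 'I_n.+1 := inord 1.

Definition setS (n : nat) : pred 'I_n.+1 := [pred i | i != node0 n].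
Definition setS' (n : nat) : pred 'I_n.+1 := [pred i | i != node1 n].
Arguments setS n : clear implicits.
Arguments setS' n : clear implicits.

Definition poincare (n : nat) (G : groupType) (s : 'I_n.+1 -> G) (w : G) :
    {poly int} :=
  (\sum_(v <- fset_set [set v | minrep s (setS n) v /\ bruhat s v w])
     'X^(len s v))%R.

Definition palindromic (n : nat) (G : groupType) (s : 'I_n.+1 -> G) (w : G) :
    Prop :=
  forall i, (i <= len s w)%N ->
    ((poincare s w)`_i = (poincare s w)`_(len s w - i))%R.

(* f j lists, without repetition, the elements satisfying X j.  The position in
   the list f j is the color, so colors are numbered from 0. *)
Definition listing (G : groupType) (X : nat -> G -> Prop) (f : nat -> seq G) :
    Prop :=
  forall j, uniq (f j) /\ forall g, g \in f j <-> X j g.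

Definition leaf_J (n : nat) (G : groupType) (s : 'I_n.+1 -> G) :
    pred 'I_n.+1 :=
  [pred i | setS n i && (s i * s (node0 n) == s (node0 n) * s i)].

Definition fork_J (n : nat) : pred 'I_n.+1 := [pred i | setS n i && setS' n i].
Arguments fork_J n : clear implicits.

Definition leaf_segments (n : nat) (G : groupType) (s : 'I_n.+1 -> G)
    (sigma : nat -> seq G) : Prop :=
  exists2 f, listing (quotient_elt s (setS n) (leaf_J s)) f &
    sigma 0%N = [:: 1] /\
    forall j, sigma j.+1 = [seq g * s (node0 n) | g <- f j].

Definition fork_segments (n : nat) (M : 'I_n.+1 -> 'I_n.+1 -> nat)
    (G : groupType) (s : 'I_n.+1 -> G) (sigma1 sigma0 : nat -> seq G) : Prop :=
  [/\ listing (quotient_elt s (setS n) (fork_J n)) sigma1,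
      listing (quotient_elt s (setS' n) (fork_J n)) sigma0 &
      exists (theta : {perm 'I_n.+1}) (phi : G -> G),
        [/\ forall i j, M (theta i) (theta j) = M i j,
            theta (node0 n) = node1 n /\ theta (node1 n) = node0 n,
            forall x, phi (wprod s x) = wprod s (map theta x) &
            forall j, sigma0 j = map phi (sigma1 j)]].

(* Outside types B and D there is only one kind of segment. *)
Definition segments (T : dynkin) (G : groupType) (s : 'I_(rank T).+1 -> G)
    (sigma1 sigma0 : nat -> seq G) : Prop :=
  if forked T then fork_segments (@affine_coxeter T) s sigma1 sigma0
  else leaf_segments s sigma0 /\ sigma1 = sigma0.

(* The pair (j, c) is the part j of color c.  A colored partition lists its
   parts with the largest first. *)
Definition part : Type := (nat * nat)%type.

Definition is_part (G : groupType) (sigma : nat -> seq G) (p : part) : Prop :=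
  (0 < p.1)%N /\ (p.2 < size (sigma p.1))%N.

(* The absent part (0, 0) gives the identity. *)
Definition seg (G : groupType) (sigma : nat -> seq G) (p : part) : G :=
  nth 1 (sigma p.1) p.2.

Inductive leaf_pi (n : nat) (G : groupType) (s : 'I_n.+1 -> G)
    (sigma : nat -> seq G) : G -> seq part -> Prop :=
| leaf_pi_nil : leaf_pi s sigma 1 [::]
| leaf_pi_cons w u v p lam :
    w <> 1 -> factorization s (setS n) (w * s (node0 n)) u v ->
    is_part sigma p -> seg sigma p = v * s (node0 n) ->
    leaf_pi s sigma u lam -> leaf_pi s sigma w (p :: lam).

(* b = false splits off v_S' (a 0-segment), b = true splits off v_S. *)
Inductive fork_pi (n : nat) (G : groupType) (s : 'I_n.+1 -> G)
    (sigma1 sigma0 : nat -> seq G) : bool -> G -> seq part -> Prop :=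
| fork_pi_nil b : fork_pi s sigma1 sigma0 b 1 [::]
| fork_pi_cons b w u v p lam :
    w <> 1 -> factorization s (if b then setS n else setS' n) w u v ->
    is_part (if b then sigma1 else sigma0) p ->
    seg (if b then sigma1 else sigma0) p = v ->
    fork_pi s sigma1 sigma0 (~~ b) u lam ->
    fork_pi s sigma1 sigma0 b w (p :: lam).

(* pi(w) = lam. *)
Definition pi_spec (T : dynkin) (G : groupType) (s : 'I_(rank T).+1 -> G)
    (sigma1 sigma0 : nat -> seq G) (w : G) (lam : seq part) : Prop :=
  if forked T then fork_pi s sigma1 sigma0 false w lam
  else leaf_pi s sigma0 w lam.

Definition allowed (n : nat) (G : groupType) (s : 'I_n.+1 -> G)
    (sigma1 sigma0 : nat -> seq G) (p q : part) : Prop :=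
  minrep s (setS n) (seg sigma1 p * seg sigma0 q) /\
  len s (seg sigma1 p * seg sigma0 q) = (p.1 + q.1)%N.

Definition colored_partition (n : nat) (G : groupType) (s : 'I_n.+1 -> G)
    (sigma1 sigma0 : nat -> seq G) (lam : seq part) : Prop :=
  [/\ forall p, p \in lam -> is_part sigma0 p,
      sorted geq [seq p.1 | p <- lam] &
      forall t, (t.+1 < size lam)%N ->
        allowed s sigma1 sigma0 (nth (0, 0)%N lam t.+1) (nth (0, 0)%N lam t)].

Definition part_cover (n : nat) (G : groupType) (s : 'I_n.+1 -> G)
    (sigma0 : nat -> seq G) (p q : part) : Prop :=
  p.1 = q.1.+1 /\ left_weak_cover s (seg sigma0 p) (seg sigma0 q).

(* Parts beyond the end of a partition are read as the absent part (0, 0). *)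
Definition young_cover (n : nat) (G : groupType) (s : 'I_n.+1 -> G)
    (sigma1 sigma0 : nat -> seq G) (mu lam : seq part) : Prop :=
  [/\ colored_partition s sigma1 sigma0 mu,
      colored_partition s sigma1 sigma0 lam &
      exists j,
        part_cover s sigma0 (nth (0, 0)%N lam j) (nth (0, 0)%N mu j) /\
        forall k, k <> j -> nth (0, 0)%N lam k = nth (0, 0)%N mu k].

Definition young (n : nat) (G : groupType) (s : 'I_n.+1 -> G)
    (sigma1 sigma0 : nat -> seq G) : seq part -> seq part -> Prop :=
  clos_refl_trans (seq part) (young_cover s sigma1 sigma0).

Definition psize (lam : seq part) : nat := sumn [seq p.1 | p <- lam].

Definition young_interval (n : nat) (G : groupType) (s : 'I_n.+1 -> G)
    (sigma1 sigma0 : nat -> seq G) (lam : seq part) : set (seq part) :=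
  [set mu | [/\ colored_partition s sigma1 sigma0 mu,
                young s sigma1 sigma0 [::] mu & young s sigma1 sigma0 mu lam]].

Definition bruhat_interval (n : nat) (G : groupType) (s : 'I_n.+1 -> G)
    (w : G) : set G :=
  [set v | [/\ minrep s (setS n) v, bruhat s 1 v & bruhat s v w]].

Definition poset_isomorphic (X Y : Type) (A : set X) (leX : X -> X -> Prop)
    (B : set Y) (leY : Y -> Y -> Prop) : Prop :=
  exists2 f : X -> Y, set_bij A B f &
    forall x y, A x -> A y -> (leX x y <-> leY (f x) (f y)).

Definition rank_symmetric (A : set (seq part)) (N : nat) : Prop :=
  forall r, (r <= N)%N ->
    #|` fset_set (A `&` [set mu | psize mu = r])| =
    #|` fset_set (A `&` [set mu | psize mu = (N - r)%N])|.

(* Main.v *)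
Require Import Defs.
From Stdlib Require Import ZArith Lia.
From mathcomp Require Import zify ssrZ.
Delimit Scope nat_scope with N.
Set Implicit Arguments.
Unset Strict Implicit.
Unset Printing Implicit Defensive.
Local Open Scope group_scope.

(** Following the numbers game, an element w of the quotient is encoded by the
    integers c_i = <w(Lambda_0), alpha_i^vee>: the game starts from the state e_0, s_i
    acts by firing node i, and s_i w < w exactly when c_i < 0.  Bruhat coatoms are
    produced by deleting a letter of a reduced word, so two of them close to the
    top can be exhibited by firing sequences.  The quotient has a single element of
    each small length, hence palindromicity forces uniqueness of the elements
    of small colength, and a search over the states shows that w lies in a proper
    parabolic subgroup, up to a few words that are the only reduced words of the
    elements they represent.  For elements of a proper parabolic subgroup all the
    integers c_i met are in {-1, 0, 1}; then Bruhat covers below w are left weak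
    covers, the descents of an element commute, and a weak cover removes one box
    from one part of pi(w).  Conversely the isomorphism preserves ranks, so that
    rank symmetry of the Young interval is palindromicity of w. *)

(** The obstacle on the Young side is locality. Removing a box from an inner part multiplies by a
    generator in the middle of the factorization; this is a weak cover of the whole element only if
    that generator commutes with all segments to its left. It does, because the letters of a segment
    form a submultiset of those of the segment to its right, up to exchanging the nodes 0 and 1 in
    the forked types; for proper support this follows from the linearity of states, every letter
    being fired at an entry 1. On the side of the search, a state is bound by a linear form that no
    firing changes (the level) and by inequalities that forbid a second coatom. In the exceptional
    types linear arithmetic then leaves finite lists, and in E6 and E7 also one-parameter families
    that need long certificates. In types B, C, D a state is an integer vector whose entries are
    permuted and reflected by the generators; uniqueness in colengths 1 and 2 suffices except for
    the constant vectors of type B (up to exchanging 0 and 1), excluded by a count in colength 4. In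
    type A1 the whole quotient is a good domain and nothing has to be searched. *)

(* Restated on [groupType] so that all products in a goal are syntactically
   the same, which [lia] needs to identify their lengths. *)
Lemma mgA (G : groupType) (a b c : G) : a * (b * c) = a * b * c.
Proof. exact: mulgA. Qed.

Lemma mgV (G : groupType) (a b : G) : (a * b)^-1 = b^-1 * a^-1.
Proof. exact: invgM. Qed.

(** * Words, length and the strong exchange condition *)

Section Coxeter.
Variables (I : finType) (M : I -> I -> nat) (G : groupType) (s : I -> G).
Hypothesis cox : coxeter_system M s.
Hypothesis M1 : forall i, M i i = 1%N.

Notation wp := (wprod s).
Notation l := (len s).

Lemma wprod_nil : wp [::] = 1. Proof. exact: big_nil. Qed.
Lemma wprod_cons i x : wp (i :: x) = s i * wp x. Proof. exact: big_cons. Qed.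
Lemma wprod_cat x y : wp (x ++ y) = wp x * wp y. Proof. exact: big_cat. Qed.
Lemma wprod_seq1 i : wp [:: i] = s i. Proof. exact: big_seq1. Qed.

Lemma gen_sq i : s i * s i = 1.
Proof.
have := (proj2 cox [:: i; i] [::]).2.
rewrite !wprod_cons wprod_nil mulg1; apply.
by have := @cox_rel I M [::] [::] i i; rewrite M1.
Qed.

Lemma genV i : (s i)^-1 = s i.
Proof. exact: mulg1_eq (gen_sq i). Qed.

Lemma genK i g : s i * (s i * g) = g.
Proof. by rewrite mgA gen_sq mul1g. Qed.

Lemma genKr i g : g * s i * s i = g.
Proof. by rewrite -mgA gen_sq mulg1. Qed.

Lemma wprod_rev x : wp (rev x) = (wp x)^-1.
Proof.
elim: x => [|i x IH]; first by rewrite wprod_nil invg1.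
by rewrite rev_cons -cats1 wprod_cat IH wprod_seq1 wprod_cons mgV genV.
Qed.

Lemma wprod_surj g : exists x, wp x = g. Proof. exact: (proj1 cox). Qed.

Lemma len_spec g : (exists2 x, wp x = g & size x = l g) /\
  (forall x, wp x = g -> (l g <= size x)%N).
Proof.
rewrite /len; case: xgetP => [k -> [] //|/= none].
suff [k [H1 H2]] : exists k, (exists2 x, wp x = g & size x = k) /\
    (forall x, wp x = g -> (k <= size x)%N) by case: (none k).
have ex : exists k, `[< exists2 x, wp x = g & size x = k >].
  by have [x xg] := wprod_surj g; exists (size x); apply/asboolP; exists x.
case: (ex_minnP ex) => k /asboolP Hk Hmin; exists k; split => // x xg.
by apply: Hmin; apply/asboolP; exists x.
Qed.

Lemma len_word g : exists2 x, wp x = g & size x = l g.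
Proof. exact: (len_spec g).1. Qed.

Lemma len_le x : (l (wp x) <= size x)%N.
Proof. exact: (len_spec _).2. Qed.

Lemma len1 : l 1 = 0%N.
Proof. by have := len_le [::]; rewrite wprod_nil leqn0 => /eqP. Qed.

Lemma len0 g : l g = 0%N -> g = 1.
Proof. by have [[|i x] <- <-] // := len_word g; rewrite wprod_nil. Qed.

Lemma len_mul g h : (l (g * h) <= l g + l h)%N.
Proof.
have [x <- <-] := len_word g; have [y <- <-] := len_word h.
by rewrite -wprod_cat -size_cat len_le.
Qed.

Lemma lenV g : l g^-1 = l g.
Proof.
have le h : (l h^-1 <= l h)%N.
  by have [x <- <-] := len_word h; rewrite -wprod_rev -(size_rev x) len_le.
by apply/eqP; rewrite eqn_leq le -{1}(invgK g) le.
Qed.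

Lemma len_gen_le i : (l (s i) <= 1)%N.
Proof. by rewrite -wprod_seq1 (len_le [:: i]). Qed.

(* t lies in [refls x] when t * wp x is obtained by deleting a letter of x. *)
Fixpoint refls (x : seq I) : seq G :=
  if x is i :: y then s i :: [seq s i * t * s i | t <- refls y] else [::].

(** Unlike the multiset [refls x], this parity depends only on the element [wp x]: it tells whether
    [t] is a left inversion. This is the reflection cocycle from which strong exchange follows. *)
Definition par x t := odd (count_mem t (refls x)).

Lemma refls_cat x y :
  refls (x ++ y) = refls x ++ [seq wp x * t * (wp x)^-1 | t <- refls y].
Proof.
elim: x => [|i x IH] /=.
  by rewrite wprod_nil invg1; elim: (refls y) => //= t r <-; rewrite mul1g mulg1.
rewrite IH map_cat -map_comp; congr (_ :: _ ++ _); apply: eq_map => t /=.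
by rewrite wprod_cons mgV genV !mgA.
Qed.

Lemma refls_dihedral i j m :
  refls (flatten (nseq m [:: i; j])) =
  [seq (s i * s j) ^+ p * s i | p <- iota 0 (m + m)].
Proof.
elim: m => [|m IH] //=.
rewrite addnS /= IH expg0 expg1 mul1g; congr [:: _, _ & _].
rewrite -map_comp -[in RHS](addn0 2) iotaDl -map_comp -map_comp.
apply: eq_map => p /=.
by rewrite add2n expgS expgSr !mgA.
Qed.

Lemma count_conj (g t : G) r :
  count_mem t [seq g * u * g^-1 | u <- r] = count_mem (g^-1 * t * g) r.
Proof.
rewrite count_map; apply: eq_count => u /=.
apply/eqP/eqP => [<-|->]; first by rewrite !mgA mulVg mul1g mulgVK.
by rewrite !mgA mulgV mul1g mulgK.
Qed.

Lemma par_cat x y t : par (x ++ y) t = par x t (+) par y ((wp x)^-1 * t * wp x).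
Proof. by rewrite /par refls_cat count_cat count_conj oddD. Qed.

Lemma gen_relation i j : (s i * s j) ^+ M i j = 1.
Proof.
have := (proj2 cox _ _).2 (@cox_rel I M [::] [::] i j); rewrite /= cats0 wprod_nil.
elim: (M i j) => [|m IH] //= H; rewrite -{}H expgS.
by elim: m {IH} => [|m IH] /=; rewrite !wprod_cons ?wprod_nil ?expg0 !mgA // expgS IH /= !wprod_cons !mgA.
Qed.

(** The list runs through the exponents below [M i j + M i j]; by the relation its second half
    repeats the first, so every reflection is counted an even number of times. *)
Lemma par_dihedral i j t : par (flatten (nseq (M i j) [:: i; j])) t = false.
Proof.
rewrite /par refls_dihedral iotaD map_cat count_cat oddD.
rewrite add0n -[X in _ (+) X]/(odd (count_mem t [seq _ | p <- iota (M i j) _])).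
have -> : [seq (s i * s j) ^+ p * s i | p <- iota (M i j) (M i j)] =
          [seq (s i * s j) ^+ p * s i | p <- iota 0 (M i j)].
  rewrite -[in X in map _ X](addn0 (M i j)) iotaDl addn0 -map_comp.
  by apply: eq_map => p /=; rewrite expgnDr gen_relation mul1g.
by rewrite addbb.
Qed.

Lemma par_cox_eq x y : cox_eq M x y -> forall t, par x t = par y t.
Proof.
elim=> {x y} [x y i j t|//|x y _ IH t|x y z _ IH1 _ IH2 t].
- rewrite par_cat par_cat par_dihedral addFb par_cat; congr (_ (+) par _ _).
  have -> : wp (flatten (nseq (M i j) [:: i; j])) = 1.
    have := (proj2 cox _ _).2 (@cox_rel I M [::] [::] i j).
    by rewrite /= cats0 wprod_nil.
  by rewrite invg1 mul1g mulg1.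
- by rewrite IH.
- by rewrite IH1 IH2.
Qed.

Lemma par_eq x y t : wp x = wp y -> par x t = par y t.
Proof. by move=> /(proj2 cox x y).1 /par_cox_eq ->. Qed.

Lemma mem_refls t x : t \in refls x ->
  exists x1 i x2, x = x1 ++ i :: x2 /\ t * wp x = wp (x1 ++ x2).
Proof.
elim: x t => [//|i x IH] t /=; rewrite inE => /predU1P[->|/mapP[u ux ->]].
  by exists [::], i, x; rewrite /= wprod_cons genK.
have [x1 [j [x2 [xE uE]]]] := IH _ ux.
exists (i :: x1), j, x2; rewrite xE; split => //=.
by rewrite !wprod_cons -uE xE -!mgA genK.
Qed.

Lemma par_delete t x : par x t ->
  exists x1 i x2, x = x1 ++ i :: x2 /\ t * wp x = wp (x1 ++ x2).
Proof.
move=> tx; apply: mem_refls; rewrite -has_pred1 has_count.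
by move: tx; rewrite /par; case: (count_mem t _).
Qed.

(** In the word [u ++ i :: rev u] the contributions of [u] and [rev u] cancel, because [u ++ rev u]
    represents 1; what remains is the middle letter, counted once. *)
Lemma par_self t x : reflection s t -> wp x = t -> par x t.
Proof.
move=> [i [g tE]] xt; have [u uE] := wprod_surj g^-1.
have tu : wp (u ++ i :: rev u) = t.
  by rewrite wprod_cat wprod_cons wprod_rev uE invgK tE conjgE.
have cu : (wp u)^-1 * t * wp u = s i.
  by rewrite uE tE conjgE invgK -!mgA mulVKg mulgV mulg1.
rewrite (par_eq t (etrans xt (esym tu))) par_cat cu -cat1s par_cat wprod_seq1.
have -> : par [:: i] (s i) = true by rewrite /par /= eqxx.
rewrite genV gen_sq mul1g.
have : par (u ++ rev u) t = false.
  by rewrite (@par_eq _ [::]) // wprod_cat wprod_rev mulgV wprod_nil.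
by rewrite par_cat cu; case: (par u t) (par (rev u) (s i)) => [] [].
Qed.

Lemma par_mul t x y : reflection s t -> wp y = t * wp x -> par y t = ~~ par x t.
Proof.
move=> rt yE; have [z zE] := wprod_surj t.
rewrite (@par_eq y (z ++ x)) ?wprod_cat ?zE // par_cat (par_self rt zE) zE.
by rewrite mulVg mul1g addTb.
Qed.

Lemma reflection_sq t : reflection s t -> t * t = 1.
Proof. by case=> i [g ->]; rewrite -conjMg gen_sq conj1g. Qed.

Lemma reflectionK t g : reflection s t -> t * (t * g) = g.
Proof. by move=> rt; rewrite mgA reflection_sq // mul1g. Qed.

Lemma reflection_conj t g : reflection s t -> reflection s (t ^ g).
Proof. by case=> i [h ->]; exists i, (h * g); rewrite conjgM. Qed.

Lemma reflection_gen i : reflection s (s i).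
Proof. by exists i, 1; rewrite conjg1. Qed.

(** Odd parity deletes a letter of a reduced word, hence shortens. Even parity at [x] means odd
    parity at [t * wp x] by [par_mul], so there it is the way back that shortens. *)
Lemma par_len t x : reflection s t -> par x t = (l (t * wp x) < l (wp x))%N.
Proof.
move=> rt.
have lt y : par y t -> (l (t * wp y) < l (wp y))%N.
  have [z zy <-] := len_word (wp y); rewrite (par_eq t (esym zy)) => /par_delete.
  case=> x1 [i [x2 [zE]]]; rewrite -zy => ->; apply: leq_ltn_trans (len_le _) _.
  by rewrite zE !size_cat /= addnS.
case px: (par x t); first by rewrite lt.
have [y yE] := wprod_surj (t * wp x).
have := lt y; rewrite (par_mul rt yE) px yE reflectionK // => /(_ isT).
by move=> H; apply/esym/negbTE; rewrite -leqNgt ltnW.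
Qed.

Lemma reflection_len t w : reflection s t ->
  ((l (t * w) < l w) || (l w < l (t * w)))%N.
Proof.
move=> rt; have [x <-] := wprod_surj w; have [y yE] := wprod_surj (t * wp x).
have := par_mul rt yE; rewrite !par_len // yE reflectionK //.
by case: ltngtP.
Qed.

Theorem strong_exchange t x : reflection s t -> (l (t * wp x) < l (wp x))%N ->
  exists x1 i x2, x = x1 ++ i :: x2 /\ t * wp x = wp (x1 ++ x2).
Proof. by move=> rt; rewrite -par_len // => /par_delete. Qed.

Lemma strong_exchange_right t x : reflection s t -> (l (wp x * t) < l (wp x))%N ->
  exists x1 i x2, x = x1 ++ i :: x2 /\ wp x * t = wp (x1 ++ x2).
Proof.
move=> rt; have -> : wp x * t = t ^ (wp x)^-1 * wp x.
  by rewrite conjgE invgK !mgA mulgVK.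
by apply: strong_exchange; apply: reflection_conj.
Qed.

Lemma len_genM i w : l (s i * w) = (l w).+1 \/ l w = (l (s i * w)).+1.
Proof.
have := reflection_len w (reflection_gen i).
have := len_mul (s i) w; have := len_mul (s i) (s i * w).
by have := len_gen_le i; rewrite genK; lia.
Qed.

Lemma len_Mgen i w : l (w * s i) = (l w).+1 \/ l w = (l (w * s i)).+1.
Proof. by have := len_genM i w^-1; rewrite -genV -mgV !lenV genV. Qed.

Lemma len_gen i : l (s i) = 1%N.
Proof. by have := len_genM i 1; rewrite mulg1 len1 => -[]. Qed.

Lemma desc_exists w : w <> 1 -> exists i, (l (s i * w) < l w)%N.
Proof.
have [[|i x] <- xl] := len_word w; first by rewrite wprod_nil.
move=> _; exists i; rewrite wprod_cons genK -wprod_cons -xl.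
by apply: leq_ltn_trans (len_le _) _.
Qed.

Lemma desc_right_exists w : w <> 1 -> exists i, (l (w * s i) < l w)%N.
Proof.
move=> w1; have [|i] := @desc_exists w^-1.
  by move=> /(congr1 (fun g => g^-1)); rewrite invgK invg1.
by exists i; rewrite -(lenV (w * s i)) mgV genV -(lenV w).
Qed.

(** * Bruhat order *)

Notation le := (bruhat s).

Lemma bruhat_refl w : le w w. Proof. exact: rt_refl. Qed.
Lemma bruhat_trans v u w : le u v -> le v w -> le u w. Proof. exact: rt_trans. Qed.

Lemma bruhat_edge t u : reflection s t -> (l u < l (t * u))%N -> le u (t * u).
Proof.
move=> rt lt; apply: rt_step; split => //; exists (t ^ u).
  exact: reflection_conj.
by rewrite conjgE mulVKg.
Qed.

Lemma bruhat_ind_left (P : G -> G -> Prop) :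
  (forall w, P w w) ->
  (forall t u w, reflection s t -> (l u < l (t * u))%N ->
     le (t * u) w -> P (t * u) w -> P u w) ->
  forall u w, le u w -> P u w.
Proof.
move=> H0 H1 u w /Operators_Properties.clos_rt_rt1n_iff; elim=> // {u w} u v w [lt [t rt vE]] vw Pvw.
have vE' : v = t ^ u^-1 * u by rewrite vE conjgE invgK !mgA mulgVK.
apply: (H1 (t ^ u^-1)); rewrite -?vE' //; first exact: reflection_conj.
exact/Operators_Properties.clos_rt_rt1n_iff.
Qed.

Lemma bruhat_len u w : le u w -> (l u <= l w)%N.
Proof. by elim=> {u w} [u w [/ltnW]|//|u v w _ H1 _ H2] //; apply: leq_trans H2. Qed.

Lemma bruhat_eq u w : le u w -> (l w <= l u)%N -> u = w.
Proof.
elim/bruhat_ind_left => {u w} // t u w _ lt /bruhat_len H _ H'.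
by lia.
Qed.

Lemma bruhat_inv u w : le u w -> le u^-1 w^-1.
Proof.
elim/bruhat_ind_left => {u w} [w|t u w rt lt _]; first exact: bruhat_refl.
apply: bruhat_trans; apply: rt_step; split; first by rewrite !lenV.
by exists t => //; rewrite mgV (mulg1_eq (reflection_sq rt)).
Qed.

Lemma bruhat_edge_gen t u i : reflection s t -> (l u < l (t * u))%N ->
  le (s i * u) (s i * (t * u)) \/ s i * u = t * u.
Proof.
move=> rt lt; set v := t * u.
have vE : s i * v = t ^ (s i) * (s i * u).
  by rewrite conjgE genV -!mgA genK.
have rt' : reflection s (t ^ s i) by apply: reflection_conj.
case/orP: (reflection_len (s i * u) rt'); rewrite -vE => lt'; last first.
  by left; rewrite vE; apply: bruhat_edge; rewrite -?vE.
right; have [x xE xl] := len_word (s i * v).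
have vx : v = wp (i :: x) by rewrite wprod_cons xE genK.
have := @strong_exchange t (i :: x) rt; rewrite -vx {1 3}/v reflectionK //.
case=> // [[|k x1]] [j [x2 [/= ]]].
  by move=> [_ <-] ->; rewrite xE genK.
move=> [<- xE2]; rewrite wprod_cons => uE.
have : (l (s i * u) < l (s i * v))%N.
  rewrite uE genK -xl xE2 !size_cat /= addnS ltnS -size_cat; exact: len_le.
by lia.
Qed.

Lemma bruhat_gen u w i : le u w -> le (s i * u) w \/ le (s i * u) (s i * w).
Proof.
elim/bruhat_ind_left => {u w} [w|t u w rt lt tuw IH].
  by right; apply: bruhat_refl.
have [H|->] := bruhat_edge_gen i rt lt; last by left.
by case: IH => H'; [left|right]; apply: bruhat_trans H'.
Qed.

Lemma bruhat_gen' u w i : le u w -> le u (s i * w) \/ le (s i * u) (s i * w).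
Proof.
elim/bruhat_ind_left => {u w} [w|t u w rt lt tuw IH].
  by right; apply: bruhat_refl.
have [H|E] := bruhat_edge_gen i rt lt.
  case: IH => H'; last by right; apply: bruhat_trans H'.
  by left; apply: bruhat_trans H'; apply: bruhat_edge.
case: IH => H'; first by left; apply: bruhat_trans H'; apply: bruhat_edge.
by left; move: H'; rewrite -E genK.
Qed.

Lemma bruhat_asc i u : (l u < l (s i * u))%N -> le u (s i * u).
Proof. exact/bruhat_edge/reflection_gen. Qed.

Lemma bruhat_desc i u : (l (s i * u) < l u)%N -> le (s i * u) u.
Proof. by move=> lt; rewrite -{2}(genK i u); apply: bruhat_asc; rewrite genK. Qed.

Lemma lift_up i u w : le u w -> (l (s i * w) < l w)%N -> le (s i * u) w.
Proof.
move=> uw lt; case: (bruhat_gen i uw) => // H; apply: bruhat_trans H _.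
by rewrite -{2}(genK i w); apply: bruhat_asc; rewrite genK.
Qed.

Lemma lift_down i u w : le u w -> (l u < l (s i * u))%N -> le u (s i * w).
Proof.
move=> uw lt; case: (bruhat_gen' i uw) => // H.
exact: bruhat_trans (bruhat_asc lt) H.
Qed.

Lemma lift_down_right i u w : le u w -> (l u < l (u * s i))%N -> le u (w * s i).
Proof.
move=> uw lt; rewrite -(invgK u) -(invgK (w * s i)); apply: bruhat_inv.
rewrite mgV genV; apply: lift_down; first exact: bruhat_inv.
by rewrite -{1}(genV i) -mgV !lenV.
Qed.

Lemma bruhat_suffix x u : l (x * u) = (l x + l u)%N -> le u (x * u).
Proof.
have [y <- <-] := len_word x => {x}.
elim: y => [|i y IH]; first by rewrite wprod_nil mul1g => _; apply: bruhat_refl.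
rewrite wprod_cons -mgA => E.
have E' : l (wp y * u) = (size y + l u)%N.
  have := len_mul (wp y) u; have := len_le y.
  by have := len_mul (s i) (wp y * u); have := len_gen i; move: E => /=; lia.
apply: bruhat_trans (IH E') _; apply: bruhat_asc.
by rewrite E E' /=; lia.
Qed.

Lemma bruhat1 w : le 1 w.
Proof. by have := @bruhat_suffix w 1; rewrite mulg1 len1 addn0; apply. Qed.

(** * Parabolic subgroups and quotients *)

Implicit Types A : pred I.

Lemma parabolic1 A : parabolic s A 1.
Proof. by exists [::]; rewrite ?wprod_nil. Qed.

Lemma parabolicM A g h : parabolic s A g -> parabolic s A h -> parabolic s A (g * h).
Proof.
by move=> [x Ax <-] [y Ay <-]; exists (x ++ y); rewrite ?wprod_cat // all_cat Ax.
Qed.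

Lemma parabolicV A g : parabolic s A g -> parabolic s A g^-1.
Proof. by move=> [x Ax <-]; exists (rev x); rewrite ?wprod_rev // all_rev. Qed.

Lemma parabolic_gen A i : A i -> parabolic s A (s i).
Proof. by move=> Ai; exists [:: i]; rewrite ?wprod_seq1 //= Ai. Qed.

(** Strong exchange only deletes letters, so shortening a word never leaves [A]. *)
Lemma parabolic_word A v : parabolic s A v ->
  exists x, [/\ all A x, wp x = v & size x = l v].
Proof.
move=> [y Ay <-]; elim: y Ay => [_|i y IH /= /andP[Ai /IH [x [Ax xy xl]]]].
  by exists [::]; rewrite wprod_nil len1.
rewrite wprod_cons -xy; have [E|E] := len_genM i (wp x).
  by exists (i :: x); rewrite /= Ai Ax wprod_cons E xl xy.
have [||x1 [j [x2 [xE xE2]]]] := @strong_exchange (s i) x.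
- exact: reflection_gen.
- by rewrite E.
exists (x1 ++ x2); split => //.
  by move: Ax; rewrite xE !all_cat /= => /and3P[-> _ ->].
by move: E; rewrite xy -xl xE !size_cat /=; lia.
Qed.

(** The letters of a reduced word of [v] are added one at a time. If one of them shortened the
    product, strong exchange would delete a letter: in the word of [g] this contradicts the
    minimality of [g] in its coset, in the word of [v] it contradicts that this word stays
    reduced. *)
Lemma minrep_len_add A g v : minrep s A g -> parabolic s A v ->
  l (g * v) = (l g + l v)%N.
Proof.
move=> mg /parabolic_word[x [Ax <- xl]]; rewrite -xl.
elim/last_ind: x Ax xl => [|x k IH]; first by rewrite wprod_nil mulg1 addn0.
rewrite all_rcons size_rcons -cats1 wprod_cat wprod_seq1 => /andP[Ak Ax] xl.
have xl' : size x = l (wp x).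
  by have := len_le x; have := len_mul (wp x) (s k); rewrite len_gen -xl; lia.
have {}IH := IH Ax xl'.
rewrite mgA; have [->|E] := len_Mgen k (g * wp x); first by rewrite IH; lia.
have [y yg yl] := len_word g.
have [||x1 [j [x2 [xE xE2]]]] := @strong_exchange_right (s k) (y ++ x).
- exact: reflection_gen.
- by rewrite wprod_cat yg E.
have /(congr1 (take (size y))) := xE; have /(congr1 (drop (size y))) := xE.
rewrite take_size_cat // drop_size_cat // drop_cat take_cat.
case: (ltnP (size x1) (size y)) => [lt|ge].
  rewrite ltnNge (ltnW lt) /= => xd yd; exfalso.
  have d1 : (size y - size x1)%N = (size y - size x1).-1.+1 by lia.
  set y' := x1 ++ take (size y - size x1).-1 x2.
  have x2E : x2 = take (size y - size x1).-1 x2 ++ x.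
    by rewrite xd d1 /= cat_take_drop.
  have yl' : (size y' < size y)%N.
    by rewrite [in X in (_ < X)%N]yd d1 /y' !size_cat /= ltn_add2l.
  have E' : g * (wp x * s k * (wp x)^-1) = wp y'.
    move: xE2; rewrite {1}x2E catA -/y' !wprod_cat yg !mgA => ->.
    by rewrite mulgK.
  have := mg (wp x * s k * (wp x)^-1).
  have pA : parabolic s A (wp x * s k * (wp x)^-1).
    by apply: parabolicM; [apply: parabolicM; [exists x|apply: parabolic_gen]|apply: parabolicV; exists x].
  by rewrite E' -yl => /(_ pA); have := len_le y'; lia.
case: ltnP => [lt|le] xd yd; exfalso.
  have x1E : x1 = y ++ drop (size y) x1 by rewrite {1}yd cat_take_drop.
  move: xE2; rewrite {1}x1E -catA !(wprod_cat y) -mgA => /mulgI E3.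
  have := len_le (drop (size y) x1 ++ x2); rewrite -E3 -xl xd !size_cat /=; lia.
have szE : size x1 = size y by lia.
rewrite szE subnn drop0 in xd; rewrite szE subnn take0 cats0 in yd.
move: xE2; rewrite -yd !wprod_cat -mgA => /mulgI E3.
have := len_le x2; rewrite -E3 -xl xd /=; lia.
Qed.

Lemma coset_min A w : exists2 u, minrep s A u &
  exists2 v, parabolic s A v & w = u * v.
Proof.
have ex : exists k, `[< exists2 v, parabolic s A v & l (w * v) = k >].
  by exists (l w); apply/asboolP; exists 1; rewrite ?mulg1 //; apply: parabolic1.
case: (ex_minnP ex) => k /asboolP[v pv vE] Hmin.
exists (w * v); last by exists v^-1; rewrite ?mulgK //; apply: parabolicV.
move=> v' pv'; rewrite vE; apply: Hmin; apply/asboolP.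
by exists (v * v'); rewrite ?mgA //; apply: parabolicM.
Qed.

Lemma factorization_exists A w : exists u v, factorization s A w u v.
Proof.
have [u mu [v pv wE]] := coset_min A w; exists u, v; split => //.
by rewrite wE; apply: minrep_len_add mu pv.
Qed.

Lemma minrep_coset_inj A u u' v : minrep s A u -> minrep s A u' ->
  parabolic s A v -> u' = u * v -> u' = u /\ v = 1.
Proof.
move=> mu mu' pv E; have H1 := minrep_len_add mu pv.
have H2 := minrep_len_add mu' (parabolicV pv).
have v1 : v = 1 by apply: len0; move: H1 H2; rewrite lenV -E {2}E mulgK; lia.
by rewrite E v1 mulg1.
Qed.

Lemma minrepP A g : minrep s A g <-> forall k, A k -> (l g < l (g * s k))%N.
Proof.
split=> [mg k Ak|H].
  by rewrite (minrep_len_add mg (parabolic_gen Ak)) len_gen addn1.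
have [u mu [v pv gE]] := coset_min A g.
suff v1 : v = 1 by rewrite gE v1 mulg1.
have [x [Ax xv xl]] := parabolic_word pv; rewrite -xv in xl gE pv *.
elim/last_ind: x Ax xl gE pv {xv} => [|x k _]; first by rewrite wprod_nil.
rewrite all_rcons size_rcons -cats1 wprod_cat wprod_seq1 => /andP[Ak Ax] xl gE pv.
have := H k Ak; rewrite gE -!mgA gen_sq mulg1.
rewrite !(minrep_len_add mu) //; last by exists x.
by have := len_le x; lia.
Qed.

Lemma minrep1 A : minrep s A 1.
Proof. by move=> v _; rewrite len1. Qed.

Lemma minrep_desc A w i : minrep s A w -> (l (s i * w) < l w)%N ->
  minrep s A (s i * w).
Proof.
move=> /minrepP mw lt; apply/minrepP => k /mw; rewrite -mgA.
by have := len_genM i w; have := len_genM i (w * s k); have := len_Mgen k (s i * w); rewrite -mgA; lia.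
Qed.

Lemma minrep_suffix A x u : l (x * u) = (l x + l u)%N -> minrep s A (x * u) ->
  minrep s A u.
Proof.
have [y <- <-] := len_word x => {x}.
elim: y => [|i y IH]; first by rewrite wprod_nil mul1g.
rewrite wprod_cons -mgA => E mw.
have E' : l (wp y * u) = (size y + l u)%N.
  have := len_mul (wp y) u; have := len_le y.
  by have := len_mul (s i) (wp y * u); have := len_gen i; move: E => /=; lia.
apply: IH => //; rewrite -(genK i (wp y * u)); apply: minrep_desc => //.
by rewrite genK E E' /=; lia.
Qed.

(* Deodhar's lemma. *)
Lemma minrep_asc A w i : minrep s A w -> (l w < l (s i * w))%N ->
  minrep s A (s i * w) \/ exists2 k, A k & s i * w = w * s k.
Proof.
move=> mw lt; have [H|H] := pselect (exists2 k, A k & s i * w = w * s k).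
  by right.
left; apply/minrepP => k Ak.
have [->//|E] := len_Mgen k (s i * w).
have [x xw xl] := len_word w.
have [||x1 [j [x2 [xE xE2]]]] := @strong_exchange_right (s k) (i :: x).
- exact: reflection_gen.
- by rewrite wprod_cons xw E.
case: x1 xE xE2 => [|i' x1] /= [E0 xE]; rewrite wprod_cons xw -?E0.
  by rewrite -xE xw => E2; case: H; exists k => //; rewrite -{2}E2 genKr.
rewrite wprod_cons -mgA => /mulgI E2.
have := (minrepP A w).1 mw k Ak; rewrite E2 -xl xE.
by have := len_le (x1 ++ x2); rewrite !size_cat /=; lia.
Qed.

Lemma minrep_desc_right A w k : minrep s A w -> (l (w * s k) < l w)%N -> ~~ A k.
Proof. by move=> /minrepP mw lt; apply/negP => /mw; lia. Qed.

(** The quotient is graded by length. Along a left descent [i] of [w]: if [u] is not below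
    [s i * w], then [i] is a descent of [u] as well, and a coatom found between [s i * u] and
    [s i * w] is multiplied back by [s i]. *)
Lemma quotient_chain A u w : minrep s A u -> minrep s A w -> le u w -> u <> w ->
  exists v, [/\ minrep s A v, le u v, le v w & l w = (l v).+1].
Proof.
move: {2}(l w) (leqnn (l w)) => N; elim: N u w => [|N IH] u w wN mu mw uw neq.
  have lw : l w = 0%N by lia.
  by case: neq; apply: bruhat_eq => //; rewrite lw.
have [|i lt] := @desc_exists w.
  by move=> w1; case: neq; apply: bruhat_eq => //; rewrite w1 len1.
have mw' := minrep_desc mw lt.
have le' : le (s i * w) w by rewrite -{2}(genK i w); apply: bruhat_asc; rewrite genK.
have lw : l w = (l (s i * w)).+1 by have := len_genM i w; lia.
have [H|nle] := pselect (le u (s i * w)); first by exists (s i * w).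
have ltu : (l (s i * u) < l u)%N.
  by have [E|->//] := len_genM i u; case: nle; apply: lift_down => //; rewrite E.
have H : le (s i * u) (s i * w) by case: (bruhat_gen' i uw).
have [|||||v [mv uv vw lv]] := IH (s i * u) (s i * w).
- by lia.
- exact: minrep_desc.
- by [].
- exact: H.
- by move=> /mulgI.
have uE : u = s i * (s i * u) by rewrite genK.
have [E|E] := len_genM i v; last first.
  case: nle; case: (bruhat_gen i uv); rewrite genK => H'; first exact: bruhat_trans vw.
  apply: bruhat_trans H' _; apply: bruhat_trans vw.
  by rewrite -{2}(genK i v); apply: bruhat_asc; rewrite genK E.
have lti : (l v < l (s i * v))%N by rewrite E.
have [mv'|[k Ak E2]] := minrep_asc mv lti.
  exists (s i * v); split => //.
  - case: (bruhat_gen i uv); rewrite genK // => H'.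
    by case: nle; apply: bruhat_trans vw.
  - by apply: lift_up => //; apply: bruhat_trans vw le'.
  - by rewrite lw lv E.
(* Here [s i * v = v * s k] has left the quotient. Since [u] is minimal in its coset, [u] below
   [v * s k] would already lie below [v], hence below [s i * w]. *)
case: nle; case: (bruhat_gen i uv); rewrite genK => H'; first exact: bruhat_trans vw.
apply: bruhat_trans vw; rewrite -(genKr k v) -E2; apply: lift_down_right => //.
exact: (minrepP A u).1.
Qed.

(** * The numbers game *)

Variables (z0 : I) (A : I -> I -> Z).

(** The labels 2, 3, 4, 6 and infinity (encoded as 0) go with off-diagonal Cartan entries of product
    0, 1, 2, 3 and 4. For 4 and 6 both orientations are accepted, because the Coxeter group does not
    see the orientation of a multiple bond. *)
Definition bond (m : nat) (a b : Z) : Prop :=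
  match m with
  | 2 => a = 0%Z /\ b = 0%Z
  | 3 => a = 1%Z /\ b = 1%Z
  | 4 => (a = 1%Z /\ b = 2%Z) \/ (a = 2%Z /\ b = 1%Z)
  | 6 => (a = 1%Z /\ b = 3%Z) \/ (a = 3%Z /\ b = 1%Z)
  | 0 => a = 2%Z /\ b = 2%Z
  | _ => False
  end.

Hypothesis Aii : forall i, A i i = (-2)%Z.
Hypothesis Abond : forall i j, i != j -> bond (M i j) (A i j) (A j i).

(** [A] is minus the Cartan matrix, so this is a simple reflection acting on a weight given by its
    values on the simple coroots. *)
Definition fire (c : I -> Z) (i : I) : I -> Z := fun j => (c j + A i j * c i)%Z.

Definition actw (x : seq I) (c : I -> Z) : I -> Z := foldr (fun i d => fire d i) c x.

Definition e0 : I -> Z := fun i => if i == z0 then 1%Z else 0%Z.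

Lemma fireK c i : fire (fire c i) i = c.
Proof. by apply: funext => j; rewrite /fire Aii; lia. Qed.

Lemma fire_at c i : fire c i i = (- c i)%Z.
Proof. by rewrite /fire Aii; lia. Qed.

Lemma fire0 c i : c i = 0%Z -> fire c i = c.
Proof. by move=> ci; apply: funext => j; rewrite /fire ci; lia. Qed.

(** Firing [i] or [j] only adds multiples of the rows [i] and [j] of [A]. On the coefficients [p]
    and [q] it is an explicit affine map, which turns the Coxeter relations into ring identities. *)
Definition dihedral_state i j (c : I -> Z) p q : I -> Z :=
  fun k => (c k + p * A i k + q * A j k)%Z.

Lemma fire_lin1 i j c p q :
  fire (dihedral_state i j c p q) i = dihedral_state i j c (c i - p + q * A j i)%Z q.
Proof. by apply: funext => k; rewrite /fire /dihedral_state Aii; ring. Qed.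

Lemma fire_lin2 i j c p q :
  fire (dihedral_state i j c p q) j = dihedral_state i j c p (c j - q + p * A i j)%Z.
Proof. by apply: funext => k; rewrite /fire /dihedral_state Aii; ring. Qed.

Lemma actw_relation i j c : actw (flatten (nseq (M i j) [:: i; j])) c = c.
Proof.
have [<-|ij] := eqVneq i j; first by rewrite M1 /= fireK.
have cl : c = dihedral_state i j c 0 0 by apply: funext => k; rewrite /dihedral_state; ring.
suff H : actw (flatten (nseq (M i j) [:: i; j])) (dihedral_state i j c 0 0) = dihedral_state i j c 0 0.
  by rewrite {1}cl H -cl.
move: (Abond ij); case: (M i j) => [|[|[|[|[|[|[|m]]]]]]] //=.
- by case=> a b; rewrite !(fire_lin1, fire_lin2) a b; congr dihedral_state; ring.
- by case=> a b; rewrite !(fire_lin1, fire_lin2) a b; congr dihedral_state; ring.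
- by case=> [[a b]|[a b]]; rewrite !(fire_lin1, fire_lin2) a b; congr dihedral_state; ring.
- by case=> [[a b]|[a b]]; rewrite !(fire_lin1, fire_lin2) a b; congr dihedral_state; ring.
Qed.

Lemma actw_cat x y c : actw (x ++ y) c = actw x (actw y c).
Proof. exact: foldr_cat. Qed.

Lemma actw_cox_eq x y : cox_eq M x y -> forall c, actw x c = actw y c.
Proof.
elim=> {x y} [x y i j c|//|x y _ IH c|x y z _ IH1 _ IH2 c].
- by rewrite !actw_cat actw_relation.
- by rewrite IH.
- by rewrite IH1 IH2.
Qed.

Definition st (g : G) : I -> Z := actw (sval (cid (wprod_surj g))) e0.

Lemma stE x : st (wp x) = actw x e0.
Proof.
rewrite /st; case: cid => y /= yE; apply: actw_cox_eq.
exact: (proj2 cox y x).1.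
Qed.

Lemma st1 : st 1 = e0.
Proof. by rewrite -wprod_nil stE. Qed.

Lemma st_gen i g : st (s i * g) = fire (st g) i.
Proof. by have [x <-] := wprod_surj g; rewrite -wprod_cons !stE. Qed.

Lemma st_word x g : st (wp x * g) = actw x (st g).
Proof. by have [y <-] := wprod_surj g; rewrite -wprod_cat !stE actw_cat. Qed.

Notation S := [pred i | i != z0].

(** The entries of [e0] away from [z0] vanish, so these generators fix the starting weight and the
    state only depends on the coset. *)
Lemma st_parabolic g v : parabolic s S v -> st (g * v) = st g.
Proof.
move=> [x Sx <-]; have [y <-] := wprod_surj g; rewrite !st_word stE.
rewrite stE; congr actw; elim: x Sx => //= i x IH /andP[Si /IH ->].
by apply: fire0; rewrite /e0 (negbTE Si).
Qed.

Fixpoint alt (j i : I) (k : nat) : seq I :=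
  if k is k'.+1 then j :: alt i j k' else [::].

Lemma size_alt j i k : size (alt j i k) = k.
Proof. by elim: k i j => //= k IH i j; rewrite IH. Qed.

Lemma altSr j i k : alt j i k.+1 = rcons (alt j i k) (if odd k then i else j).
Proof.
elim: k i j => // k IH i j; rewrite -[LHS]/(j :: alt i j k.+1) IH /=.
by case: (odd k).
Qed.

Lemma alt_add j i m k : exists x, alt j i (m + k) = alt j i m ++ x /\ size x = k.
Proof.
elim: k => [|k [x [E sx]]]; first by exists [::]; rewrite addn0 cats0.
exists (rcons x (if odd (m + k) then i else j)).
by rewrite addnS altSr E -rcons_cat size_rcons sx.
Qed.

Lemma braid i j : M i j \in [:: 2; 3; 4; 6]%N ->
  wp (alt i j (M i j)) = wp (alt j i (M i j)).
Proof.
have := gen_relation i j.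
rewrite !inE; case: (M i j) => [|[|[|[|[|[|[|m]]]]]]] //= E _;
  rewrite !wprod_cons wprod_nil !mulg1; move: E; rewrite !expgS expg0 !mulg1 => E.
- by have := mulg1_eq E; rewrite !mgV !genV.
- have {}E : (s i * (s j * s i)) * (s j * (s i * s j)) = 1 by rewrite -E !mgA.
  by have := mulg1_eq E; rewrite !mgV !genV !mgA.
- have {}E : (s i * (s j * (s i * s j))) * (s i * (s j * (s i * s j))) = 1.
    by rewrite -E !mgA.
  by have := mulg1_eq E; rewrite !mgV !genV !mgA.
- set x := s i * (s j * (s i * (s j * (s i * s j)))).
  have {}E : x * x = 1 by rewrite -E /x !mgA.
  by have := mulg1_eq E; rewrite /x !mgV !genV !mgA.
Qed.

(** Strips the largest left factor in the dihedral subgroup of [i] and [j]. As [i] is not a descent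
    of [w], this factor is alternating and, if not trivial, starts with [j]. *)
Lemma strip_dihedral w i j : ~~ (l (s i * w) < l w)%N ->
  exists k v, [/\ w = wp (alt j i k) * v, l w = (k + l v)%N,
    (l v < l (s i * v))%N & (l v < l (s j * v))%N].
Proof.
move: {2}(l w) (leqnn (l w)) => N.
elim: N w i j => [|N IH] w i j wN ni.
  have w1 : w = 1 by apply: len0; lia.
  exists 0%N, w; rewrite wprod_nil mul1g w1 len1 !mulg1 !len_gen.
  by split.
have [E|E] := len_genM j w.
  exists 0%N, w; rewrite wprod_nil mul1g E; split => //.
  by have := len_genM i w; lia.
have [||k [v [E1 E2 E3 E4]]] := IH (s j * w) j i.
- by lia.
- by rewrite genK E; lia.
exists k.+1, v; split => //; last by lia.
by rewrite /= wprod_cons -mgA -E1 genK.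
Qed.

Lemma not_minrep_gen (w v : G) x r k : w = wp x * v * s r -> S r ->
  l w = (k + l v)%N -> (size x < k)%N -> ~ minrep s S w.
Proof.
move=> wE Sr lw sx /(@minrepP S w).1 /(_ r Sr); rewrite {2}wE genKr lw.
by have := len_mul (wp x) v; have := len_le x; lia.
Qed.

(** The counterpart of the fact that every root is positive or negative. For a descent [j] of [w]
    the dihedral factor of [i] and [j] is stripped off; the shorter [v] has nonnegative entries at
    both nodes by induction, and the entry of [w] at [i] is a combination of these two, computed in
    rank two. *)
Lemma st_sign N w : (l w <= N)%N -> minrep s S w -> forall i,
  (l w < l (s i * w))%N -> (0 <= st w i)%Z /\
    (st w i = 0%Z -> exists2 k, S k & s i * w = w * s k).
Proof.
elim: N w => [|N IH] w wN mw i lt.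
  have w1 : w = 1 by apply: len0; lia.
  rewrite w1 st1 /e0 mulg1; case: eqVneq => [_|Si] //; split => // _.
  by exists i; rewrite ?mul1g.
have [w1|/eqP w1] := eqVneq w 1; first by apply: IH => //; rewrite w1 len1.
have [j ltj] := desc_exists w1.
have ij : j != i by apply: contraTneq ltj => ->; lia.
have [|k [v [wE lw vi vj]]] := @strip_dihedral w i j; first by lia.
have k0 : (0 < k)%N.
  by case: k wE lw => // wE _; move: ltj; rewrite wE wprod_nil mul1g; lia.
have mv : minrep s S v.
  apply: (@minrep_suffix S (wp (alt j i k))); rewrite -?wE // lw.
  have := len_mul (wp (alt j i k)) v; have := len_le (alt j i k).
  by rewrite -wE lw size_alt; lia.
have [|di zi] := IH v _ mv i vi; first by lia.
have [|dj zj] := IH v _ mv j vj; first by lia.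
(* If both entries vanish, the last letter of the alternating word passes through [v] as a generator
   [s r] with [r] in [S], so [w] would not be minimal in its coset. *)
have both0 : st v i = 0%Z -> st v j = 0%Z -> False.
  move=> /zi[r Sr Er] /zj[r' Sr' Er'].
  move: k0 wE lw; case: k => // k _; rewrite altSr -cats1 wprod_cat wprod_seq1 -mgA.
  case: (odd k); rewrite ?Er ?Er' mgA => wE lw.
    by apply: (@not_minrep_gen w v (alt j i k) r k.+1); rewrite ?size_alt.
  by apply: (@not_minrep_gen w v (alt j i k) r' k.+1); rewrite ?size_alt.
have stw : st w = actw (alt j i k) (st v) by rewrite wE st_word.
have bd := Abond ij.
(* An alternating word of full length could be rewritten by the braid relation to start with [i],
   making [i] a descent of [w]. *)
have km : M j i \in [:: 2; 3; 4; 6]%N -> (k < M j i)%N.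
  move=> mm; rewrite ltnNge; apply/negP => ge.
  have [x [xE sx]] := alt_add j i (M j i) (k - M j i).
  move: wE; rewrite -(subnKC ge) xE wprod_cat braid //.
  case: (M j i) mm xE ge sx => // m _ _ ge sx wE.
  have : (l (s i * w) <= m + (size x + l v))%N.
    rewrite wE /= wprod_cons -!mgA genK.
    apply: leq_trans (len_mul _ _) _; apply: leq_add.
      by rewrite -{2}(size_alt j i m) len_le.
    by apply: leq_trans (len_mul _ _) _; rewrite leq_add2r len_le.
  by lia.
(* A zero entry only occurs when the dihedral factor is one letter short of the longest element; the
   braid relation then moves [s i] through it. *)
have last0 : M j i \in [:: 2; 3; 4; 6]%N -> k.+1 = M j i ->
    (exists2 r, S r & s (if odd k then i else j) * v = v * s r) ->
    exists2 r, S r & s i * w = w * s r.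
  move=> mm kE [r Sr Er]; exists r => //.
  rewrite wE mgA -wprod_cons -[i :: alt j i k]/(alt i j k.+1) kE -braid // -kE.
  by rewrite altSr -cats1 wprod_cat wprod_seq1 -!mgA Er.
rewrite stw; case: (M j i) bd km last0 => [|[|[|[|[|[|[|m]]]]]]] //= bd km last0.
(* For the label infinity there is no bound on [k]. Firing keeps the sum of the two entries, and the
   entry of the node not fired last is at least [t] times that sum. *)
- have key : forall a b t c, A a b = 2%Z -> A b a = 2%Z ->
      (0 <= c a)%Z -> (0 <= c b)%Z ->
      (actw (alt b a t) c a + actw (alt b a t) c b = c a + c b)%Z /\
      (Z.of_nat t * (c a + c b) <= actw (alt b a t) c a)%Z.
    move=> a b t c Aab Aba; elim: t a b Aab Aba => [|t IHt] a b Aab Aba ca cb.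
      by rewrite /=; lia.
    have [H1 H2] := IHt b a Aba Aab cb ca.
    rewrite -[actw (alt b a t.+1) c]/(fire (actw (alt a b t) c) b) Nat2Z.inj_succ.
    by rewrite /fire Aii Aba; lia.
  have [_ H] := key i j k (st v) bd.2 bd.1 di dj.
  have kk : (1 <= Z.of_nat k)%Z by lia.
  have H3 : (st v i + st v j <= Z.of_nat k * (st v i + st v j))%Z by nia.
  by split=> [|E]; [lia|case: both0; lia].
- have {}km := km isT; have {}last0 := last0 isT.
  case: k k0 km last0 {wE lw stw both0} => [|[|k]] //= _ _ last0.
  by rewrite /fire bd.1 Z.mul_0_l Z.add_0_r; split => // /zi /last0; apply.
- have {}km := km isT; have {}last0 := last0 isT.
  case: k k0 km last0 {wE lw stw} => [|[|[|k]]] //= _ _ last0; rewrite /fire ?Aii bd.1 ?bd.2.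
    by split=> [|E]; [lia|case: both0; lia].
  split; first by lia.
  by move=> E; apply: last0 => //; apply: zj; lia.
- have {}km := km isT; have {}last0 := last0 isT.
  case: bd => -[a b]; case: k k0 km last0 {wE lw stw} => [|[|[|[|k]]]] //= _ _ last0;
    rewrite /fire ?Aii a ?b; (split; first by lia);
    by [move=> E; case: both0; lia | move=> E; apply: last0 => //; apply: zi; lia].
- have {}km := km isT; have {}last0 := last0 isT.
  case: bd => -[a b]; case: k k0 km last0 {wE lw stw} => [|[|[|[|[|[|k]]]]]] //= _ _ last0;
    rewrite /fire ?Aii a ?b; (split; first by lia);
    by [move=> E; case: both0; lia | move=> E; apply: last0 => //; apply: zi; lia].
Qed.

Lemma st_asc_pos w i : minrep s S w -> (l w < l (s i * w))%N ->
  minrep s S (s i * w) -> (0 < st w i)%Z.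
Proof.
move=> mw lt mw'; have [ge0 z] := st_sign (leqnn _) mw lt.
have [E|] := Z.eq_dec (st w i) 0; last by lia.
have [k Sk Ek] := z E; have := (minrepP S (s i * w)).1 mw' k Sk.
by rewrite {2}Ek genKr; lia.
Qed.

Lemma st_neg w i : minrep s S w -> (l (s i * w) < l w)%N -> (st w i < 0)%Z.
Proof.
move=> mw lt; have := @st_asc_pos (s i * w) i (minrep_desc mw lt).
by rewrite genK st_gen fire_at => /(_ lt mw); lia.
Qed.

Lemma neg_desc w i : minrep s S w -> (st w i < 0)%Z -> (l (s i * w) < l w)%N.
Proof.
move=> mw neg; have [E|->//] := len_genM i w.
have [|] := @st_sign _ w (leqnn _) mw i; [by rewrite E|by lia].
Qed.

Lemma pos_asc w i : minrep s S w -> (0 < st w i)%Z ->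
  (l w < l (s i * w))%N /\ minrep s S (s i * w).
Proof.
move=> mw pos; have [E|E] := len_genM i w; last first.
  by have := @st_neg w i mw; rewrite E => /(_ (leqnn _)); lia.
have lt : (l w < l (s i * w))%N by rewrite E.
split => //; have [//|[k Sk Ek]] := minrep_asc mw lt.
have := st_gen i w; rewrite Ek st_parabolic; last exact: parabolic_gen.
by move=> /(congr1 (fun c => c i)); rewrite fire_at; lia.
Qed.

Lemma st_inj v w : minrep s S v -> minrep s S w -> st v = st w -> v = w.
Proof.
move: {2}(l v) (leqnn (l v)) => N.
elim: N v w => [|N IH] v w vN mv mw E.
  have v1 : v = 1 by apply: len0; lia.
  have [->//|/eqP w1] := eqVneq w 1; have [i lti] := desc_exists w1.
  by have := st_neg mw lti; rewrite -E v1 st1 /e0; case: ifP => _; lia.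
have [v1|/eqP v1] := eqVneq v 1; first by apply: IH => //; rewrite v1 len1.
have [i lti] := desc_exists v1.
have ltw : (l (s i * w) < l w)%N by apply: neg_desc => //; rewrite -E; apply: st_neg.
apply: (mulgI (s i)); apply: IH; rewrite ?st_gen ?E //; try exact: minrep_desc.
by lia.
Qed.

(* cov u y certifies that y is the state of a Bruhat coatom of the element with
   state u: delete the letter k from a reduced word, then multiply back. *)
Inductive cov : (I -> Z) -> (I -> Z) -> Prop :=
| cov_base u k : (u k < 0)%Z -> cov u (fire u k)
| cov_step u y i : (0 < u i)%Z -> (0 < y i)%Z -> cov u y -> cov (fire u i) (fire y i).

Lemma cov_sound u y : cov u y -> forall w, minrep s S w -> st w = u ->
  exists v, [/\ minrep s S v, st v = y, bruhat s v w & l w = (l v).+1].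
Proof.
elim=> {u y} [u k neg w mw wu|u y i ui yi _ IH w mw wu].
  have lt : (l (s k * w) < l w)%N by apply: neg_desc; rewrite ?wu.
  exists (s k * w); split; rewrite ?st_gen ?wu //; first exact: minrep_desc.
    by rewrite -{2}(genK k w); apply: bruhat_asc; rewrite genK.
  by have := len_genM k w; lia.
have lt : (l (s i * w) < l w)%N by apply: neg_desc; rewrite ?wu ?fire_at //; lia.
have [||v [mv vy vw lv]] := IH (s i * w).
- exact: minrep_desc.
- by rewrite st_gen wu fireK.
have [|ltv mv'] := @pos_asc v i mv; first by rewrite vy.
exists (s i * v); split => //; first by rewrite st_gen vy.
  apply: lift_up => //; apply: bruhat_trans vw _.
  by rewrite -{2}(genK i w); apply: bruhat_asc; rewrite genK.
by have := len_genM i w; have := len_genM i v; lia.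
Qed.

(** Uniqueness of the elements of colength 1 to [K] as far as states show it: coatoms are only those
    with a certificate, and deeper levels are only entered along descents. *)
Fixpoint topuniq (K : nat) (c : I -> Z) : Prop :=
  if K is K'.+1 then
    (forall y1 y2, cov c y1 -> cov c y2 -> y1 = y2) /\
    (forall k, (c k < 0)%Z -> topuniq K' (fire c k))
  else True.

Definition level_uniq (w : G) (t : nat) : Prop := forall v v',
  minrep s S v -> minrep s S v' -> bruhat s v w -> bruhat s v' w ->
  (l v + t)%N = l w -> (l v' + t)%N = l w -> v = v'.

Lemma topuniq_sound w K t v : minrep s S v -> bruhat s v w -> (l v + t)%N = l w ->
  (forall r, (t < r <= t + K)%N -> level_uniq w r) -> topuniq K (st v).
Proof.
elim: K t v => //= K IH t v mv vw lv H; split=> [y1 y2 c1 c2|k neg].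
  have [v1 [m1 <- b1 l1]] := cov_sound c1 mv erefl.
  have [v2 [m2 <- b2 l2]] := cov_sound c2 mv erefl.
  congr st; apply: (H t.+1); rewrite ?addnS ?ltnS ?leqnn ?leq_addr //;
    try exact: bruhat_trans vw; lia.
have lt := neg_desc mv neg.
rewrite -st_gen; apply: (IH t.+1).
- exact: minrep_desc.
- by apply: bruhat_trans vw; rewrite -{2}(genK k v); apply: bruhat_asc; rewrite genK.
- by have := len_genM k v; lia.
- by move=> r rr; apply: H; lia.
Qed.

(** * Domains where Bruhat covers are weak covers *)

Lemma bond_commute i j : A i j = 0%Z -> s i * s j = s j * s i.
Proof.
move=> a0; have [->//|ij] := eqVneq i j.
have : M i j = 2%N.
  by move: (Abond ij); rewrite a0; case: (M i j) => [|[|[|[|[|[|[|m]]]]]]] //=; lia.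
move=> E; have := @braid i j; rewrite E => /(_ isT).
by rewrite /= !wprod_cons wprod_nil !mulg1.
Qed.

Lemma bond_sym0 i j : A i j = 0%Z -> A j i = 0%Z.
Proof.
move=> a0; have [E|ij] := eqVneq i j; first by move: a0; rewrite E.
by move: (Abond ij); rewrite a0; case: (M i j) => [|[|[|[|[|[|[|m]]]]]]] //=; lia.
Qed.

Lemma bond_ge0 i j : i != j -> (0 <= A i j)%Z.
Proof.
by move=> /Abond; case: (M i j) => [|[|[|[|[|[|[|m]]]]]]] //=; lia.
Qed.

Lemma gen_inj i j : s i = s j -> i = j.
Proof.
move=> E; apply/eqP/negPn/negP => ij.
have /(proj2 cox) /actw_cox_eq H : wp [:: i] = wp [:: j] by rewrite !wprod_seq1.
have := congr1 (fun c => c i) (H (fun k => if k == i then 1%Z else 0%Z)).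
by rewrite /= /fire !eqxx Aii eq_sym (negbTE ij); lia.
Qed.

(** [gd_comm] makes all reduced words agree up to commutations. [gd_nobraid] concerns
    [v = s i * s j * u] with non-commuting [i] and [j]: were [s i * u] longer than [u] and in the
    quotient, deleting [s j] would give a Bruhat coatom of [v] that is not a left weak one. *)
Record good_domain (D : G -> Prop) : Prop := GoodDomain {
  gd_minrep : forall v, D v -> minrep s S v;
  gd_desc : forall v i, D v -> (st v i < 0)%Z -> D (s i * v);
  gd_comm : forall v i j, D v -> (st v i < 0)%Z -> (st v j < 0)%Z -> i != j -> A i j = 0%Z;
  gd_nobraid : forall v i j, D v -> (st v i < 0)%Z -> (fire (st v) i j < 0)%Z ->
    A i j <> 0%Z -> (fire (fire (st v) i) j i <= 0)%Z }.

Section Domain.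
Variable D : G -> Prop.
Hypothesis gD : good_domain D.

Lemma domain_desc v i : D v -> (l (s i * v) < l v)%N -> D (s i * v).
Proof. by move=> Dv lt; apply: (gd_desc gD) => //; apply: st_neg => //; apply: (gd_minrep gD). Qed.

(** If [v] is not [s i * w] for the chosen descent [i], then [s i * v] is a coatom of [s i * w],
    hence equal to [s j * (s i * w)] by induction. Either [i] and [j] commute and [v = s j * w], or
    [gd_nobraid] is violated. *)
Lemma coatom_weak v w : D w -> minrep s S v -> bruhat s v w -> l w = (l v).+1 ->
  exists i, w = s i * v.
Proof.
move: {2}(l w) (leqnn (l w)) => N; elim: N v w => [|N IH] v w wN Dw mv vw lw.
  by lia.
have [|i lti] := @desc_exists w; first by move=> w1; move: lw; rewrite w1 len1.
have mw := gd_minrep gD Dw; have neg := st_neg mw lti.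
have li : l w = (l (s i * w)).+1 by have := len_genM i w; lia.
have [vE|/eqP neq] := eqVneq v (s i * w); first by exists i; rewrite vE genK.
have nle : ~ bruhat s v (s i * w).
  by move=> H; apply: neq; apply: bruhat_eq => //; lia.
have ltv : (l (s i * v) < l v)%N.
  by have [E|->//] := len_genM i v; case: nle; apply: lift_down => //; rewrite E.
have lv : l v = (l (s i * v)).+1 by have := len_genM i v; lia.
have H : bruhat s (s i * v) (s i * w) by case: (bruhat_gen' i vw).
have mv' := minrep_desc mv ltv.
have [|||||j wE] := IH (s i * v) (s i * w).
- by lia.
- exact: gd_desc.
- by [].
- by [].
- by lia.
have Dw' := gd_desc gD Dw neg.
have ltj : (l (s j * (s i * w)) < l (s i * w))%N by rewrite {1}wE genK; lia.
have negj := st_neg (gd_minrep gD Dw') ltj.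
have ij : i != j.
  by apply: contraTneq ltj => <-; rewrite genK; lia.
have [a0|/(gd_nobraid gD Dw neg)] := Z.eq_dec (A i j) 0.
  exists j; apply: (mulgI (s i)); rewrite wE !mgA.
  by rewrite (bond_commute a0).
rewrite -st_gen => /(_ negj); rewrite -st_gen wE genK.
have := @st_asc_pos (s i * v) i mv'; rewrite genK => /(_ ltv mv); lia.
Qed.

Lemma bruhat_weak v w : D w -> minrep s S v -> bruhat s v w ->
  exists2 x, w = wp x * v & l w = (size x + l v)%N.
Proof.
move: {2}(l w) (leqnn (l w)) => N; elim: N w => [|N IH] w wN Dw mv vw.
  have vE : v = w by apply: bruhat_eq => //; lia.
  by exists [::]; rewrite ?wprod_nil ?mul1g ?vE.
have [->|/eqP neq] := eqVneq v w; first by exists [::]; rewrite ?wprod_nil ?mul1g.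
have mw := gd_minrep gD Dw.
have [u [mu vu uw lu]] := quotient_chain mv mw vw neq.
have [i wE] := coatom_weak Dw mu uw lu.
have uE : u = s i * w by rewrite wE genK.
have Du : D u by rewrite uE; apply: domain_desc => //; rewrite -uE lu.
have [|x xE lx] := IH u _ Du mv vu; first by lia.
exists (i :: x); first by rewrite wprod_cons -mgA -xE.
by rewrite lu lx.
Qed.

(** Different first letters of two reduced words are commuting descents, so both words can be
    compared with words that start with these two letters in either order. *)
Lemma count_uniq v x y a : D v -> wp x = v -> size x = l v ->
  wp y = v -> size y = l v -> count_mem a x = count_mem a y.
Proof.
move: {2}(l v) (leqnn (l v)) => N; elim: N v x y => [|N IH] v x y vN Dv xv sx yv sy.
  have v0 : l v = 0%N by lia.
  by move: sx sy; rewrite v0 => /size0nil -> /size0nil ->.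
case: x xv sx => [|i x] xv sx.
  by move: sy; rewrite -sx => /size0nil ->.
case: y yv sy => [|j y] yv sy; first by move: sx; rewrite -sy.
have desc k z : wp (k :: z) = v -> size (k :: z) = l v ->
    wp z = s k * v /\ (l (s k * v) < l v)%N /\ size z = l (s k * v).
  move=> zv sz; have zE : wp z = s k * v by rewrite -zv wprod_cons genK.
  have := len_le z; rewrite zE; have := len_genM k v; move: sz => /=.
  by move=> *; split => //; lia.
have [xE [ltx sx']] := desc _ _ xv sx; have [yE [lty sy']] := desc _ _ yv sy.
have Dx := domain_desc Dv ltx; have Dy := domain_desc Dv lty.
have [ij|ij] := eqVneq i j.
  by rewrite /= ij; congr (_ + _)%N; apply: (IH (s i * v)) => //; rewrite ?ij //; rewrite ?ij in ltx; lia.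
have mv := gd_minrep gD Dv.
have a0 := gd_comm gD Dv (st_neg mv ltx) (st_neg mv lty) ij.
have neg : (st (s j * v) i < 0)%Z.
  by rewrite st_gen /fire (bond_sym0 a0); have := st_neg mv ltx; lia.
have lt2 := neg_desc (gd_minrep gD Dy) neg.
have [z zE sz] := len_word (s i * (s j * v)).
have li := len_genM i (s j * v); have lj := len_genM j v; have lii := len_genM i v.
have -> : count_mem a (j :: y) = count_mem a [:: j, i & z].
  rewrite /=; congr (_ + _)%N; apply: (IH (s j * v) y (i :: z)) => //; first by lia.
    by rewrite wprod_cons zE genK.
  by rewrite /= sz; lia.
have -> : count_mem a (i :: x) = count_mem a [:: i, j & z].
  rewrite /=; congr (_ + _)%N; apply: (IH (s i * v) x (j :: z)) => //; first by lia.
    by rewrite wprod_cons zE !mgA -(bond_commute a0) -!mgA genK.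
  by rewrite /= sz; lia.
by rewrite /=; lia.
Qed.

End Domain.

(** * Elements of proper support *)

Definition proper_support (v : G) : Prop :=
  exists j, parabolic s [pred i | i != j] v.

(** The weight [e0] is minuscule for every proper standard parabolic subgroup. The entry at the
    omitted node is left out because it may be larger: at node [n] in type C it reaches 2. *)
Definition minuscule : Prop := forall j v, minrep s S v ->
  parabolic s [pred i | i != j] v -> forall i, i != j -> (-1 <= st v i <= 1)%Z.

Lemma parabolic_desc (P : pred I) v i : parabolic s P v -> (l (s i * v) < l v)%N ->
  parabolic s P (s i * v) /\ P i.
Proof.
move=> pv lt; have [x [Px xv sx]] := parabolic_word pv.
have [||x1 [k [x2 [xE xE2]]]] := @strong_exchange (s i) x.
- exact: reflection_gen.
- by rewrite xv.
have pi : parabolic s P (s i * v).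
  exists (x1 ++ x2); last by rewrite -xE2 xv.
  by move: Px; rewrite xE !all_cat /= => /and3P[-> _ ->].
split => //; have := parabolicM pi (parabolicV pv); rewrite mulgK.
move=> /parabolic_word[y [Py yE]]; rewrite len_gen.
case: y Py yE => [|k' []] //= /andP[Pk _].
by rewrite wprod_seq1 => /gen_inj <-.
Qed.

Definition proper_minrep v := minrep s S v /\ proper_support v.

(** A descent entry can only be -1. Beside it, a non-commuting descent would drop below -1 after the
    first firing; and after firing [i] and then [k] at entries -1, the entry at [i] is [1 - A k i],
    which is at most 0. *)
Lemma proper_good : minuscule -> good_domain proper_minrep.
Proof.
move=> mini.
have key v i : proper_minrep v -> (st v i < 0)%Z -> exists j,
   [/\ parabolic s [pred i | i != j] v, parabolic s [pred i | i != j] (s i * v), i != j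
     & minrep s S (s i * v)].
  move=> [mv [j pv]] neg; have lt := neg_desc mv neg.
  by exists j; have [] := parabolic_desc pv lt; split => //; apply: minrep_desc.
split=> [v []//|v i Dv neg|v i k Dv negi negk ik|v i k Dv neg neg2 a0].
- by have [j [_ p _ m]] := key _ _ Dv neg; split => //; exists j.
- have [j [p p' ij m]] := key _ _ Dv negi.
  have [_ kj] := parabolic_desc p (neg_desc Dv.1 negk).
  have := mini j v Dv.1 p i ij; have := mini j _ m p' k kj; have := mini j v Dv.1 p k kj.
  rewrite st_gen /fire; have := bond_ge0 ik => H1 H2 H3 H4.
  by have -> : A i k = (A i k * - (st v i))%Z; [nia|nia].
- have [j [p p' ij m]] := key _ _ Dv neg.
  rewrite -st_gen in neg2 *.
  have [p'' kj] := parabolic_desc p' (neg_desc m neg2).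
  have := mini j v Dv.1 p i ij; have := mini j _ m p' k kj.
  have ik : k != i.
    by apply: contraTneq isT => E; move: neg2; rewrite E st_gen fire_at; lia.
  have := bond_ge0 ik; have : A k i <> 0%Z by move=> /bond_sym0.
  rewrite /fire {3}st_gen fire_at => *; nia.
Qed.

Definition sumA (x : seq I) (k : I) : Z := foldr (fun b z => (A b k + z)%Z) 0%Z x.

Lemma sumA_cat x y k : sumA (x ++ y) k = (sumA x k + sumA y k)%Z.
Proof. by elim: x => //= b x ->; lia. Qed.

Lemma sumA_rem x b k : b \in x -> sumA x k = (A b k + sumA (rem b x) k)%Z.
Proof.
elim: x => //= a x IH; rewrite inE; have [->//|ab] := eqVneq b a.
by move=> /= /IH ->; rewrite /=; lia.
Qed.

Lemma sumA_ge0 x k : k \notin x -> (0 <= sumA x k)%Z.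
Proof.
elim: x => //= b x IH; rewrite inE negb_or => /andP[kb /IH].
by have := @bond_ge0 b k; rewrite eq_sym => /(_ kb); lia.
Qed.

(** The additional letters of [y] differ from [k], and the off-diagonal entries of [A] are
    nonnegative. *)
Lemma sumA_mono x y k : (forall b, (count_mem b x <= count_mem b y)%N) ->
  count_mem k x = count_mem k y -> (sumA x k <= sumA y k)%Z.
Proof.
elim: x y => [|b x IH] y le eqk /=.
  by apply: sumA_ge0; rewrite -has_pred1 has_count -eqk.
have by_ : b \in y by rewrite -has_pred1 has_count; have := le b; rewrite /= eqxx; lia.
rewrite (sumA_rem _ by_); suff : (sumA x k <= sumA (rem b y) k)%Z by lia.
have cr a : count_mem a (rem b y) = (count_mem a y - (b == a))%N.
  by rewrite count_mem_rem.
apply: IH => [a|]; rewrite cr; first by have := le a; rewrite /=; lia.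
by rewrite -eqk /=; lia.
Qed.

(** Along a reduced word every letter is fired at an entry equal to 1, so each firing just adds a
    row of [A]. *)
Lemma st_linear x : minuscule -> proper_minrep (wp x) -> size x = l (wp x) ->
  forall k, st (wp x) k = (e0 k + sumA x k)%Z.
Proof.
move=> mini; elim: x => [|i x IH] Dx sx k; first by rewrite wprod_nil st1 /=; lia.
have lx : l (wp x) = size x.
  by have := len_le x; have := len_genM i (wp x); rewrite -wprod_cons -sx /=; lia.
have lt : (l (s i * wp (i :: x)) < l (wp (i :: x)))%N.
  by rewrite wprod_cons genK lx -wprod_cons -sx.
have [mx [j px]] := Dx; have [px' ij] := parabolic_desc px lt.
have mx' := minrep_desc mx lt; move: px' mx'; rewrite wprod_cons genK => px' mx'.
rewrite st_gen /fire {1}IH //=; last by split => //; exists j.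
have := mini j _ mx' px' i ij; have := mini j _ mx px i ij.
have := st_neg mx lt; rewrite wprod_cons st_gen fire_at => *.
have -> : st (wp x) i = 1%Z by lia.
by lia.
Qed.

(* The heart of the comparison of consecutive segments: if the letter a were
   used more often in r' than tau a in r, the linearity of the states would
   contradict the monotonicity of sumA. *)
Lemma count_dominated (tau : I -> I) r' r a : minuscule -> involutive tau ->
  (forall i j, A (tau i) (tau j) = A i j) ->
  proper_minrep (wp (a :: r' ++ r)) -> size (a :: r' ++ r) = l (wp (a :: r' ++ r)) ->
  proper_minrep (wp (map tau (a :: r'))) ->
  size (map tau (a :: r')) = l (wp (map tau (a :: r'))) ->
  (forall b, (count_mem b r' <= count_mem (tau b) r)%N) ->
  count_mem a r' = count_mem (tau a) r ->
  (1 - e0 (tau a) <= sumA r (tau a))%Z /\ sumA r a = (e0 (tau a) - e0 a)%Z.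
Proof.
move=> mini tauK tauA D1 s1 D2 s2 le eqa; have gD := proper_good mini.
have val1 i y : proper_minrep (wp (i :: y)) -> size (i :: y) = l (wp (i :: y)) ->
    [/\ proper_minrep (wp y), size y = l (wp y) & st (wp y) i = 1%Z].
  move=> D sz.
  have ly : l (wp y) = size y.
    by have := len_le y; have := len_genM i (wp y); rewrite -wprod_cons -sz /=; lia.
  have lt : (l (s i * wp (i :: y)) < l (wp (i :: y)))%N.
    by rewrite wprod_cons genK ly -wprod_cons -sz.
  have neg := st_neg D.1 lt.
  have Dy : proper_minrep (wp y) by have := gd_desc gD D neg; rewrite wprod_cons genK.
  split => //; have [_ [j pj]] := D; have [_ ij] := parabolic_desc pj lt.
  have := mini j _ D.1 pj i ij; move: neg; rewrite wprod_cons st_gen fire_at; lia.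
have [E1 E2 E3] := val1 _ _ D1 s1; have [F1 F2 F3] := val1 _ _ D2 s2.
have sE : sumA (map tau r') (tau a) = sumA r' a.
  by elim: r' {le eqa D1 s1 D2 s2 E1 E2 E3 F1 F2 F3} => //= b x ->; rewrite tauA.
have := st_linear mini E1 E2 a; rewrite E3 sumA_cat.
have := st_linear mini F1 F2 (tau a); rewrite F3 sE.
have cE b : count_mem b (map tau r') = count_mem (tau b) r'.
  rewrite count_map; apply: eq_count => c /=.
  by rewrite (inv_eq tauK).
have := @sumA_mono (map tau r') r (tau a).
rewrite cE tauK sE => H H1 H2.
have {}H := H (fun b => eq_ind_r (fun z => (z <= _)%N) (leq_trans (le (tau b)) (eq_leq (congr1 (fun c => count_mem c r) (tauK b)))) (cE b)) eqa.
by split; lia.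
Qed.

Lemma parabolic_reduced (P : pred I) x : parabolic s P (wp x) -> size x = l (wp x) ->
  all P x.
Proof.
elim: x => //= i x IH px sx.
have lx : l (wp x) = size x.
  by have := len_le x; have := len_genM i (wp x); rewrite -wprod_cons -sx; lia.
have [] := @parabolic_desc P (wp (i :: x)) i px.
  by rewrite wprod_cons genK lx -wprod_cons -sx.
by rewrite wprod_cons genK => /IH H ->; rewrite H.
Qed.

Lemma parabolic_factors (P : pred I) u v : parabolic s P (u * v) ->
  l (u * v) = (l u + l v)%N -> parabolic s P u /\ parabolic s P v.
Proof.
have [x <- <-] := len_word u; have [y <- <-] := len_word v.
rewrite -wprod_cat -size_cat => p /esym /(parabolic_reduced p).
by rewrite all_cat => /andP[ax ay]; split; [exists x|exists y].
Qed.

(** * Diagram automorphisms *)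

Record relabel (th : I -> I) (f : G -> G) : Prop := Relabel {
  relabelK : involutive th;
  relabel_word : forall x, f (wp x) = wp (map th x) }.

Lemma relabel_exists th : involutive th -> (forall i j, M (th i) (th j) = M i j) ->
  exists f, relabel th f.
Proof.
move=> thK thM; exists (fun g => wp (map th (sval (cid (wprod_surj g))))).
split=> // x; case: cid => y /= /(proj2 cox y x).1 yx; apply/(proj2 cox).
elim: yx => {x y} [x y i j|x|x y _ IH|x y z _ IH1 _ IH2].
- rewrite !map_cat map_flatten map_nseq /= -(thM i j); exact: cox_rel.
- exact: cox_refl.
- exact: cox_sym.
- exact: cox_trans IH2.
Qed.

Section Relabel.
Variables (th : I -> I) (f : G -> G).
Hypothesis R : relabel th f.

Lemma relabelM g h : f (g * h) = f g * f h.
Proof.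
have [x <-] := wprod_surj g; have [y <-] := wprod_surj h.
by rewrite -wprod_cat !(relabel_word R) map_cat wprod_cat.
Qed.

Lemma relabel_inv g : f (f g) = g.
Proof.
have [x <-] := wprod_surj g; rewrite !(relabel_word R) -map_comp.
by rewrite (eq_map (relabelK R)) map_id.
Qed.

Lemma relabel1 : f 1 = 1.
Proof. by rewrite -wprod_nil (relabel_word R). Qed.

Lemma relabel_gen i : f (s i) = s (th i).
Proof. by rewrite -!wprod_seq1 (relabel_word R). Qed.

Lemma relabelV g : f g^-1 = (f g)^-1.
Proof. by apply/esym/mulg1_eq; rewrite -relabelM mulgV relabel1. Qed.

Lemma relabel_len g : l (f g) = l g.
Proof.
have le h : (l (f h) <= l h)%N.
  have [x <- <-] := len_word h; rewrite (relabel_word R) -(size_map th x).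
  exact: len_le.
by apply/eqP; rewrite eqn_leq le -{1}(relabel_inv g) le.
Qed.

Lemma relabel_minrep z g : minrep s [pred i | i != z] g ->
  minrep s [pred i | i != th z] (f g).
Proof.
move=> /minrepP mg; apply/minrepP => k /= kz.
have := mg (th k); rewrite -(relabel_len g) -(relabel_len (g * _)) relabelM relabel_gen (relabelK R).
by apply; rewrite /= -(eqtype.inj_eq (inv_inj (relabelK R))) (relabelK R).
Qed.

Lemma relabel_parabolic z g : parabolic s [pred i | i != z] g ->
  parabolic s [pred i | i != th z] (f g).
Proof.
move=> [x ax <-]; exists (map th x); last by rewrite (relabel_word R).
rewrite all_map; apply: sub_all ax => i /=.
by rewrite (eqtype.inj_eq (inv_inj (relabelK R))).
Qed.

Lemma relabel_bruhat u w : bruhat s u w -> bruhat s (f u) (f w).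
Proof.
elim=> {u w} [u w [lt [t [i [g tE]] wE]]|u|u v w _ H1 _ H2].
- apply: rt_step; rewrite !relabel_len; split => //.
  exists (f t); last by rewrite wE relabelM.
  by exists (th i), (f g); rewrite tE !conjgE !relabelM relabelV relabel_gen.
- exact: bruhat_refl.
- exact: bruhat_trans H2.
Qed.

End Relabel.

End Coxeter.

(** * The generalized Young's lattice *)

Section Young.
Variable n : nat.
(* Written so that [len s] is syntactically the one of the general theory. *)
Notation I := (Finite.sort (fintype_ordinal__canonical__fintype_Finite n.+1)).
Variables (M : I -> I -> nat) (G : groupType) (s : I -> G).
Hypothesis cox : coxeter_system M s.
Hypothesis M1 : forall i, M i i = 1%N.
Variables (sigma1 sigma0 : nat -> seq G) (zz : bool -> I).

Notation wp := (wprod s).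
Notation l := (len s).
Notation SS b := [pred i | i != zz b].
Notation isp := (is_part sigma0).
Notation p0 := (0, 0)%N.
Let sg (b : bool) := if b then sigma1 else sigma0.

(* Both kinds of segments, seen as one structure: a b-segment is split off from
   a minimal representative for the complement of the node zz b. *)
Record segment_system : Prop := SegmentSystem {
  ss_zz : zz false = node0 n;
  ss_isp : forall b p, is_part (sg b) p <-> isp p;
  ss_seg0 : forall b, seg (sg b) p0 = 1;
  ss_len : forall b p, isp p -> l (seg (sg b) p) = p.1;
  ss_asc : forall b p k, isp p -> SS (~~ b) k -> l (s k * seg (sg b) p) = p.1.+1 ->
    (exists2 q, isp q & seg (sg b) q = s k * seg (sg b) p) \/
    (exists2 r, SS b r & s k * seg (sg b) p = seg (sg b) p * s r);
  ss_fact : forall b w, minrep s (SS b) w -> w <> 1 -> exists u p,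
    [/\ minrep s (SS (~~ b)) u, isp p, w = u * seg (sg b) p & l w = (l u + p.1)%N];
  ss_uniq : forall b u u' p p', minrep s (SS (~~ b)) u -> minrep s (SS (~~ b)) u' ->
    isp p -> isp p' -> u * seg (sg b) p = u' * seg (sg b) p' -> u = u' /\ p = p';
  ss_first : forall b, exists2 p, isp p & seg (sg b) p = s (zz b);
  ss_allowed : forall b p q, isp p -> isp q -> allowed s sigma1 sigma0 p q <->
    minrep s (SS b) (seg (sg (~~ b)) p * seg (sg b) q) /\
    l (seg (sg (~~ b)) p * seg (sg b) q) = (p.1 + q.1)%N;
  ss_cover : forall b p q, left_weak_cover s (seg sigma0 p) (seg sigma0 q) <->
    left_weak_cover s (seg (sg b) p) (seg (sg b) q) }.

(** What the comparison uses of the elements concerned, kept abstract so that one argument serves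
    leaf and forked types. [cm] is a relation on nodes that implies commuting generators; [yd_dom]
    is the domination of a segment by the segment to its right. *)
Record young_domain (cm : I -> I -> Prop) (D : bool -> G -> Prop) : Prop :=
  YoungDomain {
  yd_cm : forall i j, cm i j -> s i * s j = s j * s i;
  yd_minrep : forall b v, D b v -> minrep s (SS b) v;
  yd_desc : forall b v i, D b v -> (l (s i * v) < l v)%N -> D b (s i * v);
  yd_fact : forall b u p, D b (u * seg (sg b) p) -> minrep s (SS (~~ b)) u -> isp p ->
    l (u * seg (sg b) p) = (l u + p.1)%N -> D (~~ b) u;
  yd_coatom : forall b v w, D b w -> minrep s (SS b) v -> bruhat s v w ->
    l w = (l v).+1 -> exists i, w = s i * v;
  yd_count : forall b v x y a, D b v -> wp x = v -> size x = l v ->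
    wp y = v -> size y = l v -> count_mem a x = count_mem a y;
  yd_comm : forall b v i j, D b v -> (l (s i * v) < l v)%N -> (l (s j * v) < l v)%N ->
    i != j -> cm i j;
  yd_dom : forall b p q, isp p -> isp q -> D b (seg (sg (~~ b)) p * seg (sg b) q) ->
    l (seg (sg (~~ b)) p * seg (sg b) q) = (p.1 + q.1)%N ->
    minrep s (SS (~~ b)) (seg (sg (~~ b)) p) ->
    (p.1 <= q.1)%N /\ forall i r' r, wp r' = seg (sg (~~ b)) p -> size r' = p.1 ->
      wp r = seg (sg b) q -> size r = q.1 ->
      (forall a, a \in r -> cm i a) -> forall a, a \in r' -> cm i a }.

Hypothesis sys : segment_system.

(** The map pi for both shapes of diagram: the kind [b] of the segment alternates, which is harmless
    in leaf types where the two kinds coincide. Membership in the quotients is recorded at each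
    stage for use in inductions. *)
Inductive pil : bool -> G -> seq part -> Prop :=
| pil_nil b : pil b 1 [::]
| pil_cons b w u p lam : minrep s (SS b) w -> minrep s (SS (~~ b)) u -> isp p ->
    w = u * seg (sg b) p -> l w = (l u + p.1)%N -> pil (~~ b) u lam ->
    pil b w (p :: lam).

Lemma pil_exists b w : minrep s (SS b) w -> exists lam, pil b w lam.
Proof.
move: {2}(l w) (leqnn (l w)) => N; elim: N b w => [|N IH] b w wN mw.
  have -> : w = 1 by apply: (len0 cox); lia.
  by exists [::]; exact: pil_nil.
have [->|/eqP w1] := eqVneq w 1; first by exists [::]; exact: pil_nil.
have [u [p [mu ip wE lw]]] := ss_fact sys mw w1.
have [|lam H] := IH (~~ b) u _ mu; first by case: ip; lia.
by exists (p :: lam); apply: pil_cons H.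
Qed.

Lemma pil_minrep b w lam : pil b w lam -> minrep s (SS b) w.
Proof. by case=> // {}b; apply: (minrep1 cox). Qed.

Lemma pil_isp b w lam p : pil b w lam -> p \in lam -> isp p.
Proof.
elim=> // {b w} b w u q {}lam _ _ iq _ _ _ IH; rewrite inE => /predU1P[->//|].
exact: IH.
Qed.

Lemma pil_cons_inv b w p lam : pil b w (p :: lam) -> exists u,
  [/\ minrep s (SS b) w, minrep s (SS (~~ b)) u, isp p, w = u * seg (sg b) p &
      l w = (l u + p.1)%N] /\ pil (~~ b) u lam.
Proof.
move E : (p :: lam) => L H; case: H E => // {}b {}w u q lam' mw mu iq wE lw pu [-> ->].
by exists u.
Qed.

Lemma pil_nil_inv b w : pil b w [::] -> w = 1.
Proof. by move E : [::] => L H; case: H E. Qed.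

Lemma pil_uniq b w lam lam' : pil b w lam -> pil b w lam' -> lam = lam'.
Proof.
move=> H; elim: H lam' => {b w lam} [b|b w u p lam mw mu ip wE lw _ IH] lam'.
  case: lam' => // p lam' /pil_cons_inv[u [[_ _ [p1 _] _]]].
  by rewrite (len1 cox); lia.
case: lam' => [/pil_nil_inv w1|q lam' /pil_cons_inv[u' [[_ mu' iq wE' _]]]].
  by move: lw; rewrite w1 (len1 cox); case: ip; lia.
have [|<- <-] := @ss_uniq sys b u u' p q mu mu' ip iq; first by rewrite -wE.
by move=> H; rewrite (IH lam').
Qed.

Lemma pil_inj b v v' lam : pil b v lam -> pil b v' lam -> v = v'.
Proof.
move=> H; elim: H v' => {b v lam} [b|b w u p lam _ _ _ -> _ _ IH] v'.
  by move/pil_nil_inv.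
by move=> /pil_cons_inv[u' [[_ _ _ -> _] /IH ->]].
Qed.

(** The generator is passed to [u] as long as [s i * u] stays in its quotient. Otherwise
    [s i * u = u * s k], and [s k] must enlarge the segment split off here, since else [s i * w]
    would leave the quotient. *)
Lemma pil_asc b v lam i : pil b v lam -> minrep s (SS b) (s i * v) ->
  (l v < l (s i * v))%N -> exists lam', pil b (s i * v) lam' /\
  exists t, part_cover s sigma0 (nth p0 lam' t) (nth p0 lam t) /\
    forall k, k <> t -> nth p0 lam' k = nth p0 lam k.
Proof.
move=> H; elim: H => {b v lam} [b|b w u p lam mw mu ip wE lw pu IH] mi lt.
  have iz : i = zz b.
    apply/eqP/negPn/negP => iz.
    have := (minrepP cox M1 _ _).1 mi i iz.
    by rewrite mulg1 (gen_sq cox M1) (len1 cox).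
  have [p ip pE] := ss_first sys b; exists [:: p]; split.
    apply: (@pil_cons b _ 1 p [::]) => //; rewrite ?mulg1 ?mul1g ?pE ?iz //.
    - exact: (minrep1 cox).
    - by rewrite -pE (ss_len sys) // (len1 cox).
    - exact: pil_nil.
  have p1 : p.1 = 1%N by rewrite -(ss_len sys b ip) pE (len_gen cox M1).
  exists 0%N; split; last by case=> // k _; rewrite /= !nth_nil.
  split; rewrite /= ?p1 //; apply/(ss_cover sys b).
  rewrite (ss_seg0 sys) pE; split; first by rewrite (len_gen cox M1) (len1 cox).
  by exists (zz b); rewrite mulg1.
have [E|E] := len_genM cox M1 i u; last first.
  have := len_mul cox (s i * u) (seg (sg b) p); rewrite -mgA -wE (ss_len sys) //.
  by lia.
have [|mi'|[k Sk Ek]] := minrep_asc cox M1 mu (i := i); first by rewrite E.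
  have [|lam' [pl [t [pc eqt]]]] := IH mi'; first by rewrite E.
  exists (p :: lam'); split.
    apply: (pil_cons mi mi' ip) pl; first by rewrite wE mgA.
    have := len_mul cox (s i * u) (seg (sg b) p); rewrite -mgA -wE (ss_len sys) //.
    by have := len_genM cox M1 i w; lia.
  by exists t.+1; split => // -[|k'] //= kt; apply: eqt => kt'; apply: kt; rewrite kt'.
have lk : l (s k * seg (sg b) p) = p.1.+1.
  have := len_mul cox u (s k * seg (sg b) p); rewrite mgA -Ek -mgA -wE.
  have := len_genM cox M1 i w; have := len_genM cox M1 k (seg (sg b) p).
  by rewrite (ss_len sys) //; lia.
have [[q iq qE]|[r Sr rE]] := ss_asc sys ip Sk lk; last first.
  have := (minrepP cox M1 _ _).1 mi r Sr.
  have -> : s i * w * s r = w by rewrite wE (mgA (s i)) Ek -(mgA u) rE mgA (genKr cox M1) -wE.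
  by lia.
have q1 : q.1 = p.1.+1 by rewrite -(ss_len sys b iq) qE.
exists (q :: lam); split.
  apply: (pil_cons mi mu iq) pu; first by rewrite qE mgA -Ek -mgA -wE.
  by have := len_genM cox M1 i w; lia.
exists 0%N; split; last by case.
split => //=; apply/(ss_cover sys b); rewrite qE; split; last by exists k.
by rewrite -qE !(ss_len sys).
Qed.

(** The default part has size 0, so lists of positive parts, including their lengths, are determined
    by their padded entries. *)
Lemma eq_parts (lam mu : seq part) : (forall p, p \in lam -> 0 < p.1)%N ->
  (forall p, p \in mu -> 0 < p.1)%N -> (forall k, nth p0 lam k = nth p0 mu k) ->
  lam = mu.
Proof.
elim: lam mu => [|p lam IH] [|q mu] //= pl pm E.
- by have := pm q (mem_head _ _); have := E 0%N => /= <-.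
- by have := pl p (mem_head _ _); have := E 0%N => /= ->.
- have := E 0%N => /= ->; congr cons; apply: IH => [r rl|r rm|k].
  + by apply: pl; rewrite inE rl orbT.
  + by apply: pm; rewrite inE rm orbT.
  + exact: (E k.+1).
Qed.

(** Converse of [pil_asc]: the box leaves part [t] by left multiplication once [s i] commutes with
    the product [u] of the segments to the left of that part. *)
Lemma pil_lower b v lam (mu : seq part) t i : pil b v lam -> (forall p, p \in mu -> isp p) ->
  (nth p0 lam t).1 = (nth p0 mu t).1.+1 ->
  seg (sg (b (+) odd t)) (nth p0 lam t) = s i * seg (sg (b (+) odd t)) (nth p0 mu t) ->
  (forall k, k <> t -> nth p0 lam k = nth p0 mu k) ->
  (forall u, pil (b (+) odd t.+1) u (drop t.+1 lam) -> s i * u = u * s i) ->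
  pil b (s i * v) mu /\ l v = (l (s i * v)).+1.
Proof.
move=> H; elim: H mu t => {b v lam} [b|b w u p lam mw mu ip wE lw pu IH] nu t pn.
  by rewrite nth_nil.
case: t => [|t].
  rewrite /= addbF => p1 pE eqn comm.
  have cu : s i * u = u * s i by apply: comm; rewrite /= drop0 addbT.
  case: nu pn p1 pE eqn => [|q nu] pn /= p1 pE eqn.
    have lam0 : lam = [::].
      apply: eq_parts => // [r rl|k]; first by have [] := pil_isp pu rl.
      by have := eqn k.+1; rewrite /= nth_nil; apply.
    have u1 : u = 1 by move: pu; rewrite lam0 => /pil_nil_inv.
    have wi : w = s i by rewrite wE u1 mul1g pE (ss_seg0 sys) mulg1.
    rewrite wi (gen_sq cox M1) (len1 cox) -{1}wi lw u1 (len1 cox); split => //.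
    exact: pil_nil.
  have lamE : lam = nu.
    apply: eq_parts => [r rl|r rl|k]; first by have [] := pil_isp pu rl.
      by have [] := pn r; rewrite // inE rl orbT.
    by have := eqn k.+1; apply.
  have iq : isp q by apply: pn; rewrite mem_head.
  have swE : s i * w = u * seg (sg b) q by rewrite wE mgA cu pE -!mgA (genK cox M1).
  have lsw : l w = (l (s i * w)).+1.
    have := len_mul cox u (seg (sg b) q); rewrite -swE (ss_len sys) //.
    by have := len_genM cox M1 i w; lia.
  split => //; apply: (@pil_cons b _ u q nu) => //; rewrite -?lamE //; last by lia.
  by apply: (minrep_desc cox M1) => //; lia.
rewrite oddS addbN => p1 pE eqn comm.
case: nu pn p1 pE eqn => [|q nu] pn /= p1 pE eqn.
  by have := eqn 0%N => /= E; case: ip; rewrite E.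
have pq : p = q by exact: (eqn 0%N).
have iq : isp q by rewrite -pq.
have [|||||pu' lu] := IH nu t.
- by move=> r rn; apply: pn; rewrite inE rn orbT.
- exact: p1.
- by rewrite addNb.
- by move=> k kt; apply: (eqn k.+1) => -[].
- by move=> u' pu'; apply: comm; move: pu'; rewrite !oddS addNb !addbN.
have swE : s i * w = (s i * u) * seg (sg b) q by rewrite wE pq mgA.
have lsw : l w = (l (s i * w)).+1.
  have := len_mul cox (s i * u) (seg (sg b) q); rewrite -swE (ss_len sys) //.
  by have := len_genM cox M1 i w; rewrite pq in lw; lia.
split => //; apply: (pil_cons _ _ iq swE _ pu'); rewrite pq in lw.
- by apply: (minrep_desc cox M1) => //; lia.
- exact: pil_minrep pu'.
- by lia.
Qed.

Section InDomain.
Variables (cm : I -> I -> Prop) (D : bool -> G -> Prop).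
Hypothesis dom : young_domain cm D.

Lemma domain_suffix b x v : D b (x * v) -> l (x * v) = (l x + l v)%N -> D b v.
Proof.
have [y <- <-] := len_word cox x => {x}.
elim: y => [|i y IH]; first by rewrite wprod_nil mul1g.
rewrite wprod_cons -mgA => Dv E.
have E' : l (wp y * v) = (size y + l v)%N.
  have := len_mul cox (wp y) v; have := len_le cox y.
  have := len_mul cox (s i) (wp y * v); have := len_gen cox M1 i.
  by move: E => /=; lia.
apply: IH => //; rewrite -(genK cox M1 i (wp y * v)); apply: (yd_desc dom) => //.
by rewrite (genK cox M1) E E' /=; lia.
Qed.

Lemma pil_pair b w p q lam : D b w -> pil b w (p :: q :: lam) ->
  [/\ isp p, isp q, D b (seg (sg (~~ b)) q * seg (sg b) p),
      l (seg (sg (~~ b)) q * seg (sg b) p) = (q.1 + p.1)%N &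
      minrep s (SS (~~ b)) (seg (sg (~~ b)) q)].
Proof.
move=> Dw /pil_cons_inv[u [[mw mu ip wE lw] /pil_cons_inv[u' [[_ mu' iq uE lu] _]]]].
have wE' : w = u' * (seg (sg (~~ b)) q * seg (sg b) p) by rewrite wE uE mgA.
have lp : l (seg (sg (~~ b)) q * seg (sg b) p) = (q.1 + p.1)%N.
  have := len_mul cox u' (seg (sg (~~ b)) q * seg (sg b) p).
  have := len_mul cox (seg (sg (~~ b)) q) (seg (sg b) p).
  by rewrite -wE' !(ss_len sys) //; lia.
split => //.
  by apply: (@domain_suffix b u'); rewrite -?wE' // lp; lia.
apply: (minrep_suffix cox M1 (x := u')); rewrite -uE // (ss_len sys) //.
Qed.

Lemma pil_colored w lam : D false w -> pil false w lam ->
  colored_partition s sigma1 sigma0 lam.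
Proof.
move=> Dw pw; split; first by move=> p; apply: pil_isp pw.
  elim: pw Dw => {w lam} // b w u p lam mw mu ip wE lw pu IH Dw.
  have Du : D (~~ b) u by apply: (yd_fact dom) mu ip _; rewrite -wE.
  have := IH Du; case: lam pu {IH} => //= q lam pu ->; rewrite andbT.
  have [_ iq Dp lp mq] := pil_pair Dw (pil_cons mw mu ip wE lw pu).
  by have [] := yd_dom dom iq ip Dp lp mq.
move: Dw; elim: pw => {w lam} // b w u p lam mw mu ip wE lw pu IH Dw t.
have Du : D (~~ b) u by apply: (yd_fact dom) mu ip _; rewrite -wE.
case: t => [|t]; last by apply: IH.
case: lam pu {IH} => //= q lam pu _.
have [_ iq Dp lp mq] := pil_pair Dw (pil_cons mw mu ip wE lw pu).
by apply/(ss_allowed sys b iq ip); split => //; apply: (yd_minrep dom).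
Qed.

(** By [yd_dom], commutation with the letters of one segment passes to the next segment on its left,
    and so to the whole product. *)
Lemma comm_tail b u p lam i : D b u -> pil b u (p :: lam) ->
  (forall r a, wp r = seg (sg b) p -> size r = p.1 -> a \in r -> cm i a) ->
  s i * u = u * s i.
Proof.
move=> Du pu; elim: lam b u p Du pu => [|q lam IH] b u p Du pu H;
  have [u' [[_ mu' ip uE lu] pu']] := pil_cons_inv pu;
  (have [r rE sr] := len_word cox (seg (sg b) p); rewrite (ss_len sys) // in sr);
  have cp : s i * seg (sg b) p = seg (sg b) p * s i.
- have {}H := H r _ rE sr; rewrite -rE; elim: r H {rE sr} => [|a r IHr] H.
    by rewrite wprod_nil mulg1 mul1g.
  rewrite wprod_cons mgA (yd_cm dom (H a (mem_head _ _))) -!mgA; congr (_ * _).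
  by apply: IHr => c cr; apply: H; rewrite inE cr orbT.
- by rewrite uE (pil_nil_inv pu') mul1g.
- have {}H := H r _ rE sr; rewrite -rE; elim: r H {rE sr} => [|a r IHr] H.
    by rewrite wprod_nil mulg1 mul1g.
  rewrite wprod_cons mgA (yd_cm dom (H a (mem_head _ _))) -!mgA; congr (_ * _).
  by apply: IHr => c cr; apply: H; rewrite inE cr orbT.
have [_ iq Dp lp mq] := pil_pair Du pu.
have [_ dm] := yd_dom dom iq ip Dp lp mq.
have Du' : D (~~ b) u' by apply: (yd_fact dom) mu' ip _; rewrite -uE.
have cu' := IH (~~ b) u' q Du' pu' _.
rewrite uE mgA cu' -?mgA ?cp // => r' a r'E sr' ar'.
by apply: (dm i r' r) ar' => // c; apply: H.
Qed.

Lemma pil_drop b v lam t : D b v -> pil b v lam -> (t <= size lam)%N ->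
  exists2 u, D (b (+) odd t) u & pil (b (+) odd t) u (drop t lam).
Proof.
move=> Dv pv; elim: pv t Dv => {v lam} [b' [|t] D1 lt|b' w u p lam mw mu ip wE lw pu IH [|t] Dw lt].
- by exists 1; rewrite //= addbF //; exact: pil_nil.
- by [].
- by exists w; rewrite //= addbF //; exact: pil_cons pu.
have Du : D (~~ b') u by apply: (yd_fact dom) mu ip _; rewrite -wE.
by have [//|u' Du' pu'] := IH t Du; exists u'; rewrite oddS addbN -addNb.
Qed.

(** At each letter [c] of [r], both [c] and [i] are descents of the same element of the domain,
    hence commute; cancelling [c] reproduces the hypotheses. *)
Lemma letters_commute b i r (x y : G) : x = s i * y -> D b (wp r * x) ->
  l (wp r * x) = (size r + l x)%N -> l x = (l y).+1 ->
  s i * (wp r * x) = wp r * y -> forall a, a \in r -> cm i a.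
Proof.
move=> xE; elim: r => // c r IH Dr lr lx E a.
have sz : size (c :: r) = (size r).+1 by [].
have lr' : l (wp r * x) = (size r + l x)%N.
  have := len_mul cox (s c) (wp r * x); have := len_gen cox M1 c.
  have := len_mul cox (wp r) x; have := len_le cox r.
  by move: lr; rewrite wprod_cons -mgA /=; lia.
have dc : (l (s c * (wp (c :: r) * x)) < l (wp (c :: r) * x))%N.
  by rewrite lr wprod_cons -mgA (genK cox M1) lr' /=; lia.
have di : (l (s i * (wp (c :: r) * x)) < l (wp (c :: r) * x))%N.
  rewrite E; have := len_mul cox (wp (c :: r)) y; have := len_le cox (c :: r).
  by rewrite lr sz; lia.
have ic : i != c.
  apply: contraTneq isT => ic; move: E; rewrite -ic wprod_cons -!mgA (genK cox M1) => E.
  have := len_mul cox (wp r) y; have := len_le cox r.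
  move: lr; rewrite sz wprod_cons -ic -mgA E (genK cox M1) => H1 H2 H3.
  by exfalso; lia.
have cmc := yd_comm dom Dr di dc ic.
rewrite inE => /predU1P[->//|]; apply: IH => //.
  have := yd_desc dom Dr dc; by rewrite wprod_cons -mgA (genK cox M1).
apply: (mulgI (s c)); rewrite mgA -(yd_cm dom cmc) -mgA.
by move: E; rewrite !wprod_cons -!mgA.
Qed.

(** The generator [i] that shortens part [t] has to get through the segments on its left.
    Allowedness of the shortened pair makes it a Bruhat coatom of the original pair, hence a weak
    one, by some [j]; counting letters gives [i = j], then [i] commutes with every letter of the
    neighbouring segment, and [comm_tail] reaches the rest. *)
Lemma young_lower b v lam (mu : seq part) t : D b v -> pil b v lam ->
  (forall p, p \in mu -> isp p) ->
  (forall k, (k.+1 < size mu)%N -> allowed s sigma1 sigma0 (nth p0 mu k.+1) (nth p0 mu k)) ->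
  part_cover s sigma0 (nth p0 lam t) (nth p0 mu t) ->
  (forall k, k <> t -> nth p0 lam k = nth p0 mu k) ->
  exists i, pil b (s i * v) mu /\ l v = (l (s i * v)).+1.
Proof.
move=> Dv pv im am [p1 /(ss_cover sys (b (+) odd t)) [_ [i pE]]] eqn.
exists i; apply: (pil_lower pv im p1 pE eqn) => u pu.
have tl : (t < size lam)%N.
  by rewrite ltnNge; apply/negP => H; move: p1; rewrite nth_default.
case: (ltnP t.+1 (size lam)) => [tl2|ge]; last first.
  by move: pu; rewrite drop_oversize // => /pil_nil_inv ->; rewrite mulg1 mul1g.
have [w Dw pw] := pil_drop Dv pv (ltnW tl).
move: pw; rewrite (drop_nth p0 tl) (drop_nth p0 tl2).
set p := nth p0 lam t; set q := nth p0 lam t.+1; set lam2 := drop t.+2 lam => pw.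
set c := b (+) odd t; rewrite -/p -/c in pE Dw pw p1.
have [ip iq Dp lp mq] := pil_pair Dw pw.
have qE : q = nth p0 mu t.+1 by apply: eqn => /esym/n_Sn.
have tm : (t.+1 < size mu)%N.
  rewrite ltnNge; apply/negP => H; have [] := iq.
  by rewrite qE nth_default.
have ipm : isp (nth p0 mu t) by apply/im/mem_nth/ltnW.
set p' := nth p0 mu t in p1 pE ipm.
have /(ss_allowed sys c) := am t tm; rewrite -qE -/p' => /(_ iq ipm) [mR lR].
set sp := seg (sg c) p in pE Dp lp *; set sp' := seg (sg c) p' in pE mR lR.
set sq := seg (sg (~~ c)) q in Dp lp mq mR lR.
have RE : sq * sp' = (s i ^ sq^-1) * (sq * sp).
  by rewrite conjgE invgK pE -!mgA mulKg (genK cox M1).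
have rfl : reflection s (s i ^ sq^-1) by exists i, sq^-1.
have RP : bruhat s (sq * sp') (sq * sp).
  have -> : sq * sp = (s i ^ sq^-1) * (sq * sp') by rewrite RE (reflectionK cox M1).
  apply: (bruhat_edge rfl); rewrite RE (reflectionK cox M1) // -RE lR lp p1; lia.
have [|j PE] := yd_coatom dom Dp mR RP; first by rewrite lR lp p1; lia.
have [r' r'E sr'] := len_word cox sq; have [rr rrE srr] := len_word cox sp'.
rewrite /sq /sp' !(ss_len sys) // in sr' srr.
(* Both words are reduced words of [sq * sp], so they contain each letter equally often. *)
have ij : i = j.
  have := @yd_count _ _ dom _ _ (r' ++ i :: rr) (j :: r' ++ rr) i Dp.
  rewrite wprod_cat wprod_cons r'E rrE -pE => /(_ erefl).
  rewrite size_cat /= lp sr' srr => H.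
  have {}H := H (ltac:(lia)).
  rewrite wprod_cons wprod_cat r'E rrE -PE size_cat /= sr' srr in H.
  have := H erefl (ltac:(lia)).
  by rewrite count_cat /= count_cat eqxx; case: eqVneq => // _; lia.
have cr' : forall a, a \in r' -> cm i a.
  apply: (@letters_commute c i r' sp sp'); rewrite ?r'E //.
  - by rewrite lp sr' /sp (ss_len sys).
  - by rewrite /sp /sp' !(ss_len sys).
  - by rewrite PE -ij (genK cox M1).
have [w' [[_ mw' _ wE lw] pw']] := pil_cons_inv pw.
have Dw' : D (~~ c) w' by apply: (yd_fact dom) mw' ip _; rewrite -wE.
have cE : b (+) odd t.+1 = ~~ c by rewrite /c oddS addbN.
have -> : u = w'.
  by apply: pil_inj pw'; move: pu; rewrite cE (drop_nth p0 tl2).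
apply: (comm_tail Dw' pw') => r a rE sr ar.
have sqw : seg (sg (~~ c)) q = sq by [].
apply: cr'; rewrite -has_pred1 has_count.
have Dq : count_mem a (r ++ rr) = count_mem a (r' ++ rr).
  have DR : D c (sq * sp').
    have := yd_desc dom (i := j) Dp; rewrite PE (genK cox M1); apply.
    by rewrite -PE lR lp p1; lia.
  apply: (yd_count dom) DR _ _ _ _; rewrite ?wprod_cat ?rE ?r'E ?rrE //.
    by rewrite size_cat sr srr lR.
  by rewrite size_cat sr' srr lR.
move: Dq; rewrite !count_cat => /addIn <-.
by rewrite -has_count has_pred1.
Qed.

Hypothesis weak : forall v w, D false w -> minrep s (SS false) v ->
  bruhat s v w -> exists2 x, w = wp x * v & l w = (size x + l v)%N.

Lemma weak_young x v lam nu : D false (wp x * v) ->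
  l (wp x * v) = (size x + l v)%N -> pil false v lam -> pil false (wp x * v) nu ->
  young s sigma1 sigma0 lam nu.
Proof.
elim: x nu => [|i x IH] nu.
  rewrite wprod_nil mul1g => _ _ p1 p2; rewrite (pil_uniq p1 p2); exact: rt_refl.
rewrite wprod_cons -mgA => Dw lw pv pw.
have lx : l (wp x * v) = (size x + l v)%N.
  have := len_mul cox (wp x) v; have := len_le cox x.
  have := len_mul cox (s i) (wp x * v); have := len_gen cox M1 i.
  by move: lw => /=; lia.
have lt : (l (wp x * v) < l (s i * (wp x * v)))%N by rewrite lw lx /=; lia.
have Dx : D false (wp x * v).
  rewrite -(genK cox M1 i (wp x * v)); apply: (yd_desc dom) => //.
  by rewrite (genK cox M1).
have [kap pk] := pil_exists (yd_minrep dom Dx).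
apply: rt_trans (IH _ Dx lx pv pk) _; apply: rt_step.
have [nu' [pn [t [pc eqt]]]] := pil_asc pk (yd_minrep dom Dw) lt.
have nuE : nu = nu' by apply: pil_uniq pw pn.
split; [exact: pil_colored pk|exact: pil_colored pw|].
by exists t; rewrite nuE.
Qed.

Lemma young_pil mu lam w : young s sigma1 sigma0 mu lam -> D false w ->
  pil false w lam ->
  exists v, [/\ D false v, pil false v mu & bruhat s v w].
Proof.
move=> H; elim: H w => {mu lam} [mu lam [[im _ am] cl [t [pc eqt]]] w Dw pw|mu w Dw pw|
  mu nu lam _ IH1 _ IH2 w Dw pw].
- have [i [pi li]] := young_lower Dw pw im am pc eqt.
  exists (s i * w); split => //; first by apply: (yd_desc dom) => //; lia.
  by apply: (bruhat_desc cox M1); lia.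
- by exists w; split => //; apply: bruhat_refl.
- have [v [Dv pv vw]] := IH2 w Dw pw; have [u [Du pu uv]] := IH1 v Dv pv.
  by exists u; split => //; apply: bruhat_trans vw.
Qed.

(** Both orders are generated by the same moves: below [w] the Bruhat order is the left weak order,
    each weak cover changes one part by one box, and by [young_lower] every Young cover arises in
    this way. *)
Theorem young_iso w lam : D false w -> pil false w lam ->
  poset_isomorphic (bruhat_interval s w) (bruhat s)
    (young_interval s sigma1 sigma0 lam) (young s sigma1 sigma0).
Proof.
move=> Dw pw.
have zE v : minrep s (setS n) v = minrep s (SS false) v by rewrite (ss_zz sys).
pose f v := xget [::] [set mu | pil false v mu].
have fP v : minrep s (SS false) v -> pil false v (f v).
  by move=> /pil_exists[mu pm]; rewrite /f; case: xgetP => [mu' -> //|/(_ mu)].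
have DQ v : bruhat_interval s w v -> D false v.
  move=> [mv _ vw]; rewrite zE in mv; have [x wE lw] := weak Dw mv vw.
  apply: (@domain_suffix _ (wp x)); rewrite -wE //.
  have := len_mul cox (wp x) v; have := len_le cox x.
  by rewrite -wE; lia.
have mQ v : bruhat_interval s w v -> minrep s (SS false) v by case; rewrite zE.
have ord x y : bruhat_interval s w x -> bruhat_interval s w y ->
    bruhat s x y <-> young s sigma1 sigma0 (f x) (f y).
  move=> Qx Qy; split=> [xy|H].
    have [z yE ly] := weak (DQ y Qy) (mQ x Qx) xy.
    apply: (@weak_young z x); rewrite -?yE //; [exact: DQ|exact/fP/mQ|exact/fP/mQ].
  have [v [Dv pv vy]] := young_pil H (DQ y Qy) (fP y (mQ y Qy)).
  by rewrite (pil_inj (fP x (mQ x Qx)) pv).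
have Qw : bruhat_interval s w w.
  split; [rewrite zE; exact: (yd_minrep dom)|exact: (bruhat1 cox M1)|exact: bruhat_refl].
have Q1 : bruhat_interval s w 1.
  by split; [exact: (minrep1 cox)|exact: bruhat_refl|exact: (bruhat1 cox M1)].
have fw : f w = lam by apply: pil_uniq (fP w (mQ w Qw)) pw.
have f1 : f 1 = [::] by apply: pil_uniq (fP 1 (mQ 1 Q1)) (pil_nil _).
exists f => //; split.
- move=> v Qv; have [_ v1 vw] := Qv; split.
  + exact: pil_colored (DQ v Qv) (fP v (mQ v Qv)).
  + by rewrite -f1; apply/ord.
  + by rewrite -fw; apply/ord.
- move=> x y /set_mem Qx /set_mem Qy E; apply: (pil_inj (fP x (mQ x Qx))).
  by rewrite E; exact/fP/mQ.
- move=> mu [_ _ H]; have [v [Dv pv vw]] := young_pil H Dw pw.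
  have Qv : bruhat_interval s w v.
    by split => //; [rewrite zE; exact: (yd_minrep dom)|exact: (bruhat1 cox M1)].
  by exists v => //; apply: pil_uniq (fP v (mQ v Qv)) pv.
Qed.

End InDomain.
End Young.

(** * Rank generating functions *)

Section Ranks.
Variables (n : nat).
Notation I := (Finite.sort (fintype_ordinal__canonical__fintype_Finite n.+1)).
Variables (M : I -> I -> nat) (G : groupType) (s : I -> G).
Hypothesis cox : coxeter_system M s.
Hypothesis M1 : forall i, M i i = 1%N.

Notation l := (len s).
Notation wp := (wprod s).
Notation p0 := (0, 0)%N.

Definition rank_set (w : G) (i : nat) : set G :=
  [set v | [/\ minrep s (setS n) v, bruhat s v w & l v = i]].

(** [fset_set] is empty on an infinite set, so Poincare polynomials and rank counts only have their
    meaning once finiteness is known. *)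
Lemma finite_bounded N : finite_set [set g : G | (l g <= N)%N].
Proof.
apply: (@sub_finite_set _ _ ((fun b : N.-bseq I => wp b) @` setT)%classic); last first.
  exact/finite_image/finite_finset.
move=> g /= gN; have [x xE sx] := len_word cox g.
have xN : (size x <= N)%N by rewrite sx.
by exists (Bseq xN).
Qed.

Lemma finite_lower w :
  finite_set [set v : G | minrep s (setS n) v /\ bruhat s v w].
Proof.
apply: sub_finite_set (finite_bounded (l w)) => v [_ /bruhat_len].
exact.
Qed.

Lemma finite_rank_set w i : finite_set (rank_set w i).
Proof. by apply: sub_finite_set (finite_lower w) => v [mv vw _]. Qed.

Lemma poincare_coef w i :
  ((poincare s w)`_i = (#|` fset_set (rank_set w i)|)%:R)%R.
Proof.
rewrite /poincare coef_sum.
under eq_bigr => v _ do rewrite coefXn.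
set X := fset_set _.
have -> : #|` fset_set (rank_set w i)| = size [seq v <- X | i == l v].
  apply: perm_size; apply: uniq_perm; rewrite ?fset_uniq ?filter_uniq ?fset_uniq //.
  move=> v; rewrite mem_filter.
  rewrite [LHS]in_fset_set; last exact: finite_rank_set.
  rewrite [X in _ && X]in_fset_set; last exact: finite_lower.
  apply/idP/andP => [/set_mem[mv vw <-]|[/eqP -> /set_mem[mv vw]]].
    by rewrite eqxx; split => //; apply/mem_set.
  exact/mem_set.
elim: (X : seq G) => [|v r IH]; first by rewrite big_nil.
rewrite big_cons IH /=; case: (i == l v) => /=; first by rewrite -GRing.natrD.
by rewrite GRing.add0r.
Qed.

Lemma palindromicP w : palindromic s w <-> forall i, (i <= l w)%N ->
  #|` fset_set (rank_set w i)| = #|` fset_set (rank_set w (l w - i)%N)|.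
Proof.
split=> H i iw; have := H i iw; rewrite !poincare_coef; last by move->.
by move=> /eqP; rewrite Num.Theory.eqr_nat => /eqP.
Qed.

(** Padding with parts of size 0 lets partitions of different lengths be compared entry by entry. *)
Lemma psize_nth K lam : (size lam <= K)%N ->
  psize lam = (\sum_(k < K) (nth p0 lam k).1)%N.
Proof.
rewrite /psize; elim: lam K => [|p lam IH] K /=.
  by move=> _; rewrite big1 // => k _; rewrite nth_nil.
by case: K => // K lt; rewrite big_ord_recl /= (IH K).
Qed.

Lemma young_cover_psize sigma1 sigma0 mu lam :
  young_cover s sigma1 sigma0 mu lam -> psize lam = (psize mu).+1.
Proof.
case=> _ _ [j [[pj _] eqk]].
set K := maxn j.+1 (maxn (size lam) (size mu)).
rewrite !(@psize_nth K); try by rewrite /K; lia.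
have jK : (j < K)%N by rewrite /K; lia.
rewrite [in LHS](bigD1 (Ordinal jK)) // [in RHS](bigD1 (Ordinal jK)) //= pj addSn.
congr (_ + _).+1.
apply: eq_bigr => k kj; rewrite eqk // => kj'.
by move: kj; rewrite -val_eqE /= kj' eqxx.
Qed.

Lemma young_psize sigma1 sigma0 mu lam : young s sigma1 sigma0 mu lam ->
  mu = lam \/ (psize mu < psize lam)%N.
Proof.
elim=> {mu lam} [mu lam /young_cover_psize ->|mu|mu nu lam _ IH1 _ IH2].
- by right.
- by left.
- by case: IH1 IH2 => [->|lt1] // [<-|lt2]; right => //; apply: ltn_trans lt2.
Qed.

(** The isomorphism is arbitrary: it need not be pi, so the ranks are recovered from the orders
    alone. Chains in the quotient rise by single lengths, which gives [l v <= psize (f v)]; Young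
    covers add single boxes, which gives the other inequality. *)
Lemma iso_palindromic sigma1 sigma0 w lam : minrep s (setS n) w ->
  poset_isomorphic (bruhat_interval s w) (bruhat s)
    (young_interval s sigma1 sigma0 lam) (young s sigma1 sigma0) ->
  palindromic s w <-> rank_symmetric (young_interval s sigma1 sigma0 lam) (psize lam).
Proof.
move=> mw [f [fun_f inj_f surj_f] ord].
set Q := bruhat_interval s w in fun_f inj_f surj_f ord *.
set Y := young_interval s sigma1 sigma0 lam in fun_f inj_f surj_f ord *.
have b1 v : bruhat s 1 v by exact: (bruhat1 cox M1).
have le1 : forall N v, (l v <= N)%N -> Q v -> (l v <= psize (f v))%N.
  elim=> [|N IH] v vN Qv; first by lia.
  have [mv _ vw] := Qv.
  have [->|/eqP v1] := eqVneq v 1; first by rewrite (len1 cox).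
  have m1 : minrep s (setS n) 1 by apply: (minrep1 cox).
  have [|u [mu _ uv lu]] := quotient_chain cox M1 m1 mv (b1 v).
    by move=> /esym.
  have Qu : Q u by split => //; apply: bruhat_trans vw.
  have := IH u _ Qu; have /(ord u v Qu Qv) := uv; move=> /young_psize[E|]; last by lia.
  have uE : u = v by apply: inj_f E; exact/mem_set.
  by rewrite uE in lu; lia.
have le2 : forall N v, (psize (f v) <= N)%N -> Q v -> (psize (f v) <= l v)%N.
  elim=> [|N IH] v vN Qv; first by lia.
  have [cf y0 yl] := fun_f v Qv.
  have [E|[nu [ynu cov]]] : f v = [::] \/ exists nu,
      young s sigma1 sigma0 [::] nu /\ young_cover s sigma1 sigma0 nu (f v).
    move/Operators_Properties.clos_rt_rtn1_iff: y0.
    case=> [|nu mu cov /Operators_Properties.clos_rt_rtn1_iff ynu]; first by left.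
    by right; exists nu.
  - by rewrite E.
  have Ynu : Y nu.
    by split; [case: cov|exact: ynu|apply: rt_trans yl; exact: rt_step].
  have [u Qu fu] := surj_f nu Ynu.
  have /(ord u v Qu Qv) uv : young s sigma1 sigma0 (f u) (f v) by rewrite fu; exact: rt_step.
  have pE := young_cover_psize cov; rewrite -fu in pE.
  have := IH u _ Qu; have := bruhat_len uv => H1 H2.
  have [ll|ll] := leqP (l v) (l u); last by lia.
  by move: pE; rewrite (bruhat_eq uv ll); lia.
have rk v : Q v -> psize (f v) = l v.
  by move=> Qv; apply/eqP; rewrite eqn_leq (le1 _ v (leqnn _)) // (le2 _ v (leqnn _)).
have Qw : Q w by split => //; exact: bruhat_refl.
have [cw y0 yl] := fun_f w Qw.
have Ylam : Y lam.
  have clam : colored_partition s sigma1 sigma0 lam.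
    move/Operators_Properties.clos_rt_rtn1_iff: yl.
    by case=> [|nu mu [_ ? _] _].
  by split; [exact: clam|apply: rt_trans yl|exact: rt_refl].
(* Both [lam] and [f w] are greatest elements of the Young interval. *)
have lamE : psize lam = l w.
  have [v Qv fv] := surj_f lam Ylam.
  have [_ _ vw] := Qv; have /(ord v w Qv Qw) := vw; rewrite fv.
  move: yl => /young_psize[<-|lt1]; first by rewrite rk.
  by move=> /young_psize[E|]; [rewrite E in lt1|]; lia.
have cardE i : #|` fset_set (Y `&` [set mu | psize mu = i])%classic| =
    #|` fset_set (rank_set w i)|.
  have -> : (Y `&` [set mu | psize mu = i])%classic = (f @` rank_set w i)%classic.
    apply/seteqP; split=> mu.
      move=> [Ymu pm]; have [v Qv fv] := surj_f mu Ymu; exists v => //.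
      by have [mv _ vw] := Qv; split => //; rewrite -rk // fv.
    move=> [v [mv vw lv] <-]; have Qv : Q v by split.
    by split; [exact: fun_f|rewrite /= rk].
  rewrite fset_set_image; last exact: finite_rank_set.
  rewrite card_in_imfset //= => x y; rewrite !in_fset_set; try exact: finite_rank_set.
  move=> /set_mem[mx xw _] /set_mem[my yw _]; apply: inj_f; apply/mem_set; by split.
rewrite palindromicP /rank_symmetric lamE.
by split=> H i iw; move: (H i iw); rewrite !cardE.
Qed.

End Ranks.

(** * Segments of the leaf types *)

(* [lia] distinguishes convertible inheritance paths to the group product. *)
Ltac glia :=
  match goal with G : groupType |- _ =>
    let std := constr:(@monoid.mul (monoid_Group__to__monoid_Magma G)) in
    repeat match goal with
    | H : context [Finite.sort (fintype_ordinal__canonical__fintype_Finite ?k)] |- _ =>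
        change (Finite.sort (fintype_ordinal__canonical__fintype_Finite k)) with (ordinal k) in H
    | |- context [Finite.sort (fintype_ordinal__canonical__fintype_Finite ?k)] =>
        change (Finite.sort (fintype_ordinal__canonical__fintype_Finite k)) with (ordinal k)
    | H : context [@monoid.mul ?X] |- _ =>
        lazymatch X with monoid_Group__to__monoid_Magma G => fail
        | _ => change (@monoid.mul X) with std in H end
    | |- context [@monoid.mul ?X] =>
        lazymatch X with monoid_Group__to__monoid_Magma G => fail
        | _ => change (@monoid.mul X) with std end
    end
  end; lia.

Lemma e0_neg (I : finType) (z i : I) : ~ (e0 z i < 0)%Z.
Proof. by rewrite /e0; case: ifP. Qed.

Section Leaf.
Variable n : nat.
Notation I := (Finite.sort (fintype_ordinal__canonical__fintype_Finite n.+1)).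
Variables (M : I -> I -> nat) (G : groupType) (s : I -> G).
Hypothesis cox : coxeter_system M s.
Hypothesis M1 : forall i, M i i = 1%N.
Variable A : I -> I -> Z.
Hypothesis Aii : forall i, A i i = (-2)%Z.
Hypothesis Abond : forall i j, i != j -> bond (M i j) (A i j) (A j i).
Variable sigma : nat -> seq G.
Hypothesis seg_sigma : leaf_segments s sigma.

Notation wp := (wprod s).
Notation l := (len s).
Notation z0 := (node0 n : I).
Notation S := [pred i : I | i != z0].
Notation J := (leaf_J s).
Notation isp := (is_part sigma).
Notation zz := (fun _ : bool => z0).

Lemma parabolic_z0 g : parabolic s S g -> l (g * s z0) = (l g).+1.
Proof.
move=> pg; have [//|E] := len_Mgen cox M1 z0 g.
have := @parabolic_desc _ _ _ _ cox M1 A Aii Abond S g^-1 z0 (parabolicV cox M1 pg).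
rewrite -(lenV cox M1 (_ * _)) mgV invgK (genV cox M1) (lenV cox M1) E.
by move=> H; case: (H (leqnn _)) => _ /eqP.
Qed.

Lemma leaf_seg p : isp p -> exists2 g, quotient_elt s S J p.1.-1 g &
  seg sigma p = g * s z0.
Proof.
have [f lf [s0 sS]] := seg_sigma; case: p => [[|j] c] [] //= _.
rewrite /seg /= sS size_map => cj; rewrite (nth_map 1) //.
by exists (nth 1 (f j) c) => //; apply/(lf j).2/mem_nth.
Qed.

Lemma leaf_part j g : quotient_elt s S J j g -> exists2 p, isp p & seg sigma p = g * s z0.
Proof.
have [f lf [s0 sS]] := seg_sigma => /(lf j).2 gf.
exists (j.+1, index g (f j)); first by rewrite /is_part /= sS size_map index_mem.
by rewrite /seg /= sS (nth_map 1) ?index_mem // nth_index.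
Qed.

Lemma leaf_len p : isp p -> l (seg sigma p) = p.1.
Proof.
move=> ip; have [g [pg _ lg] ->] := leaf_seg ip; rewrite parabolic_z0 // lg.
by case: ip; case: p.1.
Qed.

Lemma leaf_inj p q : isp p -> isp q -> seg sigma p = seg sigma q -> p = q.
Proof.
move=> ip iq E; have := leaf_len ip; rewrite E leaf_len //.
have [f lf [s0 sS]] := seg_sigma.
case: p q ip iq E => [j c] [j' c'] [/= j0 cj] [/= j0' cj'] E jE; rewrite jE in cj' E *.
congr pair; case: j j0 cj E {jE} cj' => // j _; rewrite /seg /= sS size_map => cj E cj'.
apply/eqP; rewrite -(nth_uniq 1 cj cj' (lf j).1); move/eqP: E.
by rewrite !(nth_map 1) // => /eqP/mulIg ->.
Qed.

Lemma leaf_desc w : minrep s S w -> w <> 1 -> l w = (l (w * s z0)).+1.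
Proof.
move=> mw w1; have [i lt] := desc_right_exists cox M1 w1.
have /negPn/eqP iz := minrep_desc_right cox M1 mw lt; subst i.
by have := len_Mgen cox M1 z0 w; glia.
Qed.

(** The elements of [J] commute with [s z0]. Hence an ascent that leaves the minimal representatives
    for [J] moves through the final [s z0] of the segment, and the segments are cut exactly at the
    occurrences of [s z0]. *)
Lemma leaf_system : segment_system s sigma sigma zz.
Proof.
split=> //.
- by case.
- by have [f _ [s0 _]] := seg_sigma; case; rewrite /seg /= s0.
- by case=> p; apply: leaf_len.
- move=> b p k ip Sk; have -> : (if b then sigma else sigma) = sigma by case: b.
  have [g [pg mg lg] ->] := leaf_seg ip; rewrite mgA.
  have pk : parabolic s S (s k * g) by apply: parabolicM => //; apply: parabolic_gen.
  rewrite parabolic_z0 // => -[lk].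
  have lt : (l g < l (s k * g))%N by rewrite lk lg; case: ip; glia.
  have [mk|[r Jr rE]] := minrep_asc cox M1 mg lt.
    by left; apply: leaf_part.
  right; have /andP[/= Sr /eqP comm] := Jr; exists r => //.
  by rewrite rE -!mgA comm.
- move=> b w mw w1; have -> : (if b then sigma else sigma) = sigma by case: b.
  have lw := leaf_desc mw w1.
  have [u [v [wE mu pv lv]]] := factorization_exists cox M1 S (w * s z0).
  have wE' : w = u * (v * s z0) by rewrite mgA -wE (genKr cox M1).
  have [|p ip pE] := @leaf_part (l v) v.
    split => //; apply/(minrepP cox M1) => r /andP[/= Sr /eqP comm].
    have [->//|E] := len_Mgen cox M1 r v.
    have := (minrepP cox M1 _ _).1 mw r Sr.
    have -> : w * s r = u * (v * s r * s z0) by rewrite wE' -!mgA comm.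
    have := len_mul cox u (v * s r * s z0); have := len_mul cox (v * s r) (s z0).
    by rewrite (len_gen cox M1); glia.
  exists u, p; split => //; rewrite ?pE // lw lv -(leaf_len ip) pE parabolic_z0 //.
  by rewrite addnS.
- move=> b u u' p p' mu mu' ip ip'; have -> : (if b then sigma else sigma) = sigma by case: b.
  have [g [pg _ _] gE] := leaf_seg ip; have [g' [pg' _ _] gE'] := leaf_seg ip'.
  rewrite gE gE' !mgA => /mulIg E.
  have [||uu gg] := @minrep_coset_inj _ _ _ _ cox M1 S u u' (g * g'^-1) mu mu'.
  - by apply: parabolicM => //; apply: (parabolicV cox M1).
  - by rewrite mgA E mulgK.
  split=> //; apply: leaf_inj => //; rewrite gE gE'; congr (_ * _).
  by rewrite -(mul1g g') -gg mulgVK.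
- move=> b; have -> : (if b then sigma else sigma) = sigma by case: b.
  have [|p ip pE] := @leaf_part 0 1.
    by split; [exact: parabolic1|exact: (minrep1 cox)|exact: (len1 cox)].
  by exists p => //; rewrite pE mul1g.
- by case.
- by case.
Qed.

Lemma leaf_pil b w lam : minrep s S w -> leaf_pi s sigma w lam ->
  pil s sigma sigma zz b w lam.
Proof.
move=> mw H; elim: H b mw => {w lam} [b _|w u v p lam w1 [wE mu pv lv] ip pE _ IH b mw].
  exact: pil_nil.
have sE (c : bool) : (if c then sigma else sigma) = sigma by case: c.
apply: (pil_cons (u := u)) (IH _ _) => //; rewrite ?sE ?pE //.
- by rewrite mgA -wE (genKr cox M1).
- by rewrite (leaf_desc mw w1) lv -(leaf_len ip) pE parabolic_z0 // addnS.
Qed.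

Definition commuting (i j : I) : Prop := i = j \/ A i j = 0%Z.

Section Domain.
Variable D : G -> Prop.
Hypothesis gD : good_domain cox z0 A D.
Hypothesis D_prefix : forall u p, D (u * seg sigma p) -> minrep s S u -> isp p ->
  l (u * seg sigma p) = (l u + p.1)%N -> D u.
Hypothesis D_dom : forall r' r, D (wp (r' ++ r)) -> size (r' ++ r) = l (wp (r' ++ r)) ->
  (exists2 p, isp p & wp r' = seg sigma p) -> (exists2 p, isp p & wp r = seg sigma p) ->
  minrep s S (wp r') -> forall a, (count_mem a r' <= count_mem a r)%N.

Lemma leaf_young_domain : young_domain s sigma sigma zz commuting (fun _ => D).
Proof.
have sE (c : bool) : (if c then sigma else sigma) = sigma by case: c.
split.
- by move=> i j [->//|]; apply: (bond_commute cox M1 Abond).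
- by move=> _ v; apply: (gd_minrep gD).
- by move=> _ v i Dv lt; apply: (domain_desc M1 Aii Abond gD).
- by move=> b u p; rewrite sE; apply: D_prefix.
- by move=> _ v w; apply: (coatom_weak M1 Aii Abond gD).
- by move=> _ v x y a; apply: (count_uniq M1 Aii Abond gD).
- move=> _ v i j Dv lti ltj ij; right; have mv := gd_minrep gD Dv.
  exact: (gd_comm gD Dv (st_neg cox M1 Aii Abond mv lti) (st_neg cox M1 Aii Abond mv ltj) ij).
- move=> b p q ip iq; rewrite !sE => DP lP mp.
  have dm r' r : wp r' = seg sigma p -> size r' = p.1 -> wp r = seg sigma q ->
      size r = q.1 -> forall a, (count_mem a r' <= count_mem a r)%N.
    move=> r'E sr' rE sr; apply: D_dom; rewrite ?wprod_cat ?r'E ?rE //.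
    + by rewrite size_cat sr' sr lP.
    + by exists p.
    + by exists q.
  split.
    have [r' r'E sr'] := len_word cox (seg sigma p).
    have [r rE sr] := len_word cox (seg sigma q); rewrite !leaf_len // in sr' sr.
    have /count_subseqP[x sx /perm_size] := dm _ _ r'E sr' rE sr.
    by rewrite sr' => ->; rewrite -sr; apply: size_subseq.
  move=> i r' r r'E sr' rE sr H a ar'; apply: H.
  have := dm _ _ r'E sr' rE sr a.
  by move: ar'; rewrite -!has_pred1 !has_count; glia.
Qed.

Lemma leaf_iso w lam : D w -> leaf_pi s sigma w lam ->
  poset_isomorphic (bruhat_interval s w) (bruhat s)
    (young_interval s sigma sigma lam) (young s sigma sigma).
Proof.
move=> Dw H; apply: (young_iso cox M1 leaf_system leaf_young_domain) => //.
  by move=> v u; apply: (bruhat_weak M1 Aii Abond gD).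
by apply: leaf_pil => //; apply: (gd_minrep gD).
Qed.

End Domain.

Lemma leaf_word r p : isp p -> wp r = seg sigma p -> size r = l (wp r) ->
  minrep s S (wp r) -> exists2 y, r = rcons y z0 & all S y.
Proof.
move=> ip rE sr mr; have [g [pg _ _] gE] := leaf_seg ip.
case/lastP: r rE sr mr => [|y k] rE sr mr.
  by have := leaf_len ip; rewrite -rE wprod_nil (len1 cox); case: ip; glia.
have yE : wp y = wp (rcons y k) * s k.
  by rewrite -cats1 wprod_cat wprod_seq1 (genKr cox M1).
have lt : (l (wp (rcons y k) * s k) < l (wp (rcons y k)))%N.
  by rewrite -yE -sr size_rcons ltnS; apply: (len_le cox).
have /negPn/eqP kz := minrep_desc_right cox M1 mr lt; subst k.
exists y => //; have yg : wp y = g by rewrite yE rE gE (genKr cox M1).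
apply: (parabolic_reduced cox M1 Aii Abond); first by rewrite yg.
by have := len_le cox y; have := len_Mgen cox M1 z0 (wp y); move: sr;
  rewrite -cats1 wprod_cat wprod_seq1 size_cat /=; glia.
Qed.

Section Chains.
Hypothesis mini : minuscule cox z0 A.

Notation stt := (st cox z0 A).

(* The words whose suffixes are the only reduced words of the elements they
   represent. *)
Fixpoint chain_word (x : seq I) : Prop :=
  if x is i :: y then
    [/\ chain_word y, (0 < stt (wp y) i)%Z,
        forall k, (stt (wp x) k < 0)%Z -> k = i &
        if y is j :: y' then A i j <> 0%Z -> (stt (wp y') i <= 0)%Z else True]
  else True.

(** With at most one [z0] after its first letter, a chain word is a single segment or a segment
    preceded by [s z0] alone; the domination of consecutive segments is then immediate. *)
Definition leaf_domain v := proper_minrep s z0 v \/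
  exists x, [/\ chain_word x, (count_mem z0 (behead x) <= 1)%N & wp x = v].

Lemma chain_minrep x : chain_word x -> minrep s S (wp x) /\ size x = l (wp x).
Proof.
elim: x => [_|i y IH /= [/IH[my sy] pos _ _]].
  by rewrite wprod_nil (len1 cox); split => //; exact: (minrep1 cox).
have [lt mi] := pos_asc M1 Aii Abond my pos; rewrite wprod_cons; split => //.
by have := len_genM cox M1 i (wp y); glia.
Qed.

(** The first letter of each suffix is its only descent. *)
Lemma chain_uniq x y : chain_word x -> wp y = wp x -> size y = l (wp y) -> y = x.
Proof.
elim: x y => [|i x IH] y cx yx sy.
  by move: sy; rewrite yx wprod_nil (len1 cox) => /size0nil.
have [mx sx] := chain_minrep cx; case: y yx sy => [|j y] yx sy.
  by move: sx; rewrite -yx wprod_nil (len1 cox).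
have sjy : wp y = s j * wp (j :: y) by rewrite wprod_cons (genK cox M1).
have ly : l (wp y) = size y.
  by have := len_le cox y; have := len_genM cox M1 j (wp y); move: sy; rewrite wprod_cons /=; glia.
have lt : (l (s j * wp (j :: y)) < l (wp (j :: y)))%N by rewrite -sjy ly -sy.
move: cx => /= [cx pos un _]; have ji : j = i.
  by apply: un; apply: (st_neg cox M1 Aii Abond mx); rewrite -yx.
rewrite ji (IH y) //; move: yx; rewrite !wprod_cons ji; exact: mulgI.
Qed.

Lemma leaf_domain_good : good_domain cox z0 A leaf_domain.
Proof.
have gp := proper_good M1 Aii Abond mini; split.
- by move=> v [/(gd_minrep gp)//|[x [/chain_minrep[]? _ _ <-]]].
- move=> v i [Dv neg|[[|k x] [cx ct <-]] neg]; first by left; apply: (gd_desc gp).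
    by move: neg; rewrite wprod_nil (st1 cox M1 z0 Aii Abond) => ng; case: (e0_neg ng).
  move: cx ct => [cx pos un _] ct; rewrite (un _ neg) wprod_cons (genK cox M1).
  right; exists x; split => //; apply: leq_trans ct.
  by case: x {cx pos un neg} => //= a x; rewrite leq_addl.
- move=> v i j [|[[|k x] [cx ct <-]]]; first exact: (gd_comm gp).
    by rewrite wprod_nil (st1 cox M1 z0 Aii Abond) => ng; case: (e0_neg ng).
  by move: cx => [_ _ un _] /un -> /un ->; rewrite eqxx.
- move=> v i j [|[[|k x] [cx ct <-]]]; first exact: (gd_nobraid gp).
    by rewrite wprod_nil (st1 cox M1 z0 Aii Abond) => ng; case: (e0_neg ng).
  move: cx => [cx pos un nb] neg; have ik := un _ neg; subst k.
  rewrite -(st_gen cox M1 z0 Aii Abond) wprod_cons (genK cox M1) => negj.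
  case: x cx nb {pos un neg ct} negj => [|k x] cx nb negj.
    by move: negj; rewrite wprod_nil (st1 cox M1 z0 Aii Abond) => ng; case: (e0_neg ng).
  move: cx => [_ _ un _]; have := un _ negj => ->.
  by rewrite -(st_gen cox M1 z0 Aii Abond) wprod_cons (genK cox M1).
Qed.

Hypothesis n1 : (0 < n)%N.

Lemma gen_proper : proper_minrep s z0 (s z0).
Proof.
have z1 : z0 != (inord 1 : 'I_n.+1) by rewrite -val_eqE /= inordK.
split; last by exists (inord 1); apply: parabolic_gen.
apply/(minrepP cox M1) => k kz.
have [->//|E'] := len_Mgen cox M1 k (s z0).
have E : s z0 * s k = 1 by apply: (len0 cox); move: E'; rewrite (len_gen cox M1); glia.
have := mulg1_eq E; rewrite (genV cox M1) => /(gen_inj cox M1 Aii Abond) zk.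
by move: kz; rewrite -zk /= ?eqxx.
Qed.

(** In the case of a chain word, removing the rightmost segment leaves 1 or [s z0], and both have
    proper support. *)
Lemma leaf_domain_prefix u p : leaf_domain (u * seg sigma p) -> minrep s S u -> isp p ->
  l (u * seg sigma p) = (l u + p.1)%N -> leaf_domain u.
Proof.
move=> D mu ip lE.
case: D => [[mup [j pj]]|[x [cx ct xE]]].
  left; split => //; exists j.
  by have [] := parabolic_factors cox M1 Aii Abond pj (etrans lE _); rewrite ?leaf_len.
left; have [ru ruE sru] := len_word cox u; have [rp rpE srp] := len_word cox (seg sigma p).
have E : ru ++ rp = x.
  by apply: chain_uniq => //; rewrite ?wprod_cat ruE rpE // size_cat sru srp lE leaf_len.
have [mx sx] := chain_minrep cx.
have mp : minrep s S (wp rp).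
  rewrite rpE; apply: (minrep_suffix cox M1 (x := u)); rewrite -?xE //.
  by rewrite xE lE leaf_len.
have srp' : size rp = l (wp rp) by rewrite rpE.
have [y yE _] := leaf_word ip rpE srp' mp.
case: ru ruE sru E => [|k ru] ruE sru E.
  rewrite -ruE wprod_nil; split; first exact: (minrep1 cox).
  by exists z0; apply: parabolic1.
move: ct; rewrite -E /= count_cat yE -cats1 count_cat /= ?eqxx.
case/lastP: ru ruE sru E => [|ru k'] ruE sru E.
  move=> _; rewrite -ruE wprod_seq1; have kz : k = z0; last by rewrite kz; apply: gen_proper.
  apply/eqP; apply/negPn; apply: (minrep_desc_right cox M1 mu).
  by rewrite -ruE wprod_seq1 (gen_sq cox M1) (len1 cox) (len_gen cox M1).
have /negPn/eqP kz : ~~ (k' != z0).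
  apply: (minrep_desc_right cox M1 mu); rewrite -ruE -rcons_cons -cats1 wprod_cat wprod_seq1.
  rewrite (genKr cox M1) -wprod_seq1 -wprod_cat cats1 rcons_cons ruE -sru.
  by apply: leq_ltn_trans (len_le cox _) _; rewrite /= size_rcons.
by rewrite kz -cats1 count_cat /= ?eqxx; glia.
Qed.

(** For proper support, letters are added at the left of [r']. A letter [a] other than [z0] that
    exceeded its count in [r] would satisfy [count_dominated] with the identity, whose conclusions
    become [1 <= sumA A r a] and [sumA A r a = 0]. *)
Lemma leaf_domain_dom r' r : leaf_domain (wp (r' ++ r)) ->
  size (r' ++ r) = l (wp (r' ++ r)) ->
  (exists2 p, isp p & wp r' = seg sigma p) -> (exists2 p, isp p & wp r = seg sigma p) ->
  minrep s S (wp r') -> forall a, (count_mem a r' <= count_mem a r)%N.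
Proof.
move=> D sz [p' ip' E'] [p ip E] mr'; have gD := leaf_domain_good.
have mD := gd_minrep gD D.
have s1 := len_le cox r'; have s2 := len_le cox r.
have s3 := len_mul cox (wp r') (wp r); rewrite wprod_cat size_cat in sz.
have mr : minrep s S (wp r).
  by apply: (minrep_suffix cox M1 (x := wp r')); rewrite -?wprod_cat //; rewrite wprod_cat; glia.
have sr : size r = l (wp r) by glia.
have [y rE _] := leaf_word ip E sr mr.
have sr' : size r' = l (wp r') by glia.
have [y' rE' aS] := leaf_word ip' E' sr' mr'.
have zr : (0 < count_mem z0 r)%N by rewrite rE -cats1 count_cat /= ?eqxx; glia.
case: D => [D|[x [cx ct xE]]]; last first.
  have xr : r' ++ r = x by apply: chain_uniq => //; rewrite wprod_cat size_cat.
  case: y' rE' aS => [|k y'] rE' aS a.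
    rewrite rE' /= addn0; case: eqVneq => //= <-; exact: zr.
  have : (count_mem z0 (rcons y' z0 ++ r) <= 1)%N by move: ct; rewrite -xr rE'.
  rewrite count_cat -cats1 count_cat; have -> : count_mem z0 [:: z0] = 1%N by rewrite /= ?eqxx.
  by glia.
have pr' : proper_minrep s z0 (wp r').
  split => //; have [_ [j pj]] := D; exists j.
  rewrite wprod_cat in pj.
  have lE : l (wp r' * wp r) = (l (wp r') + l (wp r))%N by glia.
  by have [] := parabolic_factors cox M1 Aii Abond pj lE.
move: sz; rewrite -size_cat -wprod_cat => sz; move: D pr' sr' sz; rewrite {}rE' {E' mr' s1 s3 mD}.
elim: y' aS => [_ _ _ _ _ a|a y' IH /andP[az aS] D pr' sr' sz b].
  by rewrite /= addn0; case: eqVneq => //= <-; exact: zr.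
have {}IH := IH aS; rewrite rcons_cons in D pr' sr' sz *; rewrite cat_cons in D sz.
move: (rcons y' z0) IH D pr' sr' sz => q IH D pr' sr' sz.
have lt1 : (l (s a * wp (a :: q)) < l (wp (a :: q)))%N.
  by rewrite -sr' wprod_cons (genK cox M1) ltnS; apply: (len_le cox).
have lt2 : (l (s a * wp (a :: q ++ r)) < l (wp (a :: q ++ r)))%N.
  by rewrite -sz wprod_cons (genK cox M1) ltnS; apply: (len_le cox).
have gp := proper_good M1 Aii Abond mini.
have D1 := domain_desc M1 Aii Abond gp pr' lt1.
have D2 := domain_desc M1 Aii Abond gp D lt2.
have H1 := len_genM cox M1 a (wp q).
have H2 := len_genM cox M1 a (wp (q ++ r)).
have sr2 := sr'; have sz2 := sz; rewrite !wprod_cons !(genK cox M1) in D1 D2 lt1 lt2 sr2 sz2.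
have {}sr2 : size q = l (wp q) by move: sr2 => /=; glia.
have {}sz2 : size (q ++ r) = l (wp (q ++ r)) by move: sz2 => /=; glia.
have {}IH := IH D2 D1 sr2 sz2.
have [ab|ab] := eqVneq a b; last by rewrite /= (negbTE ab); apply: IH.
subst b; rewrite /= eqxx; have [//|ge] := ltnP (count_mem a q) (count_mem a r).
have eqa : count_mem a q = count_mem a r by apply/eqP; rewrite eqn_leq IH.
have := @count_dominated _ _ _ _ cox M1 z0 A Aii Abond id q r a mini.
rewrite !map_id => /(_ (fun=> erefl) (fun _ _ => erefl) D sz pr' sr' IH eqa).
by rewrite /e0 (negbTE az); glia.
Qed.

Lemma leaf_domain_iso w lam : leaf_domain w -> leaf_pi s sigma w lam ->
  poset_isomorphic (bruhat_interval s w) (bruhat s)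
    (young_interval s sigma sigma lam) (young s sigma sigma).
Proof.
apply: (leaf_iso leaf_domain_good).
  exact: leaf_domain_prefix.
by move=> r' r D sz p' p m a; apply: leaf_domain_dom.
Qed.

End Chains.

End Leaf.

(** * Segments of the forked types *)

Lemma bond_inj m m' a b : bond m a b -> bond m' a b -> m = m'.
Proof.
by case: m => [|[|[|[|[|[|[|m]]]]]]] //=; case: m' => [|[|[|[|[|[|[|m']]]]]]] //=; lia.
Qed.

Section Fork.
Variable n : nat.
Notation I := (Finite.sort (fintype_ordinal__canonical__fintype_Finite n.+1)).
Variables (M : I -> I -> nat) (G : groupType) (s : I -> G).
Hypothesis cox : coxeter_system M s.
Hypothesis M1 : forall i, M i i = 1%N.
Variable A : I -> I -> Z.
Hypothesis Aii : forall i, A i i = (-2)%Z.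
Hypothesis Abond : forall i j, i != j -> bond (M i j) (A i j) (A j i).
Hypothesis n1 : (0 < n)%N.

Notation wp := (wprod s).
Notation l := (len s).
Notation z0 := (node0 n : I).
Notation z1 := (node1 n : I).
Notation J := (fork_J n).
Notation zz := (fun b : bool => if b then z1 else z0).
Notation SS b := [pred i : I | i != zz b].

Let z01 : z0 != z1.
Proof. by rewrite -val_eqE /= inordK. Qed.

Let J_SS (b : bool) r : J r -> SS b r.
Proof. by case: b => /andP[]. Qed.

Variables (sigma1 sigma0 : nat -> seq G).
Hypothesis lst1 : listing (quotient_elt s (setS n) (fork_J n)) sigma1.
Hypothesis lst0 : listing (quotient_elt s (setS' n) (fork_J n)) sigma0.
Notation sg b := (if b then sigma1 else sigma0).
Notation isp := (is_part sigma0).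

Let lst (b : bool) : listing (quotient_elt s (SS (~~ b)) J) (sg b).
Proof. by case: b. Qed.

Section System.
Variables (th : I -> I) (phi : G -> G).
Hypothesis R : relabel s th phi.
Hypothesis th0 : th z0 = z1.
Hypothesis th1 : th z1 = z0.
Hypothesis phiE : forall j, sigma0 j = map phi (sigma1 j).

Lemma fork_seg p : seg sigma0 p = phi (seg sigma1 p).
Proof.
rewrite /seg phiE; have [lt|ge] := ltnP p.2 (size (sigma1 p.1)).
  by rewrite (nth_map 1).
by rewrite !nth_default ?size_map // (relabel1 R).
Qed.

Lemma fork_isp b p : is_part (sg b) p <-> isp p.
Proof. by case: b => //; rewrite /is_part phiE size_map. Qed.

Lemma fork_elt b p : isp p -> quotient_elt s (SS (~~ b)) J p.1 (seg (sg b) p).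
Proof. by move=> /(fork_isp b)[p0 lt]; apply/(lst b p.1).2/mem_nth. Qed.

Lemma fork_part b j g : (0 < j)%N -> quotient_elt s (SS (~~ b)) J j g ->
  exists2 p, isp p & seg (sg b) p = g.
Proof.
move=> j0 /(lst b j).2 gf; exists (j, index g (sg b j)).
  by apply/(fork_isp b); rewrite /is_part /= index_mem.
by rewrite /seg /= nth_index.
Qed.

Lemma fork_phi_minrep b g : minrep s (SS b) g <-> minrep s (SS (~~ b)) (phi g).
Proof.
have H (c : bool) h : minrep s (SS c) h -> minrep s (SS (~~ c)) (phi h).
  move=> /(relabel_minrep cox M1 R); case: c; rewrite /= ?th0 ?th1; exact.
split; first exact: H.
by move=> /H; rewrite (relabel_inv cox R) negbK.
Qed.

Lemma fork_system : segment_system s sigma1 sigma0 zz.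
Proof.
split=> //.
- exact: fork_isp.
- move=> b; rewrite /seg /=; case: (lst b 0%N) => _; case: (sg b 0%N) => //= g x H.
  by have [_ _ /(len0 cox)] := (H g).1 (mem_head _ _).
- by move=> b p /(fork_elt b)[].
- move=> b p k ip Sk lk; have [pg mg lg] := fork_elt b ip.
  have lt : (l (seg (sg b) p) < l (s k * seg (sg b) p))%N by rewrite lk lg.
  have [mk|[r Jr rE]] := minrep_asc cox M1 mg lt.
    left; apply: (fork_part (j := p.1.+1)) => //; split => //.
    by apply: parabolicM => //; apply: parabolic_gen.
  by right; exists r => //; apply: J_SS.
- move=> b w mw w1.
  have [u [v [wE mu pv lv]]] := factorization_exists cox M1 (SS (~~ b)) w.
  have mv : minrep s J v.
    apply: (minrep_suffix cox M1 (x := u)); rewrite -?wE //.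
    by apply/(minrepP cox M1) => r /(J_SS b); apply: (minrepP cox M1 _ _).1.
  (* Were [v = 1], the last letter of [w] would have to be both [z0] and [z1]. *)
  have v0 : (0 < l v)%N.
    rewrite lt0n; apply/eqP => /(len0 cox) v1; rewrite v1 mulg1 in wE; subst u.
    have [i lt] := desc_right_exists cox M1 w1.
    have H1 := minrep_desc_right cox M1 mw lt; have H2 := minrep_desc_right cox M1 mu lt.
    by move: H1 H2; rewrite /=; case: (b) => /= /negPn/eqP -> /negPn; rewrite ?(negbTE z01) // eq_sym (negbTE z01).
  have [//|p ip pE] := @fork_part b (l v) v v0.
  exists u, p; split => //; first by rewrite pE.
  by have [_ _ <-] := fork_elt b ip; rewrite pE.
- move=> b u u' p p' mu mu' ip ip' E.
  have [pg _ lg] := fork_elt b ip; have [pg' _ lg'] := fork_elt b ip'.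
  have [||uu gg] := @minrep_coset_inj _ _ _ _ cox M1 (SS (~~ b)) u u'
     (seg (sg b) p * (seg (sg b) p')^-1) mu mu'.
  - by apply: parabolicM => //; apply: (parabolicV cox M1).
  - by rewrite mgA E mulgK.
  have gE : seg (sg b) p = seg (sg b) p' by rewrite -(mul1g (seg (sg b) p')) -gg mulgVK.
  split=> //.
  have /(fork_isp b)[_ /= c1] := ip; have /(fork_isp b)[_ /= c2] := ip'.
  have pp : p'.1 = p.1 by rewrite -lg -lg' gE.
  case: p p' c1 c2 pp gE {ip ip' E pg lg pg' lg' gg} => [j c] [j' c'] /= c1 c2 jj gE.
  subst j'; congr pair; apply/eqP.
  by rewrite -(nth_uniq 1 c1 c2 (lst b j).1); apply/eqP.
- move=> b; apply: (fork_part (j := 1%N)) => //; split; last exact: (len_gen cox M1).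
    by apply: parabolic_gen; case: b => //=; rewrite eq_sym.
  apply/(minrepP cox M1) => k Jk; have [->//|E'] := len_Mgen cox M1 k (s (zz b)).
  have E : s (zz b) * s k = 1 by apply: (len0 cox); move: E'; rewrite (len_gen cox M1); glia.
  have := mulg1_eq E; rewrite (genV cox M1) => /(gen_inj cox M1 Aii Abond) zk.
  by have := J_SS b Jk; rewrite -zk /= eqxx.
- move=> [] p q ip iq //=; rewrite /allowed.
  have E : phi (seg sigma0 p * seg sigma1 q) = seg sigma1 p * seg sigma0 q.
    by rewrite (relabelM cox R) !fork_seg (relabel_inv cox R).
  rewrite -(relabel_len cox R (seg sigma0 p * _)) E.
  by have := fork_phi_minrep true (seg sigma0 p * seg sigma1 q); rewrite E => ->.
- move=> [] p q //; rewrite /left_weak_cover !fork_seg !(relabel_len cox R).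
  have H g h : (exists i, phi g = s i * phi h) <-> exists i, g = s i * h.
    split=> -[i E]; exists (th i); last by rewrite E (relabelM cox R) (relabel_gen R).
    by rewrite -(relabel_inv cox R g) E (relabelM cox R) (relabel_gen R) (relabel_inv cox R).
  by rewrite H.
Qed.

Lemma fork_pil b w lam : minrep s (SS b) w -> fork_pi s sigma1 sigma0 b w lam ->
  pil s sigma1 sigma0 zz b w lam.
Proof.
move=> mw H; elim: H mw => {b w lam} [b _|b w u v p lam w1 [wE mu pv lv] ip pE _ IH mw].
  exact: pil_nil.
have {}mu : minrep s (SS (~~ b)) u by case: (b) mu.
have {}ip : isp p by apply/(fork_isp b).
apply: (pil_cons (u := u)) (IH mu) => //; first by rewrite pE.
by have [_ _ <-] := fork_elt b ip; rewrite pE.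
Qed.

End System.

Notation tau := (tperm z0 z1).
Hypothesis tauA : forall i j, A (tau i) (tau j) = A i j.

Let tauK : involutive tau.
Proof. exact: tpermK. Qed.

Lemma swap_relabel : exists psi, relabel s tau psi.
Proof.
apply: (relabel_exists cox) => // i j; have [->|ij] := eqVneq i j; first by rewrite !M1.
have := Abond ij; rewrite -(tauA i j) -(tauA j i); apply: bond_inj; apply: Abond.
by rewrite (eqtype.inj_eq perm_inj).
Qed.

Hypothesis mini : minuscule cox z0 A.
Hypothesis A01 : A z0 z1 = 0%Z.

Lemma swap_A i a : i != z0 -> i != z1 -> A i (tau a) = A i a.
Proof.
move=> i0 i1; rewrite -(tauA i a); congr (A _ _); rewrite tpermD // eq_sym //.
Qed.

Lemma swap_commuting i a : commuting A i (tau a) -> commuting A i a.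
Proof.
have A10 : A z1 z0 = 0%Z by rewrite -(tauA z1 z0) tpermR tpermL.
have [ia|ia] := eqVneq i a; first by left.
case: tpermP ia => [->|->|//] ia; rewrite /commuting.
- move=> [->|E]; first by right.
  by have [->|i1] := eqVneq i z1; [right|right; rewrite -(swap_A _ ia i1) tpermL].
- move=> [->|E]; first by right.
  by have [->|i1] := eqVneq i z0; [right|right; rewrite -(swap_A _ i1 ia) tpermR].
Qed.

(** The two nodes of the fork have the same neighbours with the same entries, so the sums differ
    only through the letters [z0]; the letter [z1] is absent from [r]. *)
Lemma sumA_swap r : all (SS true) r ->
  sumA A r z0 = (sumA A r z1 - 2 * Z.of_nat (count_mem z0 r))%Z.
Proof.
elim: r => [|b r IH] //; rewrite [all _ _]/= => /andP[b1 /IH E].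
rewrite -[sumA A (b :: r) z0]/(A b z0 + sumA A r z0)%Z.
rewrite -[sumA A (b :: r) z1]/(A b z1 + sumA A r z1)%Z {}E.
rewrite -[count_mem z0 (b :: r)]/((b == z0) + count_mem z0 r)%N.
have [->|b0] := eqVneq b z0; first by rewrite Aii A01 Nat2Z.inj_add; lia.
by rewrite -{1}(tpermR z0 z1) (swap_A _ b0 b1); lia.
Qed.

(** As in the leaf case, with the left segment compared after exchanging the two nodes of the fork.
    The new case is [a = z1]: [count_dominated] asks for [sumA A r z0 >= 0] and [sumA A r z1 = 1],
    but an occurrence of [z0] in [r] separates the two sums by at least 2. *)
Lemma fork_dom r' r : proper_minrep s z0 (wp (r' ++ r)) ->
  size (r' ++ r) = l (wp (r' ++ r)) -> proper_minrep s z0 (wp (map tau r')) ->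
  size r' = l (wp r') -> all (SS false) r' -> all (SS true) r -> z0 \in r ->
  forall b, (count_mem b r' <= count_mem (tau b) r)%N.
Proof.
move=> + + + + + rS zr; have [psi P] := swap_relabel.
elim: r' => [//|a r' IH] D sz pr' sr' /andP[a0 aS] b.
have sr2' : size (map tau (a :: r')) = l (wp (map tau (a :: r'))).
  by rewrite size_map -(relabel_word P) (relabel_len cox P).
have lt1 : (l (s (tau a) * wp (map tau (a :: r'))) < l (wp (map tau (a :: r'))))%N.
  rewrite -sr2' /= wprod_cons (genK cox M1) ltnS; apply: (len_le cox).
have lt2 : (l (s a * wp ((a :: r') ++ r)) < l (wp ((a :: r') ++ r)))%N.
  rewrite -sz /= wprod_cons (genK cox M1) ltnS; apply: (len_le cox).
have gp := proper_good M1 Aii Abond mini.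
have D1 := domain_desc M1 Aii Abond gp pr' lt1.
have D2 := domain_desc M1 Aii Abond gp D lt2.
have H1 := len_le cox r'; have H3 := len_genM cox M1 a (wp r').
have H2 := len_genM cox M1 a (wp (r' ++ r)).
rewrite /= !wprod_cons !(genK cox M1) in D1 D2 lt1 lt2 sr' sz.
have sr2 : size r' = l (wp r') by glia.
have sz2 : size (r' ++ r) = l (wp (r' ++ r)) by glia.
have {}IH := IH D2 sz2 D1 sr2 aS.
have [ab|ab] := eqVneq a b; last by rewrite /= (negbTE ab); apply: IH.
subst b; rewrite /= eqxx; have [//|ge] := ltnP (count_mem a r') (count_mem (tau a) r).
have eqa : count_mem a r' = count_mem (tau a) r by apply/eqP; rewrite eqn_leq IH.
have sz3 : size (a :: r' ++ r) = l (wp (a :: r' ++ r)) by rewrite /= wprod_cons.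
have [] := @count_dominated _ _ _ _ cox M1 z0 A Aii Abond tau r' r a mini tauK tauA
  D sz3 pr' sr2' IH eqa.
rewrite /e0 (negbTE a0); have [->|a1] := eqVneq a z1.
  rewrite tpermR eqxx (sumA_swap rS) => E1 E2.
  have : (0 < count_mem z0 r)%N by rewrite -has_count has_pred1.
  by move: E1; rewrite E2; lia.
have -> : tau a = a by rewrite tpermD // eq_sym.
by rewrite (negbTE a0); lia.
Qed.

(** Two relabelings occur. The automorphism that matches the colors may, in type D, also move the
    other end of the diagram; the argument on letters uses the plain exchange of [z0] and [z1],
    realized by [psi]. *)
Lemma fork_iso (th : I -> I) (phi : G -> G) w lam : relabel s th phi ->
  th z0 = z1 -> th z1 = z0 -> (forall j, sigma0 j = map phi (sigma1 j)) ->
  proper_minrep s z0 w -> fork_pi s sigma1 sigma0 false w lam ->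
  poset_isomorphic (bruhat_interval s w) (bruhat s)
    (young_interval s sigma1 sigma0 lam) (young s sigma1 sigma0).
Proof.
move=> R t0 t1 phiE Dw H; have [psi P] := swap_relabel.
have gp := proper_good M1 Aii Abond mini.
have [psi_m psi_p] : (forall (b : bool) g, minrep s (SS b) g -> minrep s (SS (~~ b)) (psi g)) /\
    (forall g, proper_support s g -> proper_support s (psi g)).
  split=> [b g /(relabel_minrep cox M1 P)|g [j /(relabel_parabolic P) pj]]; last by exists (tau j).
  by case: b; rewrite /= ?tpermL ?tpermR.
(* States are defined for the quotient at [z0] only; elements of the quotient at [z1] are first sent
   there by [psi]. *)
pose D (b : bool) v := proper_minrep s z0 (if b then psi v else v).
have pK := relabel_inv cox P.
have DP (b : bool) g : D b g <-> minrep s (SS b) g /\ proper_support s g.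
  case: b; rewrite /D //=; split=> -[m p]; last by split; [apply: (psi_m true)|apply: psi_p].
  by split; [rewrite -(pK g); apply: (psi_m false)|rewrite -(pK g); apply: psi_p].
have isp_eq := fork_isp phiE; have elt := fork_elt phiE.
have yd : young_domain s sigma1 sigma0 zz (commuting A) D.
  split.
  - by move=> i j [->//|]; apply: (bond_commute cox M1 Abond).
  - by move=> b v /DP[].
  - move=> b v i /DP[mv [j pj]] lt; apply/DP; split; first exact: (minrep_desc cox M1).
    by exists j; have [] := parabolic_desc cox M1 Aii Abond pj lt.
  - move=> b u p /DP[_ [j pj]] mu ip lE; apply/DP; split => //; exists j.
    by have [] := parabolic_factors cox M1 Aii Abond pj (etrans lE _); rewrite //; have [_ _ ->] := elt b _ ip.
  - move=> [] v x Dx mv vx lE; last exact: (coatom_weak M1 Aii Abond gp Dx).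
    have [||||i E] := coatom_weak M1 Aii Abond gp (v := psi v) (w := psi x).
    + exact: Dx.
    + exact: (psi_m true).
    + exact: (relabel_bruhat cox P).
    + by rewrite !(relabel_len cox P).
    by exists (tau i); rewrite -(pK x) E (relabelM cox P) pK (relabel_gen P).
  - move=> [] v x y a Dv xE sx yE sy; last exact: (count_uniq M1 Aii Abond gp a Dv).
    have ct z : count_mem a z = count_mem (tau a) (map tau z).
      by rewrite count_map; apply: eq_count => c /=; rewrite (eqtype.inj_eq perm_inj).
    rewrite !ct; apply: (count_uniq M1 Aii Abond gp (tau a) Dv);
      by rewrite -?(relabel_word P) ?xE ?yE // size_map (relabel_len cox P).
  - move=> [] v i j Dv lti ltj ij; last first.
      right; exact: (gd_comm gp Dv (st_neg cox M1 Aii Abond Dv.1 lti) (st_neg cox M1 Aii Abond Dv.1 ltj) ij).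
    right; rewrite -(tauA i j).
    have lt k : (l (s k * v) < l v)%N -> (l (s (tau k) * psi v) < l (psi v))%N.
      by rewrite -(relabel_gen P) -(relabelM cox P) !(relabel_len cox P).
    apply: (gd_comm gp Dv (st_neg cox M1 Aii Abond Dv.1 (lt _ lti)) (st_neg cox M1 Aii Abond Dv.1 (lt _ ltj))).
    by rewrite (eqtype.inj_eq perm_inj).
  - move=> b p q ip iq Dpq lE mp.
    have [pp _ lp] := elt (~~ b) _ ip; have [pq _ lq] := elt b _ iq.
    rewrite negbK in pp.
    have dm r' r : wp r' = seg (sg (~~ b)) p -> size r' = p.1 -> wp r = seg (sg b) q ->
        size r = q.1 -> forall a, (count_mem a r' <= count_mem (tau a) r)%N.
      move=> r'E sr' rE sr.
      have ar' : all (SS b) r'.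
        by apply: (parabolic_reduced cox M1 Aii Abond); rewrite r'E ?lp.
      have ar : all (SS (~~ b)) r.
        by apply: (parabolic_reduced cox M1 Aii Abond); rewrite rE ?lq.
      have /DP[mpq sup] := Dpq.
      have mq : minrep s (SS b) (wp r).
        by apply: (minrep_suffix cox M1 (x := seg (sg (~~ b)) p)); rewrite rE // lE lp lq.
      have zr : zz b \in r.
        case/lastP: r rE sr mq {ar} => [|r k] rE sr mq; first by move: iq.1; rewrite -sr.
        have /negPn/eqP <- : ~~ (k != zz b); last by rewrite mem_rcons mem_head.
        apply: (minrep_desc_right cox M1 mq); rewrite {2}rE lq -sr size_rcons ltnS.
        by rewrite -cats1 wprod_cat wprod_seq1 (genKr cox M1); apply: (len_le cox).
      have sup' : proper_support s (seg (sg (~~ b)) p).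
        have [j pj] := sup; exists j.
        by have [] := parabolic_factors cox M1 Aii Abond pj (etrans lE _); rewrite // lp lq.
      have mtau x : all (SS true) x -> all (SS false) (map tau x).
        rewrite all_map; apply: sub_all => i /=; apply: contraNneq => E.
        by rewrite -(tauK i) E tpermL.
      have mtau' x : all (SS false) x -> all (SS true) (map tau x).
        rewrite all_map; apply: sub_all => i /=; apply: contraNneq => E.
        by rewrite -(tauK i) E tpermR.
      have szE : size (r' ++ r) = l (wp (r' ++ r)).
        by rewrite size_cat wprod_cat r'E rE sr' sr lE.
      have sr'E : size r' = l (wp r') by rewrite r'E lp.
      have cE a x : count_mem a (map tau x) = count_mem (tau a) x.
        by rewrite count_map; apply: eq_count => c /=; rewrite (inv_eq tauK).
      move: Dpq mp ar ar' zr {elt lE pp lp lq pq sup mpq mq sr sr'} sup' r'E rE.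
      rewrite /D; case: b => /= Dpq mp ar ar' zr sup' r'E rE.
        have H1 : forall a, (count_mem a (map tau r') <= count_mem (tau a) (map tau r))%N.
          apply: fork_dom.
          - by rewrite -map_cat -(relabel_word P) wprod_cat r'E rE.
          - by rewrite -map_cat -(relabel_word P) size_map (relabel_len cox P).
          - by rewrite mapK // r'E; split.
          - by rewrite size_map -(relabel_word P) (relabel_len cox P).
          - exact: mtau.
          - exact: mtau'.
          - by apply/mapP; exists z1; rewrite ?tpermR.
        by move=> a; have := H1 (tau a); rewrite !cE !tauK.
      apply: fork_dom => //.
      - by rewrite wprod_cat r'E rE.
      - rewrite -(relabel_word P) r'E; split; last exact: psi_p.
        exact: (psi_m true).
    split.
      have [r' r'E sr'] := len_word cox (seg (sg (~~ b)) p).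
      have [r rE sr] := len_word cox (seg (sg b) q); rewrite lp in sr'; rewrite lq in sr.
      have : forall a, (count_mem a (map tau r') <= count_mem a r)%N.
        move=> a; rewrite count_map; have := dm _ _ r'E sr' rE sr (tau a); rewrite tauK.
        by apply: leq_trans; rewrite leq_eqVlt; apply/orP; left; apply/eqP;
          apply: eq_count => c /=; rewrite (inv_eq tauK).
      move=> /count_subseqP[x sx /perm_size]; rewrite size_map sr' => ->; rewrite -sr.
      exact: size_subseq.
    move=> i r' r r'E sr' rE sr Hc a ar'; apply: swap_commuting; apply: Hc.
    have := dm _ _ r'E sr' rE sr a.
    by move: ar'; rewrite -!has_pred1 !has_count; lia.
apply: (young_iso cox M1 (fork_system R t0 t1 phiE) yd); last 2 first.
- by [].
- by apply: (fork_pil phiE) => //; have [] := Dw.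
by move=> v u; apply: (bruhat_weak M1 Aii Abond gp).
Qed.

End Fork.

(** * Certificates for the top of Bruhat intervals *)

Lemma fireE (I : finType) (A : I -> I -> Z) c i j :
  fire A c i j = (c j + A i j * c i)%Z.
Proof. by []. Qed.

Section Certificates.
Variables (I : finType) (A : I -> I -> Z).
Hypothesis Aii : forall i, A i i = (-2)%Z.
Hypothesis A_ge0 : forall i j, i != j -> (0 <= A i j)%Z.

Notation fire := (fire A).
Notation cov := (cov A).
Notation topuniq := (topuniq A).

Lemma cov_fire c y i : (c i < 0)%Z -> cov (fire c i) y -> (0 < y i)%Z ->
  cov c (fire y i).
Proof.
move=> ci cy yi; rewrite -(fireK Aii c i); apply: cov_step => //.
by rewrite (fire_at Aii); lia.
Qed.

(* A second coatom: the up-step i takes y below c, while c itself has i as a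
   descent, so the coatom fire y i cannot be fire c i. *)
Lemma topuniq_low K c y i : topuniq K.+1 c -> (c i < 0)%Z -> cov (fire c i) y ->
  (y i <= 0)%Z.
Proof.
move=> [un _] ci cy; have [//|yi] := Z_le_gt_dec (y i) 0.
have := un _ _ (cov_fire ci cy (Z.gt_lt _ _ yi)) (cov_base _ ci).
move=> /(congr1 (fun f => fire f i)); rewrite !(fireK Aii) => E.
by move: yi; rewrite E; lia.
Qed.

(** A second descent [k] would give a second coatom, and the entries of the two at [i] have opposite
    signs. *)
Lemma topuniq_neg K c i k : topuniq K.+1 c -> (c i < 0)%Z -> k != i -> (0 <= c k)%Z.
Proof.
move=> [un _] ci ki; have [//|ck] := Z_le_gt_dec 0 (c k).
have := un _ _ (cov_base _ ci) (cov_base _ (Z.gt_lt _ _ ck)).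
move=> /(congr1 (fun f => f i)); rewrite (fire_at Aii) fireE.
by have := A_ge0 ki; nia.
Qed.

Lemma topuniq_sub K c i : topuniq K.+1 c -> (c i < 0)%Z -> topuniq K (fire c i).
Proof. by move=> [_]; apply. Qed.

(* Descend along p, skip the descent k, and climb back. *)
Fixpoint cert (p : seq I) (k : I) (c : I -> Z) : I -> Z :=
  if p is i :: p' then fire (cert p' k (fire c i)) i else fire c k.

Fixpoint certok (p : seq I) (k : I) (c : I -> Z) : Prop :=
  if p is i :: p' then
    [/\ (c i < 0)%Z, certok p' k (fire c i) & (0 < cert p' k (fire c i) i)%Z]
  else (c k < 0)%Z.

Lemma cert_cov p k c : certok p k c -> cov c (cert p k c).
Proof.
elim: p c => [|i p IH] c /=; first exact: cov_base.
by move=> [ci /IH cy yi]; apply: cov_fire.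
Qed.

Lemma topuniq_cert K c i p k : topuniq K.+1 c -> ~ certok (i :: p) k c.
Proof.
by move=> tu [ci /cert_cov cy yi]; have := topuniq_low tu ci cy; lia.
Qed.

End Certificates.

(** * Consequences of palindromicity *)

Section Palindromic.
Variable n : nat.
Notation I := (Finite.sort (fintype_ordinal__canonical__fintype_Finite n.+1)).
Variables (M : I -> I -> nat) (G : groupType) (s : I -> G).
Hypothesis cox : coxeter_system M s.
Hypothesis M1 : forall i, M i i = 1%N.
Variable A : I -> I -> Z.
Hypothesis Aii : forall i, A i i = (-2)%Z.
Hypothesis Abond : forall i j, i != j -> bond (M i j) (A i j) (A j i).

Notation wp := (wprod s).
Notation l := (len s).
Notation z0 := (node0 n : I).
Notation S := [pred i : I | i != z0].
Notation stt := (st cox z0 A).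

(** Colength [t] below [w] has as many elements as length [t], and the latter are bounded by the
    whole quotient, independently of [w]. *)
Lemma palindromic_card w t (L V : seq G) : palindromic s w ->
  (forall v, minrep s S v -> l v = t -> v \in L) -> uniq V ->
  (forall v, v \in V -> [/\ minrep s S v, bruhat s v w & (l v + t)%N = l w]) ->
  (size V <= size L)%N.
Proof.
move=> /(palindromicP cox) pal Lt uV HV.
have [->//|V0] := eqVneq V [::].
have tl : (t <= l w)%N.
  by case: V V0 HV {uV} => // v0 V _ HV; have [_ _ <-] := HV _ (mem_head _ _); rewrite leq_addl.
have fin k : finite_set (rank_set s w k) by apply: (finite_rank_set cox).
apply: (@leq_trans #|` fset_set (rank_set s w (l w - t))|).
  apply: uniq_leq_size => // v /HV[mv vw lv]; rewrite in_fset_set // inE; split => //.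
  by rewrite -lv addnK.
rewrite -(pal t tl); apply: uniq_leq_size; first exact: fset_uniq.
by move=> v; rewrite in_fset_set // inE => -[mv _ /Lt]; apply.
Qed.

Lemma palindromic_level w t : palindromic s w ->
  (forall v v', minrep s S v -> minrep s S v' -> l v = t -> l v' = t -> v = v') ->
  level_uniq s z0 w t.
Proof.
move=> pal un v v' mv mv' vw vw' lv lv'; apply/eqP/negPn/negP => neq.
have [L [L1 HL]] : exists L : seq G, (size L <= 1)%N /\
    forall v, minrep s S v -> l v = t -> v \in L.
  have [[u [mu lu]]|no] := pselect (exists u, minrep s S u /\ l u = t).
    by exists [:: u]; split => // x mx lx; rewrite inE; apply/eqP/un.
  by exists [::]; split => // x mx lx; case: no; exists x.
have := palindromic_card (V := [:: v; v']) pal HL.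
rewrite /= inE neq => /(_ isT) H; suff : (2 <= size L)%N by lia.
by apply: H => x; rewrite !inE => /orP[]/eqP ->.
Qed.

Lemma palindromic_topuniq w K : palindromic s w -> minrep s S w ->
  (forall t v v', (0 < t <= K)%N -> minrep s S v -> minrep s S v' ->
     l v = t -> l v' = t -> v = v') ->
  topuniq A K (stt w).
Proof.
move=> pal mw un.
apply: (topuniq_sound cox M1 Aii Abond (t := 0%N) mw (@bruhat_refl _ _ s w) (addn0 _)).
by move=> r rK; apply: palindromic_level => // v v'; apply: un.
Qed.

(** Firing descents of the state spells a reduced word of [w]; the invariant [Q] keeps [j] out of
    it. *)
Lemma invariant_parabolic (Q : (I -> Z) -> Prop) j w :
  (forall c i, Q c -> (c i < 0)%Z -> i != j /\ Q (fire A c i)) ->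
  minrep s S w -> Q (stt w) -> parabolic s [pred i | i != j] w.
Proof.
move=> HQ; move: {2}(l w) (leqnn (l w)) => N; elim: N w => [|N IH] w wN mw Qw.
  have -> : w = 1 by apply: (len0 cox); lia.
  exact: parabolic1.
have [->|/eqP w1] := eqVneq w 1; first exact: parabolic1.
have [i lt] := desc_exists cox M1 w1.
have [ij Qi] := HQ _ _ Qw (st_neg cox M1 Aii Abond mw lt).
rewrite -(genK cox M1 i w); apply: parabolicM; first exact: parabolic_gen.
apply: IH; first by glia.
  exact: (minrep_desc cox M1).
by rewrite (st_gen cox M1 z0 Aii Abond).
Qed.

Lemma word_invariant (Q : (I -> Z) -> Prop) (P : pred I) g : Q (e0 z0) ->
  (forall c i, P i -> Q c -> Q (fire A c i)) -> parabolic s P g -> Q (stt g).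
Proof.
move=> Q0 QP [x + <-]; elim: x => [_|i x IH /andP[Pi /IH Qx]].
  by rewrite wprod_nil (st1 cox M1 z0 Aii Abond).
by rewrite wprod_cons (st_gen cox M1 z0 Aii Abond); apply: QP.
Qed.

Lemma word_invariantT (Q : (I -> Z) -> Prop) g : Q (e0 z0) ->
  (forall c i, Q c -> Q (fire A c i)) -> Q (stt g).
Proof.
move=> Q0 QP; apply: (@word_invariant Q predT) => // [c i _|]; first exact: QP.
by have [x <-] := wprod_surj cox g; exists x => //; apply/allP.
Qed.

Lemma minrep_level t v : minrep s S v -> l v = t.+1 -> exists i v',
  [/\ minrep s S v', l v' = t, (0 < stt v' i)%Z & v = s i * v'].
Proof.
move=> mv lv; have [|i lt] := @desc_exists _ _ _ _ cox M1 v.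
  by move=> v1; move: lv; rewrite v1 (len1 cox).
exists i, (s i * v); split; last by rewrite (genK cox M1).
- exact: (minrep_desc cox M1).
- by have := len_genM cox M1 i v; glia.
- rewrite (st_gen cox M1 z0 Aii Abond) (fire_at Aii).
  by have := st_neg cox M1 Aii Abond mv lt; lia.
Qed.

Lemma dominant_one w : minrep s S w -> (forall i, (0 <= stt w i)%Z) -> w = 1.
Proof.
move=> mw dom; have [//|/eqP w1] := eqVneq w 1.
have [i lt] := desc_exists cox M1 w1.
by have := st_neg cox M1 Aii Abond mw lt; have := dom i; lia.
Qed.

End Palindromic.

(** Only the forward direction needs the classification [leaf_domain]; in the other one the
    isomorphism is given and transports ranks. *)
Lemma leaf_main n (M : 'I_n.+1 -> 'I_n.+1 -> nat) (G : groupType) (s : 'I_n.+1 -> G)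
    (A : 'I_n.+1 -> 'I_n.+1 -> Z) (cox : coxeter_system M s) sigma w lam :
  (forall i, M i i = 1%N) -> (forall i, A i i = (-2)%Z) ->
  (forall i j, i != j -> bond (M i j) (A i j) (A j i)) -> (0 < n)%N ->
  minuscule cox (node0 n) A -> leaf_segments s sigma ->
  (palindromic s w -> leaf_domain cox A w) ->
  minrep s (setS n) w -> leaf_pi s sigma w lam ->
  palindromic s w <->
    (poset_isomorphic (bruhat_interval s w) (bruhat s)
       (young_interval s sigma sigma lam) (young s sigma sigma)
     /\ rank_symmetric (young_interval s sigma sigma lam) (psize lam)).
Proof.
move=> M1 Aii Abond n0 mini sg cls mw pw; split=> [pal|[iso rs]]; last first.
  exact/(iso_palindromic cox M1 mw iso).
have iso := leaf_domain_iso M1 Aii Abond sg mini n0 (cls pal) pw.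
by split => //; apply/(iso_palindromic cox M1 mw iso).
Qed.

(** * Computing with states as lists *)

Section ListStates.
Variables (n : nat) (An : nat -> nat -> Z).
Notation I := (Finite.sort (fintype_ordinal__canonical__fintype_Finite n.+1)).
Let A (i j : I) : Z := An i j.
Notation nodes := (iota 0 n.+1).
Notation "l `@ k" := (nth 0%Z l k) (at level 2, k at level 1, format "l `@ k").

Definition state_list (c : I -> Z) : seq Z := [seq c (inord k) | k <- nodes].
Definition lfire (l : seq Z) (i : nat) : seq Z :=
  [seq (l`@k + An i k * l`@i)%Z | k <- nodes].
Definition lunit : seq Z := [seq if k == 0%N then 1%Z else 0%Z | k <- nodes].

Fixpoint lcert (p : seq nat) (k : nat) (l : seq Z) : seq Z :=
  if p is i :: p' then lfire (lcert p' k (lfire l i)) i else lfire l k.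

(** The negation of [certok], pushed inwards to a disjunction of linear inequalities that [lia] can
    split. *)
Fixpoint lnocert (p : seq nat) (k : nat) (l : seq Z) : Prop :=
  if p is i :: p' then
    (0 <= l`@i)%Z \/ lnocert p' k (lfire l i) \/ ((lcert p' k (lfire l i))`@i <= 0)%Z
  else (0 <= l`@k)%Z.

Lemma nth_nodes (f : nat -> Z) k : (k < n.+1)%N -> [seq f k | k <- nodes]`@k = f k.
Proof. by move=> kn; rewrite (nth_map 0%N) ?size_iota // nth_iota. Qed.

Lemma nth_state_list c k : (k < n.+1)%N -> (state_list c)`@k = c (inord k).
Proof. exact: nth_nodes. Qed.

Lemma state_listE c (i : I) : (state_list c)`@i = c i.
Proof. by rewrite nth_state_list // inord_val. Qed.

Lemma state_list_inj c d : state_list c = state_list d -> c = d.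
Proof. by move=> E; apply: funext => i; rewrite -!state_listE E. Qed.

Lemma state_list_fire c i : (i < n.+1)%N ->
  state_list (fire A c (inord i)) = lfire (state_list c) i.
Proof.
move=> iN; apply/eq_in_map => k; rewrite mem_iota /= => kn.
by rewrite !nth_state_list // /fire /A !inordK.
Qed.

Lemma state_list_e0 : state_list (e0 (node0 n)) = lunit.
Proof.
apply/eq_in_map => k; rewrite mem_iota /= => kn.
by rewrite /e0 -val_eqE /= inordK.
Qed.

Notation inI := (fun k => (k < n.+1)%N).

Lemma state_list_cert p k c : all inI p -> inI k ->
  state_list (cert A [seq inord i | i <- p] (inord k) c) = lcert p k (state_list c).
Proof.
move=> + kn; elim: p c => [|i p IH] c /=; first by move=> _; apply: state_list_fire.
by move=> /andP[iN pN]; rewrite state_list_fire // IH // state_list_fire.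
Qed.

Lemma state_list_nocert p k c : all inI p -> inI k ->
  ~ certok A [seq inord i | i <- p] (inord k) c -> lnocert p k (state_list c).
Proof.
move=> + kn; elim: p c => [|i p IH] c /=.
  by rewrite nth_state_list //; lia.
move=> /andP[iN pN] H; rewrite nth_state_list // -state_list_fire // -state_list_cert //.
rewrite nth_state_list //.
have [//|ci] := Z_le_gt_dec 0 (c (inord i)); first by left.
right; have [ok|] := pselect (certok A [seq inord i | i <- p] (inord k) (fire A c (inord i))).
  right; have [//|yi] := Z_le_gt_dec (cert A [seq inord i | i <- p] (inord k) (fire A c (inord i)) (inord i)) 0.
  by case: H; split => //; lia.
by move=> /IH H'; left; apply: H'.
Qed.

(* What uniqueness of the top K levels says about a list state, as far as it is
   witnessed by the certificates in R. *)
Fixpoint lfacts (R : nat -> seq (seq nat * nat)) (K : nat) (l : seq Z) : Prop :=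
  if K is K'.+1 then forall i, (i < n.+1)%N -> (l`@i < 0)%Z ->
    [/\ foldr (fun k P => if k == i then P else (0 <= l`@k)%Z /\ P) True nodes,
        foldr (fun r P => (lnocert r.1 r.2 (lfire l i) \/
                 ((lcert r.1 r.2 (lfire l i))`@i <= 0)%Z) /\ P) True (R i)
      & lfacts R K' (lfire l i)]
  else True.

Lemma lfacts_step R K l : lfacts R K.+1 l -> forall i, (i < n.+1)%N -> (l`@i < 0)%Z ->
  [/\ foldr (fun k P => if k == i then P else (0 <= l`@k)%Z /\ P) True nodes,
      foldr (fun r P => (lnocert r.1 r.2 (lfire l i) \/
               ((lcert r.1 r.2 (lfire l i))`@i <= 0)%Z) /\ P) True (R i)
    & lfacts R K (lfire l i)].
Proof. by []. Qed.

Hypothesis Aii : forall i, A i i = (-2)%Z.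
Hypothesis A_ge0 : forall i j, i != j -> (0 <= A i j)%Z.

Lemma topuniq_lfacts R K c :
  all (fun i => all (fun r => all inI r.1 && inI r.2) (R i)) nodes ->
  topuniq A K c -> lfacts R K (state_list c).
Proof.
move=> Rok; elim: K c => // K IH c tu i iN; rewrite nth_state_list // => ci; split.
- have : all inI nodes by apply/allP => k; rewrite mem_iota.
  elim: (nodes) => //= k x IHx /andP[kn xn]; case: eqP => ki; first exact: IHx.
  split; last exact: IHx.
  rewrite nth_state_list //; apply: (topuniq_neg Aii A_ge0 tu ci).
  by rewrite -val_eqE /= !inordK //; apply/eqP.
- have /allP/(_ i) := Rok; rewrite mem_iota => /(_ iN).
  elim: (R i) => // r x IHx /andP[/andP[r1 r2] rx]; rewrite [foldr _ _ _]/=; split; last exact: IHx.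
  have := @topuniq_cert _ A Aii K c (inord i) [seq inord i | i <- r.1] (inord r.2) tu.
  move=> /(@state_list_nocert (i :: r.1) r.2 c); rewrite /= iN => /(_ r1 r2).
  by rewrite nth_state_list //; case; [lia|].
- by rewrite -state_list_fire //; apply: IH; apply: topuniq_sub tu ci.
Qed.

(** A checkable witness for node [j]. Closure under the other generators gives the bounds of
    [minuscule] on the whole orbit of the starting state; the nonnegative entry at [j] shows that
    elements with a state in [q] never use [j]. *)
Definition proper_closed (j : nat) (q : seq (seq Z)) : bool :=
  (lunit \in q) && all (fun l => (0 <=? l`@j)%Z && all (fun i => (i == j) ||
    [&& (-1 <=? l`@i)%Z, (l`@i <=? 1)%Z & lfire l i \in q]) nodes) q.

(* The states reached by at most N up-steps avoiding j. *)
Definition closure (N j : nat) : seq (seq Z) :=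
  (ssrnat.iter N (fun qf =>
    let f := undup (flatten [seq [seq lfire l i |
      i <- [seq i <- nodes | (i != j) && (0 <? l`@i)%Z]] | l <- qf.2]) in
    (qf.1 ++ f, f)) ([:: lunit], [:: lunit])).1.

Fixpoint llevel (t : nat) : seq (seq Z) :=
  if t is t'.+1 then undup
    (flatten [seq [seq lfire l i | i <- [seq i <- nodes | (0 <? l`@i)%Z]] | l <- llevel t'])
  else [:: lunit].

Definition lact (x : seq nat) : seq Z := foldr (fun i l => lfire l i) lunit x.

Fixpoint lchain (x : seq nat) : bool :=
  if x is i :: y then
    [&& lchain y, (0 <? (lact y)`@i)%Z,
        all (fun k => (k == i) || (0 <=? (lact x)`@k)%Z) nodes &
        if y is j :: y' then (An i j =? 0)%Z || ((lact y')`@i <=? 0)%Z else true]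
  else true.

Definition lsum (a l : seq Z) : Z :=
  foldr (fun k z => (a`@k * l`@k + z)%Z) 0%Z nodes.

Definition row (i : nat) : seq Z := [seq An i k | k <- nodes].

Lemma lsum_fire a l i : (i < n.+1)%N -> lsum a (lfire l i) = (lsum a l + lsum a (row i) * l`@i)%Z.
Proof.
move=> iN; rewrite /lsum.
have H x : all inI x -> foldr (fun k z => (a`@k * (lfire l i)`@k + z)%Z) 0%Z x =
    (foldr (fun k z => (a`@k * l`@k + z)%Z) 0%Z x +
     foldr (fun k z => (a`@k * (row i)`@k + z)%Z) 0%Z x * l`@i)%Z.
  elim: x => // k x IH /andP[kn /IH E]; rewrite /= E.
  have -> : (lfire l i)`@k = (l`@k + An i k * l`@i)%Z by rewrite /lfire nth_nodes.
  have -> : (row i)`@k = An i k by rewrite /row nth_nodes.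
  by ring.
by apply: H; apply/allP => k; rewrite mem_iota.
Qed.

Variables (M : I -> I -> nat) (G : groupType) (s : I -> G).
Hypothesis cox : coxeter_system M s.
Hypothesis M1 : forall i, M i i = 1%N.
Hypothesis Abond : forall i j, i != j -> bond (M i j) (A i j) (A j i).
Notation wp := (wprod s).
Notation len := (len s).
Notation z0 := (node0 n : I).
Notation S := [pred i : I | i != z0].
Notation stt := (st cox z0 A).

(** Firing [i] changes the form [a] by a multiple of its value on row [i]. With [m = 0] this gives
    the level of an affine weight, with [m > 1] its class modulo the root lattice. *)
Lemma lsum_state m a g : all (fun i => (lsum a (row i) =? m * (lsum a (row i) / m))%Z) nodes ->
  exists t, lsum a (state_list (stt g)) = (lsum a lunit + m * t)%Z.
Proof.
move=> am; apply: (word_invariantT cox M1 Aii Abond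
  (Q := fun c => exists t, lsum a (state_list c) = (lsum a lunit + m * t)%Z)).
  by exists 0%Z; rewrite state_list_e0; lia.
move=> c i [t E]; rewrite -(inord_val i) state_list_fire // lsum_fire // E.
have /allP/(_ (val i)) := am; rewrite mem_iota /= => /(_ (ltn_ord i))/Z.eqb_eq ->.
by exists (t + lsum a (row i) / m * (state_list c)`@i)%Z; ring.
Qed.

Lemma proper_closed_parabolic j q w : (j < n.+1)%N -> proper_closed j q -> minrep s S w ->
  state_list (stt w) \in q -> parabolic s [pred i | i != inord j] w.
Proof.
move=> jn /andP[_ qc] mw wq.
apply: (invariant_parabolic M1 Aii Abond (Q := fun c => state_list c \in q) _ mw wq).
move=> c i /(allP qc)/andP[/Z.leb_le cj /allP/(_ (val i))].
rewrite mem_iota /= => /(_ (ltn_ord i)) H ci.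
have ij : val i != j by apply/eqP => ij; move: cj; rewrite -ij state_listE; lia.
split; first by rewrite -val_eqE /= inordK.
move: H; rewrite (negbTE ij) /= => /and3P[_ _].
by rewrite -state_list_fire // inord_val.
Qed.

Lemma proper_closed_minuscule (Q : nat -> seq (seq Z)) :
  all (fun j => proper_closed j (Q j)) nodes -> minuscule cox z0 A.
Proof.
move=> /allP HQ j v mv pv i ij.
have /andP[Q0 Qc] : proper_closed j (Q j) by apply: HQ; rewrite mem_iota /= ltn_ord.
have step c k : state_list c \in Q j -> k != j ->
    [/\ (-1 <= c k)%Z, (c k <= 1)%Z & state_list (fire A c k) \in Q j].
  move=> /(allP Qc)/andP[_ /allP/(_ (val k))]; rewrite mem_iota /= => /(_ (ltn_ord k)) + kj.
  have -> /= : (val k == val j) = false by rewrite val_eqE; apply/negbTE.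
  rewrite state_listE => /and3P[/Z.leb_le H1 /Z.leb_le H2 H3]; split => //.
  by rewrite -(inord_val k) state_list_fire.
have : state_list (stt v) \in Q j; last by move=> /step/(_ ij)[].
apply: (word_invariant cox M1 Aii Abond (Q := fun c => state_list c \in Q j) _ _ pv).
  by rewrite state_list_e0.
by move=> c k kj /step/(_ kj)[].
Qed.

Lemma level_state t v : minrep s S v -> len v = t -> state_list (stt v) \in llevel t.
Proof.
elim: t v => [|t IH] v mv lv.
  by rewrite (len0 cox lv) (st1 cox M1 z0 Aii Abond) state_list_e0 inE.
have [i [v' [mv' lv' pos ->]]] := minrep_level cox M1 Aii Abond mv lv.
rewrite (st_gen cox M1 z0 Aii Abond) -(inord_val i) state_list_fire // mem_undup.
apply/flattenP; exists [seq lfire (state_list (stt v')) i | i <- [seq i <- nodes | (0 <? (state_list (stt v'))`@i)%Z]].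
  by apply/mapP; exists (state_list (stt v')) => //; apply: IH.
apply/mapP; exists (val i) => //; rewrite mem_filter mem_iota ltn_ord /= andbT state_listE.
exact/Z.ltb_lt.
Qed.

Lemma level_inj t v v' : (size (llevel t) <= 1)%N -> minrep s S v -> minrep s S v' ->
  len v = t -> len v' = t -> v = v'.
Proof.
move=> sz mv mv' lv lv'; apply: (st_inj (cox := cox) M1 Aii Abond mv mv').
apply: state_list_inj; have := level_state mv lv; have := level_state mv' lv'.
by case: (llevel t) sz => [|x []] // _; rewrite !inE => /eqP -> /eqP ->.
Qed.

Lemma palindromic_lfacts R K w :
  all (fun i => all (fun r => all inI r.1 && inI r.2) (R i)) nodes ->
  all (fun t => (size (llevel t) <= 1)%N) (iota 1 K) ->
  minrep s S w -> palindromic s w -> lfacts R K (state_list (stt w)).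
Proof.
move=> Rok /allP lev mw pal; apply: topuniq_lfacts => //.
apply: (palindromic_topuniq cox M1 Aii Abond pal mw) => t v v' tK.
by apply: level_inj; apply: lev; rewrite mem_iota; lia.
Qed.

Lemma state_list_word x : all inI x ->
  state_list (stt (wp [seq inord i | i <- x])) = lact x.
Proof.
elim: x => [_|i x IH /andP[iN /IH E]].
  by rewrite wprod_nil (st1 cox M1 z0 Aii Abond) state_list_e0.
by rewrite /= wprod_cons (st_gen cox M1 z0 Aii Abond) state_list_fire // E.
Qed.

Lemma lchain_domain x w : all inI x -> lchain x -> (count_mem 0%N (behead x) <= 1)%N ->
  minrep s S w -> state_list (stt w) = lact x -> leaf_domain cox A w.
Proof.
move=> xI xc ct mw E; right; exists [seq inord i | i <- x].
have ch : chain_word cox A [seq inord i | i <- x].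
  elim: x xI xc {ct E} => // i x IH /andP[iN xI] /and4P[cx /Z.ltb_lt pos /allP un nb].
  have stx := state_list_word xI.
  have xI' : all inI (i :: x) by rewrite /= iN.
  have stix := state_list_word xI'.
  split; first exact: IH.
  - by rewrite -nth_state_list // stx.
  - move=> k neg; apply/eqP; have := un (val k); rewrite mem_iota ltn_ord => /(_ isT).
    rewrite -stix state_listE -val_eqE /= inordK //.
    case/orP => // /Z.leb_le ge.
    by case: (Zle_not_lt _ _ ge).
  - case: x xI nb {IH cx pos un stx stix xI'} => // j x /andP[jN xI] /orP[/Z.eqb_eq a0|/Z.leb_le nb] a1.
      by case: a1; rewrite /A !inordK.
    by rewrite -nth_state_list // state_list_word.
have [mx sx] := chain_minrep M1 Aii Abond ch; split => //.
- rewrite behead_map count_map; apply: leq_trans ct; rewrite leq_eqVlt; apply/orP; left.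
  apply/eqP; apply: eq_in_count => k kx /=; rewrite -val_eqE /= inordK //.
  by apply: (allP xI); apply: mem_behead.
- apply: (st_inj (cox := cox) M1 Aii Abond mx mw); apply: state_list_inj.
  by rewrite state_list_word.
Qed.

End ListStates.

(** * The exceptional types *)

Definition bond_matrix (L : seq (nat * nat * Z)) (i j : nat) : Z :=
  if i == j then (-2)%Z else head 0%Z [seq e.2 | e <- L & e.1 == (i, j)].

Definition bondb (m : nat) (a b : Z) : bool :=
  match m with
  | 2 => (a =? 0)%Z && (b =? 0)%Z
  | 3 => (a =? 1)%Z && (b =? 1)%Z
  | 4 => (a =? 1)%Z && (b =? 2)%Z || (a =? 2)%Z && (b =? 1)%Z
  | 6 => (a =? 1)%Z && (b =? 3)%Z || (a =? 3)%Z && (b =? 1)%Z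
  | 0 => (a =? 2)%Z && (b =? 2)%Z
  | _ => false
  end.

Lemma bondbP m a b : bondb m a b -> bond m a b.
Proof. by case: m => [|[|[|[|[|[|[|m]]]]]]] //=; lia. Qed.

Definition coxeter_label (T : dynkin) (i j : nat) : nat :=
  if i == j then 1%N else
  head 2%N [seq e.2 | e <- affine_bonds T & (e.1 == (i, j)) || (e.1 == (j, i))].

Lemma affine_coxeterE T (i j : 'I_(rank T).+1) : affine_coxeter i j = coxeter_label T i j.
Proof. by rewrite /affine_coxeter /coxeter_label val_eqE. Qed.

Lemma affine_coxeter1 T (i : 'I_(rank T).+1) : affine_coxeter i i = 1%N.
Proof. by rewrite /affine_coxeter eqxx. Qed.

Definition bonds_ok (T : dynkin) (An : nat -> nat -> Z) : bool :=
  all (fun i => (An i i =? -2)%Z && all (fun j => (i == j) ||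
    bondb (coxeter_label T i j) (An i j) (An j i)) (iota 0 (rank T).+1)) (iota 0 (rank T).+1).

Section Exceptional.
Variables (T : dynkin) (L : seq (nat * nat * Z)) (N K : nat).
Notation n := (rank T).
Notation An := (bond_matrix L).
Let A (i j : 'I_n.+1) : Z := An i j.
Variables (R1 R2 : nat -> seq (seq nat * nat)) (a b : seq Z) (m : Z) (X : seq (seq nat)).
Notation nodes := (iota 0 n.+1).
Definition rules_ok (R : nat -> seq (seq nat * nat)) : bool :=
  all (fun i => all (fun r => all (fun k => k < n.+1)%N r.1 && (r.2 < n.+1)%N) (R i)) nodes.
Hypothesis n0 : (0 < n)%N.
Hypothesis okb : bonds_ok T An.
Hypothesis ok1 : rules_ok R1.
Hypothesis ok2 : rules_ok R2.
Hypothesis okl : all (fun t => (size (llevel n An t) <= 1)%N) (iota 1 K).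
Hypothesis okc : all (fun j => proper_closed n An j (closure n An N j)) nodes.
Hypothesis oka : all (fun i => (lsum n a (row n An i) =? 0)%Z) nodes.
Hypothesis okm : all (fun i => (lsum n b (row n An i) =? m * (lsum n b (row n An i) / m))%Z) nodes.
Hypothesis okX : all (fun x => [&& all (fun k => k < n.+1)%N x, lchain n An x &
  count_mem 0%N (behead x) <= 1]%N) X.
(** The only hypothesis on the tables that is not decided by computation; it comes from the symbolic
    search. [R1] holds the rules followed by the search, [R2] those that afterwards refute the
    one-parameter families. *)
Hypothesis cls : forall l t, size l = n.+1 -> lsum n a l = lsum n a (lunit n) ->
  lsum n b l = (lsum n b (lunit n) + m * t)%Z -> lfacts n An R1 K l -> lfacts n An R2 K l ->
  (forall k, (k < n.+1)%N -> (0 <= nth 0 l k)%Z) \/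
  has (fun j => l \in closure n An N j) nodes || (l \in [seq lact n An x | x <- X]).

Variables (G : groupType) (s : 'I_n.+1 -> G).
Hypothesis cox : coxeter_system (@affine_coxeter T) s.

Lemma exceptional_Aii i : A i i = (-2)%Z.
Proof.
have /allP/(_ (val i)) := okb; rewrite mem_iota /= => /(_ (ltn_ord i)) /andP[/Z.eqb_eq].
by [].
Qed.

Lemma exceptional_bond i j : i != j -> bond (affine_coxeter i j) (A i j) (A j i).
Proof.
move=> ij; have /allP/(_ (val i)) := okb; rewrite mem_iota leq0n add0n => /(_ (ltn_ord i)) /andP[_].
move=> /allP/(_ (val j)); rewrite mem_iota /= => /(_ (ltn_ord j)).
have -> /= : (val i == val j) = false by rewrite val_eqE; apply/negbTE.
by rewrite affine_coxeterE => /bondbP.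
Qed.

Lemma exceptional_domain w : minrep s (setS n) w -> palindromic s w ->
  leaf_domain cox A w.
Proof.
have Aii := exceptional_Aii; have Ab := exceptional_bond.
have M1 := @affine_coxeter1 T.
have ge0 i j : i != j -> (0 <= A i j)%Z by apply: (bond_ge0 (M := @affine_coxeter T)).
move=> mw pal; set l := state_list (st cox (node0 n) A w).
have F1 := palindromic_lfacts Aii ge0 cox M1 Ab ok1 okl mw pal.
have F2 := palindromic_lfacts Aii ge0 cox M1 Ab ok2 okl mw pal.
have [t tE] := @lsum_state n An Aii _ G s cox M1 Ab m b w okm.
have [t' tE'] : exists t, lsum n a l = (lsum n a (lunit n) + 0 * t)%Z.
  apply: (lsum_state Aii cox M1 Ab); apply: sub_all oka => i /Z.eqb_eq ->.
  by [].
have szl : size l = n.+1 by rewrite /l /state_list size_map size_iota.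
have [dom|/orP[/hasP[j jn lj]|/mapP[x xX lx]]] := cls szl (etrans tE' (Z.add_0_r _)) tE F1 F2.
- left; have -> : w = 1.
    apply: (dominant_one M1 Aii Ab mw) => i; have := dom i (ltn_ord i).
    by rewrite /l state_listE.
  by split; [exact: (minrep1 cox)|exists (node0 n); apply: parabolic1].
- left; split => //; exists (inord j); move: jn; rewrite mem_iota /= => jn.
  apply: (proper_closed_parabolic Aii M1 Ab jn _ mw lj).
  by apply: (allP okc); rewrite mem_iota.
- have /(allP okX)/and3P[xI xc ct] := xX.
  exact: (lchain_domain Aii M1 Ab xI xc ct mw lx).
Qed.

Lemma exceptional_main sigma w lam : leaf_segments s sigma ->
  minrep s (setS n) w -> leaf_pi s sigma w lam ->
  palindromic s w <->
    (poset_isomorphic (bruhat_interval s w) (bruhat s)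
       (young_interval s sigma sigma lam) (young s sigma sigma)
     /\ rank_symmetric (young_interval s sigma sigma lam) (psize lam)).
Proof.
move=> sg mw pw; apply: (leaf_main (@affine_coxeter1 T) exceptional_Aii exceptional_bond) => //.
  exact: (proper_closed_minuscule exceptional_Aii cox (@affine_coxeter1 T) exceptional_bond okc).
exact: exceptional_domain.
Qed.

End Exceptional.

(* States depending linearly on a parameter m >= 2: the pair (p, q) stands for
   p * m + q. *)
Section LinearFamilies.
Variables (n : nat) (An : nat -> nat -> Z) (R : nat -> seq (seq nat * nat)).
Notation nodes := (iota 0 n.+1).

Definition at_value (m : Z) (f : seq (Z * Z)) : seq Z := [seq (p.1 * m + p.2)%Z | p <- f].

Definition pfire (f : seq (Z * Z)) (i : nat) : seq (Z * Z) :=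
  [seq ((nth (0, 0) f k).1 + An i k * (nth (0, 0) f i).1,
        (nth (0, 0) f k).2 + An i k * (nth (0, 0) f i).2)%Z | k <- nodes].

(** The value at [m = 2] decides: with a nonpositive slope it bounds all values for larger [m]. *)
Definition pneg (p : Z * Z) : bool := (p.1 <=? 0)%Z && (2 * p.1 + p.2 <? 0)%Z.
Definition ppos (p : Z * Z) : bool := (0 <=? p.1)%Z && (0 <? 2 * p.1 + p.2)%Z.

Fixpoint pcert (p : seq nat) (k : nat) (f : seq (Z * Z)) : seq (Z * Z) :=
  if p is i :: p' then pfire (pcert p' k (pfire f i)) i else pfire f k.

Fixpoint pcertok (p : seq nat) (k : nat) (f : seq (Z * Z)) : bool :=
  if p is i :: p' then
    [&& pneg (nth (0, 0)%Z f i), pcertok p' k (pfire f i) &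
        ppos (nth (0, 0)%Z (pcert p' k (pfire f i)) i)]
  else pneg (nth (0, 0)%Z f k).

Fixpoint prefute (ds : seq nat) (f : seq (Z * Z)) : bool :=
  if ds is i :: ds' then
    [&& (i < n.+1)%N, pneg (nth (0, 0)%Z f i) &
        has (fun r => pcertok (i :: r.1) r.2 f) (R i) || prefute ds' (pfire f i)]
  else false.

Variable m : Z.
Hypothesis m2 : (2 <= m)%Z.

Lemma nth_at_value f k :
  nth 0%Z (at_value m f) k = ((nth (0, 0) f k).1 * m + (nth (0, 0) f k).2)%Z.
Proof.
rewrite /at_value; have [lt|ge] := ltnP k (size f); first by rewrite (nth_map (0, 0)%Z).
by rewrite !nth_default ?size_map.
Qed.

Lemma at_value_fire f i : at_value m (pfire f i) = lfire n An (at_value m f) i.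
Proof.
rewrite /at_value /pfire -map_comp; apply: eq_map => k /=.
by rewrite -!/(at_value m f) !nth_at_value; ring.
Qed.

Lemma at_value_cert p k f : at_value m (pcert p k f) = lcert n An p k (at_value m f).
Proof. elim: p f => [|i p IH] f; first exact: at_value_fire.
by rewrite [LHS]at_value_fire IH at_value_fire. Qed.

Lemma pnegP f k : pneg (nth (0, 0)%Z f k) -> (nth 0%Z (at_value m f) k < 0)%Z.
Proof. by rewrite nth_at_value => /andP[/Z.leb_le a /Z.ltb_lt b]; nia. Qed.

Lemma pposP f k : ppos (nth (0, 0)%Z f k) -> (0 < nth 0%Z (at_value m f) k)%Z.
Proof. by rewrite nth_at_value => /andP[/Z.leb_le a /Z.ltb_lt b]; nia. Qed.

Lemma pcertokP p k f : pcertok p k f -> ~ lnocert n An p k (at_value m f).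
Proof.
elim: p f => [|i p IH] f /=; first by move/pnegP; lia.
move=> /and3P[/pnegP a /IH b /pposP c].
by rewrite -at_value_fire -at_value_cert => -[|[//|]]; lia.
Qed.

Lemma prefuteP ds f : prefute ds f -> ~ lfacts n An R (size ds) (at_value m f).
Proof.
elim: ds f => // i ds IH f /and3P[iN ng Hr] H.
have [_ Rr F] := lfacts_step H iN (pnegP ng).
case/orP: Hr => [|/IH]; last by rewrite at_value_fire; apply.
elim: (R i) Rr => //= r x IHx [Rr Rx] /orP[|]; last exact: IHx.
move=> /and3P[_ /pcertokP b /pposP]; rewrite at_value_cert at_value_fire => c.
by case: Rr; [rewrite -at_value_fire|lia].
Qed.

End LinearFamilies.

Ltac zlia := xlia zchecker.

Ltac lstep H i F :=
  let U := fresh "U" in let Rr := fresh "Rr" in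
  let P := fresh "P" in
  match type of H with lfacts _ _ _ _ ?l =>
    assert (P : (nth 0%Z l i < 0)%Z) by (lazy -[Z.add Z.mul Z.le Z.lt]; zlia) end;
  destruct (lfacts_step H (i := i) isT P) as [U Rr F]; clear P;
  lazy -[Z.add Z.mul Z.le Z.lt] in U;
  lazy -[Z.add Z.mul Z.le Z.lt] in Rr;
  match type of F with lfacts ?n ?a ?r ?k ?l =>
    let l' := eval lazy -[Z.add Z.mul] in l in change (lfacts n a r k l') in F
  end.

Ltac lsplit := repeat match goal with
  | H : _ /\ _ |- _ => destruct H
  | H : True |- _ => clear H
  | H : _ \/ _ |- _ =>
      first [ destruct H as [H|H]; [exfalso; zlia|]
            | destruct H as [H|H]; [|exfalso; zlia]
            | destruct H as [H|H] ]
  end.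

(* Follows the unique descents of a symbolic state, as long as the level
   conditions and linear arithmetic leave a possibility. *)
Ltac lsearch H fin :=
  let rec over i l := lazymatch l with
    | nil => fin
    | ?e :: ?l' =>
        let go := (let F := fresh "F" in lstep H i F; lsplit; lsearch F fin) in
        let N := fresh "N" in
        tryif (assert (N : (0 <= e)%Z) by zlia) then (clear N; over (S i) l')
        else tryif (assert (N : (e < 0)%Z) by zlia) then (clear N; go)
        else (destruct (Z_lt_le_dec e 0) as [N|N]; [go | over (S i) l'])
    end in
  lazymatch type of H with
  | lfacts _ _ _ O _ => fin
  | lfacts _ _ _ _ ?l => over O l
  end.

Ltac lpick cand := lazymatch cand with
  | ?c :: ?cs => first
      [ exists c; [reflexivity | repeat (apply f_equal2; [zlia|]); reflexivity] | lpick cs ]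
  end.

Ltac lfinish cand :=
  let c := eval lazy in cand in
  first [ exfalso; zlia | left; zlia | right; lpick c ].

Ltac lfamily l fams := lazymatch fams with
  | (?i, ?f) :: ?fs => first
      [ let xi := eval lazy in (nth 0%Z l i) in
        exists f, (- xi)%Z; split; [reflexivity | zlia | lazy -[Z.add Z.mul Z.opp];
          repeat (apply f_equal2; [zlia|]); reflexivity]
      | lfamily l fs ]
  end.

(** The families only cover [m >= 2]; splitting the negative entry at -1 separates them from the
    sporadic candidates. *)
Ltac lfinish_fam l cand fams :=
  let c := eval lazy in cand in let fs := eval lazy in fams in
  let basic := first [ exfalso; zlia | left; zlia | right; left; lpick c
                     | right; right; lfamily l fs ] in
  let rec split fs := lazymatch fs with
    | (?i, _) :: ?fs' => first
        [ let xi := eval lazy in (nth 0%Z l i) in destruct (Z_lt_le_dec xi (-1)); basic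
        | split fs' ]
    end in
  first [ basic | split fs ].

(** * Search tables for the exceptional types *)

Definition edge (i j : nat) (a b : Z) : seq (nat * nat * Z) := [:: (i, j, a); (j, i, b)].

(** The orientation of the double bond matters: with [A 2 3 = 2] instead of 1, firing 0, 1, 2 would
    already produce an entry 2 at node 3, and [minuscule] would fail. *)
Definition F4_bonds := edge 0 1 1 1 ++ edge 1 2 1 1 ++ edge 2 3 1 2 ++ edge 3 4 1 1.
(** The shortest certificates suffice here: below the descent [i], skip a neighbour of [i] and climb
    back by [i]. *)
Definition F4_rules (i : nat) : seq (seq nat * nat) :=
  nth [::] [:: [:: ([::], 1)]; [:: ([::], 0); ([::], 2)]; [:: ([::], 1); ([::], 3)];
     [:: ([::], 2); ([::], 4)]; [:: ([::], 3)]]%N i.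
Definition F4_cand : seq (seq Z) := [:: [:: -1; 0; 0; 0; 1]; [:: -1; 1; 0; 0; 0];
  [:: 0; -1; 1; 0; 0]; [:: 1; -1; 0; 0; 1]; [:: 0; 0; -1; 1; 0]; [:: 0; 1; -1; 0; 1];
  [:: 0; 0; 1; -1; 1]; [:: 0; 0; 1; 0; -1]]%Z.

(** The linear form vanishes on all rows of the matrix and is 1 at the starting state. The depth 4
    is available because the quotient has a single element in each of the lengths 1 to 4; the depths
    for the other types have the same origin. *)
Lemma F4_search x0 x1 x2 x3 x4 : (x0 + 2 * x1 + 3 * x2 + 4 * x3 + 2 * x4 = 1)%Z ->
  lfacts 4 (bond_matrix F4_bonds) F4_rules 4 [:: x0; x1; x2; x3; x4] ->
  (0 <= x0 /\ 0 <= x1 /\ 0 <= x2 /\ 0 <= x3 /\ 0 <= x4)%Z \/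
  exists2 c, c \in F4_cand & [:: x0; x1; x2; x3; x4] = c.
Proof. by move=> E H; lsearch H ltac:(lfinish F4_cand). Qed.

Definition G2_bonds := edge 0 1 1 1 ++ edge 1 2 1 3.
Definition G2_rules (i : nat) : seq (seq nat * nat) :=
  nth [::] [:: [:: ([::], 1)]; [:: ([::], 0); ([::], 2)]; [:: ([::], 1)]]%N i.
Definition G2_cand : seq (seq Z) := [:: [:: -1; 1; 0]; [:: -2; 0; 1]; [:: 0; -1; 1];
  [:: 3; -1; 0]; [:: 2; -2; 1]; [:: 0; 2; -1]; [:: 2; 1; -1]]%Z.

Lemma G2_search x0 x1 x2 : (x0 + 2 * x1 + 3 * x2 = 1)%Z ->
  lfacts 2 (bond_matrix G2_bonds) G2_rules 4 [:: x0; x1; x2] ->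
  (0 <= x0 /\ 0 <= x1 /\ 0 <= x2)%Z \/
  exists2 c, c \in G2_cand & [:: x0; x1; x2] = c.
Proof. by move=> E H; lsearch H ltac:(lfinish G2_cand). Qed.

Definition E8_bonds := edge 0 1 1 1 ++ edge 1 2 1 1 ++ edge 2 3 1 1 ++ edge 3 4 1 1 ++
  edge 4 5 1 1 ++ edge 5 6 1 1 ++ edge 6 7 1 1 ++ edge 5 8 1 1.

(* The certificates with down-paths of length 1 along the diagram, and those of
   length 2 starting at the trivalent node z. *)
Definition path_rules (L : seq (nat * nat * Z)) (z i : nat) : seq (seq nat * nat) :=
  let nb i := [seq e.1.2 | e <- L & e.1.1 == i] in
  [seq ([::], j) | j <- nb i] ++
  if i == z then flatten [seq [seq ([:: j], k) | k <- nb j & k != i] | j <- nb i]%N else [::].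

Definition E8_cand : seq (seq Z) := [:: [:: -1; 0; 0; 0; 0; 0; 0; 1; 0];
  [:: -1; 1; 0; 0; 0; 0; 0; 0; 0]; [:: 0; -1; 1; 0; 0; 0; 0; 0; 0];
  [:: 0; 0; -1; 1; 0; 0; 0; 0; 0]; [:: 0; 0; 0; -1; 1; 0; 0; 0; 0];
  [:: 0; 0; 0; 0; -1; 1; 0; 0; 0]; [:: 0; 0; 0; 0; 0; -1; 1; 0; 1];
  [:: 0; 0; 0; 0; 0; 0; -1; 1; 1]; [:: 0; 0; 0; 0; 0; 0; 0; -1; 1];
  [:: 0; 0; 0; 0; 0; 0; 1; 0; -1]]%Z.

Lemma E8_search x0 x1 x2 x3 x4 x5 x6 x7 x8 :
  (x0 + 2 * x1 + 3 * x2 + 4 * x3 + 5 * x4 + 6 * x5 + 4 * x6 + 2 * x7 + 3 * x8 = 1)%Z ->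
  lfacts 8 (bond_matrix E8_bonds) (path_rules E8_bonds 5) 6 [:: x0; x1; x2; x3; x4; x5; x6; x7; x8] ->
  (0 <= x0 /\ 0 <= x1 /\ 0 <= x2 /\ 0 <= x3 /\ 0 <= x4 /\ 0 <= x5 /\ 0 <= x6 /\ 0 <= x7 /\ 0 <= x8)%Z \/
  exists2 c, c \in E8_cand & [:: x0; x1; x2; x3; x4; x5; x6; x7; x8] = c.
Proof. by move=> E H; lsearch H ltac:(lfinish E8_cand). Qed.

Definition E6_bonds := edge 0 1 1 1 ++ edge 1 2 1 1 ++ edge 2 3 1 1 ++ edge 3 4 1 1 ++
  edge 2 5 1 1 ++ edge 5 6 1 1.
Definition E6_cand : seq (seq Z) := [:: [:: -1; 0; 0; 0; 1; 0; 1]; [:: -1; 1; 0; 0; 0;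
  0; 0]; [:: 0; -1; 1; 0; 0; 0; 0]; [:: 0; 0; -1; 1; 0; 1; 0]; [:: 0; 0; 0; -1; 1; 1;
  0]; [:: 0; 0; 0; 0; -1; 0; 2]; [:: 0; 0; 0; 0; -1; 1; 0]; [:: 0; 0; 0; 1; 0; -1; 1];
  [:: 0; 0; 0; 0; 2; 0; -1]; [:: 0; 0; 0; 1; 0; 0; -1]]%Z.
(** The end nodes 0, 4, 6 have coefficient 1 in the level. Entries [-m] and [m + 1] at two ends
    therefore pass the linear tests for infinitely many [m]. *)
Definition E6_families : seq (nat * seq (Z * Z)) := [:: (0%N, [:: (-1, 0); (0, 0); (0,
  0); (0, 0); (1, 1); (0, 0); (0, 0)]%Z); (0%N, [:: (-1, 0); (0, 0); (0, 0); (0, 0); (0,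
  0); (0, 0); (1, 1)]%Z); (4%N, [:: (1, 1); (0, 0); (0, 0); (0, 0); (-1, 0); (0, 0); (0,
  0)]%Z); (4%N, [:: (0, 0); (0, 0); (0, 0); (0, 0); (-1, 0); (0, 0); (1, 1)]%Z); (6%N,
  [:: (1, 1); (0, 0); (0, 0); (0, 0); (0, 0); (0, 0); (-1, 0)]%Z); (6%N, [:: (0, 0); (0,
  0); (0, 0); (0, 0); (1, 1); (0, 0); (-1, 0)]%Z)].
(** One certificate for each ordered pair of ends. After the descent from the end with [-m] to the
    branch node 2, the path lowers the entry [m + 1] at the other end to [1 - m], which is negative
    for [m >= 2] and can be skipped. *)
Definition E6_rules (i : nat) : seq (seq nat * nat) := if i == 2 then [:: ([:: 5; 6; 3;
  2; 1; 5; 2; 3], 4); ([:: 3; 4; 5; 2; 1; 3; 2; 5], 6); ([:: 5; 6; 1; 2; 3; 5; 2; 1],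
  0); ([:: 1; 0; 5; 2; 3; 1; 2; 5], 6); ([:: 3; 4; 1; 2; 5; 3; 2; 1], 0); ([:: 1; 0; 3;
  2; 5; 1; 2; 3], 4)]%N else [::].

Lemma E6_search x0 x1 x2 x3 x4 x5 x6 t : (x0 + 2 * x1 + 3 * x2 + 2 * x3 + x4 + 2 * x5 + x6 = 1)%Z ->
  (x3 + 2 * x4 + 2 * x5 + x6 = 3 * t)%Z ->
  lfacts 6 (bond_matrix E6_bonds) (path_rules E6_bonds 2) 3 [:: x0; x1; x2; x3; x4; x5; x6] ->
  (0 <= x0 /\ 0 <= x1 /\ 0 <= x2 /\ 0 <= x3 /\ 0 <= x4 /\ 0 <= x5 /\ 0 <= x6)%Z \/
  (exists2 c, c \in E6_cand & [:: x0; x1; x2; x3; x4; x5; x6] = c) \/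
  exists f m, [/\ f \in unzip2 E6_families, (2 <= m)%Z & [:: x0; x1; x2; x3; x4; x5; x6] = at_value m f].
Proof. by move=> E1 E2 H; lsearch H ltac:(lfinish_fam [:: x0; x1; x2; x3; x4; x5; x6] E6_cand E6_families). Qed.

Definition E7_bonds := edge 0 1 1 1 ++ edge 1 2 1 1 ++ edge 2 3 1 1 ++ edge 3 4 1 1 ++
  edge 4 5 1 1 ++ edge 5 6 1 1 ++ edge 3 7 1 1.
Definition E7_cand : seq (seq Z) := [:: [:: -1; 0; 0; 0; 0; 0; 2; 0]; [:: -1; 0; 0; 0;
  0; 1; 0; 0]; [:: -1; 1; 0; 0; 0; 0; 0; 0]; [:: 0; -1; 1; 0; 0; 0; 0; 0]; [:: 0; 0; -1;
  1; 0; 0; 0; 0]; [:: 0; 0; 0; -1; 1; 0; 0; 1]; [:: 0; 0; 0; 0; -1; 1; 0; 1]; [:: 0; 0;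
  0; 0; 0; -1; 1; 1]; [:: 0; 0; 0; 0; 0; 0; -1; 1]; [:: 0; 0; 0; 0; 1; 0; 0; -1]]%Z.
Definition E7_families : seq (nat * seq (Z * Z)) := [:: (0%N, [:: (-1, 0); (0, 0); (0,
  0); (0, 0); (0, 0); (0, 0); (1, 1); (0, 0)]%Z); (6%N, [:: (1, 1); (0, 0); (0, 0); (0,
  0); (0, 0); (0, 0); (-1, 0); (0, 0)]%Z)].
(** As in type E6, with the two ends 0 and 6: the path from the branch node 3 lowers [m + 1] to
    [1 - m]. *)
Definition E7_rules (i : nat) : seq (seq nat * nat) := if i == 3 then [:: ([:: 4; 5; 7;
  3; 2; 1; 4; 3; 2; 7; 3; 4; 5], 6); ([:: 2; 1; 7; 3; 2; 4; 3; 5; 4; 7; 3; 2; 1], 0)]%N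
  else [::].

Lemma E7_search x0 x1 x2 x3 x4 x5 x6 x7 t : (x0 + 2 * x1 + 3 * x2 + 4 * x3 + 3 * x4 + 2 * x5 + x6 + 2 * x7 = 1)%Z ->
  (x4 + x6 + x7 = 2 * t)%Z ->
  lfacts 7 (bond_matrix E7_bonds) (path_rules E7_bonds 3) 4 [:: x0; x1; x2; x3; x4; x5; x6; x7] ->
  (0 <= x0 /\ 0 <= x1 /\ 0 <= x2 /\ 0 <= x3 /\ 0 <= x4 /\ 0 <= x5 /\ 0 <= x6 /\ 0 <= x7)%Z \/
  (exists2 c, c \in E7_cand & [:: x0; x1; x2; x3; x4; x5; x6; x7] = c) \/
  exists f m, [/\ f \in unzip2 E7_families, (2 <= m)%Z & [:: x0; x1; x2; x3; x4; x5; x6; x7] = at_value m f].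
Proof. by move=> E1 E2 H; lsearch H ltac:(lfinish_fam [:: x0; x1; x2; x3; x4; x5; x6; x7] E7_cand E7_families). Qed.

Lemma families_refuted n An R K (D : seq (seq nat)) (fs : seq (seq (Z * Z))) f m :
  all (fun d => size d == K) D ->
  all (fun f => has (fun d => prefute n An R d f) D) fs -> f \in fs -> (2 <= m)%Z ->
  ~ lfacts n An R K (at_value m f).
Proof.
move=> /allP sD /allP H /H /hasP[d dD rf] m2.
by rewrite -(eqP (sD d dD)); apply: prefuteP.
Qed.

Section Instances.
Variables (G : groupType) (sigma : nat -> seq G) (w : G) (lam : seq part).

Let statement T (s : 'I_(rank T).+1 -> G) := coxeter_system (@affine_coxeter T) s ->
  leaf_segments s sigma -> minrep s (setS (rank T)) w -> leaf_pi s sigma w lam ->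
  palindromic s w <->
    (poset_isomorphic (bruhat_interval s w) (bruhat s)
       (young_interval s sigma sigma lam) (young s sigma sigma)
     /\ rank_symmetric (young_interval s sigma sigma lam) (psize lam)).

Lemma F4_main (s : 'I_(rank DF4).+1 -> G) : statement s.
Proof.
move=> cox sg mw pw.
apply: (@exceptional_main DF4 F4_bonds 30 4 F4_rules (fun=> [::])
  [:: 1; 2; 3; 4; 2]%Z [::]%Z 1
  (* The only candidate of full support. The other candidates form, with the starting state, its
     orbit under the generators other than 4. *)
  [:: [:: 4; 3; 2; 1; 0]%N] _ _ _ _ _ _ _ _ _ _ G s cox sigma w lam
  sg mw pw); last first.
move=> l t sl la lb F1 F2; case: l sl la lb F1 F2 => [|x0 [|x1 [|x2 [|x3 [|x4 [|]]]]]] // _ la lb F1 F2.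
have [|dom|[c cE ->]] := F4_search _ F1.
- by move: la; lazy -[Z.add Z.mul]; lia.
- by left; case=> [|[|[|[|[|k]]]]] //= _; lia.
- by right; move: c cE; apply/allP; vm_compute.
all: by vm_compute.
Qed.

Lemma G2_main (s : 'I_(rank DG2).+1 -> G) : statement s.
Proof.
move=> cox sg mw pw.
apply: (@exceptional_main DG2 G2_bonds 30 4 G2_rules (fun=> [::])
  [:: 1; 2; 3]%Z [::]%Z 1
  (* Each of the seven candidates is the state of one of these seven words. *)
  [:: [:: 0]; [:: 1; 0]; [:: 2; 1; 0]; [:: 1; 2; 1; 0]; [:: 2; 1; 2; 1; 0];
     [:: 0; 1; 2; 1; 0]; [:: 1; 2; 1; 2; 1; 0]]%N _ _ _ _ _ _ _ _ _ _ G s cox sigma w lam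
  sg mw pw); last first.
move=> l t sl la lb F1 F2; case: l sl la lb F1 F2 => [|x0 [|x1 [|x2 [|]]]] // _ la lb F1 F2.
have [|dom|[c cE ->]] := G2_search _ F1.
- by move: la; lazy -[Z.add Z.mul]; lia.
- by left; case=> [|[|[|k]]] //= _; lia.
- by right; move: c cE; apply/allP; vm_compute.
all: by vm_compute.
Qed.

Lemma E8_main (s : 'I_(rank (DE 8)).+1 -> G) : statement s.
Proof.
move=> cox sg mw pw.
apply: (@exceptional_main (DE 8) E8_bonds 30 6 (path_rules E8_bonds 5) (fun=> [::])
  [:: 1; 2; 3; 4; 5; 6; 4; 2; 3]%Z [::]%Z 1
  [::] _ _ _ _ _ _ _ _ _ _ G s cox sigma w lam
  sg mw pw); last first.
move=> l t sl la lb F1 F2; case: l sl la lb F1 F2 => [|x0 [|x1 [|x2 [|x3 [|x4 [|x5 [|x6 [|x7 [|x8 [|]]]]]]]]]] // _ la lb F1 F2.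
have [|dom|[c cE ->]] := E8_search _ F1.
- by move: la; lazy -[Z.add Z.mul]; lia.
- by left; case=> [|[|[|[|[|[|[|[|[|k]]]]]]]]] //= _; lia.
- by right; move: c cE; apply/allP; vm_compute.
all: by vm_compute.
Qed.

Lemma E7_main (s : 'I_(rank (DE 7)).+1 -> G) : statement s.
Proof.
move=> cox sg mw pw.
(* 30 up-steps exhaust all orbits: the deepest one, with node 6 omitted, is the minuscule orbit of
   56 weights of E7, of depth 27. The form read modulo 2 is the class modulo the root lattice; in
   type E6 the modulus is 3. *)
apply: (@exceptional_main (DE 7) E7_bonds 30 4 (path_rules E7_bonds 3) E7_rules
  [:: 1; 2; 3; 4; 3; 2; 1; 2]%Z [:: 0; 0; 0; 0; 1; 0; 1; 1]%Z 2
  [::] _ _ _ _ _ _ _ _ _ _ G s cox sigma w lam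
  sg mw pw); last first.
move=> l t sl la lb F1 F2; case: l sl la lb F1 F2 => [|x0 [|x1 [|x2 [|x3 [|x4 [|x5 [|x6 [|x7 [|]]]]]]]]] // _ la lb F1 F2.
have [||dom|[[c cE ->]|[f [m [fE m2 lE]]]]] := E7_search (t := t) _ _ F1.
- by move: la; lazy -[Z.add Z.mul]; lia.
- by move: lb; lazy -[Z.add Z.mul]; lia.
- by left; case=> [|[|[|[|[|[|[|[|k]]]]]]]] //= _; lia.
- by right; move: c cE; apply/allP; vm_compute.
- have ok : all (fun f => has (fun d => prefute 7 (bond_matrix E7_bonds) E7_rules d f)
      [:: [:: 0; 1; 2; 3]; [:: 6; 5; 4; 3]]%N) (unzip2 E7_families) by vm_compute.
  have sz : all (fun d => size d == 4%N) [:: [:: 0; 1; 2; 3]; [:: 6; 5; 4; 3]]%N by vm_compute.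
  by case: (families_refuted sz ok fE m2); rewrite -lE; exact F2.
all: by vm_compute.
Qed.

Lemma E6_main (s : 'I_(rank (DE 6)).+1 -> G) : statement s.
Proof.
move=> cox sg mw pw.
apply: (@exceptional_main (DE 6) E6_bonds 30 3 (path_rules E6_bonds 2) E6_rules
  [:: 1; 2; 3; 2; 1; 2; 1]%Z [:: 0; 0; 0; 1; 2; 2; 1]%Z 3
  [::] _ _ _ _ _ _ _ _ _ _ G s cox sigma w lam
  sg mw pw); last first.
move=> l t sl la lb F1 F2; case: l sl la lb F1 F2 => [|x0 [|x1 [|x2 [|x3 [|x4 [|x5 [|x6 [|]]]]]]]] // _ la lb F1 F2.
have [||dom|[[c cE ->]|[f [m [fE m2 lE]]]]] := E6_search (t := t) _ _ F1.
- by move: la; lazy -[Z.add Z.mul]; lia.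
- by move: lb; lazy -[Z.add Z.mul]; lia.
- by left; case=> [|[|[|[|[|[|[|k]]]]]]] //= _; lia.
- by right; move: c cE; apply/allP; vm_compute.
- have ok : all (fun f => has (fun d => prefute 6 (bond_matrix E6_bonds) E6_rules d f)
      [:: [:: 0; 1; 2]; [:: 4; 3; 2]; [:: 6; 5; 2]]%N) (unzip2 E6_families) by vm_compute.
  have sz : all (fun d => size d == 3%N) [:: [:: 0; 1; 2]; [:: 4; 3; 2]; [:: 6; 5; 2]]%N by vm_compute.
  by case: (families_refuted sz ok fE m2); rewrite -lE; exact F2.
all: by vm_compute.
Qed.

End Instances.

(** * Type A1 *)

Section TypeA1.
Variables (G : groupType) (s : 'I_(rank (DA 1)).+1 -> G).
Hypothesis cox : coxeter_system (@affine_coxeter (DA 1)) s.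
Notation I := (Finite.sort (fintype_ordinal__canonical__fintype_Finite 2)).
Let A (i j : I) : Z := bond_matrix (edge 0 1 2 2) i j.
Notation M := (@affine_coxeter (DA 1)).
Notation z0 := (node0 1 : I).
Notation S := [pred i : I | i != z0].

Lemma I2_third (i j k : I) : i != j -> k != i -> k = j.
Proof.
rewrite -!val_eqE => ij ki; apply: ord_inj.
by have := ltn_ord i; have := ltn_ord j; have := ltn_ord k; move: ij ki => /=; lia.
Qed.

Lemma A1_bonds : bonds_ok (DA 1) (bond_matrix (edge 0 1 2 2)).
Proof. by vm_compute. Qed.
Let Aii : forall i, A i i = (-2)%Z := exceptional_Aii A1_bonds.
Let Abond : forall i j, i != j -> bond (M i j) (A i j) (A j i) := exceptional_bond A1_bonds.
Let M1 := @affine_coxeter1 (DA 1).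

Lemma A1_other (i j : I) : i != j -> A i j = 2%Z.
Proof.
by case: i j => [[|[|i]] iP] [[|[|j]] jP] //=; rewrite -val_eqE.
Qed.

Lemma A1_sum g (i j : I) : i != j -> (st cox z0 A g i + st cox z0 A g j = 1)%Z.
Proof.
move=> ij; apply: (word_invariantT cox M1 Aii Abond (Q := fun c => (c i + c j = 1)%Z)).
  rewrite /e0; case: i j ij => [[|[|i]] iP] [[|[|j]] jP] //=; rewrite -!val_eqE //=.
move=> c k E; rewrite /fire; have [->|ki] := eqVneq k i; first by rewrite Aii A1_other //; lia.
have -> : k = j by apply: I2_third ij ki.
by rewrite Aii A1_other 1?eq_sym //; lia.
Qed.

(** The two entries have sum 1, so they are never both negative, and every element of the quotient
    belongs to the domain. The isomorphism then holds without assuming palindromicity. *)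
Lemma A1_good : good_domain cox z0 A (minrep s S).
Proof.
split=> //.
- by move=> v i mv neg; apply: (minrep_desc cox M1) => //; apply: (neg_desc M1 Aii Abond mv neg).
- by move=> v i j mv ni nj ij; have := A1_sum v ij; lia.
- move=> v i j mv neg; have [ij|ij] := eqVneq i j.
    by rewrite -ij (fire_at Aii) => H; move: neg H; lia.
  have ji : j != i by rewrite eq_sym.
  rewrite /fire Aii !A1_other //; have := A1_sum v ij; lia.
Qed.

Lemma A1_reduced i j x : size [:: i, j & x] = len s (wprod s [:: i, j & x]) -> i <> j.
Proof.
move=> + ij; rewrite ij !wprod_cons (genK cox M1).
by have := len_le cox x; rewrite /=; lia.
Qed.

Variables (sigma : nat -> seq G).
Hypothesis sg : leaf_segments s sigma.

Lemma A1_segment r p : is_part sigma p -> wprod s r = seg sigma p ->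
  size r = len s (wprod s r) -> minrep s S (wprod s r) -> r = [:: z0] \/ exists2 k : I, k != z0 & r = [:: k; z0].
Proof.
move=> ip rE sr mr; have [y yE yS] := leaf_word cox M1 Aii Abond sg ip rE sr mr.
move: sr; rewrite {}yE; case: y yS => [|k [|k' y]] /=; first by left.
  by rewrite andbT => kz _; right; exists k.
move=> /and3P[kz kz' _] /A1_reduced[].
by apply: (@I2_third z0); rewrite // eq_sym.
Qed.

Lemma A1_main w lam : minrep s (setS 1) w -> leaf_pi s sigma w lam ->
  palindromic s w <->
    (poset_isomorphic (bruhat_interval s w) (bruhat s)
       (young_interval s sigma sigma lam) (young s sigma sigma)
     /\ rank_symmetric (young_interval s sigma sigma lam) (psize lam)).
Proof.
move=> mw pw.
suff iso : poset_isomorphic (bruhat_interval s w) (bruhat s)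
    (young_interval s sigma sigma lam) (young s sigma sigma).
  have := iso_palindromic cox M1 mw iso; tauto.
apply: (leaf_iso M1 Aii Abond sg A1_good) pw => //.
move=> r' r mD sz [p' ip' E'] [p ip E] mr' a.
have s1 := len_le cox r'; have s2 := len_le cox r.
have s3 := len_mul cox (wprod s r') (wprod s r); have sz' := sz.
rewrite wprod_cat size_cat in sz'.
have sr : size r = len s (wprod s r) by glia.
have sr' : size r' = len s (wprod s r') by glia.
have mr : minrep s S (wprod s r).
  by apply: (minrep_suffix cox M1 (x := wprod s r')); rewrite -?wprod_cat //; rewrite wprod_cat; glia.
have [rE|[k kz rE]] := A1_segment ip E sr mr; have [rE'|[k' kz' rE']] := A1_segment ip' E' sr' mr'.
- by move: sz; rewrite rE rE' => /A1_reduced.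
- have szz : size [:: z0; z0] = len s (wprod s [:: z0; z0]).
    move: sz; rewrite rE rE' /= !wprod_cons wprod_nil !mulg1 (gen_sq cox M1).
    by have := len_mul cox (s k') 1; rewrite mulg1 (len_gen cox M1) ; lia.
  by case: (A1_reduced szz).
- by rewrite rE rE' /= !addn0 leq_addl.
- have kk : k' = k by apply: (@I2_third z0); rewrite // eq_sym.
  by rewrite rE rE' kk.
Qed.

End TypeA1.

(** * The classical types *)

Section Symmetry.
Variables (I : finType) (A : I -> I -> Z) (f : I -> I).
Hypothesis fK : involutive f.
Hypothesis fA : forall i j, A (f i) (f j) = A i j.

Lemma fire_sym c i : fire A (c \o f) i = fire A c (f i) \o f.
Proof. by apply: funext => j; rewrite /fire /= fA. Qed.

Lemma cov_sym c y : cov A c y -> cov A (c \o f) (y \o f).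
Proof.
elim=> {c y} [u k neg|u y i ui yi _ IH].
  have := @cov_base _ A (u \o f) (f k); rewrite fire_sym fK; apply.
  by rewrite /= fK.
have := @cov_step _ A (u \o f) (y \o f) (f i); rewrite !fire_sym !fK; apply => //=;
  by rewrite fK.
Qed.

Lemma comp_symK (c : I -> Z) : (c \o f) \o f = c.
Proof. by apply: funext => i; rewrite /= fK. Qed.

Lemma topuniq_sym K c : topuniq A K c -> topuniq A K (c \o f).
Proof.
elim: K c => //= K IH c [un H]; split=> [y1 y2 c1 c2|k neg].
  rewrite -(comp_symK y1) -(comp_symK y2); congr (_ \o _).
  by apply: un; rewrite -(comp_symK c); apply: cov_sym.
by rewrite fire_sym; apply: IH; apply: H.
Qed.

End Symmetry.

Local Arguments Z.add : simpl never.
Local Arguments Z.sub : simpl never.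
Local Arguments Z.mul : simpl never.
Local Arguments Z.opp : simpl never.

Section Classical.
Variables (n : nat) (dl dr : bool).
Hypothesis n2 : (2 <= n)%N.
Hypothesis nd : dl || dr -> (4 <= n)%N.
Hypothesis drl : dr -> dl.
Notation I := (Finite.sort (fintype_ordinal__canonical__fintype_Finite n.+1)).

(* Vectors of length n; dl and dr tell whether the diagram is forked at its left
   and right end, so (dl, dr) is (false, false) in type C, (true, false) in type
   B and (true, true) in type D.  The entry i of the state of x is lin i x, plus 1
   for i = 0, and firing i subtracts a multiple of rho i from x. *)
Definition lin (i : nat) (x : nat -> Z) : Z :=
  if i == 0%N then (if dl then - x 0%N - x 1%N else -2 * x 0%N)%Z
  else if i == n then
    (if dr then x (n - 2)%N + x (n - 1)%N else if dl then x (n - 1)%N else 2 * x (n - 1)%N)%Z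
  else (x (i - 1)%N - x i)%Z.

(** The 2 at the right end of type B goes with the coefficient 1 in [lin]. With this orientation the
    coordinate [n] of a signed unit vector stays within -1, 0, 1, as [minuscule] requires. *)
Definition rho (i k : nat) : Z :=
  if i == 0%N then (if (k == 0%N) || dl && (k == 1%N) then -1 else 0)%Z
  else if i == n then
    (if k == (n - 1)%N then (if dl && ~~ dr then 2 else 1)
     else if dr && (k == (n - 2)%N) then 1 else 0)%Z
  else (if k == (i - 1)%N then 1 else if k == i then -1 else 0)%Z.

Definition cartan (i j : nat) : Z := (- lin j (rho i))%Z.
Definition classicalA (i j : I) : Z := cartan i j.
Notation A := classicalA.

Definition coord (x : seq Z) (i : nat) : Z :=
  ((if i == 0%N then 1 else 0) + lin i (nth 0%Z x))%Z.
Definition cst (x : seq Z) : I -> Z := fun i => coord x i.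
Definition refl (i : nat) (x : seq Z) : seq Z :=
  mkseq (fun k => (nth 0 x k - coord x i * rho i k)%Z) n.

Lemma lin_ext j x y : (j <= n)%N -> (forall k, (k < n)%N -> x k = y k) -> lin j x = lin j y.
Proof.
move=> jn xy; rewrite /lin; case: eqP => j0; first by rewrite !xy //; lia.
by case: eqP => j1; rewrite !xy //; lia.
Qed.

Lemma lin_sub j x c r : lin j (fun k => (x k - c * r k)%Z) = (lin j x - c * lin j r)%Z.
Proof. by rewrite /lin; do ?case: ifP => _; ring. Qed.

Lemma size_refl i x : size (refl i x) = n.
Proof. exact: size_mkseq. Qed.

Lemma fire_cst x (i : I) : fire A (cst x) i = cst (refl i x).
Proof.
apply: funext => j; rewrite /fire /cst /coord /A /cartan.
rewrite (@lin_ext j (nth 0%Z (refl i x)) (fun k => (nth 0 x k - coord x i * rho i k)%Z)).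
- by rewrite lin_sub /coord; ring.
- by rewrite -ltnS.
- by move=> k kn; rewrite nth_mkseq.
Qed.

Lemma classical_ii i : A i i = (-2)%Z.
Proof.
have := ltn_ord i; rewrite /A /cartan /lin /rho => iN.
have n1 : (n == 0%N) = false by lia.
have e1 : ((n - 2)%N == (n - 1)%N) = false by lia.
case: eqP => i0; first by rewrite !eqxx /=; case: dl.
case: eqP => i1; first by rewrite !eqxx e1 /=; case: dr; case: dl.
have -> : (nat_of_ord i == (i - 1)%N) = false by lia.
by rewrite !eqxx.
Qed.

Notation node k := (inord k : I).

Lemma cst_node x k : (k <= n)%N -> cst x (node k) = coord x k.
Proof. by move=> kn; rewrite /cst inordK. Qed.

Lemma fire_node x k : (k <= n)%N -> fire A (cst x) (node k) = cst (refl k x).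
Proof. by move=> kn; rewrite fire_cst inordK. Qed.

(** * Certified coatoms in terms of vectors *)

Definition covx (x y : seq Z) : Prop := cov A (cst x) (cst y).

Lemma covx_base x k : (k <= n)%N -> (coord x k < 0)%Z -> covx x (refl k x).
Proof.
by move=> kn neg; rewrite /covx -fire_node //; apply: cov_base; rewrite cst_node.
Qed.

Lemma covx_up x y k : (k <= n)%N -> covx x y -> (0 < coord x k)%Z -> (0 < coord y k)%Z ->
  covx (refl k x) (refl k y).
Proof.
by move=> kn c ux uy; rewrite /covx -!fire_node //; apply: cov_step; rewrite ?cst_node.
Qed.

Lemma coord_swap P Q a b : size (P ++ [:: a, b & Q]) = n ->
  coord (P ++ [:: a, b & Q]) (size P).+1 = (a - b)%Z.
Proof.
rewrite size_cat /= => sz; rewrite /coord /lin /=.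
have -> : ((size P).+1 == n) = false by lia.
by rewrite subn1 /= !nth_cat ltnn subnn ltnNge leqnSn /= subSnn.
Qed.

Lemma refl_swap P Q a b : size (P ++ [:: a, b & Q]) = n ->
  refl (size P).+1 (P ++ [:: a, b & Q]) = P ++ [:: b, a & Q].
Proof.
move=> sz; have sz' := sz; rewrite size_cat /= in sz'.
apply: (@eq_from_nth _ 0%Z) => [|k]; rewrite size_refl; first by rewrite size_cat.
move=> kn; rewrite nth_mkseq // coord_swap // /rho /=.
have -> : ((size P).+1 == n) = false by lia.
rewrite subn1 /= !nth_cat; case: ltnP => kP.
  have -> : (k == size P) = false by lia.
  have -> : (k == (size P).+1) = false by lia.
  by ring.
have [->|k0] := eqVneq k (size P); first by rewrite subnn /=; ring.
have [->|k1] := eqVneq k (size P).+1; first by rewrite subSnn /=; ring.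
have -> : (k - size P)%N = (k - size P).-2.+2 by lia.
by rewrite /=; ring.
Qed.

Lemma coord_left a b Q : coord [:: a, b & Q] 0 = if dl then (1 - a - b)%Z else (1 - 2 * a)%Z.
Proof. by rewrite /coord /lin /=; case: dl; ring. Qed.

Lemma refl_left a b Q : size [:: a, b & Q] = n ->
  refl 0 [:: a, b & Q] =
    if dl then [:: 1 - b, 1 - a & Q]%Z else [:: 1 - a, b & Q]%Z.
Proof.
move=> sz; apply: (@eq_from_nth _ 0%Z) => [|k]; rewrite size_refl; first by case: dl.
move=> kn; rewrite nth_mkseq // coord_left /rho /=; case: dl => /=.
  by case: k kn => [|[|k]] kn /=; ring.
by case: k kn => [|[|k]] kn /=; ring.
Qed.

Lemma coord_right P a b : size (P ++ [:: a; b]) = n ->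
  coord (P ++ [:: a; b]) n = if dr then (a + b)%Z else if dl then b else (2 * b)%Z.
Proof.
rewrite size_cat /= => sz; rewrite /coord /lin eqxx.
have -> : (n == 0%N) = false by lia.
rewrite !nth_cat.
have -> : ((n - 2)%N < size P)%N = false by lia.
have -> : ((n - 1)%N < size P)%N = false by lia.
have -> : (n - 2 - size P)%N = 0%N by lia.
have -> : (n - 1 - size P)%N = 1%N by lia.
by [].
Qed.

Lemma refl_right P a b : size (P ++ [:: a; b]) = n ->
  refl n (P ++ [:: a; b]) =
    if dr then P ++ [:: - b; - a]%Z else P ++ [:: a; - b]%Z.
Proof.
move=> sz; have sz' := sz; rewrite size_cat /= in sz'.
apply: (@eq_from_nth _ 0%Z) => [|k]; rewrite size_refl; first by case: dr; rewrite size_cat.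
move=> kn; rewrite nth_mkseq // coord_right // /rho eqxx.
have -> : (n == 0%N) = false by lia.
have -> : (n - 1)%N = (size P).+1 by lia.
have -> : (n - 2)%N = size P by lia.
rewrite (fun_if (fun l => nth 0%Z l k)) !nth_cat; case: ltnP => kP.
  have -> : (k == size P) = false by lia.
  have -> : (k == (size P).+1) = false by lia.
  by case: dr => /=; ring.
have [->|k0] := eqVneq k (size P).
  rewrite subnn /= ltn_eqF //; case: dr => /=; ring.
have -> : k = (size P).+1 by lia.
by rewrite eqxx subSnn /=; case: dl; case: dr => /=; ring.
Qed.

(** The interior coordinates determine the differences of neighbouring entries, and the coordinate 0
    fixes the remaining constant. *)
Lemma coord_inj x y : size x = n -> size y = n -> cst x = cst y -> x = y.
Proof.
move=> sx sy E.
have Ek k : (k <= n)%N -> coord x k = coord y k by move=> kn; rewrite -!cst_node // E.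
have step k : (0 < k < n)%N -> nth 0%Z x (k - 1) = nth 0%Z y (k - 1) -> nth 0%Z x k = nth 0%Z y k.
  move=> kn; have := Ek k; rewrite /coord /lin.
  have -> : (k == 0%N) = false by lia.
  have -> : (k == n) = false by lia.
  by move=> /(_ _); lia.
apply: (@eq_from_nth _ 0%Z) => [|k]; rewrite sx ?sy // => kn.
elim: k kn => [_|k IH kn]; last first.
  by apply: step; rewrite ?subn1 /= ?IH //; lia.
have := Ek 0%N; have := Ek 1%N; rewrite /coord /lin /=.
have -> : (1%N == n) = false by lia.
rewrite subnn; case: dl => H1 H0; have := H0 isT; have := H1 (ltnW n2); lia.
Qed.

Lemma covx_swap P Q a b P' Q' a' b' : covx (P ++ [:: a, b & Q]) (P' ++ [:: a', b' & Q']) ->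
  size P = size P' -> size (P ++ [:: a, b & Q]) = n -> size (P' ++ [:: a', b' & Q']) = n ->
  (b < a)%Z -> (b' < a')%Z -> covx (P ++ [:: b, a & Q]) (P' ++ [:: b', a' & Q']).
Proof.
move=> c sP s1 s2 ab ab'.
rewrite -(refl_swap s1) -(refl_swap s2) -sP; apply: covx_up => //.
- by move: s1; rewrite size_cat /=; lia.
- by rewrite coord_swap //; lia.
- by rewrite sP coord_swap //; lia.
Qed.

(** Exchanging neighbours is an up-step when the larger entry comes first. A certified coatom is
    thus carried along while [a] and [a'] move past blocks of smaller entries simultaneously. *)
Lemma covx_right P B Q a P' B' Q' a' : covx (P ++ a :: B ++ Q) (P' ++ a' :: B' ++ Q') ->
  size P = size P' -> size B = size B' -> size (P ++ a :: B ++ Q) = n ->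
  size (P' ++ a' :: B' ++ Q') = n ->
  all (fun b => b <? a)%Z B -> all (fun b => b <? a')%Z B' ->
  covx (P ++ B ++ a :: Q) (P' ++ B' ++ a' :: Q').
Proof.
elim: B P B' P' => [|b B IH] P [|b' B'] P' //= c sP [sB] s1 s2.
move=> /andP[/Z.ltb_lt ba aB] /andP[/Z.ltb_lt ba' aB'].
have := IH (rcons P b) B' (rcons P' b'); rewrite !cat_rcons; apply => //.
- exact: covx_swap.
- by rewrite !size_rcons sP.
- by move: s1; rewrite !size_cat /= !size_cat /=.
- by move: s2; rewrite !size_cat /= !size_cat /=.
Qed.

Lemma covx_left P B Q a P' B' Q' a' : covx (P ++ B ++ a :: Q) (P' ++ B' ++ a' :: Q') ->
  size P = size P' -> size B = size B' -> size (P ++ B ++ a :: Q) = n ->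
  size (P' ++ B' ++ a' :: Q') = n ->
  all (fun b => a <? b)%Z B -> all (fun b => a' <? b)%Z B' ->
  covx (P ++ a :: B ++ Q) (P' ++ a' :: B' ++ Q').
Proof.
elim/last_ind: B B' Q Q' => [|B b IH] B' Q Q'; first by case: B'.
case/lastP: B' => [|B' b']; first by rewrite size_rcons.
rewrite !size_rcons !all_rcons !cat_rcons => c sP [sB] s1 s2.
move=> /andP[/Z.ltb_lt ba aB] /andP[/Z.ltb_lt ba' aB'].
apply: IH => //.
- rewrite !catA; apply: covx_swap; rewrite -?catA // !size_cat ?sP ?sB //.
- by move: s1; rewrite !size_cat /=; lia.
- by move: s2; rewrite !size_cat /=; lia.
Qed.

Lemma covx_swap_base P Q a b : size (P ++ [:: a, b & Q]) = n -> (a < b)%Z ->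
  covx (P ++ [:: a, b & Q]) (P ++ [:: b, a & Q]).
Proof.
move=> s1 ab; rewrite -(refl_swap s1); apply: covx_base.
  by move: s1; rewrite size_cat /=; lia.
by rewrite coord_swap //; lia.
Qed.

Lemma covx_up_left1 a Q a' Q' : ~~ dl -> covx (a :: Q) (a' :: Q') ->
  size (a :: Q) = n -> size (a' :: Q') = n -> (a <= 0)%Z -> (a' <= 0)%Z ->
  covx ((1 - a)%Z :: Q) ((1 - a')%Z :: Q').
Proof.
case: Q Q' => [|b Q] [|b' Q'] ndl c s1 s2 a0 a0'; try by move: s1 s2 => /=; lia.
have := covx_up (leq0n n) c; rewrite !coord_left !refl_left // (negbTE ndl).
by apply; lia.
Qed.

Lemma covx_up_left2 a b Q a' b' Q' : dl -> covx [:: a, b & Q] [:: a', b' & Q'] ->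
  size [:: a, b & Q] = n -> size [:: a', b' & Q'] = n -> (a + b <= 0)%Z -> (a' + b' <= 0)%Z ->
  covx [:: 1 - b, 1 - a & Q]%Z [:: 1 - b', 1 - a' & Q']%Z.
Proof.
move=> Dl c s1 s2 ab ab'.
by have := covx_up (leq0n n) c; rewrite !coord_left !refl_left // Dl; apply; lia.
Qed.

Lemma covx_left1_base a Q : ~~ dl -> size (a :: Q) = n -> (1 <= a)%Z ->
  covx (a :: Q) ((1 - a)%Z :: Q).
Proof.
case: Q => [|b Q] ndl s1 a1; first by move: s1 => /=; lia.
have := @covx_base [:: a, b & Q] 0 (leq0n n); rewrite !coord_left !refl_left // (negbTE ndl).
by apply; lia.
Qed.

Lemma covx_left2_base a b Q : dl -> size [:: a, b & Q] = n -> (2 <= a + b)%Z ->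
  covx [:: a, b & Q] [:: 1 - b, 1 - a & Q]%Z.
Proof.
move=> Dl s1 ab.
have := @covx_base [:: a, b & Q] 0 (leq0n n); rewrite !coord_left !refl_left // Dl.
by apply; lia.
Qed.

Lemma rcons_pair (P : seq Z) a : size (rcons P a) = n -> exists P' b, P = rcons P' b.
Proof.
by case/lastP: P => [|P b]; [move=> /=; lia|exists P, b].
Qed.

Lemma covx_up_right1 P a P' a' : ~~ dr -> covx (rcons P a) (rcons P' a') ->
  size (rcons P a) = n -> size (rcons P' a') = n -> (0 < a)%Z -> (0 < a')%Z ->
  covx (rcons P (- a)%Z) (rcons P' (- a')%Z).
Proof.
move=> ndr c s1 s2 a0 a0'; have [P1 [b PE]] := rcons_pair s1; have [P1' [b' PE']] := rcons_pair s2.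
move: s1 s2 c; rewrite {}PE {}PE' -!cats1 -!catA => s1 s2 c.
have := covx_up (leqnn n) c; rewrite !coord_right // !refl_right // (negbTE ndr).
by apply; case: dl; lia.
Qed.

Lemma covx_up_right2 P a b P' a' b' : dr -> covx (P ++ [:: a; b]) (P' ++ [:: a'; b']) ->
  size (P ++ [:: a; b]) = n -> size (P' ++ [:: a'; b']) = n ->
  (0 < a + b)%Z -> (0 < a' + b')%Z ->
  covx (P ++ [:: - b; - a]%Z) (P' ++ [:: - b'; - a']%Z).
Proof.
move=> Dr c s1 s2 ab ab'.
have := covx_up (leqnn n) c; rewrite !coord_right // !refl_right // Dr.
by apply; lia.
Qed.

Lemma covx_right1_base P a : ~~ dr -> size (rcons P a) = n -> (a < 0)%Z ->
  covx (rcons P a) (rcons P (- a)%Z).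
Proof.
move=> ndr s1 a0; have [P1 [b PE]] := rcons_pair s1.
move: s1; rewrite {}PE -!cats1 -!catA => s1.
have := covx_base (leqnn n) (x := P1 ++ [:: b; a]); rewrite !coord_right // !refl_right // (negbTE ndr).
by apply; case: dl; lia.
Qed.

Lemma covx_right2_base P a b : dr -> size (P ++ [:: a; b]) = n -> (a + b < 0)%Z ->
  covx (P ++ [:: a; b]) (P ++ [:: - b; - a]%Z).
Proof.
move=> Dr s1 ab.
have := covx_base (leqnn n) (x := P ++ [:: a; b]); rewrite !coord_right // !refl_right // Dr.
by apply; lia.
Qed.

Notation TU K x := (topuniq A K (cst x)).

Lemma covx_uniq K x y y' : TU K.+1 x -> covx x y -> covx x y' -> size y = n -> size y' = n ->
  y = y'.
Proof. by move=> [un _] c c' sy sy'; apply: coord_inj => //; apply: un. Qed.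

Lemma TU_refl K x k : TU K.+1 x -> (k <= n)%N -> (coord x k < 0)%Z -> TU K (refl k x).
Proof. by move=> [_ H] kn neg; rewrite -fire_node //; apply: H; rewrite cst_node. Qed.

Lemma TU_swap K P Q a b : TU K.+1 (P ++ [:: a, b & Q]) -> size (P ++ [:: a, b & Q]) = n ->
  (a < b)%Z -> TU K (P ++ [:: b, a & Q]).
Proof.
move=> tu s1 ab; rewrite -(refl_swap s1); apply: TU_refl => //.
  by move: s1; rewrite size_cat /=; lia.
by rewrite coord_swap //; lia.
Qed.

Lemma TU_left1 K a Q : ~~ dl -> TU K.+1 (a :: Q) -> size (a :: Q) = n -> (1 <= a)%Z ->
  TU K ((1 - a)%Z :: Q).
Proof.
case: Q => [|b Q] ndl tu s1 a1; first by move: s1 => /=; lia.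
have := TU_refl tu (leq0n n); rewrite coord_left refl_left // (negbTE ndl).
by apply; lia.
Qed.

Lemma TU_left2 K a b Q : dl -> TU K.+1 [:: a, b & Q] -> size [:: a, b & Q] = n ->
  (2 <= a + b)%Z -> TU K [:: 1 - b, 1 - a & Q]%Z.
Proof.
move=> Dl tu s1 ab.
have := TU_refl tu (leq0n n); rewrite coord_left refl_left // Dl.
by apply; lia.
Qed.

Lemma TU_right1 K P a : ~~ dr -> TU K.+1 (rcons P a) -> size (rcons P a) = n -> (a < 0)%Z ->
  TU K (rcons P (- a)%Z).
Proof.
move=> ndr + s1 a0; have [P1 [b PE]] := rcons_pair s1.
move: s1; rewrite {}PE -!cats1 -!catA => s1 tu.
have := TU_refl tu (leqnn n); rewrite coord_right // refl_right // (negbTE ndr).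
by apply; case: dl; lia.
Qed.

Lemma TU_right2 K P a b : dr -> TU K.+1 (P ++ [:: a; b]) -> size (P ++ [:: a; b]) = n ->
  (a + b < 0)%Z -> TU K (P ++ [:: - b; - a]%Z).
Proof.
move=> Dr tu s1 ab.
have := TU_refl tu (leqnn n); rewrite coord_right // refl_right // Dr.
by apply; lia.
Qed.

Lemma cartan_ge0 i j : (i <= n)%N -> (j <= n)%N -> i != j -> (0 <= cartan i j)%Z.
Proof.
move=> iN jN ij; rewrite /cartan /lin /rho.
have [n4|[dl0 dr0]] : (4 <= n)%N \/ dl = false /\ dr = false.
  by move: nd; case: dl; case: dr => H; [left; apply: H|left; apply: H|left; apply: H|right].
- by repeat (case: ifP => ?; try lia).
- by rewrite dl0 dr0; repeat (case: ifP => ?; try lia).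
Qed.

Lemma TU_neg K x i k : TU K.+1 x -> (i <= n)%N -> (k <= n)%N -> i != k ->
  (coord x i < 0)%Z -> (0 <= coord x k)%Z.
Proof.
move=> tu iN kN ik neg; rewrite -cst_node //; apply: (topuniq_neg classical_ii _ tu (i := node i)).
- by move=> a b ab; apply: cartan_ge0; rewrite // -ltnS.
- by rewrite cst_node.
- by rewrite -val_eqE /= !inordK // eq_sym.
Qed.

Ltac arith_hyps := repeat match goal with H : ?T |- _ =>
  lazymatch T with
  | nat => fail | Z => fail | bool => fail | seq _ => fail
  | @eq nat _ _ => fail | @eq Z _ _ => fail | ~ @eq Z _ _ => fail
  | Z.le _ _ => fail | Z.lt _ _ => fail | Z.gt _ _ => fail
  | is_true (leq _ _) => fail | is_true (negb (@eq_op nat _ _)) => fail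
  | _ => clear H end end.
Ltac alia := first [solve [arith_hyps; lia] | lia].

Notation desc := (sorted (fun a b => b <=? a)%Z).

Lemma desc_le a s : desc (a :: s) -> all (fun b => b <=? a)%Z s.
Proof.
move=> /=; apply: order_path_min => x y z /Z.leb_le H1 /Z.leb_le H2; apply/Z.leb_le; alia.
Qed.

Lemma desc_ge s a : desc (rcons s a) -> all (fun b => a <=? b)%Z s.
Proof.
elim: s => //= b s IH H; have := IH (path_sorted H); case: s H {IH} => [|c s] /=.
  by rewrite andbT => ->.
by move=> /andP[/Z.leb_le cb _] /andP[/Z.leb_le ac ->]; rewrite andbT; apply/andP; split; apply/Z.leb_le; alia.
Qed.

Lemma desc_prefix a s : desc (a :: s) -> exists k R,
  a :: s = nseq k.+1 a ++ R /\ all (fun b => b <? a)%Z R.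
Proof.
elim: s => [_|b s IH /= /andP[/Z.leb_le ba H]]; first by exists 0%N, [::].
have [ab|ab] := Z.eq_dec b a.
  have [|k [R [E aR]]] := IH; first by move: H; rewrite ab.
  by exists k.+1, R; rewrite ab E.
exists 0%N, (b :: s); split => //=; apply/andP; split; first by apply/Z.ltb_lt; alia.
apply: sub_all (@desc_le b s H) => c /Z.leb_le cb; apply/Z.ltb_lt; alia.
Qed.

Lemma desc_suffix s a : desc (rcons s a) -> exists k R,
  rcons s a = R ++ nseq k.+1 a /\ all (fun b => a <? b)%Z R.
Proof.
elim: s => [_|b s IH /= H]; first by exists 0%N, [::].
have /Z.leb_le ab : (a <=? b)%Z by have := @desc_ge (b :: s) a H => /= /andP[].
have [k [[|c R] [E aR]]] := IH (path_sorted H).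
  have [eb|nb] := Z.eq_dec b a; first by exists k.+1, [::]; rewrite E eb.
  by exists k, [:: b]; rewrite E; split => //=; rewrite andbT; apply/Z.ltb_lt; alia.
exists k, [:: b, c & R]; rewrite E; split => //; rewrite /= -/(all _ (c :: R)).
move: H; rewrite E /= => /andP[/Z.leb_le cb _]; move: aR => /= /andP[/Z.ltb_lt ac ->].
by rewrite andbT; apply/andP; split; apply/Z.ltb_lt; alia.
Qed.

Lemma all_const (s : seq Z) c : all (fun b => c <=? b)%Z s -> all (fun b => b <=? c)%Z s ->
  s = nseq (size s) c.
Proof.
elim: s => //= b s IH /andP[/Z.leb_le cb H1] /andP[/Z.leb_le bc H2].
by rewrite -IH //; congr cons; alia.
Qed.

Lemma nseqSr k (c : Z) : nseq k.+1 c = nseq k c ++ [:: c].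
Proof. by elim: k => //= k ->. Qed.

Lemma lastE (P : seq Z) : P = [::] \/ exists P' p, P = rcons P' p.
Proof. by case/lastP: P => [|P p]; [left|right; exists P, p]. Qed.

Lemma cat_head (P Q Q' : seq Z) a b : P ++ a :: Q = P ++ b :: Q' -> a = b.
Proof. by elim: P => [[]|c P IH [/IH]]. Qed.

Lemma cat_last (P P' : seq Z) a b : P ++ [:: a] = P' ++ [:: b] -> a = b.
Proof. by move=> /(congr1 (last 0%Z)); rewrite !last_cat. Qed.

Ltac szl := rewrite ?(size_cat, size_nseq, size_rcons) /= ?(size_cat, size_nseq, size_rcons) /=
  ?(size_cat, size_nseq, size_rcons); alia.

Lemma all_nseq_lt k (b a : Z) : (b < a)%Z -> all (fun b => b <? a)%Z (nseq k b).
Proof. by move=> ba; rewrite all_nseq; apply/orP; right; apply/Z.ltb_lt. Qed.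

Lemma all_nseq_gt k (b a : Z) : (a < b)%Z -> all (fun b => a <? b)%Z (nseq k b).
Proof. by move=> ba; rewrite all_nseq; apply/orP; right; apply/Z.ltb_lt. Qed.

(** With a left fork this is the reflection at node 0. Otherwise the certificate fires 0, skips the
    exchange of the first two entries, and fires 0 again. *)
Lemma covx_pair m Q : (2 <= m)%Z -> size [:: m, 0%Z & Q] = n ->
  covx [:: m, 0%Z & Q] [:: 1%Z, (1 - m)%Z & Q].
Proof.
move=> m2 sz; have [Dl|ndl] := boolP dl.
  have := @covx_left2_base m 0 Q Dl sz.
  by have -> : (1 - 0 = 1)%Z by []; apply; alia.
have := @covx_swap_base [::] Q (1 - m) 0 sz; rewrite !cat0s => H.
have {}H := H ltac:(alia).
have := @covx_up_left1 (1 - m) (0%Z :: Q) 0 ((1 - m)%Z :: Q) ndl H sz sz.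
have -> : (1 - (1 - m) = m)%Z by alia.
have -> : (1 - 0 = 1)%Z by [].
by apply; alia.
Qed.

Lemma covx_unit_pos m q r : (2 <= m)%Z -> (q + r).+2 = n ->
  covx (nseq q.+1 0%Z ++ m :: nseq r 0%Z) ((1 - m)%Z :: nseq q 0%Z ++ 1%Z :: nseq r 0%Z).
Proof.
move=> m2 sz.
have := @covx_right [::] (nseq q.+1 0%Z) (nseq r 0%Z) m [::] ((1 - m)%Z :: nseq q 0%Z) (nseq r 0%Z) 1.
rewrite !cat0s; apply; rewrite ?all_nseq_lt //; try szl.
- by apply: covx_pair => //; szl.
- by rewrite /= all_nseq_lt ?andbT //; apply/Z.ltb_lt; alia.
Qed.

Lemma covx_unit_neg m q r : (2 <= m)%Z -> (q + r).+2 = n ->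
  covx (nseq q.+1 0%Z ++ (- m)%Z :: nseq r 0%Z)
       ((1 - m)%Z :: nseq q 0%Z ++ (-1)%Z :: nseq r 0%Z).
Proof.
move=> m2 sz.
have H : covx (nseq q.+1 0%Z ++ nseq r 0%Z ++ [:: (- m)%Z])
    ((1 - m)%Z :: nseq q 0%Z ++ nseq r 0%Z ++ [:: (- 1)%Z]).
  rewrite !catA -!nseqD; have [Dr|ndr] := boolP dr.
    have n4 : (4 <= n)%N by apply: nd; rewrite Dr orbT.
    have [k kE] : exists k, (q + r)%N = k.+2 by exists (q + r - 2)%N; alia.
    have := @covx_unit_pos m k.+1 1 m2; rewrite -/(nseq _ _) => /(_ ltac:(alia)) H.
    have := @covx_up_right2 (nseq k.+2 0%Z) m 0 ((1 - m)%Z :: nseq k.+1 0%Z) 1 0 Dr H.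
    rewrite addSn kE.
    rewrite (nseqSr k.+2) [in X in _ -> covx _ X](nseqSr k.+1) -!catA.
    by apply; try szl; alia.
  have := @covx_unit_pos m (q + r) 0 m2; rewrite addn0 => /(_ sz) H.
  have := @covx_up_right1 (nseq (q + r).+1 0%Z) m ((1 - m)%Z :: nseq (q + r) 0%Z) 1 ndr.
  by rewrite -!cats1; apply => //; try szl; alia.
have := @covx_left (nseq q.+1 0%Z) (nseq r 0%Z) [::] (- m) ((1 - m)%Z :: nseq q 0%Z)
  (nseq r 0%Z) [::] (-1).
by rewrite !cats0; apply => //; rewrite ?all_nseq_gt //; try szl; alia.
Qed.

(** Exchanging [m] with the zero before it is one coatom; for [m >= 2] the certificate
    [covx_unit_pos], built at the front and carried past the zeros, is another. *)
Lemma unit_pos K m q r : TU K.+1 (nseq q.+1 0%Z ++ m :: nseq r 0%Z) -> (q + r).+2 = n ->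
  ~ (2 <= m)%Z.
Proof.
move=> tu sz m2; have c1 := covx_unit_pos m2 sz.
have c2 : covx (nseq q.+1 0%Z ++ m :: nseq r 0%Z) (nseq q 0%Z ++ [:: m, 0%Z & nseq r 0%Z]).
  by rewrite nseqSr -catA; apply: covx_swap_base; [szl|alia].
have := covx_uniq tu c1 c2 ltac:(szl) ltac:(szl).
by case: q {tu c1 c2 sz} => [|q] /= [] *; alia.
Qed.

Lemma unit_neg K m q r : TU K.+1 (nseq q.+1 0%Z ++ (- m)%Z :: nseq r 0%Z) ->
  (q + r).+2 = n -> ~ (2 <= m)%Z.
Proof.
move=> tu sz m2; have c1 := covx_unit_neg m2 sz.
case: r sz tu c1 => [|r] sz tu c1.
  have [Dr|ndr] := boolP dr.
    have n4 : (4 <= n)%N by apply: nd; rewrite Dr orbT.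
    case: q sz tu c1 => [|q] sz tu c1; first by alia.
    move: tu c1; rewrite (nseqSr q.+1) -!catA => tu c1.
    have c2 := @covx_right2_base (nseq q.+1 0%Z) 0 (- m) Dr ltac:(szl) ltac:(alia).
    by have := covx_uniq tu c1 c2 ltac:(szl) ltac:(szl) => /= -[] *; alia.
  have c2 := @covx_right1_base (nseq q.+1 0%Z) (- m) ndr ltac:(szl) ltac:(alia).
  rewrite -!cats1 in c2.
  by have := covx_uniq tu c1 c2 ltac:(szl) ltac:(szl) => /= -[] *; alia.
have c2 := @covx_swap_base (nseq q.+1 0%Z) (nseq r 0%Z) (- m) 0 ltac:(szl) ltac:(alia).
by have := covx_uniq tu c1 c2 ltac:(szl) ltac:(szl) => /= -[] *; alia.
Qed.

(** * Vectors with unique coatoms, by the position of the descent *)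

Definition unit_vector (x : seq Z) : Prop :=
  exists p r e, (e = 1 \/ e = -1)%Z /\ x = nseq p 0%Z ++ e :: nseq r 0%Z.

(** After the exchange, [b] meets the entries before it and [a] those after it. Strict inequalities
    on both sides would be two descents at colength 1, so one side is flat, and all entries but one
    vanish; the remaining one is bounded by [unit_pos] or [unit_neg]. *)
Lemma case_interior P a b Q : size (P ++ [:: a, b & Q]) = n -> TU 2 (P ++ [:: a, b & Q]) ->
  (dl -> P <> [::]) -> (dr -> Q <> [::]) -> (a <= 0)%Z -> (0 <= b)%Z -> (a < b)%Z ->
  desc (rcons P a) -> all (fun c => c <=? 0)%Z P -> desc (b :: Q) -> all (fun c => 0 <=? c)%Z Q ->
  unit_vector (P ++ [:: a, b & Q]).
Proof.
move=> sz tu Pdl Qdr a0 b0 ab dP P0 dQ Q0.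
have sz1 : size (P ++ [:: b, a & Q]) = n by move: sz; rewrite !size_cat.
have szn : (size P + size Q).+2 = n by move: sz; rewrite size_cat /=; alia.
have tu1 := TU_swap tu sz ab.
have P1 := desc_ge dP; have Q1 := desc_le dQ.
have left p P' : P = rcons P' p -> (p < b)%Z -> (coord (P ++ [:: b, a & Q]) (size P) < 0)%Z.
  move=> PE pb; rewrite PE cat_rcons size_rcons coord_swap; first by alia.
  by rewrite -cat_rcons -PE.
have left1 : (0 < b)%Z -> (coord (P ++ [:: b, a & Q]) (size P) < 0)%Z.
  move=> b1; have [PE|[P' [p PE]]] := lastE P.
    by rewrite PE coord_left; case: dl Pdl => [/(_ isT)//|_]; alia.
  apply: (left p P') => //; move: P0; rewrite PE all_rcons => /andP[/Z.leb_le p0 _]; alia.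
have right q Q' : Q = q :: Q' -> (a < q)%Z -> (coord (P ++ [:: b, a & Q]) (size P).+2 < 0)%Z.
  move=> QE aq; have := @coord_swap (rcons P b) Q' a q; rewrite cat_rcons size_rcons -QE.
  by move=> /(_ sz1) ->; alia.
have right1 : (a < 0)%Z -> (coord (P ++ [:: b, a & Q]) (size P).+2 < 0)%Z.
  move=> a1; case QE: Q => [|q Q'].
    rewrite QE in szn sz1; have -> : (size P).+2 = n by move: szn => /=; alia.
    by rewrite coord_right //; case: dr Qdr => [/(_ isT)//|_]; case: dl; alia.
  rewrite -QE; apply: (right q Q') => //; move: Q0; rewrite QE => /= /andP[/Z.leb_le q0 _]; alia.
have excl : (coord (P ++ [:: b, a & Q]) (size P) < 0)%Z ->
    (coord (P ++ [:: b, a & Q]) (size P).+2 < 0)%Z -> False.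
  move=> H1 H2; have := @TU_neg 0 _ _ (size P).+2 tu1 _ _ _ H1.
  by move=> /(_ ltac:(alia) ltac:(alia) ltac:(alia)); alia.
have [a1|a1] := Z.eq_dec a 0.
  subst a; have b1 : (0 < b)%Z by alia.
  have PE := all_const P1 P0.
  have Q2 : all (fun c => c <=? 0)%Z Q.
    case QE: Q => [//|q Q'].
    have q0 : (q <= 0)%Z.
      have [//|q1] := Z_le_gt_dec q 0; case: excl; [exact: left1|apply: (right q Q') => //; alia].
    apply/andP; split; first exact/Z.leb_le.
    have := @desc_le q Q'; move: dQ; rewrite QE => /= /andP[_ dQ] /(_ dQ).
    by apply: sub_all => c /Z.leb_le cq; apply/Z.leb_le; alia.
  have QE := all_const Q0 Q2.
  exists (size P).+1, (size Q), b; rewrite {1}PE {1}QE nseqSr -catA; split => //.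
  left; have := @unit_pos 1 b (size P) (size Q); rewrite nseqSr -catA -PE -QE => /(_ tu szn).
  by alia.
have b1 : b = 0%Z.
  by have [//|b1] := Z.eq_dec b 0; case: excl; [apply: left1|apply: right1]; alia.
subst b; have QE := all_const Q0 Q1.
have P2 : all (fun c => 0 <=? c)%Z P.
  have [->//|[P' [p PE]]] := lastE P.
  have p0 : (0 <= p)%Z.
    have [//|p1] := Z_le_gt_dec 0 p; case: excl; [apply: (left p P') => //; alia|apply: right1; alia].
  rewrite PE all_rcons; apply/andP; split; first exact/Z.leb_le.
  have : desc (rcons P' p).
    by move: dP; rewrite PE -[rcons (rcons P' p) a]cats1 => /cat_sorted2[].
  move=> /desc_ge; apply: sub_all => c /Z.leb_le cp; apply/Z.leb_le; alia.
have PE := all_const P2 P0.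
exists (size P), (size Q).+1, a; rewrite {1}PE {1}QE; split => //; right.
case: (size P) PE szn => [|k] PE szn.
  have tu1' : TU 1 (nseq 1 0%Z ++ (- - a)%Z :: nseq (size Q) 0%Z).
    by move: tu1; rewrite {1}PE {1}QE /=; have -> : (- - a = a)%Z by alia.
  by have := unit_neg tu1' szn; alia.
have tu' : TU 2 (nseq k.+1 0%Z ++ (- - a)%Z :: nseq (size Q).+1 0%Z).
  by move: tu; rewrite {1}PE {1}QE /=; have -> : (- - a = a)%Z by alia.
by have := unit_neg tu' ltac:(alia); alia.
Qed.

(** The cases follow the last block of equal entries [-a]. What precedes it provides a second coatom
    unless the vector is a unit vector. If nothing precedes it, a second coatom is found at the left
    end only when that end is not forked; the constant vectors of type B remain. *)
Lemma case_right1 s a : ~~ dr -> size (rcons s (- a)%Z) = n -> TU 2 (rcons s (- a)%Z) ->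
  (0 < a)%Z -> desc (rcons s (- a)%Z) -> all (fun c => c <=? 0)%Z (rcons s (- a)%Z) ->
  unit_vector (rcons s (- a)%Z) \/ dl /\ rcons s (- a)%Z = nseq n (- a)%Z.
Proof.
move=> ndr sz tu a0 ds le0; have tu1 := TU_right1 ndr tu sz ltac:(alia).
have Na : (- - a = a)%Z by alia.
have [k [R [E gR]]] := desc_suffix ds.
case/lastP: R E gR => [|R b'] E gR.
  right; split; last first.
    have := sz; rewrite E size_nseq => ->; by [].
  apply: contraTT isT => ndl.
  have kn : k.+1 = n by rewrite -sz E size_nseq.
  have sE : s = nseq k (- a)%Z.
    by move: E; rewrite cat0s nseqSr cats1 => /rcons_inj[].
  move: tu1; rewrite sE Na -cats1 => tu1.
  have c0 := @covx_left1_base a (nseq k (- a)%Z) ndl ltac:(szl) ltac:(alia).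
  have c1 : covx (nseq k (- a)%Z ++ [:: a]) (nseq k (- a)%Z ++ [:: (1 - a)%Z]).
    have := @covx_right [::] (nseq k (- a)%Z) [::] a [::] (nseq k (- a)%Z) [::] (1 - a).
    by rewrite !cat0s !cats0; apply => //; rewrite ?all_nseq_lt //; try szl; alia.
  case: k kn sE tu1 c0 c1 {E} => [|k] kn sE tu1 c0 c1; first by alia.
  rewrite nseqSr -catA in tu1 c1.
  have c2 := @covx_swap_base (nseq k (- a)%Z) [::] (- a) a ltac:(szl) ltac:(alia).
  have := covx_uniq tu1 c1 c2 ltac:(szl) ltac:(szl).
  have -> : nseq k (- a)%Z ++ [:: a; (- a)%Z] = rcons (nseq k (- a)%Z) a ++ [:: (- a)%Z] by rewrite cat_rcons.
  by move=> /cat_last; alia.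
left; have [b bE] : exists b, b' = (- b)%Z by exists (- b')%Z; alia.
subst b'; move: gR; rewrite all_rcons => /andP[/Z.ltb_lt ba gR].
have b0 : (0 <= b)%Z.
  by move: le0; rewrite E all_cat all_rcons => /andP[/andP[/Z.leb_le] *]; alia.
have szn : (size R + k).+2 = n by rewrite -sz E; szl.
case: k E szn => [|k] E szn.
  have E' : rcons s (- a)%Z = R ++ [:: (- b)%Z; (- a)%Z] by rewrite E cat_rcons.
  have sE : s = rcons R (- b)%Z by move: E; rewrite cats1 => /rcons_inj[].
  have [b1|b1] := Z.eq_dec b 0.
    have RE : R = nseq (size R) 0%Z.
      apply: all_const; last first.
        by move: le0; rewrite E' all_cat => /andP[].
      have : desc (rcons R (- b)%Z).
        by move: ds; rewrite sE -cats1 => /cat_sorted2[].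
      by move=> /desc_ge; rewrite b1.
    exists (size R).+1, 0%N, (- a)%Z; split; last by rewrite E' {1}RE b1 nseqSr -catA.
    right; move: tu; rewrite E' {1}RE b1.
    have -> : nseq (size R) 0%Z ++ [:: (- 0)%Z; (- a)%Z] = nseq (size R).+1 0%Z ++ (- a)%Z :: nseq 0 0%Z.
      by rewrite nseqSr -catA.
    by move=> /unit_neg/(_ ltac:(alia)); alia.
  have c0 : covx (R ++ [:: a; (- b)%Z]) (R ++ [:: a; b]).
    have := @covx_right1_base (rcons R a) (- b) ndr ltac:(szl) ltac:(alia).
    by rewrite -!cats1 -!catA; have -> : (- - b = b)%Z by alia.
  have c1 := @covx_swap R [::] a (- b) R [::] a b c0 erefl ltac:(szl) ltac:(szl) ltac:(alia) ltac:(alia).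
  have c2 : covx (R ++ [:: (- b)%Z; (- a)%Z]) (R ++ [:: b; (- a)%Z]).
    have := @covx_up_right1 (rcons R (- b)%Z) a (rcons R b) a ndr.
    by rewrite -!cats1 -!catA; apply => //; try szl; alia.
  have c3 : covx (R ++ [:: (- b)%Z; (- a)%Z]) (R ++ [:: (- b)%Z; a]).
    have := @covx_right1_base (rcons R (- b)%Z) (- a) ndr ltac:(szl) ltac:(alia).
    by rewrite -!cats1 -!catA Na.
  rewrite E' in tu.
  have := covx_uniq tu c2 c3 ltac:(szl) ltac:(szl) => /cat_head; alia.
have sE : s = rcons R (- b)%Z ++ nseq k.+1 (- a)%Z.
  by move: E; rewrite (nseqSr k.+1) catA cats1 => /rcons_inj[].
move: tu1; rewrite sE Na cat_rcons -cats1 -catA cat_cons => tu1.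
have c0 := @covx_swap_base R (nseq k.+1 (- a)%Z) (- b) a ltac:(szl) ltac:(alia).
have c1 : covx (R ++ (- b)%Z :: nseq k.+1 (- a)%Z ++ [:: a]) (R ++ a :: nseq k.+1 (- a)%Z ++ [:: (- b)%Z]).
  have := @covx_right (rcons R (- b)%Z) (nseq k.+1 (- a)%Z) [::] a (rcons R a) (nseq k.+1 (- a)%Z) [::] (- b).
  by rewrite !cats0 !cat_rcons !size_rcons; apply => //; rewrite ?all_nseq_lt //; try szl; alia.
have c2 : covx (R ++ (- b)%Z :: nseq k.+1 (- a)%Z ++ [:: a]) (R ++ (- b)%Z :: nseq k (- a)%Z ++ [:: a; (- a)%Z]).
  have := @covx_swap_base (rcons R (- b)%Z ++ nseq k (- a)%Z) [::] (- a) a ltac:(szl) ltac:(alia).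
  by rewrite -!catA !cat_rcons nseqSr -catA.
have := covx_uniq tu1 c1 c2 ltac:(szl) ltac:(szl) => /cat_head; alia.
Qed.

(** The right fork changes the last two entries together. Constant vectors are excluded, unlike in
    type B: one reflection at the right end already creates the two positive entries on which the
    left fork acts. *)
Lemma case_right2 s a : dl -> dr -> size (rcons s (- a)%Z) = n -> TU 2 (rcons s (- a)%Z) ->
  desc (rcons s (- a)%Z) -> all (fun c => c <=? 0)%Z (rcons s (- a)%Z) -> (0 < a)%Z ->
  unit_vector (rcons s (- a)%Z).
Proof.
move=> Dl Dr sz tu ds le0 a0.
have n4 : (4 <= n)%N by apply: nd; rewrite Dr orbT.
have cert1 X c b : rcons s (- a)%Z = X ++ [:: (- c)%Z; (- b)%Z; (- a)%Z] ->
    (0 <= c)%Z -> (c < b)%Z -> (b <= a)%Z -> False.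
  move=> E c0 cb ba; rewrite E in tu sz.
  have c1 := @covx_swap_base X [:: b] (- c) a ltac:(move: sz; szl) ltac:(alia).
  have c2 := @covx_up_right2 (rcons X (- c)%Z) a b (rcons X a) (- c) b Dr.
  rewrite !cat_rcons in c2; have {}c2 := c2 c1 ltac:(move: sz; szl) ltac:(move: sz; szl) ltac:(alia) ltac:(alia).
  have c3 := @covx_right2_base (rcons X (- c)%Z) (- b) (- a) Dr; rewrite !cat_rcons in c3.
  have {}c3 := c3 ltac:(move: sz; szl) ltac:(alia).
  have := covx_uniq tu c2 c3 ltac:(move: sz; szl) ltac:(move: sz; szl) => /cat_head; alia.
have cert2 X b : rcons s (- a)%Z = X ++ [:: (- b)%Z; (- b)%Z; (- a)%Z] ->
    (0 < b)%Z -> (b < a)%Z -> False.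
  move=> E b0 ba; rewrite E in tu sz.
  have c0 : covx (X ++ [:: a; (- b)%Z; b]) (X ++ [:: a; b; (- b)%Z]).
    have := @covx_swap_base (rcons X a) [::] (- b) b; rewrite !cat_rcons.
    by apply; [move: sz; szl|alia].
  have c1 := @covx_swap X [:: b] a (- b) X [:: (- b)%Z] a b c0 erefl
    ltac:(move: sz; szl) ltac:(move: sz; szl) ltac:(alia) ltac:(alia).
  have c2 := @covx_up_right2 (rcons X (- b)%Z) a b (rcons X b) a (- b) Dr.
  rewrite !cat_rcons in c2; have {}c2 := c2 c1 ltac:(move: sz; szl) ltac:(move: sz; szl) ltac:(alia) ltac:(alia).
  have c3 := @covx_right2_base (rcons X (- b)%Z) (- b) (- a) Dr; rewrite !cat_rcons in c3.
  have {}c3 := c3 ltac:(move: sz; szl) ltac:(alia).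
  have := covx_uniq tu c2 c3 ltac:(move: sz; szl) ltac:(move: sz; szl) => /cat_head; alia.
have [k [R [E gR]]] := desc_suffix ds.
have szR : (size R + k.+1)%N = n by rewrite -sz E; szl.
have negE (z : Z) : exists b, z = (- b)%Z by exists (- z)%Z; alia.
have Na : (- - a = a)%Z by alia.
case: k E szR => [|[|k]] E szR.
- have [RE|[R1 [b' RE]]] := lastE R; first by move: szR; rewrite RE /=; alia.
  have [R1E|[R2 [c' R1E]]] := lastE R1; first by move: szR; rewrite RE R1E /=; alia.
  have [b bE] := negE b'; have [c cE] := negE c'; subst b' c'.
  have E' : rcons s (- a)%Z = R2 ++ [:: (- c)%Z; (- b)%Z; (- a)%Z].
    by rewrite E RE R1E !cat_rcons.
  move: gR; rewrite RE all_rcons => /andP[/Z.ltb_lt ba _].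
  have dR : desc (rcons (rcons R2 (- c)%Z) (- b)%Z).
    by move: ds; rewrite E RE R1E => /cat_sorted2[].
  have := desc_ge dR; rewrite all_rcons => /andP[/Z.leb_le cb bR].
  move: le0; rewrite E' all_cat => /andP[le0 /= /and4P[/Z.leb_le c0 /Z.leb_le b0 _ _]].
  have [b1|b1] := Z.eq_dec b 0; last first.
    have [cb'|cb'] := Z.eq_dec c b; last by case: (cert1 R2 c b E'); alia.
    by case: (cert2 R2 b); [rewrite E' cb'|alia|alia].
  subst b; have R2E : R2 = nseq (size R2) 0%Z by apply: all_const.
  have c1 : c = 0%Z by alia.
  have szR2 : (size R2).+3 = n by rewrite -szR RE R1E; szl.
  have E2 : rcons s (- a)%Z = nseq (size R2).+2 0%Z ++ (- a)%Z :: nseq 0 0%Z.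
    by rewrite E' c1 {1}R2E !(nseqSr _.+1) !nseqSr -!catA.
  rewrite -E' E2; exists (size R2).+2, 0%N, (- a)%Z; split => //; right.
  by move: tu; rewrite E2 => /unit_neg/(_ ltac:(alia)); alia.
- have [RE|[R1 [c' RE]]] := lastE R; first by move: szR; rewrite RE /=; alia.
  have [c cE] := negE c'; subst c'.
  move: gR; rewrite RE all_rcons => /andP[/Z.ltb_lt ca _].
  case: (cert1 R1 c a); rewrite ?E ?RE ?cat_rcons //; try alia.
  by move: le0; rewrite E RE all_cat all_rcons => /andP[/andP[/Z.leb_le] *]; alia.
have sE : rcons s (- a)%Z = (R ++ nseq k.+1 (- a)%Z) ++ [:: (- a)%Z; (- a)%Z].
  by rewrite E (nseqSr k.+2) (nseqSr k.+1) -!catA.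
have tu1 : TU 1 (R ++ nseq k.+1 (- a)%Z ++ [:: a; a]).
  have := @TU_right2 1 (R ++ nseq k.+1 (- a)%Z) (- a) (- a) Dr.
  by rewrite -sE Na -catA; apply => //; alia.
have [RE|[R1 [b' RE]]] := lastE R.
  move: tu1 szR; rewrite RE cat0s add0n => tu1 szR.
  have c0 := @covx_left2_base a a (nseq k.+1 (- a)%Z) Dl ltac:(szl) ltac:(alia).
  have c1 : covx (a :: nseq k.+1 (- a)%Z ++ [:: a]) ((1 - a)%Z :: nseq k.+1 (- a)%Z ++ [:: (1 - a)%Z]).
    have := @covx_right [:: a] (nseq k.+1 (- a)%Z) [::] a [:: (1 - a)%Z] (nseq k.+1 (- a)%Z) [::] (1 - a).
    by rewrite !cats0; apply => //; rewrite ?all_nseq_lt //; try szl; alia.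
  have c2 : covx (nseq k.+1 (- a)%Z ++ [:: a; a]) (nseq k.+1 (- a)%Z ++ [:: (1 - a)%Z; (1 - a)%Z]).
    have := @covx_right [::] (nseq k.+1 (- a)%Z) [:: a] a [::] (nseq k.+1 (- a)%Z) [:: (1 - a)%Z] (1 - a).
    by rewrite !cat0s; apply => //; rewrite ?all_nseq_lt //; try szl; alia.
  have c3 : covx (nseq k.+1 (- a)%Z ++ [:: a; a]) (nseq k (- a)%Z ++ [:: a; (- a)%Z; a]).
    have := @covx_swap_base (nseq k (- a)%Z) [:: a] (- a) a ltac:(szl) ltac:(alia).
    by rewrite nseqSr -catA.
  have := covx_uniq tu1 c2 c3 ltac:(szl) ltac:(szl).
  by rewrite nseqSr -catA => /cat_head; alia.
have [b bE] := negE b'; subst b'.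
move: gR; rewrite RE all_rcons => /andP[/Z.ltb_lt ba _].
have b0 : (0 <= b)%Z.
  by move: le0; rewrite E RE all_cat all_rcons => /andP[/andP[/Z.leb_le] *]; alia.
have szR1 : (size R1 + k.+4)%N = n by rewrite -szR RE; szl.
move: tu1; rewrite RE cat_rcons => tu1.
have c0 := @covx_swap_base R1 (nseq k.+1 (- a)%Z ++ [:: a]) (- b) a ltac:(szl) ltac:(alia).
have c1 : covx (R1 ++ (- b)%Z :: nseq k.+1 (- a)%Z ++ [:: a; a])
    (R1 ++ a :: nseq k.+1 (- a)%Z ++ [:: (- b)%Z; a]).
  have := @covx_right (rcons R1 (- b)%Z) (nseq k.+1 (- a)%Z) [:: a] a (rcons R1 a) (nseq k.+1 (- a)%Z) [:: a] (- b).
  by rewrite !cat_rcons !size_rcons; apply => //; rewrite ?all_nseq_lt //; try szl; alia.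
have c2 : covx (R1 ++ (- b)%Z :: nseq k.+1 (- a)%Z ++ [:: a; a])
    (R1 ++ (- b)%Z :: nseq k (- a)%Z ++ [:: a; (- a)%Z; a]).
  have := @covx_swap_base (rcons R1 (- b)%Z ++ nseq k (- a)%Z) [:: a] (- a) a ltac:(szl) ltac:(alia).
  by rewrite -!catA !cat_rcons nseqSr -catA.
have := covx_uniq tu1 c1 c2 ltac:(szl) ltac:(szl) => /cat_head; alia.
Qed.

Definition in01 (x : seq Z) : bool := all (fun c => (0 <=? c) && (c <=? 1))%Z x.

Lemma desc_in01 a s : desc (a :: s) -> all (fun c => 0 <=? c)%Z (a :: s) -> (a <= 1)%Z ->
  in01 (a :: s).
Proof.
move=> ds /= /andP[/Z.leb_le a0 H] a1; rewrite /in01 /=; apply/andP; split.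
  by apply/andP; split; apply/Z.leb_le.
have le := desc_le ds; elim: s H le {ds} => //= c s IH /andP[c0 /IH H] /andP[/Z.leb_le ca /H ->].
by rewrite c0 andbT /=; apply/Z.leb_le; alia.
Qed.

(** An entry [a >= 2] in front is reflected to [1 - a], which is below all other entries. It can be
    carried past the block of entries [a], and what follows that block yields a second coatom. *)
Lemma case_left1 a s : ~~ dl -> ~~ dr -> size (a :: s) = n -> TU 2 (a :: s) ->
  desc (a :: s) -> all (fun c => 0 <=? c)%Z (a :: s) -> (1 <= a)%Z -> in01 (a :: s).
Proof.
move=> ndl ndr sz tu ds ge0 a1.
have [a2|a2] := Z_le_gt_dec a 1; first exact: desc_in01.
have tu1 := TU_left1 ndl tu sz a1.
have [k [R [E lR]]] := desc_prefix ds.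
have szR : (k.+1 + size R)%N = n by rewrite -sz E; szl.
have sE : s = nseq k a ++ R by move: E => [].
case: R lR E szR sE => [|b R] lR E szR sE.
  rewrite cats0 in sE; rewrite sE in tu1; rewrite addn0 in szR.
  have c0 := @covx_right1_base (nseq k a) (1 - a) ndr ltac:(szl) ltac:(alia).
  rewrite -!cats1 in c0.
  have c1 : covx ((1 - a)%Z :: nseq k a) ((- (1 - a))%Z :: nseq k a).
    have := @covx_left [::] (nseq k a) [::] (1 - a) [::] (nseq k a) [::] (- (1 - a)).
    by rewrite !cat0s !cats0; apply => //; rewrite ?all_nseq_gt //; try szl; alia.
  case: k szR {E} sE tu1 c0 c1 => [|k] szR sE tu1 c0 c1; first by alia.
  have c2 := @covx_swap_base [::] (nseq k a) (1 - a) a ltac:(szl) ltac:(alia).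
  have := covx_uniq tu1 c1 c2 ltac:(szl) ltac:(szl) => -[]; alia.
move: lR => /= /andP[/Z.ltb_lt ba lR].
have b0 : (0 <= b)%Z.
  by move: ge0; rewrite E all_cat => /andP[_ /= /andP[/Z.leb_le]].
rewrite sE in tu1 tu; move: szR => /= szR.
have c0 := @covx_swap_base (nseq k a) R (1 - a) b ltac:(szl) ltac:(alia).
have c1 : covx ((1 - a)%Z :: nseq k a ++ b :: R) (b :: nseq k a ++ (1 - a)%Z :: R).
  have := @covx_left [::] (nseq k a) (b :: R) (1 - a) [::] (nseq k a) ((1 - a)%Z :: R) b.
  by rewrite !cat0s; apply => //; rewrite ?all_nseq_gt //; try szl; alia.
have [b1|b1] := Z.eq_dec b 0.
  subst b.
  have c2 := @covx_up_left1 (1 - a) _ 0 _ ndl c1 ltac:(szl) ltac:(szl) ltac:(alia) ltac:(alia).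
  have c3 := @covx_left1_base a (nseq k a ++ 0%Z :: R) ndl ltac:(szl) ltac:(alia).
  have aE : (1 - (1 - a) = a)%Z by alia.
  rewrite aE in c2.
  have := covx_uniq tu c2 c3 ltac:(szl) ltac:(szl) => -[]; alia.
case: k szR {E} sE tu tu1 c0 c1 => [|k] szR sE tu tu1 c0 c1; last first.
  have c2 := @covx_swap_base [::] (nseq k a ++ b :: R) (1 - a) a ltac:(szl) ltac:(alia).
  have := covx_uniq tu1 c1 c2 ltac:(szl) ltac:(szl) => -[]; alia.
have d0 := @covx_left1_base b ((1 - a)%Z :: R) ndl ltac:(szl) ltac:(alia).
have d1 := @covx_swap [::] R b (1 - a) [::] R (1 - b) (1 - a) d0 erefl ltac:(szl) ltac:(szl) ltac:(alia) ltac:(alia).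
have d2 := @covx_up_left1 (1 - a) (b :: R) (1 - a) ((1 - b)%Z :: R) ndl d1 ltac:(szl) ltac:(szl) ltac:(alia) ltac:(alia).
have d3 := @covx_left1_base a (b :: R) ndl ltac:(szl) ltac:(alia).
have aE : (1 - (1 - a) = a)%Z by alia.
rewrite aE in d2.
have := covx_uniq tu d2 d3 ltac:(szl) ltac:(szl) => -[]; alia.
Qed.

(* tauv and etav realize the exchange of the two nodes of a forked end, 0 and 1
   resp. n - 1 and n. *)
Definition tauv (x : seq Z) : seq Z := if x is a :: s then (1 - a)%Z :: s else x.
Definition etav (x : seq Z) : seq Z :=
  rev (if rev x is a :: s then (- a)%Z :: s else [::]).

Lemma etav_rcons s a : etav (rcons s a) = rcons s (- a)%Z.
Proof. by rewrite /etav rev_rcons rev_cons revK. Qed.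

Lemma size_tauv x : size (tauv x) = size x.
Proof. by case: x. Qed.

Lemma size_etav x : size (etav x) = size x.
Proof. by case/lastP: x => // s a; rewrite etav_rcons !size_rcons. Qed.

Lemma tauvK : involutive tauv.
Proof. by case=> //= a s; congr cons; lia. Qed.

Lemma etavK : involutive etav.
Proof. by case/lastP => // s a; rewrite !etav_rcons; congr rcons; lia. Qed.

Definition swapn (p q k : nat) : nat := if k == p then q else if k == q then p else k.

Lemma coord_tau x k : dl -> size x = n -> (k <= n)%N ->
  coord (tauv x) k = coord x (swapn 0 1 k).
Proof.
move=> Dl; have n4 : (4 <= n)%N by apply: nd; rewrite Dl.
case: x => [|a [|b s]] /= sz kn; try by lia.
rewrite /coord /lin /swapn Dl; case: k kn => [|[|k]] kn /=.
- have -> : (1%N == n) = false by lia.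
  by rewrite /=; lia.
- have -> : (1%N == n) = false by lia.
  by rewrite /=; lia.
- case: eqP => kE.
    have -> : (n - 2)%N = (n - 3).+1 by lia.
    by have -> : (n - 1)%N = (n - 2).+1 by lia.
  by [].
Qed.

Lemma coord_eta x k : dr -> size x = n -> (k <= n)%N ->
  coord (etav x) k = coord x (swapn n.-1 n k).
Proof.
move=> Dr; have n4 : (4 <= n)%N by apply: nd; rewrite Dr orbT.
case/lastP: x => [|s b] sz kn; first by move: sz => /=; lia.
case/lastP: s sz => [|s a] sz; first by move: sz => /=; lia.
rewrite etav_rcons; have nE : n = (size s).+2 by rewrite -sz !size_rcons.
have nth_lt (u v : Z) i : (i < size s)%N -> nth 0%Z (rcons (rcons s u) v) i = nth 0%Z s i.
  by move=> lt; rewrite !nth_rcons size_rcons lt ltnS (ltnW lt).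
have nth0_ (u v : Z) : nth 0%Z (rcons (rcons s u) v) (size s) = u.
  by rewrite !nth_rcons size_rcons ltnS leqnn ltnn eqxx.
have nth1_ (u v : Z) : nth 0%Z (rcons (rcons s u) v) (size s).+1 = v.
  by rewrite nth_rcons size_rcons ltnn eqxx.
have n0 : (n == 0%N) = false by lia.
rewrite /swapn; have [k1|k1] := eqVneq k n.-1.
  rewrite /coord /lin k1 Dr eqxx n0.
  have -> : (n.-1 == 0%N) = false by lia.
  have -> : (n.-1 == n) = false by lia.
  have -> : (n.-1 - 1)%N = size s by lia.
  have -> : n.-1 = (size s).+1 by lia.
  have -> : (n - 2)%N = size s by lia.
  have -> : (n - 1)%N = (size s).+1 by lia.
  by rewrite !nth0_ !nth1_; lia.
have [k2|k2] := eqVneq k n.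
  rewrite /coord /lin k2 Dr eqxx n0.
  have -> : (n.-1 == 0%N) = false by lia.
  have -> : (n.-1 == n) = false by lia.
  have -> : (n.-1 - 1)%N = size s by lia.
  have -> : n.-1 = (size s).+1 by lia.
  have -> : (n - 2)%N = size s by lia.
  have -> : (n - 1)%N = (size s).+1 by lia.
  by rewrite !nth0_ !nth1_; lia.
rewrite /coord /lin (negbTE k2); case: eqP => k0; first by rewrite !nth_lt //; lia.
have [k3|k3] := eqVneq k (size s); last by rewrite !nth_lt //; lia.
by rewrite k3 !nth0_ !nth_lt //; lia.
Qed.

Lemma swapn_le p q k : (p <= n)%N -> (q <= n)%N -> (k <= n)%N -> (swapn p q k <= n)%N.
Proof. by rewrite /swapn; case: ifP => // _; case: ifP. Qed.


Lemma cartan_flip p q f : (p <= n)%N -> (q <= n)%N ->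
  (forall j x, (j <= n)%N -> lin (swapn p q j) (fun k => if k == f then - x k else x k)%Z = lin j x) ->
  (forall i k, (i <= n)%N -> (k < n)%N ->
     rho (swapn p q i) k = if k == f then (- rho i k)%Z else rho i k) ->
  forall i j, (i <= n)%N -> (j <= n)%N -> cartan (swapn p q i) (swapn p q j) = cartan i j.
Proof.
move=> pn qn Hl Hr i j iN jN; rewrite /cartan -[in RHS]Hl //; congr (- _)%Z.
by apply: lin_ext => [|k kn]; [exact: swapn_le|exact: Hr].
Qed.

Lemma cartan_tau i j : dl -> (i <= n)%N -> (j <= n)%N ->
  cartan (swapn 0 1 i) (swapn 0 1 j) = cartan i j.
Proof.
move=> Dl; have n4 : (4 <= n)%N by apply: nd; rewrite Dl.
have n1 : (1%N == n) = false by lia.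
apply: (cartan_flip (f := 0%N)); try lia.
  move=> {}j x jN; rewrite /lin /swapn Dl; case: j jN => [|[|j]] jN //=; rewrite ?n1 //=; rewrite ?subnn; try lia.
  have -> : (n - 2 == 0)%N = false by lia.
  have -> : (n - 1 == 0)%N = false by lia.
  by rewrite subn1.
move=> {}i k iN kn; rewrite /rho /swapn Dl; case: i iN => [|[|i]] iN; rewrite /= ?n1 //=.
- by case: k kn => [|[|k]].
- by case: k kn => [|[|k]].
case: k kn => [|k] kn //=; case: ifP => _.
  have -> : (0 == n - 1)%N = false by lia.
  have -> : (0 == n - 2)%N = false by lia.
  by rewrite andbF.
by [].
Qed.

Lemma cartan_eta i j : dr -> (i <= n)%N -> (j <= n)%N ->
  cartan (swapn n.-1 n i) (swapn n.-1 n j) = cartan i j.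
Proof.
move=> Dr; have n4 : (4 <= n)%N by apply: nd; rewrite Dr orbT.
have n0 : (n == 0)%N = false by lia.
have n1 : (n.-1 == 0)%N = false by lia.
have n3 : (n.-1 == n)%N = false by lia.
have e1 : (n.-1 - 1)%N = (n - 2)%N by lia.
have e2 : n.-1 = (n - 1)%N by lia.
have e3 : (n - 2 == n - 1)%N = false by lia.
apply: (cartan_flip (f := (n - 1)%N)); try lia.
  move=> {}j x jN; rewrite /lin /swapn Dr.
  have [->|j1] := eqVneq j n.-1; first by rewrite n0 n1 n3 ?eqxx e1 e2 e3 ?eqxx; lia.
  have [->|j2] := eqVneq j n; first by rewrite n0 n1 n3 ?eqxx e1 e2 e3 ?eqxx; lia.
  rewrite (negbTE j2).
  have -> : (j == n - 1)%N = false by lia.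
  have -> : (j - 1 == n - 1)%N = false by lia.
  have -> : (0 == n - 1)%N = false by lia.
  by have -> : (1 == n - 1)%N = false by lia.
move=> {}i k iN kn; rewrite /rho /swapn Dr andbF.
have [->|i1] := eqVneq i n.-1.
  rewrite n0 n1 n3 ?eqxx e1 -e2 /=.
  by have [->|k1] := eqVneq k n.-1; rewrite ?e2 1?eq_sym ?e3.
have [->|i2] := eqVneq i n.
  rewrite n0 n1 n3 ?eqxx e1 -e2 /=.
  by have [->|k1] := eqVneq k n.-1; rewrite ?e2 1?eq_sym ?e3.
rewrite (negbTE i2); case: (k =P (n - 1)%N) => [->|//].
have -> : (n - 1 == 0)%N = false by lia.
have -> : (n - 1 == 1)%N = false by lia.
have -> : (n - 1 == i - 1)%N = false by lia.
have -> : (n - 1 == i)%N = false by lia.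
by rewrite andbF; case: ifP.
Qed.

Definition swap_node p q (i : I) : I := inord (swapn p q i).

Lemma swapnK p q : involutive (swapn p q).
Proof.
move=> k; rewrite /swapn; have [->|kp] := eqVneq k p.
  by rewrite eqxx; case: eqP.
by have [->|kq] := eqVneq k q; rewrite ?eqxx // (negbTE kp) (negbTE kq).
Qed.

Lemma swap_nodeK p q : (p <= n)%N -> (q <= n)%N -> involutive (swap_node p q).
Proof.
move=> pn qn i; apply: val_inj; have iN : (i <= n)%N by rewrite -ltnS.
by rewrite /= !inordK ?swapnK // ltnS !swapn_le.
Qed.

Lemma swap_nodeA p q : (p <= n)%N -> (q <= n)%N ->
  (forall i j, (i <= n)%N -> (j <= n)%N -> cartan (swapn p q i) (swapn p q j) = cartan i j) ->
  forall i j, A (swap_node p q i) (swap_node p q j) = A i j.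
Proof.
move=> pn qn H i j; have iN : (i <= n)%N by rewrite -ltnS.
have jN : (j <= n)%N by rewrite -ltnS.
by rewrite /A !inordK ?H // ltnS swapn_le.
Qed.

Lemma cst_swap x y p q : (p <= n)%N -> (q <= n)%N ->
  (forall k, (k <= n)%N -> coord y k = coord x (swapn p q k)) -> cst y = cst x \o swap_node p q.
Proof.
move=> pn qn H; apply: funext => i; have iN : (i <= n)%N by rewrite -ltnS.
by rewrite /cst /= inordK ?ltnS ?swapn_le // -H.
Qed.

Lemma cst_tau x : dl -> size x = n -> cst (tauv x) = cst x \o swap_node 0 1.
Proof. by move=> Dl sx; apply: cst_swap => [||k kn]; [lia|lia|exact: coord_tau]. Qed.

Lemma cst_eta x : dr -> size x = n -> cst (etav x) = cst x \o swap_node n.-1 n.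
Proof. by move=> Dr sx; apply: cst_swap => [||k kn]; [lia|lia|exact: coord_eta]. Qed.

Lemma tau_A : dl -> forall i j, A (swap_node 0 1 i) (swap_node 0 1 j) = A i j.
Proof. by move=> Dl; apply: swap_nodeA => [||i j]; [lia|lia|exact: cartan_tau]. Qed.

Lemma eta_A : dr -> forall i j, A (swap_node n.-1 n i) (swap_node n.-1 n j) = A i j.
Proof. by move=> Dr; apply: swap_nodeA => [||i j]; [lia|lia|exact: cartan_eta]. Qed.

Lemma TU_tau K x : dl -> size x = n -> TU K x -> TU K (tauv x).
Proof.
move=> Dl sx tu; rewrite cst_tau //; apply: topuniq_sym tu; last exact: tau_A.
by apply: swap_nodeK; lia.
Qed.

Lemma TU_eta K x : dr -> size x = n -> TU K x -> TU K (etav x).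
Proof.
move=> Dr sx tu; rewrite cst_eta //; apply: topuniq_sym tu; last exact: eta_A.
by apply: swap_nodeK; lia.
Qed.

Lemma covx_tau x y : dl -> size x = n -> size y = n -> covx x y -> covx (tauv x) (tauv y).
Proof.
move=> Dl sx sy c; rewrite /covx !cst_tau //; apply: cov_sym c; last exact: tau_A.
by apply: swap_nodeK; lia.
Qed.

(** The exceptional vector is the image under [tauv] of the unit vector with first entry -1. *)
Lemma case_left2 a b R : dl -> size [:: a, b & R] = n -> TU 2 [:: a, b & R] ->
  desc [:: a, b & R] -> all (fun c => 0 <=? c)%Z [:: a, b & R] -> (2 <= a + b)%Z ->
  in01 [:: a, b & R] \/ [:: a, b & R] = 2%Z :: nseq n.-1 0%Z.
Proof.
move=> Dl sz tu ds ge0 ab; have n4 : (4 <= n)%N by apply: nd; rewrite Dl.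
have tu1 := TU_left2 Dl tu sz ab.
have [a1|a1] := Z_le_gt_dec a 1; first by left; apply: desc_in01.
have := ds; rewrite /= => /andP[/Z.leb_le ba dbR].
have := ge0 => /= /and3P[/Z.leb_le a0 /Z.leb_le b0 R0].
have aE : (1 - (1 - a) = a)%Z by alia.
have bE : (1 - (1 - b) = b)%Z by alia.
have [b1|b1] := Z.eq_dec b 0.
  subst b; have RE : R = nseq (size R) 0%Z by apply: all_const => //; apply: desc_le dbR.
  right; have a2 : a = 2%Z.
    have [//|a3] := Z.eq_dec a 2; have szR : (size R).+2 = n by [].
    (* Firing 0 and applying [tauv] gives entries 0 and [1 - a] followed by zeros, so [unit_neg]
       forces [a = 2]. *)
    have : TU 1 (nseq 1 0%Z ++ (- (a - 1))%Z :: nseq (size R) 0%Z).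
      have := TU_tau Dl _ tu1; rewrite /tauv {2}RE /=.
      have -> : (1 - (1 - 0) = 0)%Z by [].
      have -> : (- (a - 1) = 1 - a)%Z by alia.
      exact.
    by move=> /unit_neg/(_ szR); alia.
  by rewrite a2 {1}RE -{1}sz.
case: R sz tu tu1 ds ge0 R0 dbR => [|c R] sz tu tu1 ds ge0 R0 dbR; first by move: sz => /=; alia.
have cb : (c <= b)%Z by move: dbR => /= /andP[/Z.leb_le].
have c0 : (0 <= c)%Z by move: R0 => /= /andP[/Z.leb_le].
have szR : (size R).+3 = n by [].
have d0 := @covx_left2_base a b (c :: R) Dl sz ab.
have [cb'|cb'] := Z.eq_dec c b; last first.
  have e0 := @covx_swap_base [:: (1 - b)%Z] R (1 - a) c ltac:(szl) ltac:(alia).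
  have e1 := covx_up_left2 Dl e0 ltac:(szl) ltac:(szl) ltac:(alia) ltac:(alia).
  rewrite aE bE in e1.
  have := covx_uniq tu e1 d0 ltac:(szl) ltac:(szl) => -[]; alia.
subst c; have [ba'|ba'] := Z.eq_dec a b; last first.
  have e0 := @covx_swap_base [::] ((1 - a)%Z :: R) (1 - b) b ltac:(szl) ltac:(alia).
  have e1 := @covx_swap [:: (1 - b)%Z] R b (1 - a) [:: b] R (1 - b) (1 - a) e0 erefl
    ltac:(szl) ltac:(szl) ltac:(alia) ltac:(alia).
  have e2 := covx_up_left2 Dl e1 ltac:(szl) ltac:(szl) ltac:(alia) ltac:(alia).
  rewrite aE bE in e2.
  have := covx_uniq tu e2 d0 ltac:(szl) ltac:(szl) => -[]; alia.
subst b; have [k [R' [E lR]]] := desc_prefix ds.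
case: k E => [|[|k]] E.
- by move: E lR => [<-] /= /andP[/Z.ltb_lt]; alia.
- by move: E lR => [<-] /= /andP[/Z.ltb_lt]; alia.
have RE : a :: R = nseq k.+1 a ++ R' by move: E => [->].
rewrite RE in tu1.
have szR' : (k.+3 + size R')%N = n by rewrite -szR; have := congr1 size RE; rewrite size_cat size_nseq /=; alia.
have e2 := @covx_swap_base [:: (1 - a)%Z] (nseq k a ++ R') (1 - a) a ltac:(szl) ltac:(alia).
case: R' RE lR szR' {E} tu1 e2 => [|b' R'] RE lR szR' tu1 e2.
  rewrite !cats0 in tu1 e2; rewrite addn0 in szR'.
  have [Dr|ndr] := boolP dr.
    have f0 := @covx_right2_base (nseq k.+1 a) (1 - a) (1 - a) Dr ltac:(szl) ltac:(alia).
    have f1 : covx ((1 - a)%Z :: nseq k.+1 a ++ [:: (1 - a)%Z])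
        ((- (1 - a))%Z :: nseq k.+1 a ++ [:: (- (1 - a))%Z]).
      have := @covx_left [::] (nseq k.+1 a) [:: (1 - a)%Z] (1 - a) [::] (nseq k.+1 a) [:: (- (1 - a))%Z] (- (1 - a)).
      by rewrite !cat0s; apply => //; rewrite ?all_nseq_gt //; try szl; alia.
    have f2 : covx [:: (1 - a)%Z, (1 - a)%Z & nseq k.+1 a]
        [:: (- (1 - a))%Z, (- (1 - a))%Z & nseq k.+1 a].
      have := @covx_left [:: (1 - a)%Z] (nseq k.+1 a) [::] (1 - a) [:: (- (1 - a))%Z] (nseq k.+1 a) [::] (- (1 - a)).
      by rewrite !cats0; apply => //; rewrite ?all_nseq_gt //; try szl; alia.
    have := covx_uniq tu1 f2 e2 ltac:(szl) ltac:(szl) => -[]; alia.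
  have f0 := @covx_right1_base ((1 - a)%Z :: nseq k.+1 a) (1 - a) ndr ltac:(szl) ltac:(alia).
  rewrite -!cats1 in f0.
  have f2 : covx [:: (1 - a)%Z, (1 - a)%Z & nseq k.+1 a]
      [:: (1 - a)%Z, (- (1 - a))%Z & nseq k.+1 a].
    have := @covx_left [:: (1 - a)%Z] (nseq k.+1 a) [::] (1 - a) [:: (1 - a)%Z] (nseq k.+1 a) [::] (- (1 - a)).
    by rewrite !cats0; apply => //; rewrite ?all_nseq_gt //; try szl; alia.
  have := covx_uniq tu1 f2 e2 ltac:(szl) ltac:(szl) => -[]; alia.
move: lR => /= /andP[/Z.ltb_lt b'a _].
have b'0 : (0 <= b')%Z.
  have : b' \in a :: R by rewrite RE mem_cat mem_head orbT.
  by move/(allP R0)/Z.leb_le.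
have f0 := @covx_swap_base ((1 - a)%Z :: nseq k.+1 a) R' (1 - a) b' ltac:(move: szR'; szl) ltac:(alia).
have f1 : covx [:: (1 - a)%Z, (1 - a)%Z & nseq k.+1 a ++ b' :: R']
    [:: (1 - a)%Z, b' & nseq k.+1 a ++ (1 - a)%Z :: R'].
  have := @covx_left [:: (1 - a)%Z] (nseq k.+1 a) (b' :: R') (1 - a) [:: (1 - a)%Z] (nseq k.+1 a) ((1 - a)%Z :: R') b'.
  by apply => //; rewrite ?all_nseq_gt //; try (move: szR'; szl); alia.
have := covx_uniq tu1 f1 e2 ltac:(move: szR'; szl) ltac:(move: szR'; szl) => -[]; alia.
Qed.

(** * Classification up to the exchanges at forked ends *)

Definition uvec (x : seq Z) : Prop := exists p e,
  [/\ (p < n)%N, (e = 1 \/ e = -1)%Z & forall k, nth 0%Z x k = if k == p then e else 0%Z].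

Lemma unit_uvec x : size x = n -> unit_vector x -> uvec x.
Proof.
move=> + [p [r [e [eE xE]]]]; rewrite {}xE => sz; exists p, e; split => //.
  by rewrite -sz; szl.
move=> k; rewrite nth_cat size_nseq; case: ltnP => kp.
  by rewrite nth_nseq kp ltn_eqF.
have [->|kp'] := eqVneq k p; first by rewrite subnn.
have -> : (k - p)%N = (k - p).-1.+1 by lia.
by rewrite /= nth_nseq if_same.
Qed.

Lemma in01P x : in01 x <-> forall k, (0 <= nth 0 x k <= 1)%Z.
Proof.
split=> [/all_nthP H k|H].
  have [kx|kx] := ltnP k (size x); last by rewrite nth_default //; lia.
  by have := H 0%Z k kx => /andP[/Z.leb_le ? /Z.leb_le ?].
by apply/(all_nthP 0%Z) => k kx; have := H k; lia.
Qed.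

Lemma nth_tauv x k : size x = n ->
  nth 0%Z (tauv x) k = if k == 0%N then (1 - nth 0 x 0)%Z else nth 0%Z x k.
Proof. by case: x => [|a s] sz; [move: sz => /=; lia|case: k]. Qed.

Lemma nth_etav x k : size x = n ->
  nth 0%Z (etav x) k = if k == n.-1 then (- nth 0 x k)%Z else nth 0%Z x k.
Proof.
case/lastP: x => [|s a] sz; first by move: sz => /=; lia.
rewrite etav_rcons !nth_rcons; have -> : n.-1 = size s by rewrite -sz size_rcons.
by have [->|ks] := eqVneq k (size s); rewrite ?ltnn ?eqxx // (negbTE ks).
Qed.

Lemma uvec_eta x : size x = n -> uvec (etav x) -> uvec x.
Proof.
move=> sz [p [e [pn eE H]]].
have Hx k : nth 0%Z x k = if k == p then (if p == n.-1 then - e else e)%Z else 0%Z.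
  have := H k; rewrite nth_etav //; have [->|kp] := eqVneq k p.
    by case: (p == n.-1); lia.
  by case: (k == n.-1); lia.
exists p, (if p == n.-1 then - e else e)%Z; split => //.
by case: (p == n.-1); lia.
Qed.

Lemma tau_eta x : size x = n -> tauv (etav x) = etav (tauv x).
Proof.
move=> sz; apply: (@eq_from_nth _ 0%Z); first by rewrite !(size_tauv, size_etav).
move=> k _; rewrite !(nth_tauv, nth_etav) ?(size_tauv, size_etav) //.
have -> : (0 == n.-1)%N = false by lia.
by case: eqP => // ->; have -> : (0 == n.-1)%N = false by lia.
Qed.

Lemma in01_tau x : size x = n -> in01 (tauv x) -> in01 x.
Proof.
move=> sz /in01P H; apply/in01P => k; have := H k; rewrite nth_tauv //.
by case: eqP => [->|_]; lia.
Qed.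

(** The outcomes have different fates. Unit vectors contradict parity in types B and D; in type C
    they are 0-1 vectors or states of chain words. Zero-one vectors and the images under an exchange
    give proper support. The constant vectors of type B are excluded by counting. *)
Definition classified (x : seq Z) : Prop :=
  [\/ uvec x \/ in01 x, dl /\ uvec (tauv x), dr /\ in01 (etav x) |
      [/\ dl, ~~ dr & exists2 a, (0 < a)%Z & x = nseq n (- a)%Z \/ tauv x = nseq n (- a)%Z]].

Lemma classified_tau x : dl -> size x = n -> classified (tauv x) -> classified x.
Proof.
move=> Dl sz; rewrite /classified tauvK => -[[H|H]|[_ H]|[Dr H]|[_ ndr [a a0 H]]].
- by apply: Or42.
- by apply: Or41; right; apply: in01_tau.
- by apply: Or41; left.
- apply: Or43; split => //; apply: in01_tau; first by rewrite size_etav.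
  by rewrite tau_eta.
- by apply: Or44; split => //; exists a => //; tauto.
Qed.

Lemma classified_eta x : dr -> size x = n -> classified (etav x) -> classified x.
Proof.
move=> Dr sz; rewrite /classified etavK => -[[H|H]|[Dl H]|[_ H]|[_ ndr _]].
- by apply: Or41; left; apply: uvec_eta.
- by apply: Or43.
- apply: Or42; split => //; apply: uvec_eta; first by rewrite size_tauv.
  by rewrite -tau_eta.
- by apply: Or41; right.
- by rewrite Dr in ndr.
Qed.

Lemma desc_le0 c s : desc (c :: s) -> (c <= 0)%Z -> all (fun c => c <=? 0)%Z (c :: s).
Proof.
move=> /desc_le H c0; rewrite /=; apply/andP; split; first exact/Z.leb_le.
by apply: sub_all H => b /Z.leb_le bc; apply/Z.leb_le; lia.
Qed.

Lemma desc_ge0 s c : desc (rcons s c) -> (0 <= c)%Z -> all (fun c => 0 <=? c)%Z (rcons s c).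
Proof.
move=> /desc_ge H c0; rewrite all_rcons; apply/andP; split; first exact/Z.leb_le.
by apply: sub_all H => b /Z.leb_le bc; apply/Z.leb_le; lia.
Qed.

Lemma desc_rcons_neg s c d e : desc (rcons (rcons s c) d) -> (e <= c)%Z ->
  desc (rcons (rcons s c) e).
Proof.
case: s => [|b s] /=; first by move=> _ ec; rewrite andbT; apply/Z.leb_le.
by rewrite !rcons_path !last_rcons => /andP[-> _] ec; apply/Z.leb_le.
Qed.

(** Of the entries after the descent only the last can be negative, and only at a right fork, where
    [etav] changes its sign. *)
Lemma interior_normal P a b Q : size (P ++ [:: a, b & Q]) = n -> TU 2 (P ++ [:: a, b & Q]) ->
  (dl -> P <> [::]) -> (dr -> Q <> [::]) -> (a < b)%Z -> desc (rcons P a) -> desc (b :: Q) ->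
  all (fun c => c <=? 0)%Z (rcons P a) -> (0 <= coord (P ++ [:: a, b & Q]) n)%Z ->
  classified (P ++ [:: a, b & Q]).
Proof.
move=> sz tu Pdl Qdr ab dP dQ le0 cn.
have [a0 P0] : (a <= 0)%Z /\ all (fun c => c <=? 0)%Z P.
  by move: le0; rewrite all_rcons => /andP[/Z.leb_le].
have core Q' : size Q' = size Q -> TU 2 (P ++ [:: a, b & Q']) -> desc (b :: Q') ->
    (dr -> Q' <> [::]) -> all (fun c => 0 <=? c)%Z (b :: Q') -> classified (P ++ [:: a, b & Q']).
  move=> sQ tu' dQ' Qdr' /= /andP[/Z.leb_le b0 Q0].
  have sz' : size (P ++ [:: a, b & Q']) = n by move: sz; rewrite !size_cat /= sQ.
  by apply: Or41; left; apply: unit_uvec => //; apply: case_interior.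
have [Dr|ndr] := boolP dr; last first.
  apply: core => //; case/lastP: Q sz dQ cn {tu Qdr} => [|Q d] sz dQ cn.
    rewrite coord_right // (negbTE ndr) in cn.
    by rewrite /= andbT; apply/Z.leb_le; case: dl cn; lia.
  rewrite -rcons_cons; apply: desc_ge0; first by rewrite rcons_cons.
  case/lastP: Q sz dQ cn => [|Q c] sz dQ cn.
    move: cn; rewrite -[_ ++ _](cat_rcons a P [:: b; d]) coord_right ?cat_rcons //.
    by rewrite (negbTE ndr); case: dl; lia.
  have E : P ++ [:: a, b & rcons (rcons Q c) d] = (P ++ [:: a, b & Q]) ++ [:: c; d].
    by rewrite -!cats1 -!catA.
  move: cn; rewrite E coord_right; last by rewrite -E.
  by rewrite (negbTE ndr); case: dl; lia.
case/lastP: Q sz tu dQ cn core Qdr => [|Q d] sz tu dQ cn core Qdr; first by case: Qdr.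
have [c [Q1 QE]] : exists c Q1, b :: Q = rcons Q1 c.
  by case: (lastE (b :: Q)) => [//|[Q1 [c ->]]]; exists c, Q1.
have xE f : P ++ [:: a, b & rcons Q f] = (rcons P a ++ Q1) ++ [:: c; f].
  by rewrite -rcons_cons QE -!cats1 -!catA.
have cd : (0 <= c + d)%Z.
  by move: cn; rewrite xE coord_right -?xE // Dr.
have dc : (d <= c)%Z.
  by move: dQ; rewrite -rcons_cons QE => /desc_ge; rewrite all_rcons => /andP[/Z.leb_le].
have [d0|d0] := Z_le_gt_dec 0 d.
  apply: core => //; rewrite -rcons_cons; apply: desc_ge0 => //.
apply: (classified_eta Dr sz).
have E : etav (P ++ [:: a, b & rcons Q d]) = P ++ [:: a, b & rcons Q (- d)%Z].
  have H f : P ++ [:: a, b & rcons Q f] = rcons (P ++ [:: a, b & Q]) f.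
    by rewrite -!cats1 -catA.
  by rewrite !H etav_rcons.
have dQ' : desc (b :: rcons Q (- d)%Z).
  by move: dQ; rewrite -!rcons_cons QE => /desc_rcons_neg; apply; lia.
rewrite E; apply: core => //.
- by rewrite !size_rcons.
- by rewrite -E; apply: TU_eta.
- by case: (Q).
- by rewrite -rcons_cons; apply: desc_ge0; rewrite ?rcons_cons //; lia.
Qed.

(** Of the entries up to the descent only the first can be positive, and only at a left fork, where
    [tauv] repairs it. *)
Lemma interior_case P a b Q : size (P ++ [:: a, b & Q]) = n -> TU 2 (P ++ [:: a, b & Q]) ->
  (dl -> P <> [::]) -> (dr -> Q <> [::]) -> (a < b)%Z -> desc (rcons P a) -> desc (b :: Q) ->
  (0 <= coord (P ++ [:: a, b & Q]) 0)%Z -> (0 <= coord (P ++ [:: a, b & Q]) n)%Z ->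
  classified (P ++ [:: a, b & Q]).
Proof.
move=> sz tu Pdl Qdr ab dP dQ c0 cn.
have [Dl|ndl] := boolP dl; last first.
  apply: interior_normal => //; case: P sz tu dP c0 {Pdl cn} => [|p P] sz tu dP c0.
    rewrite coord_left (negbTE ndl) in c0.
    by rewrite /= andbT; apply/Z.leb_le; lia.
  rewrite rcons_cons; apply: desc_le0 => //.
  case: P sz dP c0 {tu} => [|q P] sz dP c0; by rewrite coord_left (negbTE ndl) in c0; lia.
case: P sz tu dP c0 cn Pdl => [|p P] sz tu dP c0 cn Pdl; first by case: Pdl.
have [r [P1 PE]] : exists r P1, rcons P a = r :: P1.
  by case: (P) => [|r P1]; [exists a, [::]|exists r, (rcons P1 a)].
have xE f : (f :: P) ++ [:: a, b & Q] = [:: f, r & P1 ++ b :: Q].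
  by rewrite /= -cat_rcons PE.
have pr : (p + r <= 1)%Z by move: c0; rewrite xE coord_left Dl; lia.
have rp : (r <= p)%Z by move: dP; rewrite rcons_cons PE => /= /andP[/Z.leb_le].
have [p0|p0] := Z_le_gt_dec p 0.
  by apply: interior_normal => //; rewrite rcons_cons; apply: desc_le0.
apply: (classified_tau Dl sz).
have E : tauv ((p :: P) ++ [:: a, b & Q]) = ((1 - p)%Z :: P) ++ [:: a, b & Q] by [].
have dP' : desc (rcons ((1 - p)%Z :: P) a).
  by move: dP; rewrite !rcons_cons PE /= => /andP[_ ->]; rewrite andbT; apply/Z.leb_le; lia.
rewrite E; apply: interior_normal => //.
- by rewrite -E; apply: TU_tau.
- by rewrite rcons_cons; apply: desc_le0 => //; lia.
- rewrite -E coord_tau //; have n4 : (4 <= n)%N by apply: nd; rewrite Dl.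
  rewrite /swapn; have -> : (n == 0)%N = false by lia.
  by have -> : (n == 1)%N = false by lia.
Qed.

Lemma left_case x : size x = n -> TU 2 x -> desc x -> (coord x 0 < 0)%Z -> (0 <= coord x n)%Z ->
  classified x.
Proof.
move=> sz tu ds c0 cn.
have core y : size y = n -> TU 2 y -> desc y -> (coord y 0 < 0)%Z ->
    all (fun c => 0 <=? c)%Z y -> classified y.
  case: y => [|a' [|b' R']] sz' tu' ds' c0' ge0; try by move: sz' => /=; lia.
  rewrite coord_left in c0'; have [Dl|ndl] := boolP dl; last first.
    rewrite (negbTE ndl) in c0'; apply: Or41; right; apply: case_left1 => //; last by lia.
    by apply/negP => /drl; apply/negP.
  rewrite Dl in c0'; have [|H|H] := @case_left2 a' b' R' Dl sz' tu' ds' ge0.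
  - by lia.
  - by apply: Or41; right.
  - apply: Or42; split => //; exists 0%N, (-1)%Z; split; [lia|by right|move=> k].
    by rewrite H; case: k => //= k; rewrite nth_nseq if_same.
case/lastP: x sz tu ds c0 cn => [|s d] sz tu ds c0 cn; first by move: sz => /=; lia.
case/lastP: s sz tu ds c0 cn => [|s c] sz tu ds c0 cn; first by move: sz => /=; lia.
have [Dr|ndr] := boolP dr; last first.
  apply: core => //; apply: desc_ge0 => //; move: cn; rewrite -cats1 cat_rcons coord_right.
    by rewrite (negbTE ndr); case: dl; lia.
  by move: sz; rewrite !size_rcons size_cat /=; lia.
have cd : (0 <= c + d)%Z.
  move: cn; rewrite -cats1 cat_rcons coord_right ?Dr //.
  by move: sz; rewrite !size_rcons size_cat /=; lia.
have [d0|d0] := Z_le_gt_dec 0 d; first by apply: core => //; apply: desc_ge0.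
have dc : (d <= c)%Z by move: (desc_ge ds); rewrite all_rcons => /andP[/Z.leb_le].
have ds' : desc (rcons (rcons s c) (- d)%Z) by apply: desc_rcons_neg ds _; lia.
apply: (classified_eta Dr sz); rewrite etav_rcons; apply: core => //.
- by move: sz; rewrite !size_rcons.
- by rewrite -etav_rcons; apply: TU_eta.
- rewrite -etav_rcons coord_eta // /swapn.
  have n4 : (4 <= n)%N by apply: nd; rewrite Dr orbT.
  have -> : (0 == n.-1)%N = false by lia.
  by have -> : (0 == n)%N = false by lia.
- by apply: desc_ge0 => //; lia.
Qed.

Lemma right_case x : size x = n -> TU 2 x -> desc x -> (coord x n < 0)%Z -> (0 <= coord x 0)%Z ->
  classified x.
Proof.
move=> sz tu ds cn c0.
have core y : size y = n -> TU 2 y -> desc y -> (coord y n < 0)%Z ->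
    all (fun c => c <=? 0)%Z y -> classified y.
  case/lastP: y => [|s d] sz' tu' ds' cn' le0; first by move: sz' => /=; lia.
  have [a aE] : exists a, d = (- a)%Z by exists (- d)%Z; lia.
  have a0 : (0 < a)%Z.
    case/lastP: s sz' tu' ds' cn' le0 => [|s c] sz' tu' ds' cn' le0; first by move: sz' => /=; lia.
    have cd : (d <= c)%Z by move: (desc_ge ds'); rewrite all_rcons => /andP[/Z.leb_le].
    move: cn'; rewrite -cats1 cat_rcons coord_right.
      by case: dr; [lia|case: dl; lia].
    by move: sz'; rewrite !size_rcons size_cat /=; lia.
  subst d; have [Dr|ndr] := boolP dr.
    by apply: Or41; left; apply: unit_uvec => //; apply: case_right2 => //; apply: drl.
  have [H|[Dl H]] := case_right1 ndr sz' tu' a0 ds' le0.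
    by apply: Or41; left; apply: unit_uvec.
  by apply: Or44; split => //; exists a => //; left.
case: x sz tu ds c0 cn => [|a [|b R]] sz tu ds c0 cn; try by move: sz => /=; lia.
have ba : (b <= a)%Z by move: ds => /= /andP[/Z.leb_le].
move: c0; rewrite coord_left; have [Dl|ndl] := boolP dl => c0; last first.
  by apply: core => //; apply: desc_le0 => //; lia.
have [a0|a0] := Z_le_gt_dec a 0; first by apply: core => //; apply: desc_le0.
apply: (classified_tau Dl sz).
have ds' : desc [:: (1 - a)%Z, b & R].
  by move: ds => /= /andP[_ ->]; rewrite andbT; apply/Z.leb_le; lia.
have n4 : (4 <= n)%N by apply: nd; rewrite Dl.
apply: core => //.
- exact: (TU_tau Dl sz tu).
- rewrite (coord_tau Dl sz (leqnn n)) /swapn; have -> : (n == 0)%N = false by lia.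
  by have -> : (n == 1)%N = false by lia.
- by apply: desc_le0 => //; lia.
Qed.

Lemma coord_interior x k : (0 < k < n)%N -> coord x k = (nth 0 x k.-1 - nth 0 x k)%Z.
Proof.
move=> kn; rewrite /coord /lin; have -> : (k == 0)%N = false by lia.
have -> : (k == n)%N = false by lia.
by rewrite subn1.
Qed.

Lemma descP x : size x = n -> (forall k, (0 < k < n)%N -> (0 <= coord x k)%Z) -> desc x.
Proof.
move=> sz H; apply/(sortedP 0%Z) => i; rewrite sz => iN; apply/Z.leb_le.
by have := H i.+1; rewrite coord_interior //= => /(_ iN); lia.
Qed.

Lemma split_at (x : seq Z) q : size x = n -> (0 < q < n)%N -> exists P a b Q,
  x = P ++ [:: a, b & Q] /\ size P = q.-1.
Proof.
move=> sz qn; exists (take q.-1 x), (nth 0%Z x q.-1), (nth 0%Z x q), (drop q.+1 x).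
have qE : q = q.-1.+1 by lia.
split; last by rewrite size_takel //; lia.
by rewrite -{1}(cat_take_drop q.-1 x) (drop_nth 0%Z) ?sz -?qE ?(drop_nth 0%Z (n := q)) ?sz //; lia.
Qed.

(** There is at most one descent. At a forked end, a descent at node 1 or [n.-1] is turned by [tauv]
    or [etav] into one at node 0 or [n], so only the interior and the two extreme nodes have to be
    treated. *)
Lemma classify x : size x = n -> TU 2 x -> classified x.
Proof.
move=> sz tu.
have left y : size y = n -> TU 2 y -> (coord y 0 < 0)%Z -> classified y.
  move=> sy tuy c0; apply: left_case => //; last by apply: (TU_neg tuy _ _ _ c0); lia.
  by apply: descP => // k kn; apply: (TU_neg tuy _ _ _ c0); lia.
have right y : size y = n -> TU 2 y -> (coord y n < 0)%Z -> classified y.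
  move=> sy tuy c0; apply: right_case => //; last by apply: (TU_neg tuy _ _ _ c0); lia.
  by apply: descP => // k kn; apply: (TU_neg tuy _ _ _ c0); lia.
have [[q [qn neg]]|no] := pselect (exists q, (q <= n)%N /\ (coord x q < 0)%Z); last first.
  have ge k : (k <= n)%N -> (0 <= coord x k)%Z.
    by move=> kn; have [//|lt] := Z_le_gt_dec 0 (coord x k); case: no; exists k; split => //; lia.
  have ds : desc x by apply: descP => // k kn; apply: ge; lia.
  apply: Or41; right; apply/in01P => k.
  have [kx|kx] := ltnP k n; last by rewrite nth_default ?sz //; lia.
  have mono i j : (i <= j < n)%N -> (nth 0 x j <= nth 0 x i)%Z.
    move=> /andP[ij]; elim: j ij => [|j IH] ij jn; first by move: ij; rewrite leqn0 => /eqP ->; lia.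
    move: ij; rewrite leq_eqVlt => /orP[/eqP ->|ij]; first by lia.
    by have := IH ltac:(lia) ltac:(lia); have := ge j.+1; rewrite coord_interior /=; lia.
  have := ge 0%N isT; have := ge n (leqnn n); rewrite /coord /lin eqxx /=.
  have -> : (n == 0)%N = false by lia.
  have := mono 0%N k ltac:(lia); have := mono k (n - 1)%N ltac:(lia).
  case Dl: dl => //=.
    have n4 : (4 <= n)%N by apply: nd; rewrite Dl.
    have := mono 0%N 1%N ltac:(lia); have := mono 1%N (n - 2)%N ltac:(lia).
    have := mono (n - 2)%N (n - 1)%N ltac:(lia).
    have [->|k0] := eqVneq k 0%N; first by case: dr; lia.
    have := mono 1%N k ltac:(lia).
    have [->|k1] := eqVneq k (n - 1)%N; first by case: dr; lia.
    by have := mono k (n - 2)%N ltac:(lia); case: dr; lia.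
  have ndr : dr = false by apply/negP => /drl; rewrite Dl.
  by rewrite ndr; lia.
have [q0|q0] := eqVneq q 0%N; first by apply: left => //; rewrite -q0.
have [q1|q1] := eqVneq q n; first by apply: right => //; rewrite -q1.
have [/andP[Dl /eqP qE]|nl] := boolP (dl && (q == 1)%N).
  apply: (classified_tau Dl sz); apply: left; rewrite ?size_tauv //; first exact: TU_tau.
  by rewrite coord_tau // /swapn /= -qE.
have [/andP[Dr /eqP qE]|nr] := boolP (dr && (q == n.-1)%N).
  apply: (classified_eta Dr sz); apply: right; rewrite ?size_etav //; first exact: TU_eta.
  rewrite coord_eta // /swapn eqxx; have -> : (n == n.-1)%N = false by lia.
  by rewrite -qE.
have ge k : (k <= n)%N -> k != q -> (0 <= coord x k)%Z.
  by move=> kn kq; apply: (TU_neg tu _ kn _ neg) => //; rewrite eq_sym.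
have qn' : (0 < q < n)%N by lia.
have [P [a [b [Q [xE sP]]]]] := split_at sz qn'.
have qE : q = (size P).+1 by lia.
move: sz tu neg ge; rewrite xE => sz tu neg ge.
have ab : (a < b)%Z by move: neg; rewrite qE coord_swap //; lia.
have szn : (size P + size Q).+2 = n by rewrite -sz size_cat /=; lia.
apply: interior_case => //.
- by move=> Dl PE; move: nl; rewrite Dl qE PE.
- by move=> Dr QE; move: nr; rewrite Dr qE -szn QE /= addn0 eqxx.
- apply/(sortedP 0%Z) => i; rewrite size_rcons => iN; apply/Z.leb_le.
  have := ge i.+1 ltac:(lia) ltac:(lia); rewrite coord_interior; last by lia.
  by rewrite -cat_rcons /= !(nth_cat 0%Z (rcons _ _)) size_rcons !ifT //; lia.
- apply/(sortedP 0%Z) => i iN; apply/Z.leb_le; rewrite /= in iN.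
  have := ge (size P + i.+2)%N ltac:(lia) ltac:(lia); rewrite coord_interior; last by lia.
  have -> : (size P + i.+2).-1 = (size P + i.+1)%N by lia.
  by rewrite !nth_cat !ifF; [rewrite !addKn /=; lia|lia|lia].
- by apply: ge; lia.
- by apply: ge; lia.
Qed.

(** * Sets of vectors stable under all reflections but one *)

Lemma nth_refl i x k : (i <= n)%N -> (k < n)%N -> nth 0%Z (refl i x) k =
  if i == 0%N then
    (if dl then if (k < 2)%N then 1 - nth 0 x (1 - k)%N else nth 0 x k
     else if k == 0%N then 1 - nth 0 x 0%N else nth 0 x k)%Z
  else if i == n then
    (if dr then if (n - 2 <= k)%N then - nth 0 x (2 * n - 3 - k)%N else nth 0 x k
     else if k == (n - 1)%N then - nth 0 x k else nth 0 x k)%Z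
  else nth 0%Z x (swapn i.-1 i k).
Proof.
move=> iN kn; rewrite nth_mkseq // /coord /lin /rho.
have n0 : (n == 0)%N = false by lia.
have [i0|i0] := eqVneq i 0%N.
  by case: dl; case: k kn => [|[|k]] kn /=; rewrite ?subn0 ?subnn; ring.
have [i1|i1] := eqVneq i n.
  have [->|k1] := eqVneq k (n - 1)%N.
    have -> : (n - 2 <= n - 1)%N by lia.
    have -> : (2 * n - 3 - (n - 1))%N = (n - 2)%N by lia.
    case Dr: dr; first by rewrite (drl Dr) /=; ring.
    by case: dl => /=; ring.
  case Dr: dr => /=; last by case: dl; ring.
  have [->|k2] := eqVneq k (n - 2)%N.
    have -> : (2 * n - 3 - (n - 2))%N = (n - 1)%N by lia.
    by rewrite leqnn; ring.
  have -> : (n - 2 <= k)%N = false by lia.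
  by ring.
rewrite subn1 /swapn; have [->|k1] := eqVneq k i.-1; first by ring.
by have [->|k2] := eqVneq k i; ring.
Qed.

Lemma uvec_refl x i : (0 < i <= n)%N -> uvec x -> uvec (refl i x).
Proof.
move=> iN [p [e [pn eE H]]].
have sr k : (n <= k)%N -> nth 0%Z (refl i x) k = 0%Z by move=> kn; rewrite nth_default ?size_refl.
have i0 : (i == 0)%N = false by lia.
have [iE|i1] := eqVneq i n; last first.
  have pn' : (swapn i.-1 i p < n)%N by rewrite /swapn; case: ifP => _; [lia|case: ifP; lia].
  exists (swapn i.-1 i p), e; split => // k; have [kn|kn] := ltnP k n; last first.
    by rewrite sr // gtn_eqF //; lia.
  rewrite nth_refl //; last by lia.
  by rewrite i0 (negbTE i1) H (inv_eq (@swapnK i.-1 i)).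
case Dr: dr.
  have n4 : (4 <= n)%N by apply: nd; rewrite Dr orbT.
  exists (if (n - 2 <= p)%N then (2 * n - 3 - p)%N else p), (if (n - 2 <= p)%N then - e else e)%Z.
  split; [by case: ifP; lia|by case: ifP; lia|move=> k].
  have [kn|kn] := ltnP k n; last first.
    by rewrite sr //; case: (leqP (n - 2) p) => p1; rewrite gtn_eqF //; lia.
  rewrite nth_refl //; last by lia.
  rewrite i0 iE eqxx Dr !H; case: (leqP (n - 2) k) => k1; case: (leqP (n - 2) p) => p1.
  - have -> : (2 * n - 3 - k == p)%N = (k == 2 * n - 3 - p)%N by lia.
    by case: ifP.
  - have -> : (2 * n - 3 - k == p)%N = false by lia.
    by have -> : (k == p)%N = false by lia.
  - have -> : (k == p)%N = false by lia.
    by have -> : (k == 2 * n - 3 - p)%N = false by lia.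
  - by [].
exists p, (if p == (n - 1)%N then - e else e)%Z; split => //; first by case: ifP; lia.
move=> k; have [kn|kn] := ltnP k n; last by rewrite sr // gtn_eqF //; lia.
rewrite nth_refl //; last by lia.
rewrite i0 iE eqxx Dr !H; have [->|kp] := eqVneq k p; first by case: ifP.
by case: ifP.
Qed.

Lemma uvec_coord x i : (0 < i <= n)%N -> (i == n -> dl) -> uvec x -> (-1 <= coord x i <= 1)%Z.
Proof.
move=> iN idl [p [e [pn eE H]]].
have [iE|i1] := eqVneq i n; last first.
  rewrite coord_interior ?H; last by lia.
  by case: eqP => E1; case: eqP => E2; lia.
rewrite /coord /lin; have -> : (i == 0)%N = false by lia.
rewrite idl iE eqxx // !H; case: dr; last by case: eqP => E1; lia.
by case: eqP => E1; case: eqP => E2; lia.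
Qed.

Lemma swapn01_gt0 i : i != 1%N -> (0 < swapn 0 1 i)%N.
Proof. by rewrite /swapn => /negbTE i1; case: ifP => // i0; rewrite i1; lia. Qed.

Lemma uvec_coord0 x : dl -> uvec x -> (0 <= coord x 0)%Z.
Proof.
move=> Dl [p [e [pn eE H]]]; rewrite /coord /lin Dl /= !H.
by case: eqP => E1; case: eqP => E2; lia.
Qed.

(** Contains the orbit of the zero vector when node [j] is omitted, for [j] other than the inner
    node of a fork. *)
Definition in01j (j : nat) (x : seq Z) : Prop :=
  forall k, (0 <= nth 0 x k <= 1)%Z /\ ((j <= k)%N -> nth 0%Z x k = 0%Z).

Lemma in01j_refl x i j : (0 < j <= n)%N -> (dl -> 2 <= j)%N -> (dr -> j != n.-1) ->
  (i <= n)%N -> i != j -> in01j j x -> in01j j (refl i x).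
Proof.
move=> jn jl jr iN ij H k; have [kn|kn] := ltnP k n; last first.
  by rewrite nth_default ?size_refl.
have Hk := H k; rewrite nth_refl //.
have [i0|i0] := eqVneq i 0%N.
  case Dl: dl; last by case: eqP => [k0|//]; have := H 0%N; lia.
  by case: ifP => [k2|//]; have := jl Dl; have := H (1 - k)%N; lia.
have [i1|i1] := eqVneq i n.
  have j1 := H (n - 1)%N; have j2 := H (n - 2)%N.
  case Dr: dr; last by case: eqP => [E|//]; have := H k; lia.
  have := jr Dr; case: ifP => [k2|//] jn1; have n4 : (4 <= n)%N by apply: nd; rewrite Dr orbT.
  by have := H (2 * n - 3 - k)%N => -[_ ->]; lia.
rewrite /swapn; case: eqP => [kE|_]; first by have := H i; split; [lia|move=> ?; apply (H i); lia].
by case: eqP => [kE|//]; have := H i.-1; split; [lia|move=> ?; apply (H i.-1); lia].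
Qed.

Lemma in01j_coord x i j : (0 < j <= n)%N -> (dr -> j != n.-1) ->
  (i <= n)%N -> i != j -> in01j j x -> (-1 <= coord x i <= 1)%Z.
Proof.
move=> jn jr iN ij H; have h0 := (H 0%N).1; have h1 := (H 1%N).1.
have [i0|i0] := eqVneq i 0%N; first by rewrite /coord /lin i0 /=; case: dl; lia.
have [i1|i1] := eqVneq i n; last first.
  rewrite coord_interior; last by lia.
  by have := (H i).1; have := (H i.-1).1; lia.
rewrite /coord /lin i1 eqxx; have -> : (n == 0)%N = false by lia.
have -> : nth 0%Z x (n - 1) = 0%Z by apply (H _); lia.
case Dr: dr; last by case: dl; lia.
have n4 : (4 <= n)%N by apply: nd; rewrite Dr orbT.
by have -> : nth 0%Z x (n - 2) = 0%Z by apply (H _); have := jr Dr; lia.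
Qed.

Lemma in01_coordn x : in01 x -> (0 <= coord x n)%Z.
Proof.
move=> /in01P H; have := H (n - 1)%N; have := H (n - 2)%N; rewrite /coord /lin eqxx.
have -> : (n == 0)%N = false by lia.
by case: dr; case: dl; lia.
Qed.

Lemma in01_in01j x : size x = n -> in01 x -> in01j n x.
Proof. by move=> sz /in01P H k; split => // kn; rewrite nth_default ?sz. Qed.

Lemma in01j_in01 j x : in01j j x -> in01 x.
Proof. by move=> H; apply/in01P => k; have [] := H k. Qed.

Lemma refl_sym g p q : (p <= n)%N -> (q <= n)%N ->
  (forall i j, A (swap_node p q i) (swap_node p q j) = A i j) ->
  (forall x, size x = n -> size (g x) = n /\ cst (g x) = cst x \o swap_node p q) ->
  forall x i, (i <= n)%N -> size x = n -> refl (swapn p q i) (g x) = g (refl i x).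
Proof.
move=> pn qn HA Hg x i iN sx; have [sg cg] := Hg x sx.
have [sr cr] := Hg _ (size_refl i x).
apply: coord_inj; rewrite ?size_refl //.
rewrite cr -!fire_node ?swapn_le // cg (fire_sym HA).
have -> // : swap_node p q (node (swapn p q i)) = node i.
by rewrite /swap_node inordK ?ltnS ?swapn_le // swapnK.
Qed.

Lemma refl_tau x i : dl -> (i <= n)%N -> size x = n ->
  refl (swapn 0 1 i) (tauv x) = tauv (refl i x).
Proof.
move=> Dl; apply: refl_sym; [lia|lia|exact: tau_A|].
by move=> y sy; rewrite size_tauv cst_tau.
Qed.

Lemma refl_eta x i : dr -> (i <= n)%N -> size x = n ->
  refl (swapn n.-1 n i) (etav x) = etav (refl i x).
Proof.
move=> Dr; apply: refl_sym; [lia|lia|exact: eta_A|].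
by move=> y sy; rewrite size_etav cst_eta.
Qed.

Definition zsum (x : seq Z) : Z := foldr Z.add 0%Z x.

Lemma zsum_cat x y : zsum (x ++ y) = (zsum x + zsum y)%Z.
Proof. by elim: x => //= a x ->; lia. Qed.

(** With a left fork every reflection changes the sum by an even number; in type C the reflection at
    node 0 changes it by an odd one. *)
Lemma zsum_refl x i : dl -> size x = n -> (i <= n)%N ->
  Z.even (zsum (refl i x)) = Z.even (zsum x).
Proof.
move=> Dl sz iN.
have add2 a b c : (a = b + 2 * c)%Z -> Z.even a = Z.even b.
  by move=> ->; rewrite Z.even_add_mul_2.
have [i0|i0] := eqVneq i 0%N.
  case: x sz => [|a [|b R]] sz; try by move: sz => /=; lia.
  by rewrite i0 refl_left // Dl; apply: (add2 _ _ (1 - a - b)%Z) => /=; lia.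
have [i1|i1] := eqVneq i n; last first.
  have [P [a [b [Q [xE sP]]]]] := split_at sz (q := i) ltac:(lia).
  have -> : i = (size P).+1 by lia.
  by move: sz; rewrite xE => sz; rewrite refl_swap // !zsum_cat /=; congr Z.even; lia.
case/lastP: x sz => [|s b] sz; first by move: sz => /=; lia.
case/lastP: s sz => [|s a]; first by move=> /=; lia.
rewrite -cats1 cat_rcons i1 => sz; rewrite refl_right //; case: dr.
  by apply: (add2 _ _ (- a - b)%Z); rewrite !zsum_cat /=; lia.
by apply: (add2 _ _ (- b)%Z); rewrite !zsum_cat /=; lia.
Qed.

Lemma zsum_nseq0 r : zsum (nseq r 0%Z) = 0%Z.
Proof. by elim: r => //= r ->. Qed.

Lemma uvec_odd x : size x = n -> uvec x -> Z.even (zsum x) = false.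
Proof.
move=> sz [p [e [pn eE H]]].
have -> : x = nseq p 0%Z ++ e :: nseq (n - p.+1) 0%Z.
  apply: (@eq_from_nth _ 0%Z) => [|k _]; first by rewrite sz; szl.
  rewrite H nth_cat size_nseq; case: ltnP => kp; first by rewrite nth_nseq kp ltn_eqF.
  have [->|kp'] := eqVneq k p; first by rewrite subnn.
  have -> : (k - p)%N = (k - p).-1.+1 by lia.
  by rewrite /= nth_nseq if_same.
by rewrite zsum_cat /= !zsum_nseq0; case: eE => ->.
Qed.

(** * Entries of the Cartan matrix *)

Lemma cartan_lt i j : (i < j <= n)%N -> cartan i j =
  if dl && (i == 0%N) then (if j == 2%N then 1 else 0)%Z
  else if dr && (j == n) then (if i == (n - 2)%N then 1 else 0)%Z
  else if j == i.+1 then (if (j == n) && ~~ dl then 2 else 1)%Z else 0%Z.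
Proof.
move=> ij; have j0 : (j == 0)%N = false by lia.
have iN : (i == n)%N = false by lia.
have n0 : (n == 0)%N = false by lia.
have nE : (n - 2 == n - 1)%N = false by lia.
have ji : (j == i)%N = false by lia.
rewrite /cartan /lin j0; have [jn|jn] := eqVneq j n.
  rewrite /rho iN andbT; have [i0|i0] := eqVneq i 0%N.
    rewrite andbT; case Dl: dl => /=.
      have n4 : (4 <= n)%N by apply: nd; rewrite Dl.
      have -> : (n - 2 == 0)%N = false by lia.
      have -> : (n - 2 == 1)%N = false by lia.
      have -> : (n - 1 == 0)%N = false by lia.
      have -> : (n - 1 == 1)%N = false by lia.
      have -> : (j == 2)%N = false by lia.
      by case: dr.
    have ndr : dr = false by apply/negP => /drl; rewrite Dl.
    rewrite ndr /= orbF; have -> : (n - 1 == 0)%N = false by lia.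
    by have -> : (j == i.+1)%N = false by lia.
  rewrite andbF; case Dr: dr => /=.
    have n4 : (4 <= n)%N by apply: nd; rewrite Dr orbT.
    have [->|i2] := eqVneq i (n - 2)%N.
      have -> : (n - 2 == n - 2 - 1)%N = false by lia.
      have -> : (n - 1 == n - 2 - 1)%N = false by lia.
      have -> : (n - 1 == n - 2)%N = false by lia.
      by [].
    have [->|i1] := eqVneq i (n - 1)%N.
      have -> : (n - 2 == n - 1 - 1)%N by lia.
      by have -> : (n - 1 == n - 1 - 1)%N = false by lia.
    have -> : (n - 2 == i - 1)%N = false by lia.
    by have -> : (n - 1 == i - 1)%N = false by lia.
  have -> : (n - 1 == i - 1)%N = false by lia.
  have -> : (n - 1 == i)%N = (j == i.+1)%N by lia.
  by case: (j == i.+1); case: dl.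
rewrite /rho iN !andbF; have [i0|i0] := eqVneq i 0%N.
  have -> : (j == 0)%N = false by lia.
  rewrite andbT i0; case Dl: dl => /=.
    have -> : (j - 1 == 0)%N = (j == 1)%N by lia.
    have -> : (j - 1 == 1)%N = (j == 2)%N by lia.
    by have [->|j1] := eqVneq j 1%N; [|case: eqP].
  rewrite !orbF; have -> : (j - 1 == 0)%N = (j == 1)%N by lia.
  by case: eqP.
rewrite andbF; have -> : (j - 1 == i - 1)%N = false by lia.
have -> : (j == i - 1)%N = false by lia.
rewrite ji; have -> : (j - 1 == i)%N = (j == i.+1)%N by lia.
by case: eqP.
Qed.

Lemma cartan_gt i j : (i < j <= n)%N -> cartan j i =
  if dl && (i == 0%N) then (if j == 2%N then 1 else 0)%Z
  else if dr && (j == n) then (if i == (n - 2)%N then 1 else 0)%Z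
  else if j == i.+1 then (if (i == 0%N) || (j == n) && dl then 2 else 1)%Z else 0%Z.
Proof.
move=> ij; have j0 : (j == 0)%N = false by lia.
have iN : (i == n)%N = false by lia.
have n0 : (n == 0)%N = false by lia.
rewrite /cartan /lin iN /rho j0; have [i0|i0] := eqVneq i 0%N.
  rewrite andbT; case Dl: dl => /=.
    have n4 : (4 <= n)%N by apply: nd; rewrite Dl.
    have [jn|jn] := eqVneq j n.
      have -> : (0 == n - 1)%N = false by lia.
      have -> : (0 == n - 2)%N = false by lia.
      have -> : (1 == n - 1)%N = false by lia.
      have -> : (1 == n - 2)%N = false by lia.
      rewrite !andbF; have -> : (j == 2)%N = false by lia.
      by [].
    have -> : (0 == j - 1)%N = (j == 1)%N by lia.
    have -> : (0 == j)%N = false by lia.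
    have -> : (1 == j - 1)%N = (j == 2)%N by lia.
    rewrite [(1 == j)%N]eq_sym.
    by have [->|j1] := eqVneq j 1%N; [|case: eqP].
  have ndr : dr = false by apply/negP => /drl; rewrite Dl.
  rewrite ndr /= i0; have [jn|jn] := eqVneq j n.
    have -> : (0 == n - 1)%N = false by lia.
    by have -> : (j == 1)%N = false by lia.
  have -> : (0 == j - 1)%N = (j == 1)%N by lia.
  have -> : (0 == j)%N = false by lia.
  by case: eqP.
rewrite andbF; have [jn|jn] := eqVneq j n.
  rewrite andbT; case Dr: dr => /=.
    have n4 : (4 <= n)%N by apply: nd; rewrite Dr orbT.
    have -> : (i - 1 == n - 1)%N = false by lia.
    have -> : (i - 1 == n - 2)%N = (i == n - 1)%N by lia.
    rewrite andbF; have [->|i1] := eqVneq i (n - 1)%N; last by case: eqP.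
    by have -> : (n - 1 == n - 2)%N = false by lia.
  have -> : (i - 1 == n - 1)%N = false by lia.
  have -> : (i == n - 1)%N = (j == i.+1)%N by lia.
  by case: (j == i.+1); case: dl.
rewrite andbF /=; have -> : (i - 1 == j - 1)%N = false by lia.
have -> : (i - 1 == j)%N = false by lia.
have -> : (i == j)%N = false by lia.
have -> : (i == j - 1)%N = (j == i.+1)%N by lia.
by case: eqP.
Qed.

(** * From vectors back to group elements *)

Section Group.
Variables (M : I -> I -> nat) (G : groupType) (s : I -> G).
Hypothesis cox : coxeter_system M s.
Hypothesis M1 : forall i, M i i = 1%N.
Hypothesis Abond : forall i j, i != j -> bond (M i j) (A i j) (A j i).
Notation z0 := (node0 n : I).
Notation S := [pred i : I | i != z0].
Notation stt := (st cox z0 A).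

Lemma ord_le (i : I) : (i <= n)%N.
Proof. by rewrite -ltnS. Qed.

Lemma e0_cst : e0 z0 = cst (nseq n 0%Z).
Proof.
apply: funext => i; rewrite /e0 /cst /coord -val_eqE /=.
have -> : lin i (nth 0%Z (nseq n 0%Z)) = 0%Z.
  by rewrite /lin !nth_nseq !if_same; case: dl; case: dr => /=; rewrite ?if_same.
by case: ifP.
Qed.

(* The parity of the sum rules out the unit vectors when dl holds. *)
Definition state_vector (c : I -> Z) (x : seq Z) : Prop :=
  [/\ size x = n, c = cst x & dl -> Z.even (zsum x)].

Lemma state_vectorP g : exists x, state_vector (stt g) x.
Proof.
apply: (word_invariantT cox M1 classical_ii Abond (Q := fun c => exists x, state_vector c x)).
  by exists (nseq n 0%Z); split; rewrite ?size_nseq ?e0_cst // zsum_nseq0.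
move=> c i [x [sx cE xe]]; exists (refl i x); split; rewrite ?size_refl ?cE ?fire_cst //.
by move=> Dl; rewrite zsum_refl ?ord_le // xe.
Qed.

Lemma parabolic_vector (Q : seq Z -> Prop) j w x : (j <= n)%N ->
  (forall y, size y = n -> Q y -> (0 <= coord y j)%Z) ->
  (forall y i, size y = n -> (i <= n)%N -> i != j -> Q y -> Q (refl i y)) ->
  minrep s S w -> size x = n -> stt w = cst x -> Q x -> proper_minrep s z0 w.
Proof.
move=> jn Qj Qr mw sx wx Qx; split => //; exists (node j).
apply: (invariant_parabolic M1 classical_ii Abond
  (Q := fun c => exists y, [/\ size y = n, Q y & c = cst y]) _ mw); last by exists x.
move=> _ i [y [sy Qy ->]] neg.
have ij : (i : nat) != j.
  by apply: contraTneq isT => E; have := Qj y sy Qy; move: neg; rewrite /cst E; lia.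
split; first by rewrite -val_eqE /= inordK.
by exists (refl i y); rewrite size_refl fire_cst; split => //; apply: Qr; rewrite ?ord_le.
Qed.

Lemma in01_proper w x : minrep s S w -> size x = n -> stt w = cst x -> in01 x ->
  proper_minrep s z0 w.
Proof.
move=> mw sx wx Qx; apply: (parabolic_vector (Q := in01) (leqnn n)) wx Qx => // [y sy|].
  exact: in01_coordn.
move=> y i sy iN ij /(in01_in01j sy) H; apply: (@in01j_in01 n).
by apply: in01j_refl => //; try (move=> *; lia).
Qed.

Lemma in01_eta_proper w x : dr -> minrep s S w -> size x = n -> stt w = cst x ->
  in01 (etav x) -> proper_minrep s z0 w.
Proof.
move=> Dr mw sx wx Qx; have n4 : (4 <= n)%N by apply: nd; rewrite Dr orbT.
have nn : (n == n.-1)%N = false by lia.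
apply: (parabolic_vector (Q := fun y => in01 (etav y)) (leq_pred n)) wx Qx => // [y sy|].
  by move=> /in01_coordn; rewrite coord_eta // /swapn eqxx nn.
move=> y i sy iN ij; rewrite -refl_eta // => /(in01_in01j _) H.
apply: (@in01j_in01 n); apply: in01j_refl; rewrite ?swapn_le ?leq_pred //.
all: try by move=> *; lia.
- by rewrite /swapn (negbTE ij); case: ifP => [_|/negbT //]; lia.
- by apply: H; rewrite size_etav.
Qed.

Lemma uvec_tau_proper w x : dl -> minrep s S w -> size x = n -> stt w = cst x ->
  uvec (tauv x) -> proper_minrep s z0 w.
Proof.
move=> Dl mw sx wx Qx; have n4 : (4 <= n)%N by apply: nd; rewrite Dl.
apply: (parabolic_vector (Q := fun y => uvec (tauv y)) (j := 1%N)) wx Qx => //; first by lia.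
  by move=> y sy /(uvec_coord0 Dl); rewrite coord_tau.
move=> y i sy iN ij; rewrite -refl_tau // => H; apply: uvec_refl => //.
by rewrite swapn_le ?swapn01_gt0 //; lia.
Qed.

Lemma vector_minuscule (Q : seq Z -> Prop) (j : I) v : Q (nseq n 0%Z) ->
  (forall y i, size y = n -> (i <= n)%N -> i != j -> Q y ->
     Q (refl i y) /\ (-1 <= coord y i <= 1)%Z) ->
  parabolic s [pred i | i != j] v -> forall i, i != j -> (-1 <= stt v i <= 1)%Z.
Proof.
move=> Q0 Qr pv; suff [y [sy Qy ->]] : exists y, [/\ size y = n, Q y & stt v = cst y].
  by move=> i ij; have [] := Qr y i sy (ord_le i) _ Qy.
apply: (word_invariant cox M1 classical_ii Abond
  (Q := fun c => exists y, [/\ size y = n, Q y & c = cst y]) _ _ pv).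
  by exists (nseq n 0%Z); rewrite size_nseq e0_cst.
move=> _ i ij [y [sy Qy ->]]; exists (refl i y); rewrite size_refl fire_cst; split => //.
by have [] := Qr y i sy (ord_le i) _ Qy.
Qed.

Lemma in01j0 j : in01j j (nseq n 0%Z).
Proof. by move=> k; rewrite nth_nseq if_same; split => //; lia. Qed.

Lemma tauv0 : uvec (tauv (nseq n 0%Z)).
Proof.
exists 0%N, 1%Z; split; [lia|by left|move=> k].
by rewrite nth_tauv ?size_nseq // !nth_nseq !if_same; case: ifP.
Qed.

Lemma etav0 : etav (nseq n 0%Z) = nseq n 0%Z.
Proof.
apply: (@eq_from_nth _ 0%Z); rewrite size_etav // => k _.
by rewrite nth_etav ?size_nseq // nth_nseq !if_same.
Qed.

(** The invariant depends on the omitted node: only the zero vector for node 0, signed unit vectors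
    seen through [tauv] for node 1 of a left fork, zero-one vectors seen through [etav] for node
    [n.-1] of a right fork, and [in01j j] otherwise. *)
Lemma classical_minuscule : minuscule cox z0 A.
Proof.
move=> j v mv pv; have jn := ord_le j.
have [j0|j0] := eqVneq (j : nat) 0%N.
  apply: (vector_minuscule (Q := fun y => y = nseq n 0%Z)) pv => // y i sy iN ij ->.
  have c0 : coord (nseq n 0%Z) i = 0%Z.
    rewrite -cst_node // -e0_cst /e0 -val_eqE /= inordK //.
    by rewrite -j0 (negbTE ij).
  rewrite c0; split => //; apply: coord_inj; rewrite ?size_refl ?size_nseq //.
  by rewrite -fire_node // fire0 // cst_node.
have [/andP[Dl /eqP j1]|nl] := boolP (dl && ((j : nat) == 1)%N).
  apply: (vector_minuscule (Q := fun y => uvec (tauv y))) pv => [|y i sy iN ij H].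
    exact: tauv0.
  have n4 : (4 <= n)%N by apply: nd; rewrite Dl.
  have iS : (0 < swapn 0 1 i <= n)%N.
    by rewrite swapn_le ?swapn01_gt0 //; lia.
  rewrite -refl_tau //; split; first exact: uvec_refl.
  rewrite -[i](@swapnK 0 1) -coord_tau ?swapn_le //; try lia.
  by apply: uvec_coord.
have [/andP[Dr /eqP j1]|nr] := boolP (dr && ((j : nat) == n.-1)%N).
  have n4 : (4 <= n)%N by apply: nd; rewrite Dr orbT.
  apply: (vector_minuscule (Q := fun y => in01j n (etav y))) pv => [|y i sy iN ij H].
    by rewrite etav0; apply: in01j0.
  have iS : (swapn n.-1 n i <= n)%N by apply: swapn_le => //; lia.
  have iSn : swapn n.-1 n i != n.
    by rewrite /swapn -j1 (negbTE ij); case: ifP => [_|/negbT //]; lia.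
  rewrite -refl_eta //; split.
    by apply: in01j_refl => //; try (move=> *; lia).
  rewrite -[i](@swapnK n.-1 n) -coord_eta //.
  by apply: (@in01j_coord _ _ n) => //; try (move=> *; lia).
apply: (vector_minuscule (Q := in01j j)) pv => [|y i sy iN ij H]; first exact: in01j0.
have jl : (dl -> 2 <= j)%N by move=> Dl; move: nl; rewrite Dl; lia.
have jr : dr -> (j : nat) != n.-1 by move=> Dr; move: nr; rewrite Dr.
split; first by apply: in01j_refl => //; lia.
by apply: (@in01j_coord _ _ j) => //; lia.
Qed.

(** * Elements of small length and the effect of palindromicity *)

Notation l := (len s).

Definition level (t : nat) (L : seq (seq Z)) : Prop :=
  forall v, minrep s S v -> l v = t -> exists2 x, x \in L & stt v = cst x.

Lemma level_step t L L' :
  (forall x k, x \in L -> (k <= n)%N -> (0 < coord x k)%Z -> refl k x \in L') ->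
  level t L -> level t.+1 L'.
Proof.
move=> H Lt v mv lv; have [i [v' [mv' lv' pos vE]]] := minrep_level cox M1 classical_ii Abond mv lv.
have [x xL xE] := Lt v' mv' lv'; exists (refl i x).
  by apply: H; rewrite ?ord_le //; move: pos; rewrite xE.
by rewrite vE (st_gen cox M1 z0 classical_ii Abond) xE fire_cst.
Qed.

Lemma level0 : level 0 [:: nseq n 0%Z].
Proof.
move=> v mv lv; exists (nseq n 0%Z); first by rewrite inE.
by rewrite (len0 cox lv) (st1 cox M1 z0 classical_ii Abond) e0_cst.
Qed.

Lemma level_uniq1 t x v v' : level t [:: x] -> minrep s S v -> minrep s S v' ->
  l v = t -> l v' = t -> v = v'.
Proof.
move=> H mv mv' lv lv'; have [y + yE] := H v mv lv; have [y' + yE'] := H v' mv' lv'.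
rewrite !inE => /eqP E /eqP E'.
have vv : stt v = stt v' by rewrite yE yE' E E'.
exact: (st_inj M1 classical_ii Abond mv mv' vv).
Qed.

Lemma coord_zero P k : (size P < k <= n)%N -> (dr -> size P + 2 <= n)%N ->
  coord (P ++ nseq (n - size P) 0%Z) k = 0%Z.
Proof.
move=> kP Pr; have n1 i : (size P <= i)%N -> nth 0%Z (P ++ nseq (n - size P) 0%Z) i = 0%Z.
  by move=> Pi; rewrite nth_cat ltnNge Pi /= nth_nseq if_same.
rewrite /coord /lin; have -> : (k == 0)%N = false by lia.
have [kE|kE] := eqVneq k n; last by rewrite !n1 //; lia.
case Dr: dr; last by rewrite n1 ?mulr0; [case: dl|lia].
by have := Pr Dr; rewrite !n1 //; lia.
Qed.

Lemma refl0_zero : refl 0 (nseq n 0%Z) =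
  if dl then [:: 1; 1]%Z ++ nseq (n - 2) 0%Z else [:: 1]%Z ++ nseq (n - 1) 0%Z.
Proof.
have nE : nseq n 0%Z = [:: 0, 0 & nseq (n - 2) 0]%Z by rewrite -[in LHS](subnKC n2).
rewrite {1}nE refl_left -?nE ?size_nseq //; case: dl => //=.
by have -> : (n - 1)%N = (n - 2).+1 by lia.
Qed.

Lemma level1 : level 1 [:: refl 0 (nseq n 0%Z)].
Proof.
apply: level_step level0 => x k; rewrite !inE => /eqP -> kn pos.
have [->//|k0] := eqVneq k 0%N; have := @coord_zero [::] k; rewrite /= subn0 => E.
by move: pos; rewrite E //; lia.
Qed.

Notation fork2 := [:: 1, 0, 1 & nseq (n - 3) 0]%Z.

Lemma nseq_split a b : (a + b <= n)%N -> nseq (n - a) 0%Z = nseq b 0%Z ++ nseq (n - (a + b)) 0%Z.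
Proof. by move=> abn; rewrite -nseqD; congr nseq; lia. Qed.

Lemma level2_fork : dl -> level 2 [:: fork2].
Proof.
move=> Dl; have n4 : (4 <= n)%N by apply: nd; rewrite Dl.
apply: level_step level1 => x k; rewrite !inE refl0_zero Dl => /eqP -> kn.
have E : [:: 1; 1]%Z ++ nseq (n - 2) 0%Z = [:: 1, 1, 0 & nseq (n - 3) 0]%Z.
  by rewrite (@nseq_split 2 1) //; lia.
have sz : size [:: 1, 1, 0 & nseq (n - 3) 0]%Z = n by rewrite /= size_nseq; lia.
case: k kn => [|[|[|k]]] kn.
- by rewrite coord_left Dl.
- by rewrite E (@coord_swap [::] (0%Z :: nseq (n - 3) 0%Z) 1 1).
- by rewrite E => _; rewrite (@refl_swap [:: 1%Z] (nseq (n - 3) 0%Z) 1 0).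
- by rewrite (@coord_zero [:: 1; 1]%Z) //= => _; lia.
Qed.

Lemma level2_leaf : ~~ dl -> ~~ dr -> level 2 [:: refl 1 (1%Z :: nseq (n - 1) 0%Z)].
Proof.
move=> ndl ndr; apply: level_step level1 => x k; rewrite !inE refl0_zero (negbTE ndl) => /eqP -> kn.
case: k kn => [|[|k]] kn //.
  have -> : (n - 1)%N = (n - 2).+1 by lia.
  by rewrite coord_left (negbTE ndl).
by rewrite (@coord_zero [:: 1]%Z) //= (negbTE ndr).
Qed.

(** With a left fork the quotient branches at length 3, so uniqueness is available in two levels
    only. *)
Lemma palindromic_TU w x : palindromic s w -> minrep s S w -> stt w = cst x -> TU 2 x.
Proof.
move=> pal mw <-; apply: (palindromic_topuniq cox M1 classical_ii Abond) => //.
move=> t v v' t2 mv mv' lv lv'; have [tE|tE] : t = 1%N \/ t = 2%N by lia.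
  by rewrite tE in lv lv'; apply: (level_uniq1 level1) lv lv'.
rewrite tE in lv lv'; have [Dl|ndl] := boolP dl.
  by apply: (level_uniq1 (level2_fork Dl)) lv lv'.
apply: (level_uniq1 (level2_leaf ndl _)) lv lv' => //.
by apply/negP => /drl; apply/negP.
Qed.

Lemma level3_fork : dl -> ~~ dr ->
  level 3 [:: [:: 0, 1, 1 & nseq (n - 3) 0]%Z; [:: 1, 0, 0, 1 & nseq (n - 4) 0]%Z].
Proof.
move=> Dl ndr; have n4 : (4 <= n)%N by apply: nd; rewrite Dl.
have E : fork2 = [:: 1, 0, 1, 0 & nseq (n - 4) 0]%Z by rewrite (@nseq_split 3 1) //; lia.
have sz : size fork2 = n by rewrite /= size_nseq; lia.
apply: level_step (level2_fork Dl) => x k; rewrite inE => /eqP -> kn.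
case: k kn => [|[|[|[|k]]]] kn.
- by rewrite coord_left Dl.
- by rewrite (@refl_swap [::] (1%Z :: nseq (n - 3) 0%Z) 1 0) // !inE eqxx.
- by rewrite (@coord_swap [:: 1%Z] (nseq (n - 3) 0%Z) 0 1).
- rewrite E; have sz' : size [:: 1, 0, 1, 0 & nseq (n - 4) 0]%Z = n by rewrite -E.
  by rewrite (@refl_swap [:: 1; 0]%Z (nseq (n - 4) 0%Z) 1 0) // !inE eqxx orbT.
- by rewrite (@coord_zero [:: 1; 0; 1]%Z) //= (negbTE ndr).
Qed.

Lemma level4_fork : dl -> ~~ dr -> level 4 [:: [:: 0, 1, 0, 1 & nseq (n - 4) 0]%Z;
  refl 4 [:: 1, 0, 0, 1 & nseq (n - 4) 0]%Z].
Proof.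
move=> Dl ndr; have n4 : (4 <= n)%N by apply: nd; rewrite Dl.
have E : [:: 0, 1, 1 & nseq (n - 3) 0]%Z = [:: 0, 1, 1, 0 & nseq (n - 4) 0]%Z.
  by rewrite (@nseq_split 3 1) //; lia.
have sz a b c d : size [:: a, b, c, d & nseq (n - 4) 0%Z] = n by rewrite /= size_nseq; lia.
apply: level_step (level3_fork Dl ndr) => x k; rewrite !inE => /orP[]/eqP -> kn.
  case: k kn => [|[|[|[|k]]]] kn.
  - by rewrite coord_left Dl.
  - by rewrite E (@coord_swap [::] (1%Z :: 0%Z :: nseq (n - 4) 0%Z) 0 1 (sz 0 1 1 0)%Z).
  - by rewrite E (@coord_swap [:: 0%Z] (0%Z :: nseq (n - 4) 0%Z) 1 1 (sz 0 1 1 0)%Z).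
  - by rewrite E (@refl_swap [:: 0; 1]%Z (nseq (n - 4) 0%Z) 1 0 (sz 0 1 1 0)%Z) ?eqxx.
  - by rewrite (@coord_zero [:: 0; 1; 1]%Z) //= (negbTE ndr).
case: k kn => [|[|[|[|[|k]]]]] kn.
- by rewrite coord_left Dl.
- by rewrite (@refl_swap [::] (0%Z :: 1%Z :: nseq (n - 4) 0%Z) 1 0 (sz 1 0 0 1)%Z) ?eqxx.
- by rewrite (@coord_swap [:: 1%Z] (1%Z :: nseq (n - 4) 0%Z) 0 0 (sz 1 0 0 1)%Z).
- by rewrite (@coord_swap [:: 1; 0]%Z (nseq (n - 4) 0%Z) 0 1 (sz 1 0 0 1)%Z).
- by rewrite eqxx orbT.
- by rewrite (@coord_zero [:: 1; 0; 0; 1]%Z) //= (negbTE ndr).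
Qed.

Lemma level_list t L : level t L -> exists V : seq G, (size V <= size L)%N /\
  forall v, minrep s S v -> l v = t -> v \in V.
Proof.
move=> Lt; suff [V [sV HV]] : exists V : seq G, (size V <= size L)%N /\
    forall v, minrep s S v -> (exists2 x, x \in L & stt v = cst x) -> v \in V.
  by exists V; split => // v mv lv; apply: HV => //; apply: Lt.
elim: (L) => [|x L' [V [sV HV]]]; first by exists [::]; split => // v _ [].
have [[u [mu ux]]|no] := pselect (exists u, minrep s S u /\ stt u = cst x).
  exists (u :: V); split => // v mv [y]; rewrite !inE => /orP[/eqP ->|yL] vy; apply/orP.
    have E : stt v = stt u by rewrite vy ux.
    by left; rewrite (st_inj M1 classical_ii Abond mv mu E).
  by right; apply: HV => //; exists y.
exists V; split; first exact: leqW.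
move=> v mv [y]; rewrite !inE => /orP[/eqP ->|yL] vy; first by case: no; exists v.
by apply: HV => //; exists y.
Qed.

Fixpoint covs (x : seq Z) (p : seq (seq Z)) : Prop :=
  if p is y :: p' then covx x y /\ covs y p' else True.

Lemma covs_sound x p v : minrep s S v -> stt v = cst x -> covs x p -> exists u,
  [/\ minrep s S u, stt u = cst (last x p), bruhat s u v & (l u + size p)%N = l v].
Proof.
elim: p x v => [|y p IH] x v mv vx /=; first by exists v; rewrite addn0; split => //; apply: bruhat_refl.
move=> [c cs]; have [v' [mv' vy bv lv]] := cov_sound M1 classical_ii Abond c mv vx.
have [u [mu uy bu lu]] := IH y v' mv' vy cs.
by exists u; split => //; [exact: bruhat_trans bu bv|rewrite addnS lu lv].
Qed.

Lemma covs_tau x p : dl -> size x = n -> all (fun y => size y == n) p -> covs x p ->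
  covs (tauv x) (map tauv p).
Proof.
move=> Dl; elim: p x => //= y p IH x sx /andP[/eqP sy sp] [c cs]; split; last exact: IH.
exact: covx_tau.
Qed.

(* Uniqueness in colengths 1 and 2 does not exclude these elements: there are
   three elements of colength 4 below them, but only two of length 4. *)
Lemma flat_not_palindromic w x a : dl -> ~~ dr -> (0 < a)%Z -> minrep s S w -> stt w = cst x ->
  x = nseq n (- a)%Z \/ tauv x = nseq n (- a)%Z -> ~ palindromic s w.
Proof.
move=> Dl ndr a0 mw wx xE pal; have n4 : (4 <= n)%N by apply: nd; rewrite Dl.
have [f [fK fx sf fcovs]] : exists f : seq Z -> seq Z, [/\ involutive f, f (nseq n (- a)%Z) = x,
    forall y, size (f y) = size y & forall y p, size y = n -> all (fun y => size y == n) p ->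
      covs y p -> covs (f y) (map f p)].
  case: xE => [->|<-]; [exists id; split => // y p _ _; by rewrite map_id|exists tauv].
  by split; [exact: tauvK|exact: tauvK|exact: size_tauv|move=> y p; exact: covs_tau].
set m := (- a)%Z; pose P := nseq (n - 4) m.
have sP b c d e : size (P ++ [:: b; c; d; e]) = n by rewrite size_cat size_nseq /=; lia.
have Na : (- m = a)%Z by rewrite /m; lia.
have XE : nseq n m = P ++ [:: m; m; m; m].
  by rewrite -[[:: m; m; m; m]]/(nseq 4 m) -nseqD; congr nseq; lia.
have flip b c d : covx (P ++ [:: b; c; d; m]) (P ++ [:: b; c; d; a]).
  have := @covx_right1_base (P ++ [:: b; c; d]) m ndr.
  by rewrite -!cats1 -!catA Na; apply; [exact: sP|lia].
have swap2 b c : covx (P ++ [:: b; c; m; a]) (P ++ [:: b; c; a; m]).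
  have := @covx_swap_base (P ++ [:: b; c]) [::] m a; rewrite -!catA.
  by apply; [exact: sP|lia].
have swap1 b d : covx (P ++ [:: b; m; a; d]) (P ++ [:: b; a; m; d]).
  have := @covx_swap_base (P ++ [:: b]) [:: d] m a; rewrite -!catA.
  by apply; [exact: sP|lia].
have swap0 c d : covx (P ++ [:: m; a; c; d]) (P ++ [:: a; m; c; d]).
  by apply: covx_swap_base; [exact: sP|lia].
(* The two entries [a] are carried to the front, turned into [1 - a] by the left fork, and carried
   back. *)
have far : covx (P ++ [:: m; m; a; a]) (P ++ [:: m; m; (1 - a)%Z; (1 - a)%Z]).
  have PE b : P ++ [:: m; m; b; b] = nseq (n - 2) m ++ [:: b; b].
    rewrite -[[:: m; m; b; b]]/(nseq 2 m ++ [:: b; b]) catA -nseqD.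
    by have -> : (n - 4 + 2)%N = (n - 2)%N by lia.
  rewrite !PE.
  have c0 := @covx_left2_base a a (nseq (n - 2) m) Dl ltac:(szl) ltac:(lia).
  have c1 : covx (a :: nseq (n - 2) m ++ [:: a]) ((1 - a)%Z :: nseq (n - 2) m ++ [:: (1 - a)%Z]).
    have := @covx_right [:: a] (nseq (n - 2) m) [::] a [:: (1 - a)%Z] (nseq (n - 2) m) [::] (1 - a).
    by rewrite !cats0; apply => //; rewrite ?all_nseq_lt //; try szl; lia.
  have := @covx_right [::] (nseq (n - 2) m) [:: a] a [::] (nseq (n - 2) m) [:: (1 - a)%Z] (1 - a).
  by rewrite !cat0s; apply => //; rewrite ?all_nseq_lt //; try szl; lia.
have ex p : size p = 4%N -> all (fun y => size y == n) p -> covs (nseq n m) p -> exists u,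
    [/\ minrep s S u, stt u = cst (f (last (nseq n m) p)), bruhat s u w & (l u + 4)%N = l w].
  move=> sp ap cp; have := fcovs _ _ (size_nseq n m) ap cp; rewrite fx => cfp.
  have [u [mu uE bu lu]] := covs_sound mw wx cfp.
  by exists u; rewrite -last_map fx -sp -(size_map f).
have sz b c d e : size (P ++ [:: b; c; d; e]) == n by rewrite sP.
have [u1 [m1 e1 b1 l1]] := @ex [:: P ++ [:: m; m; m; a]; P ++ [:: m; m; a; m];
  P ++ [:: m; m; a; a]; P ++ [:: m; a; m; a]] erefl ltac:(by rewrite /= !sz) ltac:(by rewrite XE).
have [u2 [m2 e2 b2 l2]] := @ex [:: P ++ [:: m; m; m; a]; P ++ [:: m; m; a; m];
  P ++ [:: m; m; a; a]; P ++ [:: m; m; (1 - a)%Z; (1 - a)%Z]] erefl ltac:(by rewrite /= !sz) ltac:(by rewrite XE).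
have [u3 [m3 e3 b3 l3]] := @ex [:: P ++ [:: m; m; m; a]; P ++ [:: m; m; a; m];
  P ++ [:: m; a; m; m]; P ++ [:: a; m; m; m]] erefl ltac:(by rewrite /= !sz) ltac:(by rewrite XE).
have [L [sL HL]] := level_list (level4_fork Dl ndr).
(* The last entries [a], [1 - a] and [-a] tell the three elements apart. *)
have ne u v b c d e b' c' d' e' : stt u = cst (f (P ++ [:: b; c; d; e])) ->
    stt v = cst (f (P ++ [:: b'; c'; d'; e'])) -> u = v -> e = e'.
  move=> uE vE uv; move: uE; rewrite uv vE.
  move=> /coord_inj; rewrite !sf !sP => /(_ erefl erefl)/(inv_inj fK).
  by move=> /(congr1 (last 0%Z)); rewrite !last_cat.
have := palindromic_card cox (V := [:: u1; u2; u3]) pal HL.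
rewrite /= !inE negb_or => H0.
have H12 : u1 != u2 by apply/eqP => E; have := ne _ _ _ _ _ _ _ _ _ _ e1 e2 E; lia.
have H13 : u1 != u3 by apply/eqP => E; have := ne _ _ _ _ _ _ _ _ _ _ e1 e3 E; rewrite /m; lia.
have H23 : u2 != u3 by apply/eqP => E; have := ne _ _ _ _ _ _ _ _ _ _ e2 e3 E; rewrite /m; lia.
move: H0; rewrite H12 H13 H23 /= => /(_ isT) H.
suff : (3 <= size L)%N by move: sL => /=; lia.
by apply: H => v; rewrite !inE => /or3P[]/eqP ->.
Qed.

Lemma fork_proper w : dl -> palindromic s w -> minrep s S w -> proper_minrep s z0 w.
Proof.
move=> Dl pal mw; have [x [sx wx ev]] := state_vectorP w.
have [[H|H]|[_ H]|[Dr H]|[_ ndr [a a0 H]]] := classify sx (palindromic_TU pal mw wx).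
- by have := uvec_odd sx H; rewrite ev.
- exact: in01_proper wx H.
- exact: uvec_tau_proper wx H.
- exact: in01_eta_proper wx H.
- by case: (flat_not_palindromic Dl ndr a0 mw wx H pal).
Qed.

(** In type C, firing 0 creates an entry 1 in front, 1 to [n.-1] move it to the right end, [n]
    changes its sign, and [n.-1] down to 1 move the -1 back to the front. *)
Definition chain_vec (t k : nat) : Z :=
  if (0 < t <= n)%N && (k == t.-1) then 1%Z
  else if (n < t)%N && (k == 2 * n - t)%N then (-1)%Z else 0%Z.
Definition chain_node (t : nat) : nat := if (t <= n)%N then t else (2 * n - t)%N.
Notation cvec t := (mkseq (chain_vec t) n).

Lemma coord_chain t k : (k <= n)%N -> coord (cvec t) k = ((if k == 0%N then 1 else 0) + lin k (chain_vec t))%Z.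
Proof. by move=> kn; congr Z.add; apply: lin_ext => // i iN; rewrite nth_mkseq. Qed.

Section Chain.
Hypothesis ndl : ~~ dl.
Hypothesis ndr : ~~ dr.

Lemma chain_pos t : (t < 2 * n)%N -> (0 < coord (cvec t) (chain_node t))%Z.
Proof.
move=> tn; rewrite coord_chain; last by rewrite /chain_node; case: ifP; lia.
rewrite /lin /chain_node /chain_vec (negbTE ndl) (negbTE ndr).
case: (leqP t n) => tn1.
all: by repeat (case: ifP => ?; try lia).
Qed.

Lemma chain_neg t k : (t < 2 * n)%N -> (k <= n)%N -> (coord (cvec t.+1) k < 0)%Z ->
  k = chain_node t.
Proof.
move=> tn kn; rewrite coord_chain // /lin /chain_node /chain_vec (negbTE ndl) (negbTE ndr).
case: (leqP t n) => tn1.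
all: by repeat (case: ifP => ?; try lia).
Qed.

Lemma chain_low t : (t.+1 < 2 * n)%N -> (coord (cvec t) (chain_node t.+1) <= 0)%Z.
Proof.
move=> tn; rewrite coord_chain; last by rewrite /chain_node; case: ifP; lia.
rewrite /lin /chain_node /chain_vec (negbTE ndl) (negbTE ndr).
case: (leqP t.+1 n) => tn1.
all: by repeat (case: ifP => ?; try lia).
Qed.

Lemma chain_refl t : (t < 2 * n)%N -> refl (chain_node t) (cvec t) = cvec t.+1.
Proof.
move=> tn; apply: (@eq_from_nth _ 0%Z); rewrite size_refl ?size_mkseq // => k kn.
rewrite nth_mkseq // nth_mkseq // nth_mkseq // coord_chain; last by rewrite /chain_node; case: ifP; lia.
rewrite /lin /rho /chain_node /chain_vec (negbTE ndl) (negbTE ndr).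
case: (leqP t n) => tn1.
all: by repeat (case: ifP => ?; try lia).
Qed.

Definition chain_seq (t : nat) : seq I := [seq node (chain_node k) | k <- rev (iota 0 t)].

Lemma chain_seqS t : chain_seq t.+1 = node (chain_node t) :: chain_seq t.
Proof. by rewrite /chain_seq -(addn1 t) iotaD rev_cat. Qed.

Lemma chain_seqP t : (t <= 2 * n)%N -> chain_word cox A (chain_seq t) /\
  stt (wprod s (chain_seq t)) = cst (cvec t).
Proof.
have nn k : (k <= 2 * n)%N -> (chain_node k <= n)%N by rewrite /chain_node; case: ifP; lia.
have sE k : (k <= 2 * n)%N -> stt (wprod s (chain_seq k)) = cst (cvec k).
  elim: k => [_|k IH kn].
    rewrite /chain_seq /= wprod_nil (st1 cox M1 z0 classical_ii Abond) e0_cst.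
    congr cst; apply: (@eq_from_nth _ 0%Z); rewrite size_nseq ?size_mkseq // => k kn.
    by rewrite nth_nseq if_same nth_mkseq // /chain_vec /=; have -> : (n < 0)%N = false by lia.
  rewrite chain_seqS wprod_cons (st_gen cox M1 z0 classical_ii Abond) IH; last exact: ltnW.
  by rewrite fire_node ?chain_refl // nn // ltnW.
move=> tn; split; last exact: sE.
elim: t tn => [//|t IH tn]; have sE' := sE _ tn.
rewrite chain_seqS in sE' *; split; first by apply: IH; apply: ltnW.
- rewrite sE; last exact: ltnW.
  by rewrite cst_node; [exact: chain_pos|apply: nn; apply: ltnW].
- move=> k; rewrite sE' => neg; apply: val_inj; rewrite /= inordK; last by rewrite ltnS nn // ltnW.
  by apply: chain_neg neg; rewrite ?ord_le.
- case: t IH tn {sE'} => [|t] IH tn; first by [].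
  rewrite chain_seqS => _; rewrite sE; last by lia.
  by rewrite cst_node; [exact: chain_low|apply: nn; lia].
Qed.

Lemma chain_seq_count t : (t <= 2 * n)%N -> (count_mem z0 (behead (chain_seq t)) <= 1)%N.
Proof.
move=> tn; apply: (@leq_trans (count_mem z0 (chain_seq t))).
  by case: (chain_seq t) => //= i x; apply: leq_addl.
have nz k : (0 < k < 2 * n)%N -> (node (chain_node k) == z0) = false.
  move=> kn; rewrite -val_eqE /= inordK; last by rewrite /chain_node; case: ifP; lia.
  by rewrite /chain_node; case: ifP; lia.
elim: t tn => [//|[|t] IH tn]; first by rewrite chain_seqS /=; case: eqP.
by rewrite chain_seqS /= nz ?IH //; lia.
Qed.

Lemma chain_proper w : palindromic s w -> minrep s S w -> leaf_domain cox A w.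
Proof.
move=> pal mw; have [x [sx wx _]] := state_vectorP w.
have [[H|H]|[Dl _]|[Dr _]|[Dl _ _]] := classify sx (palindromic_TU pal mw wx).
- have [p [e [pn [eE|eE] xE]]] := H.
    left; apply: in01_proper wx _ => //; apply/in01P => k; rewrite xE eE.
    by case: ifP; lia.
  (* The entry -1 stands at index [p] after [2 * n - p] firings. *)
  have tn : (2 * n - p <= 2 * n)%N by lia.
  right; exists (chain_seq (2 * n - p)); have [cw cE] := chain_seqP tn.
  split => //; first exact: chain_seq_count.
  have [mc _] := chain_minrep M1 classical_ii Abond cw.
  apply: (st_inj M1 classical_ii Abond mc mw); rewrite cE wx; congr cst.
  apply: (@eq_from_nth _ 0%Z); rewrite size_mkseq ?sx // => k kn.
  rewrite xE eE nth_mkseq // /chain_vec.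
  have -> : (0 < 2 * n - p <= n)%N = false by lia.
  have -> : (n < 2 * n - p)%N by lia.
  by have -> : (2 * n - (2 * n - p))%N = p by lia.
- by left; apply: in01_proper wx H.
- by case/negP: ndl.
- by case/negP: ndr.
- by case/negP: ndl.
Qed.

End Chain.

Lemma chain_main sigma w lam : ~~ dl -> ~~ dr -> leaf_segments s sigma ->
  minrep s (setS n) w -> leaf_pi s sigma w lam ->
  palindromic s w <->
    (poset_isomorphic (bruhat_interval s w) (bruhat s)
       (young_interval s sigma sigma lam) (young s sigma sigma)
     /\ rank_symmetric (young_interval s sigma sigma lam) (psize lam)).
Proof.
move=> ndl ndr sg mw pw; apply: (leaf_main M1 classical_ii Abond _ classical_minuscule sg _ mw pw).
  by lia.
by move=> pal; apply: chain_proper.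
Qed.

(** * Diagram automorphisms that exchange the nodes 0 and 1 *)

Lemma commute_cartan (i j : I) : (i < j)%N -> (M i j == 2) = (cartan i j =? 0)%Z.
Proof.
move=> ij; have ne : i != j by rewrite -val_eqE /= ltn_eqF.
have : bond (M i j) (cartan i j) (cartan j i) := Abond ne.
have ijn : (i < j <= n)%N by rewrite ij ord_le.
rewrite /bond; case: (M i j) => [|[|[|[|[|[|[|m]]]]]]] //=; lia.
Qed.

Lemma commute_sym (i j : I) : i != j -> (M i j == 2) = (M j i == 2).
Proof.
move=> ne; have := Abond ne; have := Abond (i := j) (j := i); rewrite eq_sym => /(_ ne).
by rewrite /bond; case: (M i j) => [|[|[|[|[|[|[|m]]]]]]] //=;
   case: (M j i) => [|[|[|[|[|[|[|m']]]]]]] //=; lia.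
Qed.

Section Automorphism.
Variable th : {perm 'I_n.+1}.
Hypothesis thM : forall i j, M (th i) (th j) = M i j.
Hypothesis th0 : th (node0 n) = node1 n.
Hypothesis th1 : th (node1 n) = node0 n.
Hypothesis Dl : dl.

Let n4 : (4 <= n)%N. Proof. by apply: nd; rewrite Dl. Qed.

Lemma adjacent (i j : I) : (i < j)%N -> M i j <> 2%N -> [\/ (i < 2)%N /\ (j : nat) = 2%N,
  (j : nat) = i.+1 /\ (1 < i)%N | [/\ dr, (j : nat) = n & (i : nat) = (n - 2)%N]].
Proof.
move=> ij /eqP; rewrite commute_cartan // cartan_lt ?ij ?ord_le // Dl /=.
case: eqP => [i0|i0]; first by case: eqP => // j2 _; constructor 1; rewrite i0.
case Dr: dr => /=.
  case: eqP => [jn|jn]; first by case: eqP => // i2 _; constructor 3.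
  case: eqP => // jE _; have [i2|i2] := ltnP 1 i; first by constructor 2.
  by constructor 1; lia.
case: eqP => // jE _; have [i2|i2] := ltnP 1 i; first by constructor 2.
by constructor 1; lia.
Qed.

Lemma adjacent_chain (i j : I) : (i < j)%N -> (i < 2)%N /\ (j : nat) = 2%N \/
  [/\ (j : nat) = i.+1, (1 < i)%N & (j < n)%N \/ ~~ dr] -> M i j <> 2%N.
Proof.
move=> ij H; apply/eqP; rewrite commute_cartan // cartan_lt ?ij ?ord_le // Dl /=.
have jn := ord_le j; case: eqP => i0; first by case: H => [[_ ->]//|[]]; lia.
have -> : dr && ((j : nat) == n) = false.
  by case: H => [[_ ->]|[_ _ [H|/negbTE ->]]] //; apply/negP => /andP[_]; lia.
have -> : ((j : nat) == i.+1) by case: H => [[]|[]]; lia.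
by case: ifP.
Qed.

Lemma val_node1 : nat_of_ord (node1 n) = 1%N. Proof. by rewrite /= inordK //; lia. Qed.

Lemma automorphism_gt1 (i : I) : (1 < i)%N -> (1 < th i)%N.
Proof.
move=> i1; have [//|t1] := ltnP 1 (th i).
have [E|E] : (th i : nat) = 0%N \/ (th i : nat) = 1%N by lia.
  have : th i = th (node1 n) by rewrite th1; apply: val_inj.
  by move/perm_inj => iE; move: i1; rewrite iE val_node1.
have : th i = th (node0 n) by rewrite th0; apply: val_inj; rewrite /= E val_node1.
by move/perm_inj => iE; move: i1; rewrite iE.
Qed.

(** Node 2 is the only neighbour of the nodes 0 and 1, hence fixed; from there the chain is followed
    node by node. *)
Lemma automorphism_fix (i : I) : (1 < i)%N -> (i < n.-1)%N \/ ~~ dr -> th i = i.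
Proof.
move: {2}(nat_of_ord i) (leqnn i) => N; elim: N i => [|N IH] i iN i1 ic; first by lia.
have t1 := automorphism_gt1 i1; have iln := ord_le i.
have [i2|i2] := eqVneq (i : nat) 2.
  have adj : M (node1 n) (th i) <> 2%N.
    by rewrite -th0 thM; apply: adjacent_chain; [rewrite /= i2|left; rewrite i2].
  have lt1 : (node1 n < th i)%N by rewrite val_node1.
  have := adjacent lt1 adj; rewrite val_node1 => -[[_ E]|[_ //]|[_ _ E]]; last by lia.
  by apply: val_inj; rewrite /= E i2.
have pN : (i.-1 <= n)%N by lia.
have pE : (node i.-1 : nat) = i.-1 by rewrite inordK.
have thp : th (node i.-1) = node i.-1.
  by apply: IH; rewrite pE; [lia|lia|case: ic => [ic|->]; [left; lia|right]].
have adj : M (node i.-1) (th i) <> 2%N.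
  rewrite -{1}thp thM; apply: adjacent_chain; rewrite pE; first by lia.
  by right; split; [lia|lia|case: ic => [ic|->]; [left; lia|right]].
have tp : th i <> node i.-1.
  by rewrite -thp => /perm_inj E; move: pE; rewrite -E; lia.
have [lt|lt] := ltnP (node i.-1) (th i).
  have := adjacent lt adj; rewrite pE => -[[H _]|[H _]|[Dr _ H]]; try lia.
    by apply: val_inj; rewrite /= H; lia.
have {}lt : (th i < node i.-1)%N.
  by rewrite ltn_neqAle lt andbT; apply/eqP => E; apply: tp; apply: val_inj.
have adj' : M (th i) (node i.-1) <> 2%N.
  move/eqP; rewrite commute_sym; first by move/eqP.
  by rewrite -val_eqE /= ltn_eqF.
have tn := ord_le (th i).
have := adjacent lt adj'; rewrite pE => -[[H _]|[H _]|[Dr H _]]; try lia.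
have E : th (th i) = th i.
  by apply: IH; [lia|lia|case: ic => [ic|->]; [left; lia|right]].
by move: E => /perm_inj E; move: H; rewrite E; lia.
Qed.

(** Besides 0 and 1, only the two nodes of a right fork can be exchanged. The segments come with an
    arbitrary automorphism, whereas [relabel] asks for an involution. *)
Lemma automorphism_involutive : involutive th.
Proof.
have ends (i : I) : dr -> (n.-1 <= i)%N -> (n.-1 <= th i)%N.
  move=> Dr iN; rewrite leqNgt; apply/negP => lt.
  have i1 : (1 < i)%N by lia.
  have := automorphism_fix (automorphism_gt1 i1) (or_introl lt) => /perm_inj E.
  by move: lt; rewrite E; lia.
move=> i; have [i1|i1] := ltnP 1 i; last first.
  have [E|E] : (i : nat) = 0%N \/ (i : nat) = 1%N by lia.
    have -> : i = node0 n by apply: val_inj.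
    by rewrite th0 th1.
  have -> : i = node1 n by apply: val_inj; rewrite /= E val_node1.
  by rewrite th1 th0.
have [/orP[ic|ic]|] := boolP ((i < n.-1)%N || ~~ dr).
- by rewrite !automorphism_fix //; left.
- by rewrite !automorphism_fix //; right.
rewrite negb_or negbK -leqNgt => /andP[iN Dr].
have tN := ends i Dr iN; have ttN := ends _ Dr tN.
have [E|ne] := eqVneq (th i) i; first by rewrite !E.
apply/eqP/negPn/negP => ne'.
have E : th (th i) = th i.
  apply: val_inj; move: ne ne'; rewrite -!val_eqE /=.
  by have := ord_le i; have := ord_le (th i); have := ord_le (th (th i)); lia.
by move/perm_inj: E => E; rewrite E eqxx in ne.
Qed.

End Automorphism.

Lemma tperm_swap (i : I) : tperm z0 (node1 n : I) i = swap_node 0 1 i.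
Proof.
have v1 : nat_of_ord (node1 n) = 1%N by rewrite /= inordK //; lia.
apply: val_inj; rewrite /swap_node /= inordK; last by rewrite ltnS swapn_le ?ord_le //; lia.
by rewrite /swapn; case: tpermP => [->|->|/eqP + /eqP]; rewrite -?val_eqE /= ?v1 // => /negbTE -> /negbTE ->.
Qed.

Lemma fork_main sigma1 sigma0 w lam : dl -> fork_segments M s sigma1 sigma0 ->
  minrep s (setS n) w -> fork_pi s sigma1 sigma0 false w lam ->
  palindromic s w <->
    (poset_isomorphic (bruhat_interval s w) (bruhat s)
       (young_interval s sigma1 sigma0 lam) (young s sigma1 sigma0)
     /\ rank_symmetric (young_interval s sigma1 sigma0 lam) (psize lam)).
Proof.
move=> Dl [lst1 lst0 [th [phi [thM [th0 th1] phiw phiE]]]] mw pw.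
split=> [pal|[iso rs]]; last exact/(iso_palindromic cox M1 mw iso).
have R : relabel s th phi by split; first exact: automorphism_involutive thM th0 th1 Dl.
have tauA i j : A (tperm z0 (node1 n : I) i) (tperm z0 (node1 n : I) j) = A i j.
  by rewrite !tperm_swap tau_A.
have A01 : A z0 (node1 n) = 0%Z.
  rewrite /A /= inordK; last by lia.
  by rewrite cartan_lt ?Dl //; lia.
have iso := fork_iso M1 classical_ii Abond (ltnW n2) lst1 lst0 tauA classical_minuscule A01
  R th0 th1 phiE (fork_proper Dl pal mw) pw.
by split => //; apply/(iso_palindromic cox M1 mw iso).
Qed.

End Group.
End Classical.

(** * Coxeter labels of the classical diagrams *)

Definition edge_between (i j : nat) (e : nat * nat * nat) : bool :=
  (e.1 == (i, j)) || (e.1 == (j, i)).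

Lemma head_bonds d i j (e : nat * nat * nat) L : (i < j)%N -> (e.1.1 < e.1.2)%N ->
  head d [seq e.2 | e <- e :: L & edge_between i j e] =
  if (i == e.1.1) && (j == e.1.2) then e.2 else head d [seq e.2 | e <- L & edge_between i j e].
Proof.
case: e => [[a b] m] /= ij ab; rewrite /edge_between /= !xpair_eqE.
have -> : (a == j) && (b == i) = false by apply/negP => /andP[/eqP aj /eqP bi]; lia.
by rewrite orbF eq_sym [b == j]eq_sym; case: ifP.
Qed.

Lemma head_chain d i j m k : (i < j)%N ->
  head d [seq e.2 | e <- chain m k & edge_between i j e] =
  if (m <= i < k)%N && (j == i.+1) then 3 else d.
Proof.
move=> ij; rewrite /chain; have -> : (m <= i < k)%N = (m <= i < m + (k - m))%N by lia.
move: (k - m)%N => r; elim: r m => [|r IH] m.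
  by rewrite /= addn0; have -> : (m <= i < m)%N = false by lia.
rewrite [iota _ _]/= [map _ _]/= head_bonds //= IH.
case: eqP => [->|im] /=; last by congr (if _ then _ else _); lia.
have -> : (m <= m < m + r.+1)%N by lia.
have -> : (m < m)%N = false by lia.
by case: ifP.
Qed.

Lemma bond_sym m a b : bond m a b -> bond m b a.
Proof. by rewrite /bond; case: m => [|[|[|[|[|[|[|m]]]]]]] //=; lia. Qed.

Lemma coxeter_label_sym T i j : coxeter_label T i j = coxeter_label T j i.
Proof.
rewrite /coxeter_label eq_sym; case: ifP => // _.
by congr (head _ (map _ _)); apply: eq_filter => e; rewrite orbC.
Qed.

Lemma bonds_by_label T n dl dr : rank T = n ->
  (forall i j, (i < j <= n)%N -> bond (coxeter_label T i j) (cartan n dl dr i j) (cartan n dl dr j i)) ->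
  forall i j : 'I_(rank T).+1, i != j ->
  bond (affine_coxeter i j) (@classicalA (rank T) dl dr i j) (@classicalA (rank T) dl dr j i).
Proof.
move=> <- H i j ij; rewrite affine_coxeterE /classicalA.
have := ltn_ord i; have := ltn_ord j; rewrite !ltnS => jn iN.
have [lt|lt] := ltnP i j; first by apply: H; rewrite lt.
rewrite coxeter_label_sym; apply: bond_sym; apply: H; rewrite iN andbT ltn_neqAle lt andbT.
by rewrite eq_sym.
Qed.

Lemma bonds_C n : (2 <= n)%N -> forall i j : 'I_(rank (DC n)).+1, i != j ->
  bond (affine_coxeter i j) (classicalA false false i j) (classicalA false false j i).
Proof.
move=> n2; apply: bonds_by_label => // i j /= ij.
rewrite (cartan_lt n2) // (cartan_gt n2) // /coxeter_label.
have -> : (i == j) = false by lia.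
rewrite -/(edge_between i j) /affine_bonds !cat_cons cat0s !head_bonds /= ?head_chain //; try lia.
have [i0|i0] := eqVneq i 0%N.
  rewrite i0; have -> : (0 == n.-1)%N = false by lia.
  rewrite /=; case: eqP => [->|//].
  have -> : (1 == n)%N = false by lia.
  by left.
rewrite /=; case: (j =P i.+1) => [jE|jE].
  have [jn|jn] := eqVneq j n.
    have -> : (i == n.-1) by lia.
    by right.
  rewrite andbF andbT /=; have -> : (0 < i < n.-1)%N by lia.
  by [].
rewrite !andbF; have -> : (i == n.-1) && (j == n) = false by lia.
by [].
Qed.

Lemma bonds_B n : (4 <= n)%N -> forall i j : 'I_(rank (DB n)).+1, i != j ->
  bond (affine_coxeter i j) (classicalA true false i j) (classicalA true false j i).
Proof.
move=> n4; have n2 : (2 <= n)%N by lia.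
apply: bonds_by_label => // i j /= ij.
rewrite (cartan_lt n2) // (cartan_gt n2) // /coxeter_label.
have -> : (i == j) = false by lia.
rewrite -/(edge_between i j) /affine_bonds !cat_cons cat0s !head_bonds /= ?head_chain //; try lia.
have [i0|i0] := eqVneq i 0%N.
  rewrite i0 /=; case: eqP => // j2; have -> : (0 == n.-1)%N = false by lia.
  by [].
rewrite /=; have [i1|i1] := eqVneq i 1%N.
  rewrite i1 /=; case: eqP => [->|//] /=.
    by have -> : (2 == n)%N = false by lia.
  by have -> : (1 == n.-1)%N = false by lia.
rewrite /=; case: (j =P i.+1) => [jE|jE].
  have [jn|jn] := eqVneq j n.
    have -> : (i == n.-1) by lia.
    by left.
  rewrite !andbF andbT /=; have -> : (1 < i < n.-1)%N by lia.
  by [].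
rewrite !andbF; have -> : (i == n.-1) && (j == n) = false by lia.
by [].
Qed.

Lemma bonds_D n : (4 <= n)%N -> forall i j : 'I_(rank (DD n)).+1, i != j ->
  bond (affine_coxeter i j) (classicalA true true i j) (classicalA true true j i).
Proof.
move=> n4; have n2 : (2 <= n)%N by lia.
apply: bonds_by_label => // i j /= ij.
rewrite (cartan_lt n2) // (cartan_gt n2) // /coxeter_label.
have -> : (i == j) = false by lia.
rewrite -/(edge_between i j) /affine_bonds !cat_cons cat0s !head_bonds /= ?head_chain //; try lia.
have [i0|i0] := eqVneq i 0%N.
  rewrite i0 /=; case: eqP => // j2; have -> : (0 == n.-2)%N = false by lia.
  by [].
rewrite /=; have [i1|i1] := eqVneq i 1%N.
  rewrite i1 /=; have -> : (1 == n.-2)%N = false by lia.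
  have -> : (1 == n - 2)%N = false by lia.
  case: eqP => [->|j2] /=.
    by have -> : (2 == n)%N = false by lia.
  by case: ifP.
rewrite /=; have -> : (i == n - 2)%N = (i == n.-2) by lia.
have [jn|jn] := eqVneq j n; rewrite ?andbT ?andbF /=.
  case: eqP => // i2; rewrite jn.
  by have -> : (1 < i < n.-1)%N && (n == i.+1) = false by lia.
case: (j =P i.+1) => [jE|jE]; rewrite ?andbF //.
by have -> : (1 < i < n.-1)%N by lia.
Qed.

Theorem theorem4p1 (T : dynkin) (G : groupType) (s : 'I_(rank T).+1 -> G)
    (sigma1 sigma0 : nat -> seq G) (w : G) (lam : seq part) :
  dynkin_valid T ->
  (forall n, (2 <= n)%N -> T <> DA n) -> T <> DB 3 ->
  coxeter_system (@affine_coxeter T) s ->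
  segments s sigma1 sigma0 ->
  minrep s (setS (rank T)) w ->
  pi_spec s sigma1 sigma0 w lam ->
  palindromic s w <->
    (poset_isomorphic (bruhat_interval s w) (bruhat s)
                      (young_interval s sigma1 sigma0 lam)
                      (young s sigma1 sigma0)
     /\ rank_symmetric (young_interval s sigma1 sigma0 lam) (psize lam)).
Proof.
case: T s => [n|n|n|n|n||] s valid nA nB cox sg mw pw.
- case: n s valid nA {nB} cox sg mw pw => [//|[|n]] s valid nA cox sg mw pw.
    by move: sg pw => [sg ->] pw; apply: A1_main.
  by case: (nA n.+2).
- have n3 : (3 <= n)%N by [].
  have n4 : (4 <= n)%N by rewrite ltn_neqAle n3 andbT; apply/eqP => E; apply: nB; rewrite -E.
  apply: (@fork_main n true false (ltnW (ltnW n4)) (fun=> n4) (fun=> isT)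
    (@affine_coxeter (DB n))) pw => //.
  + exact: (@affine_coxeter1 (DB n)).
  + exact: bonds_B.
- move: sg pw => [sg ->] pw.
  apply: (@chain_main n false false valid (fun H => False_ind _ (elimF idP erefl H)) (fun H => H)
    (@affine_coxeter (DC n))) pw => //.
  + exact: (@affine_coxeter1 (DC n)).
  + exact: bonds_C.
- have n4 : (4 <= n)%N by [].
  apply: (@fork_main n true true (ltnW (ltnW n4)) (fun=> n4) (fun=> isT)
    (@affine_coxeter (DD n))) pw => //.
  + exact: (@affine_coxeter1 (DD n)).
  + exact: bonds_D.
- move: sg pw => [sg ->] pw.
  case: n s valid cox sg mw pw {nA nB} => [|[|[|[|[|[|[|[|[|n]]]]]]]]] //= s valid cox sg mw pw.
  + exact: E6_main.
  + exact: E7_main.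
  + exact: E8_main.
- by move: sg pw => [sg ->] pw; apply: F4_main.
- by move: sg pw => [sg ->] pw; apply: G2_main.
Qed.
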